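(* Let $X$ be a proper CAT$(-1)$ space and let $\Gamma\le\operatorname{Isom}(X)$ be finitely generated, discrete, and accessible over finite subgroups. If $\Gamma$ is not virtually free, then $\delta_X(\Gamma)\ge1$. The same conclusion (not virtually free implies $\delta_X(\Gamma)\ge1$) holds, in particular, for every finitely presented discrete $\Gamma\le\operatorname{Isom}(X)$ and for every finitely generated discrete $\Gamma\le\operatorname{Isom}(X)$ whose finite subgroups have uniformly bounded order. If such a group $\Gamma$ has a maximal parabolic subgroup that is not virtually cyclic, then again $\delta_X(\Gamma)\ge1$.
   Context: $\delta_X(\Gamma)=\inf\{s>0:\sum_{g\in\Gamma}e^{-s d(o,go)}<\infty\}$ for any $o\in X$ (it does not depend on $o$). A finite graph-of-groups decomposition is reduced if no collapsible edge remains in its Bass–Serre tree (in the sense of Serre). A finitely generated group $G$ is accessible over finite subgroups if there is an integer $N_G$ such that every reduced finite graph-of-groups decomposition of $G$ with finite edge groups has at most $N_G$ unoriented edges. A parabolic point is a point of the limit set $\Lambda_\Gamma\subseteq\partial X$ whose stabilizer in $\Gamma$ is infinite and contains no hyperbolic (axial) isometry, i.e. no isometry with positive attained translation length; the stabilizer of a parabolic point is a maximal parabolic subgroup. *)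

(* Defs.v *)
From HB Require Import structures.
From mathcomp Require Import all_boot all_order all_algebra.
From mathcomp Require Import all_classical all_reals all_analysis.

Set Implicit Arguments.
Unset Strict Implicit.
Unset Printing Implicit Defensive.
Set Warnings "-redundant-canonical-projection,-projection-no-head-constant".

Import Order.TTheory GRing.Theory Num.Theory.

Local Open Scope classical_set_scope.
Local Open Scope ring_scope.

(* A group is a [groupType], a subgroup of [G] is a [groupClosed G], that is, a
   predicate containing 1 and closed under products and inverses. *)

Section SubgroupIsGroup.
Variables (G : groupType) (H : groupClosed G).

Record subgrp := Subgrp { subgrp_val :> G; subgrp_valP : subgrp_val \in H }.

Let group_closed_mem : group_closed [in H].
Proof. by split=> [|x y]; [exact: gpred1 | exact: gpredF]. Qed.

HB.instance Definition _ := [isSub of subgrp for subgrp_val].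
HB.instance Definition _ := [Choice of subgrp by <:].
HB.instance Definition _ :=
  SubChoice_isSubGroup.Build G [in H] subgrp group_closed_mem.

End SubgroupIsGroup.

Section GroupTheory.
Implicit Types G : groupType.

Definition generates G (S : set G) : Prop :=
  forall H : groupClosed G, (forall x, S x -> x \in H) -> forall x, x \in H.

Definition finitely_generated G : Prop :=
  exists2 S : set G, finite_set S & generates S.

(* [G] is free with basis [S]: every map from [S] to a group [K] (here, the
   restriction to [S] of [f]) extends to exactly one morphism [G -> K]. *)
Definition free_basis G (S : set G) : Prop :=
  forall (K : groupType) (f : G -> K),
    (exists phi : {multiplicative G -> K}, {in S, phi =1 f}) /\
    (forall phi psi : {multiplicative G -> K},
        {in S, phi =1 f} -> {in S, psi =1 f} -> phi =1 psi).

Definition free_group G : Prop := exists S : set G, free_basis S.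

Definition normal_subgroup G (N : groupClosed G) : Prop :=
  forall x y : G, x \in N -> (x ^ y)%g \in N.

Definition normal_closure G (S : set G) : set G :=
  [set x | forall N : groupClosed G, normal_subgroup N ->
             (forall y, S y -> y \in N) -> x \in N].

Definition kernel G (K : groupType) (phi : G -> K) : set G :=
  [set x | phi x = 1%g].

Definition finitely_presented G : Prop :=
  exists (F : groupType) (S rels : set F) (pi : {multiplicative F -> G}),
    [/\ finite_set S, free_basis S, finite_set rels, set_surj setT setT pi
      & kernel pi = normal_closure rels].

Definition left_coset G (g : G) (A : set G) : set G :=
  [set (g * a)%g | a in A].

Definition finite_index G (H : groupClosed G) : Prop :=
  finite_set (range (fun g : G => left_coset g [set` H])).

Definition cyclic_group G : Prop := exists x : G, generates [set x].

Definition virtually_free G : Prop :=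
  exists2 H : groupClosed G, finite_index H & free_group (subgrp H).

Definition virtually_cyclic G : Prop :=
  exists2 H : groupClosed G, finite_index H & cyclic_group (subgrp H).

Definition bounded_finite_subgroups G : Prop :=
  exists N : nat, forall H : groupClosed G,
    finite_set [set` H] -> ([set` H] #<= `I_N)%card.

End GroupTheory.

(* A finite graph with a chosen orientation: an element of [gedge] stands for
   an unoriented (geometric) edge, loops and multiple edges being allowed. *)
Record fin_graph := FinGraph {
  gvert : finType;
  gedge : finType;
  gsrc : gedge -> gvert;
  gtgt : gedge -> gvert
}.

Section Walks.
Variable Y : fin_graph.

(* [(e, true)] runs along [e], [(e, false)] is the reversed edge. *)
Definition edge_src (a : gedge Y * bool) : gvert Y :=
  if a.2 then gsrc a.1 else gtgt a.1.

Definition edge_tgt (a : gedge Y * bool) : gvert Y :=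
  if a.2 then gtgt a.1 else gsrc a.1.

Fixpoint is_walk (v : gvert Y) (s : seq (gedge Y * bool)) (w : gvert Y) : bool :=
  if s is a :: s' then (edge_src a == v) && is_walk (edge_tgt a) s' w else v == w.

Definition no_backtracking (s : seq (gedge Y * bool)) : bool :=
  sorted (fun a b => b != (a.1, ~~ a.2)) s.

Definition walk_in (T : {set gedge Y}) (s : seq (gedge Y * bool)) : bool :=
  all (fun a => a.1 \in T) s.

(* The edges in [T], with all the vertices of [Y], form a tree: a nonempty
   connected graph without circuits. *)
Definition maximal_tree (T : {set gedge Y}) : Prop :=
  [/\ exists v : gvert Y, True,
      forall v w, exists2 s, is_walk v s w & walk_in T s
    & forall v s, is_walk v s v -> walk_in T s -> no_backtracking s ->
        s = [::]].

End Walks.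

Record graph_of_groups := GraphOfGroups {
  ggraph :> fin_graph;
  vgrp : gvert ggraph -> groupType;
  egrp : gedge ggraph -> groupType;
  esrc : forall e, {multiplicative egrp e -> vgrp (gsrc e)};
  etgt : forall e, {multiplicative egrp e -> vgrp (gtgt e)};
  esrc_inj : forall e, injective (esrc e);
  etgt_inj : forall e, injective (etgt e)
}.

Section FundamentalGroup.
Variables (A : graph_of_groups) (T : {set gedge A}).

(* The defining relations of the fundamental group of [A] at the maximal tree
   [T], for images [f] of the vertex groups and [t] of the edges. *)
Definition pi1_relations (K : groupType)
    (f : forall v, {multiplicative @vgrp A v -> K}) (t : gedge A -> K) : Prop :=
  (forall e (a : @egrp A e),
     (t e * f (gtgt e) (etgt e a) * (t e)^-1 = f (gsrc e) (esrc e a))%g) /\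
  (forall e, e \in T -> t e = 1%g).

Variables (G : groupType) (i : forall v, {multiplicative @vgrp A v -> G})
  (t : gedge A -> G).

(* [G], with the images [i] of the vertex groups and the stable letters [t], is
   the group presented by the vertex groups, the edges and the relations. *)
Definition is_pi1 : Prop :=
  pi1_relations i t /\
  forall (K : groupType) (f : forall v, {multiplicative @vgrp A v -> K})
         (s : gedge A -> K), pi1_relations f s ->
    let extends (phi : {multiplicative G -> K}) :=
      (forall v a, phi (i v a) = f v a) /\ (forall e, phi (t e) = s e) in
    (exists phi, extends phi) /\
    (forall phi psi, extends phi -> extends psi -> phi =1 psi).

(* The Bass-Serre tree: its vertices are the left cosets of the vertex groups,
   its edges the left cosets of the edge groups (embedded in the vertex group
   at the source), and [G] acts by left translation. The edge [bs_edge e g]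
   joins [bs_src e g] to [bs_tgt e g]; by [pi1_relations] the latter two depend
   only on the coset. *)
Definition bs_vertex (v : gvert A) (g : G) : gvert A * set G :=
  (v, left_coset g (range (i v))).

Definition bs_edge (e : gedge A) (g : G) : gedge A * set G :=
  (e, left_coset g (range (fun a : @egrp A e => i (gsrc e) (esrc e a)))).

Definition bs_src (e : gedge A) (g : G) := bs_vertex (gsrc e) g.

Definition bs_tgt (e : gedge A) (g : G) := bs_vertex (gtgt e) (g * t e)%g.

Definition bs_act (I : Type) (h : G) (x : I * set G) : I * set G :=
  (x.1, left_coset h x.2).

Definition bs_stab (I : Type) (x : I * set G) : set G :=
  [set h | bs_act h x = x].

(* Collapsing the orbit of an edge does not change the vertex stabilizers when
   its endpoints lie in different orbits and one of them has the same
   stabilizer as the edge. *)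
Definition collapsible (e : gedge A) (g : G) : Prop :=
  ~ (exists h, bs_act h (bs_src e g) = bs_tgt e g) /\
  (bs_stab (bs_edge e g) = bs_stab (bs_src e g) \/
   bs_stab (bs_edge e g) = bs_stab (bs_tgt e g)).

Definition reduced : Prop := forall e g, ~ collapsible e g.

End FundamentalGroup.

Definition accessible_over_finite (G : groupType) : Prop :=
  exists N : nat,
    forall (A : graph_of_groups) (T : {set gedge A})
           (i : forall v, {multiplicative @vgrp A v -> G}) (t : gedge A -> G),
      maximal_tree T -> is_pi1 T i t ->
      (forall e : gedge A, finite_set [set: @egrp A e]) ->
      reduced i t -> (#|gedge A| <= N)%N.

Section Isometries.
Variables (R : realType) (X : metricType R).

Record isom := Isom {
  isom_fun :> X -> X;
  isom_mdist : forall x y, mdist (isom_fun x) (isom_fun y) = mdist x y;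
  isom_bij : bijective isom_fun
}.

Lemma isomP (f g : isom) : isom_fun f =1 isom_fun g -> f = g.
Proof.
case: f g => [f f1 f2] [g g1 g2] /= /funext fg.
by case: _ / fg in g1 g2 *; congr Isom; exact: Prop_irrelevance.
Qed.

Lemma isom1_bij : bijective (@idfun X).
Proof. by exists idfun. Qed.

Definition isom1 : isom := Isom (fun _ _ => erefl) isom1_bij.

Lemma isomM_mdist (f g : isom) x y :
  mdist ((isom_fun f \o g) x) ((isom_fun f \o g) y) = mdist x y.
Proof. by rewrite /= !isom_mdist. Qed.

Definition isomM (f g : isom) : isom :=
  Isom (isomM_mdist f g) (bij_comp (isom_bij f) (isom_bij g)).

Lemma isomV_ex (f : isom) : exists g : isom, cancel (isom_fun g) f /\ cancel (isom_fun f) g.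
Proof.
have [g fg gf] := isom_bij f.
have gd x y : mdist (g x) (g y) = mdist x y by rewrite -(isom_mdist f) !gf.
by exists (Isom gd (Bijective gf fg)).
Qed.

Definition isomV (f : isom) : isom := projT1 (cid (isomV_ex f)).

Lemma isomVK f : cancel (isom_fun (isomV f)) f.
Proof. by rewrite /isomV; case: cid => g []. Qed.

Lemma isomKV f : cancel (isom_fun f) (isomV f).
Proof. by rewrite /isomV; case: cid => g []. Qed.

HB.instance Definition _ := gen_eqMixin isom.
HB.instance Definition _ := gen_choiceMixin isom.

Lemma isom_mulA : associative isomM.
Proof. by move=> f g h; apply: isomP. Qed.

Lemma isom_mul1 : left_id isom1 isomM.
Proof. by move=> f; apply: isomP. Qed.

Lemma isom_muln1 : right_id isom1 isomM.
Proof. by move=> f; apply: isomP. Qed.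

Lemma isom_mulV : left_inverse isom1 isomV isomM.
Proof. by move=> f; apply: isomP => x /=; rewrite isomKV. Qed.

Lemma isom_mulnV : right_inverse isom1 isomV isomM.
Proof. by move=> f; apply: isomP => x /=; rewrite isomVK. Qed.

HB.instance Definition _ :=
  isGroup.Build isom isom_mulA isom_mul1 isom_muln1 isom_mulV isom_mulnV.

End Isometries.

Section Hyperbolic.
Variable R : realType.

(* The upper half-plane model of the hyperbolic plane. *)
Definition hplane : Type := {z : R * R | 0 < z.2}.

Definition arcosh (u : R) : R := ln (u + Num.sqrt (u ^+ 2 - 1)).

Definition hdist (z w : hplane) : R :=
  arcosh (1 + (((val z).1 - (val w).1) ^+ 2 + ((val z).2 - (val w).2) ^+ 2)
              / (2 * (val z).2 * (val w).2)).

End Hyperbolic.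

Section CAT.
Variables (R : realType) (X : metricType R).

Definition proper_space : Prop :=
  forall (x : X) (r : R), compact [set y | mdist x y <= r].

(* [c], restricted to [0, d(x, y)], is a geodesic from [x] to [y]. *)
Definition geodesic (x y : X) (c : R -> X) : Prop :=
  [/\ c 0 = x, c (mdist x y) = y
    & forall s t, 0 <= s <= mdist x y -> 0 <= t <= mdist x y ->
        mdist (c s) (c t) = `|s - t|].

Definition geodesic_space : Prop := forall x y : X, exists c, geodesic x y c.

(* [u] lies on the side [c] from [x] to [y], and [u'] is its comparison point
   on the segment from [x'] to [y']. *)
Definition side_comparison (x y : X) (c : R -> X) (x' y' : hplane R)
    (u : X) (u' : hplane R) : Prop :=
  exists t : R, [/\ 0 <= t <= mdist x y, u = c t, hdist x' u' = t
                  & hdist u' y' = mdist x y - t].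

(* Comparison triangles exist and are unique up to isometry, so it does not
   matter which one is used. *)
Definition CAT_minus_1 : Prop :=
  geodesic_space /\
  forall (p q r : X) (cpq cqr crp : R -> X) (p' q' r' : hplane R),
    geodesic p q cpq -> geodesic q r cqr -> geodesic r p crp ->
    hdist p' q' = mdist p q -> hdist q' r' = mdist q r ->
    hdist r' p' = mdist r p ->
    let comparison u u' :=
      [\/ side_comparison p q cpq p' q' u u',
          side_comparison q r cqr q' r' u u'
        | side_comparison r p crp r' p' u u'] in
    forall x x' y y', comparison x x' -> comparison y y' ->
      mdist x y <= hdist x' y'.

(* The group is a discrete subset of Isom(X) with the compact-open topology. *)
Definition discrete_isom_group (Gamma : groupClosed (isom X)) : Prop :=
  let A : set {compact-open, X -> X} :=
    [set g : X -> X | exists2 h : isom X, h \in Gamma & g = h] in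
  A `<=` isolated A.

Definition critical_exponent (o : X) (Gamma : groupClosed (isom X)) : \bar R :=
  ereal_inf [set s%:E | s in [set s : R | 0 < s /\
    (\esum_(g in [set` Gamma]) (expR (- s * mdist o (g o)))%:E < +oo)%E]].

(* Only the restriction of [c] to the nonnegative reals matters. *)
Definition ray (c : R -> X) : Prop :=
  forall s t, 0 <= s -> 0 <= t -> mdist (c s) (c t) = `|s - t|.

Definition asymptotic (c c' : R -> X) : Prop :=
  exists K : R, forall t, 0 <= t -> mdist (c t) (c' t) <= K.

(* A point at infinity is an asymptote class of geodesic rays. *)
Definition boundary : set (set (R -> X)) :=
  [set xi | exists2 c, ray c & xi = [set c' | ray c' /\ asymptotic c c']].

Definition boundary_act (g : isom X) (xi : set (R -> X)) : set (R -> X) :=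
  [set (g : X -> X) \o c | c in xi].

(* The trace on [X] of the basic neighborhood U(c, r, eps), in the cone
   topology, of the endpoint of the ray [c]. *)
Definition cone_nbhd (c : R -> X) (r eps : R) : set X :=
  [set x | r < mdist (c 0) x /\
     exists2 gam, geodesic (c 0) x gam & mdist (gam r) (c r) < eps].

(* The points at infinity in the closure of the orbit of [o]. *)
Definition limit_set (o : X) (Gamma : groupClosed (isom X)) :
    set (set (R -> X)) :=
  [set xi | boundary xi /\
     exists c, [/\ xi c, c 0 = o
       & forall r eps, 0 < r -> 0 < eps ->
           exists2 g : isom X, g \in Gamma & cone_nbhd c r eps (g o)]].

Definition translation_length (g : isom X) : R :=
  inf (range (fun x => mdist x (g x))).

Definition hyperbolic (g : isom X) : Prop :=
  0 < translation_length g /\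
  exists x, mdist x (g x) = translation_length g.

Definition boundary_stab (Gamma : groupClosed (isom X)) (xi : set (R -> X)) :
    set (isom X) :=
  [set g | g \in Gamma /\ boundary_act g xi = xi].

Definition parabolic_point (o : X) (Gamma : groupClosed (isom X))
    (xi : set (R -> X)) : Prop :=
  [/\ limit_set o Gamma xi, infinite_set (boundary_stab Gamma xi)
    & forall g, boundary_stab Gamma xi g -> ~ hyperbolic g].

Definition maximal_parabolic (o : X) (Gamma P : groupClosed (isom X)) : Prop :=
  exists2 xi, parabolic_point o Gamma xi & [set` P] = boundary_stab Gamma xi.

End CAT.

(* Main.v *)
From HB Require Import structures.
Require Import Defs.
From mathcomp Require Import all_boot all_order all_algebra fingroup perm.
From mathcomp Require Import finmap all_classical all_reals all_analysis.
From mathcomp Require Import ring lra zify.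

Set Implicit Arguments.
Unset Strict Implicit.
Unset Printing Implicit Defensive.
Import Order.TTheory GRing.Theory Num.Theory.

(** Suppose that the critical exponent is less than one, so that the Poincare series
    converges at some [s < 1] ([convergent_sums]). It suffices to find a tree on which
    the group acts with finitely many orbits of edges and with finite stabilizers: a
    morphism to a finite group that is injective on the stabilizers then has a kernel
    that acts freely on the tree, so it is free ([finite_stab_virtually_free]).

    The tree is built by splitting. A cut is a subset that differs from its right
    translates by finite sets, and a nested system of cuts, invariant under the group,
    is the edge set of a tree on which the group acts with finite edge stabilizers. A
    cut splits an infinite vertex stabilizer [H] if both of its sides contain
    infinitely many elements of [H]; a smallest such cut can be chosen nested with its
    translates and with the cuts chosen before ([enlarge_nested]). The process goes on
    as long as some infinite vertex stabilizer can be split ([chain_alternative]).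

    An infinite vertex stabilizer [H] can always be split ([vertex_splits]); this is
    where the exponent enters. In a CAT(-1) space the function [hsin x y], which is
    the hyperbolic sine of half the distance, satisfies Ptolemy's inequality
    ([ptolemy]), so [hsin x z / (hsin o x * hsin o z)] satisfies the triangle
    inequality. Edges of the Cayley graph at [g] have length of the order of
    [exp (- d (o, g o))] in it, so their total length is finite. If no cut splits [H],
    two elements of [H] far from the origin are joined by paths far from the origin,
    and the orbit of [H] converges to a single point. Ptolemy's inequality with this
    point at infinity says that [size_of g = hsin o (g o)] is subadditive on [H]
    ([unsplit_subadditive]). But convergence at [s < 1] leaves, for large [n], fewer than [n ^ 2]
    elements of size at most [C n] ([size_growth]). A group of subquadratic growth is
    virtually cyclic, by the theorem of Morse and Hedlund on words of low complexity
    and a count of cosets ([ex_infinite_order], [virtually_Z]); and a virtually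
    cyclic infinite vertex stabilizer is split, as almost invariant subsets of it
    extend to cuts ([virtually_Z_splits]).

    So the process stops unless it yields an infinite chain of splittings. If the
    group is finitely presented, each cut of the chain is outermost at some corner of
    a triangle of the presentation complex, which bounds the length of the chain
    ([coherent_no_infinite_chain]). If the edge stabilizers are bounded, a dimension
    count for invariant systems of linear equations in square-summable functions
    bounds the number of edges by the number of generators and the vertices with
    finite stabilizers ([tree_edge_bound]), and a chain has too few of the latter
    ([no_infinite_bounded_chain]). If they are not bounded, a subchain with increasing
    edge stabilizers has reduced trees, which accessibility forbids
    ([accessible_no_infinite_chain]).

    For a maximal parabolic subgroup, the Busemann function of its fixed point gives a
    morphism to the positive reals. If it is nontrivial, an element that contracts
    towards the point generates the subgroup up to a finite set, because the orbit is
    discrete. Otherwise [size_of] is again subadditive on the subgroup; the latter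
    contains a translation of the tree above ([ex_translation]), and by the growth
    bound all its elements commensurate this translation, so they preserve its axis
    ([parabolic_virtually_Z]). *)
(** * Cardinals of finite sets *)

Section FiniteCardinals.
Local Open Scope classical_set_scope.
Variable T : choiceType.
Implicit Types A B C D : set T.

Definition ncard A : nat := #|` fset_set A|.

Lemma ncard_sub A B : finite_set B -> A `<=` B -> (ncard A <= ncard B)%N.
Proof.
move=> fB AB; apply: fsubset_leq_card.
by rewrite -fset_set_sub //; exact: sub_finite_set fB.
Qed.

Lemma ncard_lt A B x : finite_set B -> A `<=` B -> B x -> ~ A x ->
  (ncard A < ncard B)%N.
Proof.
move=> fB AB Bx nAx; have fA : finite_set A by exact: sub_finite_set fB.
apply: fproper_ltn_card; rewrite fproperE; apply/andP; split.
  by rewrite -fset_set_sub.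
by apply/negP; rewrite -fset_set_sub // => /(_ _ Bx).
Qed.

Lemma ncardUI A B : finite_set A -> finite_set B ->
  (ncard (A `|` B) + ncard (A `&` B) = ncard A + ncard B)%N.
Proof. by move=> fA fB; rewrite /ncard fset_setU // fset_setI // cardfsUI. Qed.

Lemma ncard0 A : finite_set A -> ncard A = 0%N -> A = set0.
Proof.
move=> fA /eqP; rewrite cardfs_eq0 => /eqP A0.
by rewrite -[A]fset_setK // A0; apply/seteqP; split=> x /=.
Qed.

Lemma ncard_gt0 A x : finite_set A -> A x -> (0 < ncard A)%N.
Proof.
by move=> fA Ax; rewrite lt0n; apply/eqP => /(ncard0 fA) A0; rewrite A0 in Ax.
Qed.

Lemma ncard_submod A B C D : finite_set A -> finite_set B ->
  C `|` D `<=` A `|` B -> C `&` D `<=` A `&` B ->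
  (ncard C + ncard D <= ncard A + ncard B)%N.
Proof.
move=> fA fB UU II; have fU : finite_set (A `|` B) by rewrite finite_setU.
have fC : finite_set C by apply: sub_finite_set fU => x Cx; apply: UU; left.
have fD : finite_set D by apply: sub_finite_set fU => x Cx; apply: UU; right.
rewrite -(ncardUI fC fD) -(ncardUI fA fB) leq_add // ncard_sub //.
by apply: sub_finite_set fA => x [].
Qed.

Lemma ex_measure_min (U : Type) (P : set U) (f : U -> nat) :
  (exists x, P x) -> exists2 x, P x & forall y, P y -> (f x <= f y)%N.
Proof.
move=> [x0 Px0]; elim: {x0}_.+1 {-2}x0 (ltnSn (f x0)) Px0 => // n IH x0 fx0 Px0.
have [[y [Py fy]]|nex] := pselect (exists y, P y /\ (f y < f x0)%N).
  by apply: (IH y) => //; apply: leq_trans fy _; rewrite -ltnS.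
exists x0 => // y Py; rewrite leqNgt; apply/negP => fy.
by apply: nex; exists y.
Qed.

End FiniteCardinals.

Lemma finite_bigU (I T : Type) (D : set I) (F : I -> set T) :
  finite_set D -> (forall i, D i -> finite_set (F i)) ->
  finite_set [set x | exists2 i, D i & F i x].
Proof.
move=> fD fF; apply: sub_finite_set (bigcup_finite fD fF) => x [i Di Fix].
by exists i.
Qed.

(** * Cuts of a group *)

(** Rewriting with these rules reduces products in a group to their freely
    reduced, left-associated form. *)
Definition grpE :=
  (@invgM, @invgK, @invg1, @mulgA, @mulg1, @mul1g, @mulgV, @mulVg, @mulgK,
   @mulgVK).

Section Cuts.
Local Open Scope classical_set_scope.
Local Open Scope group_scope.
Variable G : groupType.
Implicit Types (A B C D H : set G) (g h x y : G).

Definition tr g A : set G := [set x | A (g^-1 * x)].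

Lemma tr1 A : tr 1 A = A.
Proof. by rewrite /tr; apply/seteqP; split=> x /=; rewrite invg1 mul1g. Qed.

Lemma trM g h A : tr (g * h) A = tr g (tr h A).
Proof. by apply/seteqP; split=> x; rewrite /tr /= invgM mulgA. Qed.

Lemma trK g : cancel (tr g) (tr g^-1).
Proof. by move=> A; rewrite -trM mulVg tr1. Qed.

Lemma trVK g : cancel (tr g^-1) (tr g).
Proof. by move=> A; rewrite -trM mulgV tr1. Qed.

Lemma tr_inj g : injective (tr g).
Proof. exact: can_inj (trK g). Qed.

Lemma trC g A : tr g (~` A) = ~` tr g A. Proof. by []. Qed.
Lemma trI g A B : tr g (A `&` B) = tr g A `&` tr g B. Proof. by []. Qed.
Lemma tr_sub g A B : (tr g A `<=` tr g B) = (A `<=` B).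
Proof.
apply/propext; split=> AB x; last by move=> /AB.
by have := AB (g * x); rewrite /tr /= mulKg.
Qed.

Lemma mem_tr g A x : tr g A x = A (g^-1 * x). Proof. by []. Qed.

Lemma mem_trM g A x : tr g A (g * x) = A x.
Proof. by rewrite mem_tr mulKg. Qed.

Lemma tr_eqV g A : tr g A = A -> tr g^-1 A = A.
Proof. by move=> {1}<-; rewrite trK. Qed.

Lemma finite_tr g A : finite_set (tr g A) <-> finite_set A.
Proof.
suff H h B : finite_set B -> finite_set (tr h B).
  by split; [move=> /(H g^-1); rewrite trK|exact: H].
move=> fB; apply: sub_finite_set (finite_image (fun x => h * x) fB) => x /= Bx.
by exists (h^-1 * x) => //; rewrite mulgA mulgV mul1g.
Qed.

Lemma finite_mulr x A : finite_set A -> finite_set [set g | A (g * x)].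
Proof.
move=> fA; apply: sub_finite_set (finite_image (fun g => g * x^-1) fA) => g /= Ag.
by exists (g * x) => //; rewrite -mulgA mulgV mulg1.
Qed.

(** [A] differs from each of its right translates by a finite set, that is, its
    coboundary in any locally finite Cayley graph of [G] is finite. *)
Definition cut A := forall x, finite_set [set g | A g /\ ~ A (g * x)].

Lemma cutC A : cut A -> cut (~` A).
Proof.
move=> cA x; apply: sub_finite_set (finite_mulr x (cA x^-1)) => g /=.
by move=> [nA /contrapT Ax]; rewrite -mulgA mulgV mulg1.
Qed.

Lemma cutI A B : cut A -> cut B -> cut (A `&` B).
Proof.
move=> cA cB x; have := cA x; have := cB x => fB fA.
apply: (@sub_finite_set _ _ ([set g | A g /\ ~ A (g * x)] `|`
  [set g | B g /\ ~ B (g * x)])); last by rewrite finite_setU.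
move=> g /= [[Ag Bg] /not_andP[nA|nB]]; by [left|right].
Qed.

Lemma cutU A B : cut A -> cut B -> cut (A `|` B).
Proof.
move=> cA cB; rewrite -[A `|` B]setCK setCU; apply: cutC.
by apply: cutI; exact: cutC.
Qed.

Lemma cut_tr g A : cut A -> cut (tr g A).
Proof.
move=> cA x; have := cA x => fA.
have -> : [set h | tr g A h /\ ~ tr g A (h * x)] =
  tr g [set h | A h /\ ~ A (h * x)] by apply/seteqP; split=> h /=;
  rewrite /tr /= !mulgA.
by apply/finite_tr.
Qed.

Definition splits H A :=
  [/\ cut A, infinite_set (H `&` A) & infinite_set (H `&` ~` A)].

Lemma splitsC H A : splits H A -> splits H (~` A).
Proof. by move=> [cA iA iC]; split; [exact: cutC| |rewrite setCK]. Qed.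

Lemma splits_tr g H A : splits H A -> splits (tr g H) (tr g A).
Proof.
move=> [cA iA iC]; split; first exact: cut_tr.
  by rewrite -trI => /finite_tr.
by rewrite -trC -trI => /finite_tr.
Qed.

(** ** Coboundaries in a Cayley graph *)

Variable S : seq G.
Hypothesis Ssym : forall s, s \in S -> s^-1 \in S.
Hypothesis Sgen : forall P : G -> Prop,
  P 1 -> (forall g s, s \in S -> P g -> P (g * s)) -> forall g, P g.

Lemma gen_all (P : set G) x0 : P x0 ->
  (forall g s, s \in S -> P g -> P (g * s)) -> forall g, P g.
Proof.
move=> P0 PS g; have := @Sgen (fun h => P (x0 * h)) _ _ (x0^-1 * g).
rewrite mulgA mulgV mul1g; apply; first by rewrite mulg1.
by move=> h s sS Ph; rewrite mulgA; exact: PS.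
Qed.

Definition bd A : set (G * G) :=
  [set e | [/\ A e.1, ~ A e.2 & e.1^-1 * e.2 \in S]].

Definition bdsize A := ncard (bd A).

Lemma bd_finite A : cut A -> finite_set (bd A).
Proof.
move=> cA.
apply: (@sub_finite_set _ _ [set e | exists2 s, [set` S] s &
   ((fun g => (g, g * s)) @` [set g | A g /\ ~ A (g * s)]) e]); last first.
  apply: finite_bigU; first exact: finite_seq.
  by move=> s sS; apply: finite_image; exact: cA.
move=> [g h] /= [Ag nAh ghS]; exists (g^-1 * h) => //=.
by exists g; rewrite ?mulgA ?mulgV ?mul1g.
Qed.

Lemma cut_of_bd A : finite_set (bd A) -> cut A.
Proof.
move=> fA; apply: Sgen.
  by rewrite (_ : mkset _ = set0) //; apply/seteqP; split=> // g /=; rewrite mulg1 => -[].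
move=> x s sS fx; apply: (@sub_finite_set _ _ ([set g | A g /\ ~ A (g * x)] `|`
  [set g | ((fun e => e.1) @` bd A) (g * x)])).
  move=> g /= [Ag nA]; have [Agx|nAgx] := pselect (A (g * x)); last by left.
  by right; exists (g * x, g * (x * s)) => //; split=> //=; rewrite !grpE.
by rewrite finite_setU; split=> //; apply: finite_mulr; exact: finite_image.
Qed.

Lemma bdC A : bd (~` A) = (fun e => (e.2, e.1)) @` bd A.
Proof.
apply/seteqP; split=> [[g h]|_ [[g h] [/= Ag nAh sS] <-]] /=.
  move=> [/= nA /contrapT Ah /Ssym]; rewrite invgM invgK => sS.
  by exists (h, g) => //; split.
move: (Ssym sS); rewrite invgM invgK => sS'.
by split=> //=; move/(_ Ag).
Qed.

Lemma bdsizeC A : cut A -> bdsize (~` A) = bdsize A.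
Proof.
move=> cA; rewrite /bdsize /ncard bdC fset_set_image; last exact: bd_finite.
by rewrite card_imfset //= => -[a b] [c d] [-> ->].
Qed.

Lemma bd_tr g A : bd (tr g A) = (fun e => (g * e.1, g * e.2)) @` bd A.
Proof.
apply/seteqP; split=> [[h k]|_ [[h k] [/= Ah nAk sS] <-]] /=.
  move=> [/= Ah nAk sS]; exists (g^-1 * h, g^-1 * k) => /=.
    by split=> //=; rewrite invgM invgK -mulgA mulVKg.
  by rewrite !mulVKg.
by split=> /=; rewrite ?mem_trM // invgM -mulgA mulKg.
Qed.

Lemma bdsize_tr g A : cut A -> bdsize (tr g A) = bdsize A.
Proof.
move=> cA; rewrite /bdsize /ncard bd_tr fset_set_image; last exact: bd_finite.
by rewrite card_imfset //= => -[a b] [c d] [/mulgI -> /mulgI ->].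
Qed.

Lemma bdsize_submod A B : cut A -> cut B ->
  (bdsize (A `&` B) + bdsize (A `|` B) <= bdsize A + bdsize B)%N.
Proof.
move=> cA cB; apply: ncard_submod; try exact: bd_finite.
- move=> e [[/= [Ae Be] /not_andP[n1|n1] sS]|[/= [Ae|Be] /not_orP[n1 n2] sS]];
  by [left|right].
- move=> e [[/= [Ae Be] n1 sS] [/= _ /not_orP[n2 n3] _]].
  by split; split.
Qed.

Lemma bd0 A : bd A = set0 -> A = set0 \/ A = setT.
Proof.
move=> A0; have [[x Ax]|nA] := pselect (exists x, A x); last first.
  by left; apply/seteqP; split=> // x Ax; apply: nA; exists x.
right; apply/seteqP; split=> // y _; apply: gen_all Ax _ y => g s sS Ag.
apply: contrapT => nA; have : bd A (g, g * s) by split; rewrite //= mulKg.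
by rewrite A0.
Qed.

(** Connectedness in the Cayley graph, without reference to paths: a nonempty part
    closed under the edges inside [A] is all of [A]. *)
Definition conn A := forall B, B `<=` A -> (exists x, B x) ->
  (forall g s, s \in S -> B g -> A (g * s) -> B (g * s)) -> B = A.

Definition optimal H A :=
  splits H A /\ forall B, splits H B -> (bdsize A <= bdsize B)%N.

Lemma optimalC H A : optimal H A -> optimal H (~` A).
Proof.
move=> [sA mA]; split; first exact: splitsC.
by move=> B /mA; rewrite bdsizeC //; case: sA.
Qed.

Lemma optimal_tr g H A : optimal H A -> optimal (tr g H) (tr g A).
Proof.
move=> [sA mA]; split; first exact: splits_tr.
move=> B /(splits_tr g^-1); rewrite trK => sB; have := mA _ sB.
by rewrite !bdsize_tr //; [case: (sA)|case: (splits_tr g sB); rewrite trVK].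
Qed.

(** If [A] were not connected, its coboundary would be the disjoint union of
    those of two of its pieces, one of which would still split [H]. *)
Lemma optimal_conn H A : optimal H A -> conn A.
Proof.
move=> [[cA iA iC] mA] B BA [b Bb] Bcl.
have bdB : bd B `<=` bd A.
  by move=> [g h] [/= Bg nBh sS]; split=> //=; [exact: BA|move=> Ah; apply: nBh; have := Bcl g _ sS Bg;
   rewrite mulVKg; apply].
have bdD : bd (A `\` B) `<=` bd A.
  move=> [g h] [/= [Ag nBg] nh sS]; split=> //= Ah; apply: nBg.
  have Bh : B h by apply: contrapT => nBh; apply: nh.
  have := Bcl h _ (Ssym sS) Bh; rewrite invgM invgK mulVKg; exact.
have cB : cut B by apply: cut_of_bd; exact: sub_finite_set (bd_finite cA).
have cD : cut (A `\` B) by apply: cut_of_bd; exact: sub_finite_set (bd_finite cA).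
have disj : bd B `&` bd (A `\` B) = set0.
  by apply/seteqP; split=> // e [[Be _ _] [[_ nBe] _ _]].
have szE : (bdsize B + bdsize (A `\` B) <= bdsize A)%N.
  rewrite -ncardUI; try exact: bd_finite.
  rewrite disj /ncard fset_set0 cardfs0 addn0.
  by apply: ncard_sub; [exact: bd_finite|move=> e [/bdB|/bdD]].
have nT D : D `<=` A -> D <> setT.
  move=> DA DT; apply: iC; rewrite (_ : ~` A = set0) ?setI0//.
  by apply/seteqP; split=> // x nAx; apply: nAx; apply: DA; rewrite DT.
have spl D : D `<=` A -> cut D -> infinite_set (H `&` D) -> splits H D.
  move=> DA cD' iD; split=> // fD; apply: iC.
  by apply: sub_finite_set fD => x [Hx nAx]; split=> // /DA.
have [fB|iB] := pselect (finite_set (H `&` B)).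
  have /mA : splits H (A `\` B).
    apply: (spl _ (@subDsetl _ _ _) cD).
    move=> fD; apply: iA; apply: (@sub_finite_set _ _ ((H `&` B) `|` (H `&` (A `\` B)))).
      by move=> x [Hx Ax]; have [Bx|nBx] := pselect (B x); [left|right].
    by rewrite finite_setU.
  move=> le; have : bdsize B = 0%N by apply/eqP; rewrite -leqn0 -(leq_add2r (bdsize (A `\` B))) add0n (leq_trans szE).
  move=> /ncard0 -/(_ (bd_finite cB)) /bd0[B0|]; last by move/nT => /(_ BA).
  by rewrite B0 in Bb.
have /mA : splits H B by exact: spl.
move=> le; have : bdsize (A `\` B) = 0%N by apply/eqP; rewrite -leqn0 -(leq_add2l (bdsize B)) addn0 (leq_trans szE).
move=> /ncard0 -/(_ (bd_finite cD)) /bd0[D0|]; last by move/nT => /(_ (@subDsetl _ _ _)).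
apply/seteqP; split=> // x Ax; apply: contrapT => nBx.
by have : (A `\` B) x by []; rewrite D0.
Qed.

(** ** Finiteness of families of connected cuts *)

Lemma bd_inj A B : bd A = bd B -> (exists e, bd A e) -> A = B.
Proof.
move=> AB [e Ae]; have Be := Ae; rewrite AB in Be.
have step g s : s \in S -> (A g <-> B g) -> (A (g * s) <-> B (g * s)).
  have hlp C D : bd C = bd D -> s \in S -> (C g <-> D g) -> C (g * s) -> D (g * s).
    move=> CD sS [CDg DCg] Cgs; apply: contrapT => nD.
    have [Cg|nCg] := pselect (C g).
      have : bd D (g, g * s) by split; rewrite //= ?mulKg //; exact: CDg.
      by rewrite -CD => -[].
    have : bd C (g * s, g) by split; rewrite //= invgM mulgVK; exact: Ssym.
    by rewrite CD => -[].
  move=> sS gAB; split; first exact: hlp.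
  by apply: hlp => //; split=> /gAB.
have AB0 : [set g | A g <-> B g] e.1.
  by case: Ae Be => Ae _ _ [Be _ _]; split.
have H := gen_all AB0 step.
by apply/seteqP; split=> g /=; have := H g; case.
Qed.

Definition reachable_off (D : set (G * G)) x y := forall P : set G, P x ->
  (forall g s, s \in S -> ~ D (g, g * s) -> ~ D (g * s, g) -> P g -> P (g * s)) ->
  P y.

Lemma avoids_edges (D : set (G * G)) x y : reachable_off D x y -> exists F : set (G * G),
  [/\ finite_set F, forall e, F e -> ~ D e &
      forall A, A x -> ~ A y -> exists2 e, F e & bd A e].
Proof.
move=> av; apply: (av (fun y => exists F : set (G * G),
  [/\ finite_set F, forall e, F e -> ~ D e &
      forall A, A x -> ~ A y -> exists2 e, F e & bd A e])).
  by exists set0; split=> // A Ax.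
move=> g s sS nD _ [F [fF FD FA]]; exists (F `|` [set (g, g * s)]); split.
- by rewrite finite_setU; split.
- by move=> e [/FD|->].
- move=> A Ax nA; have [Ag|nAg] := pselect (A g).
    by exists (g, g * s); [right|split; rewrite //= mulKg].
  by have [e Fe Ae] := FA A Ax nAg; exists e => //; left.
Qed.

Lemma avoids0 x y : reachable_off set0 x y.
Proof.
by move=> P Px PS; apply: (@gen_all P x Px) => g s sS; apply: PS => //.
Qed.

Lemma finite_conn_cuts_above n (D : set (G * G)) e0 : finite_set D -> D e0 ->
  finite_set [set A | [/\ conn A, conn (~` A), cut A, D `<=` bd A &
                          (bdsize A <= ncard D + n)%N]].
Proof.
have one (D' : set (G * G)) e : D' e -> finite_set [set A | bd A = D'].
  move=> De; have [[A0 A0E]|nA] := pselect (exists A, bd A = D').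
    apply: sub_finite_set (finite_set1 A0) => A /= AE.
    by apply: bd_inj; rewrite ?AE //; exists e.
  by rewrite (_ : mkset _ = set0) //; apply/seteqP; split=> // A AE; apply: nA; exists A.
elim: n D e0 => [|n IH] D e0 fD De0.
  apply: sub_finite_set (one D e0 De0) => A /= [_ _ cA DA szA].
  apply/seteqP; split=> // e Ae; apply: contrapT => nDe; move: szA.
  by rewrite addn0 leqNgt (@ncard_lt _ _ _ e) //; exact: bd_finite.
have [av|nav] := pselect (reachable_off D e0.1 e0.2); last first.
  apply: sub_finite_set (one D e0 De0) => A /= [kA kC cA DA _].
  apply/seteqP; split=> //.
  have [A1 nA2 _] := DA _ De0.
  have UE : A `&` reachable_off D e0.1 = A.
    apply: kA; [by move=> x []|by exists e0.1; split|].
    move=> g s sS [Ag Ug] Ags; split=> // P P1 PS.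
    by apply: (PS) => //; [move=> /DA[]|move=> /DA[]|exact: Ug].
  have UC : ~` A `&` reachable_off D e0.1 = set0.
    apply: contrapT => /eqP/set0P[z [nAz Uz]]; apply: nav.
    suff : (~` A `&` reachable_off D e0.1) e0.2 by case.
    rewrite (_ : _ `&` _ = ~` A) //; apply: kC; [by move=> x []|by exists z|].
    move=> g s sS [nAg Ug] nAgs; split=> // P P1 PS.
    by apply: (PS) => //; [move=> /DA[]|move=> /DA[]|exact: Ug].
  move=> [g h] [/= Ag nAh sS]; apply: contrapT => nD.
  have : (~` A `&` reachable_off D e0.1) h; last by rewrite UC.
  split=> // P P1 PS; rewrite -[h](mulVKg g); apply: (PS) => //.
  - by rewrite mulVKg.
  - by rewrite mulVKg => /DA[].
  - by have : (A `&` reachable_off D e0.1) g; [by rewrite UE | case=> _ Ug; exact: (Ug P P1 PS)].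
have [F [fF FD FA]] := avoids_edges av.
apply: (@sub_finite_set _ _ [set A | exists2 e, F e &
  [set A | [/\ conn A, conn (~` A), cut A, D `|` [set e] `<=` bd A &
    (bdsize A <= ncard (D `|` [set e]) + n)%N]] A]).
  move=> A /= [kA kC cA DA szA]; have [A1 nA2 _] := DA _ De0.
  have [e Fe Ae] := FA A A1 nA2; exists e => //; split=> //.
    by move=> e' [/DA|->].
  apply: leq_trans szA _; rewrite addnS -addSn leq_add2r.
  apply: (@ncard_lt _ _ _ e); [by rewrite finite_setU|by left|by right|exact: FD].
apply: finite_bigU => // e _; apply: (IH _ e); last by right.
by rewrite finite_setU.
Qed.

Definition conn_cut k A :=
  [/\ conn A, conn (~` A), cut A & (bdsize A <= k)%N].

Lemma finite_separating_cuts k (W : set G) : finite_set W ->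
  finite_set [set A | conn_cut k A /\
    exists x y, [/\ W x, W y, A x & ~ A y]].
Proof.
move=> fW; apply: (@sub_finite_set _ _ [set A | exists2 p, (W `*` W) p &
   [set A | [/\ conn_cut k A, A p.1 & ~ A p.2]] A]).
  by move=> A /= [kA [x [y [Wx Wy Ax nAy]]]]; exists (x, y).
apply: finite_bigU; first exact: finite_setX.
move=> [x y] _ /=; have [F [fF _ FA]] := avoids_edges (@avoids0 x y).
apply: (@sub_finite_set _ _ [set A | exists2 e, F e &
   [set A | [/\ conn A, conn (~` A), cut A, [set e] `<=` bd A &
     (bdsize A <= ncard [set e] + k)%N]] A]).
  move=> A /= [[kA kC cA szA] Ax nAy]; have [e Fe Ae] := FA A Ax nAy.
  exists e => //; split=> //; first by move=> _ ->.
  exact: leq_trans szA (leq_addl _ _).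
by apply: finite_bigU => // e _; apply: (@finite_conn_cuts_above k _ e).
Qed.

(** ** Nested cuts *)

Definition nested A B :=
  [\/ A `<=` B, A `<=` ~` B, ~` A `<=` B | ~` A `<=` ~` B].

Lemma subCC A B : ~` A `<=` ~` B <-> B `<=` A.
Proof. by split=> [AB x Bx|BA x nAx /BA//]; apply: contrapT => /AB. Qed.

Lemma nestedCl A B : nested (~` A) B = nested A B.
Proof. by apply/propext; split=> -[H|H|H|H]; rewrite /nested ?setCK in H *; by [constructor 1|constructor 2|constructor 3|constructor 4]. Qed.

Lemma nestedCr A B : nested A (~` B) = nested A B.
Proof. by apply/propext; split=> -[H|H|H|H]; rewrite /nested ?setCK in H *; by [constructor 1|constructor 2|constructor 3|constructor 4]. Qed.

Lemma subCr A B : A `<=` ~` B -> B `<=` ~` A.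
Proof. by move=> AB x Bx Ax; exact: AB Ax Bx. Qed.

Lemma subCl A B : ~` A `<=` B -> ~` B `<=` A.
Proof. by move=> AB x nBx; apply: contrapT => /AB. Qed.

Lemma nested_sym A B : nested A B -> nested B A.
Proof.
case=> H; [constructor 4|constructor 2|constructor 3|constructor 1].
- by move=> x nB /H.
- exact: subCr.
- exact: subCl.
- by move=> x Bx; apply: contrapT => /H.
Qed.

Lemma nested_tr g A B : nested (tr g A) (tr g B) = nested A B.
Proof. by rewrite /nested -!trC !tr_sub. Qed.

Lemma nested_trV g A B : nested (tr g A) B = nested A (tr g^-1 B).
Proof. by rewrite -{1}[B](trVK g) nested_tr. Qed.

Lemma nested_corner A B C : ~ nested A B -> nested A C -> nested B C ->
  nested (A `&` B) C.
Proof.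
move=> nAB [AC|AC|CA|CA]; [by constructor 1 => x [/AC]| by constructor 2 => x [/AC] | |].
  case=> [BC|BC|CB|CB]; [by constructor 1 => x [_ /BC]| by constructor 2 => x [_ /BC] | |].
    by constructor 3 => x; rewrite setCI => -[/CA|/CB].
  by case: nAB; constructor 3 => x nAx; apply: contrapT => /CB; apply; exact: CA.
case=> [BC|BC|CB|CB]; [by constructor 1 => x [_ /BC]| by constructor 2 => x [_ /BC] | |].
  by case: nAB; constructor 3 => x nAx; apply: contrapT => /CB; exact: CA.
by constructor 4 => x; rewrite setCI => -[/CA|/CB].
Qed.

Lemma not_nested_pts A B : ~ nested A B ->
  [/\ exists2 x, A x & B x, exists2 x, A x & ~ B x, exists2 x, ~ A x & B x &
      exists2 x, ~ A x & ~ B x].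
Proof.
move=> nAB; split; apply: contrapT => nex; apply: nAB.
- by constructor 2 => x Ax Bx; apply: nex; exists x.
- by constructor 1 => x Ax; apply: contrapT => nBx; apply: nex; exists x.
- by constructor 4 => x Ax Bx; apply: nex; exists x.
- by constructor 3 => x Ax; apply: contrapT => nBx; apply: nex; exists x.
Qed.

(** Both sides of a connected cut which crosses [A] contain an end of an edge of
    the coboundary of [A], so the cut separates two points of a finite set. *)
Lemma finite_crossing k A : cut A ->
  finite_set [set B | conn_cut k B /\ ~ nested A B].
Proof.
move=> cA; set W := ((fun e => e.1) @` bd A) `|` ((fun e => e.2) @` bd A).
have fW : finite_set W by rewrite finite_setU; split; apply: finite_image; exact: bd_finite.
apply: sub_finite_set (finite_separating_cuts k fW) => B [kB nAB]; split=> //.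
have side C : conn C -> (exists2 x, A x & C x) -> (exists2 x, ~ A x & C x) ->
    exists2 x, W x & C x.
  move=> kC [x Ax Cx] [y nAy Cy]; apply: contrapT => nex; apply: nAy.
  suff : (C `&` A) y by case.
  rewrite (_ : C `&` A = C) //; apply: kC; [by move=> z []|by exists x; split|].
  move=> g s sS [Cg Ag] Cgs; split=> //; apply: contrapT => nA; apply: nex.
  by exists g => //; left; exists (g, g * s) => //; split; rewrite //= mulKg.
have [p1 p2 p3 p4] := not_nested_pts nAB; case: kB => kB kC _ _.
have [x Wx Bx] := side B kB p1 p3; have [y Wy By] := side _ kC p2 p4.
by exists x, y.
Qed.

(** ** Enlarging a nested family *)

Section Enlarge.
Variables (E : set (set G)) (k0 : nat) (H : set G).
Hypothesis EC : forall C, E C -> E (~` C).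
Hypothesis Etr : forall g C, E C -> E (tr g C).
Hypothesis Enest : forall C D, E C -> E D -> nested C D.
Hypothesis Eopt : forall C, E C -> exists H', optimal H' C.
Hypothesis Ebd : forall C, E C -> (bdsize C <= k0)%N.
Hypothesis Hside : forall C, E C -> finite_set (H `\` C) \/ finite_set (H `&` C).
Hypothesis Htr : forall g, tr g H = H \/
  exists C, [/\ E C, finite_set (H `\` C) & finite_set (tr g H `&` C)].
Hypothesis Hspl : exists A, splits H A.

Lemma finite_setIU A B C : finite_set (A `&` B) -> finite_set (A `&` C) ->
  A `<=` B `|` C -> finite_set A.
Proof.
move=> fB fC AU; apply: (@sub_finite_set _ _ ((A `&` B) `|` (A `&` C))).
  by move=> x Ax; case: (AU x Ax); [left|right].
by rewrite finite_setU.
Qed.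

Let crossE A := [set C | E C /\ ~ nested A C].

Let crossE_finite A : cut A -> finite_set (crossE A).
Proof.
move=> cA; apply: sub_finite_set (finite_crossing k0 cA) => C [ECC nAC].
have [H' oC] := Eopt ECC; split=> //; split.
- exact: optimal_conn oC.
- exact: optimal_conn (optimalC oC).
- by case: oC => -[].
- exact: Ebd.
Qed.

Lemma ex_optimal_nested :
  exists2 A, optimal H A & forall C, E C -> nested A C.
Proof.
have [A1 sA1 mA1] := ex_measure_min bdsize Hspl.
have [A0 oA0 mA0] := ex_measure_min (P := optimal H) (fun A => ncard (crossE A))
  (ex_intro _ A1 (conj sA1 mA1)).
exists A0 => // C0 EC0; apply: contrapT => nAC0.
have [C [ECC nAC fC]] : exists C, [/\ E C, ~ nested A0 C & finite_set (H `\` C)].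
  have [f|f] := Hside EC0; first by exists C0.
  exists (~` C0); split; [exact: EC|by rewrite nestedCr|].
  by rewrite setDE setCK.
have cC : cut C by have [? [[]]] := Eopt ECC.
have corner A' : A' = A0 \/ A' = ~` A0 -> (bdsize (A' `|` C) < bdsize C)%N.
  move=> A'E.
  have oA' : optimal H A' by case: A'E => ->; [|exact: optimalC].
  have nA'C : ~ nested A' C by case: A'E => ->; rewrite ?nestedCl.
  have szA' : bdsize A' = bdsize A0.
    by case: A'E => -> //; rewrite bdsizeC //; case: oA0 => -[].
  have [[cA' iA' iCA'] mA'] := oA'.
  have sX : splits H (A' `&` C).
    split; first exact: cutI.
      move=> f; apply: iA'; apply: (@finite_setIU _ C (~` C)).
      - by rewrite -setIA.
      - apply: sub_finite_set fC => x [[Hx _] nCx]; by split.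
      - by move=> x _; exact: lem.
    move=> f; apply: iCA'; apply: sub_finite_set f => x [Hx nAx]; split=> //.
    by move=> [].
  have lt : (bdsize A' < bdsize (A' `&` C))%N.
    rewrite ltnNge; apply/negP => le.
    have oX : optimal H (A' `&` C) by split=> // B /mA'; exact: leq_trans.
    have := mA0 _ oX; rewrite leqNgt => /negP; apply.
    apply: (@ncard_lt _ _ _ C).
    - by apply: crossE_finite; case: oA0 => -[].
    - move=> Z [EZ nZ]; split=> // nAZ; apply: nZ.
      apply: nested_corner => //; last exact: Enest.
      by case: A'E => ->; rewrite ?nestedCl.
    - by [].
    - by move=> [_]; apply; constructor 1 => x [].
  have := bdsize_submod cA' cC; rewrite leqNgt => /negP nsub.
  by rewrite ltnNge; apply/negP => ge; apply: nsub; rewrite -addSn leq_add.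
have [H' [[_ iH1 iH2] mC]] := Eopt ECC.
have lt1 : (bdsize (~` A0 `&` ~` C) < bdsize C)%N.
  rewrite -setCU bdsizeC; first by apply: corner; left.
  by apply: cutU => //; case: oA0 => -[].
have lt2 : (bdsize (A0 `&` ~` C) < bdsize C)%N.
  rewrite -{1}[A0]setCK -setCU bdsizeC; first by apply: corner; right.
  by apply: cutU => //; apply: cutC; case: oA0 => -[].
have key B : cut B -> (bdsize (B `&` ~` C) < bdsize C)%N ->
    finite_set (H' `&` ~` C `&` B).
  move=> cB lt; apply: contrapT => iB; move: lt; rewrite ltnNge => /negP; apply.
  apply: mC; split; first by apply: cutI => //; exact: cutC.
    by rewrite [B `&` _]setIC setIA.
  move=> f; apply: iH1; apply: sub_finite_set f => x [Hx Cx]; split=> //.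
  by move=> [_].
apply: iH2; apply: (@finite_setIU _ A0 (~` A0)).
- by apply: key => //; case: oA0 => -[].
- by apply: key => //; apply: cutC; case: oA0 => -[].
- by move=> x _; exact: lem.
Qed.

Lemma ncard_image_le (T U : choiceType) (f : T -> U) (X : set T) :
  finite_set X -> (ncard (f @` X) <= ncard X)%N.
Proof.
by move=> fX; rewrite /ncard fset_set_image //; exact: leq_imfset_card.
Qed.

(** A smallest cut splitting [H] that crosses as few members of [E] as possible
    crosses none: otherwise two opposite corners would be smaller than the
    member [C] it crosses, and one of them would split what [C] was chosen to
    split. Among these, one that crosses as few of its likes as possible is
    nested with its translates, since replacing two crossing ones by opposite
    corners lowers the number of crossings. *)
Theorem enlarge_nested :
  exists A, [/\ optimal H A, forall C, E C -> nested A C &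
                forall g, nested A (tr g A)].
Proof.
pose M A := optimal H A /\ forall C, E C -> nested A C.
have [A1 oA1 nA1] := ex_optimal_nested.
pose crossM A := [set B | M B /\ ~ nested A B].
have [A [oA nA] mA] := ex_measure_min (P := M) (fun A => ncard (crossM A))
  (ex_intro _ A1 (conj oA1 nA1)).
exists A; split=> // g; have [[cA iA iC] szA] := oA.
have nBE C : E C -> nested (tr g A) C.
  by move=> EC'; rewrite nested_trV; apply: nA; exact: Etr.
(* a translate that splits another stabilizer is separated by a member [C] *)
have [gH|[C [ECC f1 f2]]] := Htr g; last first.
  have /splits_tr -/(_ g) [_ iB iBC] : splits H A by case: oA.
  have noA D X Y : infinite_set (D `&` X) -> finite_set (D `&` Y) -> ~ (X `<=` Y).
    move=> iX fY XY; apply: iX; apply: sub_finite_set fY => x [Dx Xx].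
    by split=> //; exact: XY.
  have sA : A `<=` C \/ ~` A `<=` C.
    case: (nA C ECC) => h; [by left| |by right|].
      by case: (noA H A (~` C) iA f1 h).
    by case: (noA H (~` A) (~` C) iC f1 h).
  have sB : tr g A `<=` ~` C \/ ~` tr g A `<=` ~` C.
    case: (nBE C ECC) => h; [|by left| |by right].
      by case: (noA _ (tr g A) C iB f2 h).
    by case: (noA _ (~` tr g A) C iBC f2 h).
  case: sA sB => [AC [BC|BC]|AC [BC|BC]].
  - by constructor 2 => x /AC Cx /BC.
  - by constructor 1 => x /AC Cx; apply: contrapT => /BC.
  - by constructor 4 => x /AC Cx /BC.
  - by constructor 3 => x /AC Cx; apply: contrapT => /BC.
apply: contrapT; set B := tr g A => nAB.
have oB : optimal H B by rewrite -gH; exact: optimal_tr.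
have [[cB iB iBC] szB] := oB.
have eqAB : bdsize A = bdsize B by rewrite bdsize_tr.
(* two opposite corners both split [H]; by submodularity they are again smallest *)
have [A' [A'E i1 i2]] : exists A', [/\ A' = A \/ A' = ~` A,
    infinite_set (H `&` (A' `&` B)) & infinite_set (H `&` (~` A' `&` ~` B))].
  have spl X Y : infinite_set (H `&` X) -> finite_set (H `&` (X `&` Y)) ->
      infinite_set (H `&` (X `&` ~` Y)).
    move=> iX f1 f2; apply: iX; apply: (@finite_setIU _ Y (~` Y)).
    - by rewrite -setIA.
    - by rewrite -setIA.
    - by move=> x _; exact: lem.
  have [f|i1] := pselect (finite_set (H `&` (A `&` B))).
    exists (~` A); split; [by right| |].
    - by have := @spl B A iB; rewrite ![B `&` _]setIC; apply.
    - by rewrite setCK; exact: spl.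
  have [f|i2] := pselect (finite_set (H `&` (~` A `&` ~` B))).
    exists (~` A); split; [by right| |].
    - by have := spl _ _ iC f; rewrite setCK.
    - by rewrite setCK; have := @spl (~` B) (~` A) iBC; rewrite setCK ![~` B `&` _]setIC; apply.
  by exists A; split; [left| |].
have oA' : optimal H A' by case: A'E => ->; [|exact: optimalC].
have nA'B : ~ nested A' B by case: A'E => ->; rewrite ?nestedCl.
have szA' : bdsize A' = bdsize A by case: A'E => -> //; rewrite bdsizeC.
have nA' C : nested A C -> nested A' C by case: A'E => ->; rewrite ?nestedCl.
have nA'' C : nested A' C -> nested A C by case: A'E => ->; rewrite ?nestedCl.
have [[cA' _ _] _] := oA'.
have sX : splits H (A' `&` B).
  split=> //; first exact: cutI.
  by move=> f; apply: i2; apply: sub_finite_set f => x [Hx [nAx _]]; split=> // -[].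
have sY : splits H (~` A' `&` ~` B).
  split=> //; first by apply: cutI; exact: cutC.
  by move=> f; apply: i1; apply: sub_finite_set f => x [Hx [Ax Bx]]; split=> // -[].
have szX : (bdsize A <= bdsize (A' `&` B))%N by exact: szA.
have szY : (bdsize A <= bdsize (~` A' `&` ~` B))%N by exact: szA.
have sub : (bdsize (A' `&` B) + bdsize (~` A' `&` ~` B) <= bdsize A + bdsize A)%N.
  rewrite -setCU bdsizeC; last exact: cutU.
  by rewrite {2}eqAB -{1}szA'; exact: bdsize_submod.
have MX : M (A' `&` B).
  split.
    split=> // D /szA; apply: leq_trans.
    by rewrite -(leq_add2r (bdsize (~` A' `&` ~` B))) (leq_trans sub) // leq_add2l.
  move=> C ECC; apply: nested_corner => //; last exact: nBE.
  by apply: nA'; exact: nA.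
have MY : M (~` A' `&` ~` B).
  split.
    split=> // D /szA; apply: leq_trans.
    by rewrite -(leq_add2l (bdsize (A' `&` B))) (leq_trans sub) // leq_add2r.
  move=> C ECC; apply: nested_corner; rewrite ?nestedCl ?nestedCr //; last exact: nBE.
  by apply: nA'; exact: nA.
have MB : M B by [].
have fin X : cut X -> finite_set (crossM X).
  move=> cX; apply: sub_finite_set (finite_crossing (bdsize A) cX) => Z [[oZ _] nZ].
  split=> //; split; [exact: optimal_conn oZ|exact: optimal_conn (optimalC oZ)| |].
    by case: oZ => -[].
  by case: oZ => _; apply; case: oA.
have leBA : (ncard (crossM B) <= ncard (crossM A))%N.
  apply: leq_trans (ncard_image_le (tr g) (fin _ cA)).
  apply: ncard_sub; first by apply: finite_image; exact: fin.
  move=> Z [[oZ nZ] nBZ]; exists (tr g^-1 Z); last by rewrite trVK.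
  split; last by rewrite -nested_trV.
  split; first by rewrite -[H](tr_eqV gH); exact: optimal_tr.
  by move=> C ECC; rewrite nested_trV invgK; apply: nZ; exact: Etr.
(* the corners cross fewer cuts than [A] and [B], as they do not cross [B] itself *)
have : (ncard (crossM (A' `&` B)) + ncard (crossM (~` A' `&` ~` B)) <=
        ncard (crossM A `\` [set B]) + ncard (crossM B))%N.
  apply: ncard_submod; [exact: finite_setD (fin _ cA)|exact: fin| |].
    move=> Z ZU; have ZB : Z <> B.
      by move=> ZB; case: ZU => -[_]; apply; rewrite ZB; [constructor 1|constructor 2] => x [].
    have MZ : M Z by case: ZU => -[].
    have [nAZ|nAZ] := pselect (nested A Z); last by left; split.
    right; split=> // nBZ; case: ZU => -[_]; apply.
      by apply: nested_corner => //; exact: nA'.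
    by apply: nested_corner; rewrite ?nestedCl ?nestedCr //; exact: nA'.
  move=> Z [[MZ nX] [_ nY]].
  have ZB : Z <> B.
    by move=> ZB; case: nX; rewrite ZB; constructor 1 => x [].
  split; first (split; last by []).
    split=> // /nA' [H1|H1|H1|H1].
    - by apply: nX; constructor 1 => x [/H1].
    - by apply: nX; constructor 2 => x [/H1].
    - by apply: nY; constructor 1 => x [/H1].
    - by apply: nY; constructor 2 => x [/H1].
  split=> // -[H1|H1|H1|H1].
  - by apply: nX; constructor 1 => x [_ /H1].
  - by apply: nX; constructor 2 => x [_ /H1].
  - by apply: nY; constructor 1 => x [_ /H1].
  - by apply: nY; constructor 2 => x [_ /H1].
apply/negP; rewrite -ltnNge.
have lt : (ncard (crossM A `\` [set B]) < ncard (crossM A))%N.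
  by apply: (@ncard_lt _ _ _ B); [exact: fin|exact: subDsetl| |case=> _; apply].
apply: leq_trans (leq_add (mA _ MX) (mA _ MY)).
by rewrite -addSn leq_add.
Qed.

End Enlarge.

End Cuts.

(** * The tree of a nested system of cuts *)

Lemma finite_minimal (T : Type) (P : set (set T)) (D : set T) :
  finite_set P -> P D -> exists M, [/\ P M, (M `<=` D)%classic &
    forall F, P F -> (F `<=` M)%classic -> F = M].
Proof.
move=> fP PD; pose dn F := [set F' | P F' /\ (F' `<=` F)%classic]%classic.
have fdn F : finite_set (dn F) by apply: sub_finite_set fP => F' [].
have [M [PM MD] mM] := ex_measure_min (P := fun F => P F /\ (F `<=` D)%classic)
  (fun F => ncard (dn F)) (ex_intro _ D (conj PD (@subset_refl _ D))).
exists M; split=> // F PF FM; apply: contrapT => nFM.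
have /mM : P F /\ (F `<=` D)%classic by split=> //; exact: subset_trans FM MD.
rewrite leqNgt => /negP; apply; apply: (@ncard_lt _ _ _ M); [exact: fdn| |by split|].
  by move=> F' [PF' F'F]; split=> //; exact: subset_trans F'F FM.
by move=> [_ MF]; apply: nFM; exact/seteqP.
Qed.

Section NestedSystems.
Local Open Scope classical_set_scope.
Local Open Scope group_scope.
Variable G : groupType.
Implicit Types (A B C D F M : set G) (g h x y : G) (v : set (set G)).

Record nested_system (E : set (set G)) : Prop := NestedSystem {
  nsC : forall C, E C -> E (~` C);
  ns_tr : forall g C, E C -> E (tr g C);
  ns_nested : forall C D, E C -> E D -> nested C D;
  ns_sep : forall x y, finite_set [set C | [/\ E C, C x & ~ C y]];
  ns_cut : forall C, E C -> cut C;
  ns_ne : forall C, E C -> exists x, C x }.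

(** A vertex of the tree dual to [E] is encoded as the set of the members of [E]
    that contain it; [tau E C] is the end of the edge [C] inside [C]. *)
Definition tau (E : set (set G)) C : set (set G) :=
  [set D | E D /\ (C `<=` D \/ (~` C `<=` D /\ D <> ~` C))].

Definition trv g v : set (set G) := [set D | v (tr g^-1 D)].

Lemma trv1 v : trv 1 v = v.
Proof. by apply/seteqP; split=> D; rewrite /trv /= invg1 tr1. Qed.

Lemma trvM g h v : trv (g * h) v = trv g (trv h v).
Proof. by apply/seteqP; split=> D; rewrite /trv /= invgM trM. Qed.

Lemma trvK g : cancel (trv g) (trv g^-1).
Proof. by move=> A; rewrite -trvM mulVg trv1. Qed.

Lemma trvVK g : cancel (trv g^-1) (trv g).
Proof. by move=> A; rewrite -trvM mulgV trv1. Qed.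

Lemma finite_sep_tr C x y : cut C ->
  finite_set [set g | tr g C x /\ ~ tr g C y].
Proof.
move=> cC; apply: (@sub_finite_set _ _ ((fun h => x * h^-1) @`
  [set h | C h /\ ~ C (h * (x^-1 * y))])); last exact: finite_image.
by move=> g [/= Cx nCy]; exists (g^-1 * x); rewrite /= !grpE.
Qed.

Lemma finite_stab C D : cut C -> (exists x, C x) -> (exists x, ~ C x) ->
  finite_set [set g | tr g C = D].
Proof.
move=> cC [x Cx] [y nCy]; have [[g0 <-]|nex] := pselect (exists g, tr g C = D).
  apply: sub_finite_set (finite_sep_tr (g0 * x) (g0 * y) cC) => g /= ->.
  by rewrite !mem_trM.
rewrite (_ : mkset _ = set0) //; apply/seteqP; split=> // g gC.
by apply: nex; exists g.
Qed.

Section OneSystem.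
Variable E : set (set G).
Hypothesis nsE : nested_system E.

Lemma ns_proper C : E C -> exists x, ~ C x.
Proof. by move=> /(nsC nsE) /(ns_ne nsE). Qed.

Lemma ns_stab_finite C D : E C -> finite_set [set g | tr g C = D].
Proof.
by move=> EC; apply: finite_stab; [exact: ns_cut nsE _ EC|exact: ns_ne nsE _ EC|exact: ns_proper].
Qed.

Lemma tauE C D : tau E C D -> E D. Proof. by case. Qed.

Lemma tau_self C : E C -> tau E C C.
Proof. by move=> EC; split=> //; left. Qed.

Lemma tau_up C D F : tau E C D -> E F -> D `<=` F -> tau E C F.
Proof.
move=> [ED [CD|[CD nD]]] EF DF; split=> //; first by left; exact: subset_trans DF.
right; split; first exact: subset_trans DF.
by move=> FE; apply: nD; apply/seteqP; split=> //; rewrite -FE.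
Qed.

Lemma tau_or C D : E C -> E D -> tau E C D \/ tau E C (~` D).
Proof.
move=> EC ED; have ED' := nsC nsE ED.
have [H|H|H|H] := ns_nested nsE EC ED.
- by left; split=> //; left.
- by right; split=> //; left.
- have [DE|nD] := pselect (D = ~` C).
    by right; rewrite DE setCK; exact: tau_self.
  by left; split=> //; right.
- have [DE|nD] := pselect (~` D = ~` C).
    by left; rewrite -[D]setCK DE setCK; exact: tau_self.
  by right; split=> //; right.
Qed.

Lemma tau_nand C D : E C -> tau E C D -> ~ tau E C (~` D).
Proof.
move=> EC [_ H1] [_ H2]; have [c Cc] := ns_ne nsE EC; have [c' nCc'] := ns_proper EC.
case: H1 H2 => [CD|[CD nD]] [CD'|[CD' nD']].
- exact: CD' Cc (CD _ Cc).
- by apply: nD'; congr (~` _); apply/seteqP; split=> //; move/subCC: CD'.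
- by apply: nD; apply/seteqP; split=> //; exact: subCr.
- exact: CD' nCc' (CD _ nCc').
Qed.

Lemma tau_nor C D : E C -> E D -> ~ tau E C D -> tau E C (~` D).
Proof. by move=> EC ED nD; case: (tau_or EC ED). Qed.

Lemma tau_antisym C D : E C -> tau E C D -> D `<=` C -> D = C.
Proof.
move=> EC [ED [CD|[CD nD]]] DC; first exact/seteqP.
by have [c nCc] := ns_proper EC; case: (nCc); exact/DC/CD.
Qed.

Lemma tau_eq_sub C D : E C -> E D -> (tau E D `<=` tau E C) -> tau E D = tau E C.
Proof.
move=> EC ED sub; apply/seteqP; split=> // F tF; apply: contrapT => nF.
by apply: (tau_nand EC tF); apply: sub; apply: tau_nor => //; exact: tauE tF.
Qed.

Lemma tau_eq_min C D : E C -> tau E C D ->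
  (forall F, tau E C F -> F `<=` D -> F = D) -> tau E D = tau E C.
Proof.
move=> EC tD mD; have ED := tauE tD; apply: tau_eq_sub => // F [EF [DF|[DF nF]]].
  exact: tau_up tD EF DF.
apply: contrapT => ntF; apply: nF; rewrite -(mD (~` F)) ?setCK //.
  exact: tau_nor.
exact: subCl.
Qed.

Lemma finite_tau_notin C x : E C -> finite_set [set D | tau E C D /\ ~ D x].
Proof.
move=> EC; have [c Cc] := ns_ne nsE EC; have [c' nCc'] := ns_proper EC.
apply: (@sub_finite_set _ _ ([set D | [/\ E D, D c & ~ D x]] `|`
  [set D | [/\ E D, D c' & ~ D x]])).
  move=> D [[ED [CD|[CD _]]] nDx]; [left|right]; split=> //; exact: CD.
by rewrite finite_setU; split; exact: ns_sep nsE _ _.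
Qed.

Lemma tau_exmin C D : E C -> tau E C D -> exists M,
  [/\ tau E C M, M `<=` D & tau E M = tau E C].
Proof.
move=> EC tD; have [y nDy] := ns_proper (tauE tD).
have [M [[tM nMy] MD mM]] := finite_minimal (finite_tau_notin y EC) (conj tD nDy).
exists M; split=> //; apply: tau_eq_min => // F tF FM; apply: mM => //.
by split=> // /FM.
Qed.

Lemma tau_tr g C : tau E (tr g C) = trv g (tau E C).
Proof.
apply/seteqP; split=> D; rewrite /trv /tau /=.
  move=> [ED [CD|[CD nD]]]; (split; first exact: (ns_tr nsE)).
    by left; rewrite -(tr_sub g) trVK.
  right; rewrite -(tr_sub g) trVK trC; split=> // DE; apply: nD.
  by rewrite -trC -DE trVK.
move=> [ED H]; split; first by rewrite -[D](trVK g); exact: (ns_tr nsE).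
case: H => [CD|[CD nD]]; [left|right]; first by rewrite -[D](trVK g) tr_sub.
split; first by rewrite -[D](trVK g) -trC tr_sub.
by move=> DE; apply: nD; rewrite DE -trC trK.
Qed.

Definition vstab v : set G := [set g | trv g v = v].

Lemma vstab_tau_side C D : E C -> tau E C D -> finite_set (vstab (tau E C) `\` D).
Proof.
move=> EC tD; apply: (@sub_finite_set _ _ [set h | exists2 F,
  [set F | tau E C F /\ ~ F 1] F & [set h | tr h^-1 D = F] h]).
  move=> h [hv nDh] /=; exists (tr h^-1 D) => //; split.
    by move: tD; rewrite -{1}hv.
  by rewrite mem_tr invgK mulg1.
apply: finite_bigU; first exact: finite_tau_notin.
move=> F _; apply: sub_finite_set
  (finite_image (fun g => g^-1) (ns_stab_finite F (tauE tD))) => h /= hD.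
by exists h^-1; rewrite ?invgK.
Qed.

Lemma vstab_tau_side' C D : E C -> E D -> ~ tau E C D ->
  finite_set (vstab (tau E C) `&` D).
Proof.
move=> EC ED /(tau_nor EC ED) /(vstab_tau_side EC).
by rewrite setDE setCK.
Qed.

Lemma vstab_group C : [/\ vstab (tau E C) 1,
  forall g, vstab (tau E C) g -> vstab (tau E C) g^-1 &
  forall g h, vstab (tau E C) g -> vstab (tau E C) h -> vstab (tau E C) (g * h)].
Proof.
split; first exact: trv1.
  by move=> g gv; rewrite /vstab /= -{1}gv trvK.
by move=> g h gv hv; rewrite /vstab /= trvM hv.
Qed.

(** ** Labels integrate along the tree *)

Let out C := E C /\ ~ C 1.
Let up C := [set D | [/\ out D, C `<=` D & D <> C]].
Let isnext C D := up C D /\ forall F, up C F -> D `<=` F.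

Let up_finite C : out C -> finite_set (up C).
Proof.
move=> [EC nC1]; have [c Cc] := ns_ne nsE EC.
by apply: sub_finite_set (ns_sep nsE c 1) => D [[ED nD1] CD _]; split=> //; exact: CD.
Qed.

Let ex_next C D : out C -> up C D -> exists F, isnext C F.
Proof.
move=> oC uD; have [M [uM _ mM]] := finite_minimal (up_finite oC) uD.
exists M; split=> // F uF; have [[EM nM1] CM _] := uM; have [[EF nF1] CF _] := uF.
have [c Cc] := ns_ne nsE oC.1.
have [H|H|H|H] := ns_nested nsE EM EF => //.
- by case: (H c); [exact: CM|exact: CF].
- by case: nF1; exact: H.
- by rewrite (mM F uF) //; move/subCC: H.
Qed.

Let next_lt C D : out C -> isnext C D -> (ncard (up D) < ncard (up C))%N.
Proof.
move=> oC [uD mD]; have [oD CD nD] := uD.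
apply: (@ncard_lt _ _ _ D) => //; first exact: up_finite.
  move=> F [oF DF nF]; split=> //; first exact: subset_trans DF.
  by move=> FC; apply: nD; apply/seteqP; split=> //; rewrite -FC.
by case.
Qed.

Let next_tau C D : out C -> isnext C D -> tau E (~` C) = tau E D.
Proof.
move=> [EC nC1] [uD mD]; have [[ED nD1] CD nD] := uD.
symmetry; apply: tau_eq_min; first exact: nsC nsE _ EC.
  by split=> //; right; rewrite setCK.
move=> F [EF H] FD; apply/seteqP; split=> //; apply: mD.
case: H => [CF|[]]; rewrite ?setCK; first by case: nD1; apply: FD; exact: CF.
by move=> CF nF; split=> //; split=> // /FD.
Qed.

Let next_tau0 C : out C -> (~ exists D, isnext C D) ->
  tau E (~` C) = [set D | E D /\ D 1].
Proof.
move=> oC nex; have [EC nC1] := oC.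
have sub D : tau E (~` C) D -> D 1.
  move=> [ED [CD|[]]]; first exact: CD.
  rewrite setCK => CD nD; apply: contrapT => nD1.
  by apply: nex; apply: (@ex_next _ D).
apply/seteqP; split=> D; first by move=> tD; split; [exact: tauE tD|exact: sub].
move=> [ED D1]; apply: contrapT => /(tau_nor (nsC nsE EC) ED) /sub.
exact.
Qed.

Let out_inj C D : out C -> out D -> tau E C = tau E D -> C = D.
Proof.
have sub A B : out A -> out B -> tau E A = tau E B -> A `<=` B.
  move=> oA [EB nB1] AB; have : tau E A B by rewrite AB; exact: tau_self.
  by move=> [_ [//|[AB' _]]]; case: nB1; apply: AB'; case: oA.
by move=> oC oD CD; apply/seteqP; split; apply: sub.
Qed.

(** The members of the system that do not contain [1] point away from it, and above
    each of them are finitely many others: a potential is the product of the labels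
    on the way from [1]. *)
Theorem tau_potential (L : groupType) (m : set G -> L) :
  (forall C, E C -> m (~` C) = (m C)^-1) ->
  exists Phi : set (set G) -> L, forall C, E C ->
    Phi (tau E C) = Phi (tau E (~` C)) * m C.
Proof.
move=> mC.
pose nx C := if pselect (exists D, isnext C D) is left ex then Some (projT1 (cid ex)) else None.
pose fix f n C {struct n} := if n is n'.+1 then
  (if nx C is Some D then f n' D else 1) * m C else 1.
have nxP C : (exists2 D, nx C = Some D & isnext C D) \/
             (nx C = None /\ ~ exists D, isnext C D).
  rewrite /nx; case: pselect => [ex|nex]; [left|by right].
  by case: cid => D DP /=; exists D.
pose phi C := f (ncard (up C)).+1 C.
have fE n n' C : out C -> (ncard (up C) < n)%N -> (ncard (up C) < n')%N ->
    f n C = f n' C.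
  elim: n n' C => // n IH [//|n'] C oC; rewrite !ltnS => len len' /=.
  congr (_ * _); have [[D -> nD]|[-> _] //] := nxP C.
  have lt := next_lt oC nD; have oD : out D by case: nD => -[].
  by apply: IH => //; [exact: leq_trans lt len|exact: leq_trans lt len'].
pose Phi v := if pselect (exists2 C, out C & tau E C = v) is left ex
              then phi (s2val (cid2 ex)) else 1.
have PhiE C : out C -> Phi (tau E C) = phi C.
  move=> oC; rewrite /Phi; case: pselect => [ex|[]]; last by exists C.
  by case: cid2 => D oD DC /=; rewrite (out_inj oD oC DC).
have Phi1 : Phi [set D | E D /\ D 1] = 1.
  rewrite /Phi; case: pselect => // -[C [EC nC1] CE]; exfalso.
  by have := tau_self EC; rewrite CE => -[].
exists Phi => C EC.
have key D : out D -> Phi (tau E D) = Phi (tau E (~` D)) * m D.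
  move=> oD; rewrite PhiE //; have [[F nxF nF]|[nxN nex]] := nxP D.
    have oF : out F by case: nF => -[].
    rewrite (next_tau oD nF) PhiE // /phi [in LHS]/= nxF; congr (_ * _).
    by apply: fE => //; exact: next_lt.
  by rewrite next_tau0 // Phi1 /phi /= nxN.
have [C1|nC1] := pselect (C 1); last exact: key.
have := key (~` C); rewrite setCK mC // => -> //; first by rewrite !grpE.
by split; [exact: nsC nsE _ EC|apply].
Qed.

(** Every vertex is reached from the vertex of [1] by finitely many edges. *)
Theorem tau_connected (P : set (set G) -> Prop) :
  (forall C, E C -> P (tau E C) <-> P (tau E (~` C))) ->
  forall C D, E C -> E D -> P (tau E C) -> P (tau E D).
Proof.
move=> PC; suff H C : E C -> (P (tau E C) <-> P [set D | E D /\ D 1]).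
  by move=> C D EC ED /(H C EC) /(H D ED).
suff H n D : out D -> (ncard (up D) < n)%N -> (P (tau E D) <-> P [set D | E D /\ D 1]).
  move=> EC; have [C1|nC1] := pselect (C 1); last exact: (H _ C).
  rewrite PC //; apply: (H _ (~` C)) => //.
  by split; [exact: nsC nsE _ EC|apply].
elim: n D => // n IH D oD; rewrite ltnS => len; rewrite PC; last by case: oD.
have [[F nF]|nex] := pselect (exists F, isnext D F); last by rewrite next_tau0.
have oF : out F by case: nF => -[].
rewrite (next_tau oD nF); apply: IH => //; exact: leq_trans (next_lt oD nF) len.
Qed.

End OneSystem.
End NestedSystems.

(** * Chains of splittings *)

Section Subsystems.
Local Open Scope classical_set_scope.
Local Open Scope group_scope.
Variables (G : groupType) (E1 E2 : set (set G)).
Hypotheses (ns1 : nested_system E1) (ns2 : nested_system E2).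
Hypothesis E12 : E1 `<=` E2.
Implicit Types (C D : set G) (g : G).

(** Collapsing the edges outside [E1] maps the tree of [E2] onto that of [E1]. *)
Lemma tau_collapse C : tau E1 C = tau E2 C `&` E1.
Proof.
apply/seteqP; split=> D; first by move=> [ED H]; split=> //; split=> //; exact: E12.
by move=> [[_ H] ED]; split.
Qed.

Lemma trv_collapse g C C' : E1 C -> E1 C' ->
  trv g (tau E2 C) = tau E2 C' -> trv g (tau E1 C) = tau E1 C'.
Proof.
move=> EC EC'; rewrite -!tau_tr // => CC'; rewrite !tau_collapse CC'.
by [].
Qed.

Lemma vstab_collapse C : E1 C -> vstab (tau E2 C) `<=` vstab (tau E1 C).
Proof. by move=> EC g; exact: trv_collapse. Qed.

(** A vertex of the finer tree at which only edges of [E1] end is not affected by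
    the collapse. *)
Lemma trv_expand g C C' : E1 C -> E1 C' ->
  (forall D, E2 D -> tau E2 D = tau E2 C -> E1 D) ->
  trv g (tau E1 C) = tau E1 C' -> trv g (tau E2 C) = tau E2 C'.
Proof.
move=> EC EC' star; rewrite -!tau_tr // => CC'.
have EgC : E1 (tr g C) by exact: (ns_tr ns1 _ EC).
apply: tau_eq_sub ns2 _ _ (E12 EC') (E12 EgC) _ => F tF.
have [M [tM MF ME]] := tau_exmin ns2 (E12 EgC) tF.
have EM : E1 M.
  rewrite -[M](trVK g); apply: (ns_tr ns1); apply: star.
    by apply: (ns_tr ns2); exact: tauE tM.
  by rewrite tau_tr // ME tau_tr // trvK.
have : tau E1 C' M by rewrite -CC' tau_collapse.
rewrite tau_collapse => -[tM' _].
exact: (tau_up tM' (tauE tF) MF).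
Qed.

Lemma vstab_expand C : E1 C ->
  (forall D, E2 D -> tau E2 D = tau E2 C -> E1 D) ->
  vstab (tau E1 C) = vstab (tau E2 C).
Proof.
move=> EC star; apply/seteqP; split; last exact: vstab_collapse.
by move=> g; exact: trv_expand.
Qed.

End Subsystems.

Section Chains.
Local Open Scope classical_set_scope.
Local Open Scope group_scope.
Variables (G : groupType) (S : seq G).
Hypothesis Ssym : forall s, s \in S -> s^-1 \in S.
Hypothesis Sgen : forall P : G -> Prop,
  P 1 -> (forall g s, s \in S -> P g -> P (g * s)) -> forall g, P g.
Implicit Types (A C D F H : set G) (g h x y : G) (c : nat -> set G) (I : set nat).

Definition orb c I : set (set G) :=
  [set D | exists2 i, I i & exists g, D = tr g (c i) \/ D = tr g (~` c i)].

Lemma orb_ext c c' I : (forall i, I i -> c i = c' i) -> orb c I = orb c' I.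
Proof.
move=> cc'; apply/seteqP; split=> D [i Ii [g DE]]; exists i => //; exists g.
  by rewrite -cc'.
by rewrite cc'.
Qed.

Lemma orb_sub c I J : I `<=` J -> orb c I `<=` orb c J.
Proof. by move=> IJ D [i Ii H]; exists i => //; exact: IJ. Qed.

Lemma orb_mem c I i : I i -> orb c I (c i).
Proof. by move=> Ii; exists i => //; exists 1; left; rewrite tr1. Qed.

Lemma orb_memC c I i : I i -> orb c I (~` c i).
Proof. by move=> Ii; exists i => //; exists 1; right; rewrite tr1. Qed.

(** [H] is the stabilizer of a vertex of the tree of [E]; if [E] is empty, the
    tree is a point. *)
Definition vst (E : set (set G)) H :=
  (E = set0 /\ H = setT) \/ exists2 C, E C & H = vstab (tau E C).

(** The cut [A] refines the tree of the first [n] cuts at an infinite vertex. *)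
Definition step c n A := exists H,
  [/\ vst (orb c `I_n) H, infinite_set H, optimal S H A,
      forall C, orb c `I_n C -> nested A C & forall g, nested A (tr g A)].

Definition chain c n := forall k, (k < n)%N -> step c k (c k).

Lemma chainW c n m : (m <= n)%N -> chain c n -> chain c m.
Proof. by move=> mn cn k km; apply: cn; exact: leq_trans km mn. Qed.

Lemma step_splits c n A : step c n A ->
  [/\ cut A, exists x, A x & exists x, ~ A x].
Proof.
move=> [H [_ _ [[cA i1 i2] _] _ _]]; split=> //.
  by have /infinite_setN0[x [Hx Ax]] := i1; exists x.
by have /infinite_setN0[x [Hx Ax]] := i2; exists x.
Qed.

Lemma chain_nested c n i j g : chain c n -> (i < n)%N -> (j < n)%N ->
  nested (c i) (tr g (c j)).
Proof.
move=> ch ilt jlt; have [ltij|ltji|<-] := ltngtP i j.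
- have [H [_ _ _ nE _]] := ch _ jlt.
  apply: nested_sym; rewrite nested_trV; apply: nE.
  by exists i => //; exists g^-1; left.
- have [H [_ _ _ nE _]] := ch _ ilt.
  by apply: nE; exists j => //; exists g; left.
- by have [H [_ _ _ _ nE]] := ch _ ilt.
Qed.

Lemma orb_nested_system c I : finite_set I ->
  (forall i, I i -> [/\ cut (c i), exists x, c i x & exists x, ~ c i x]) ->
  (forall i j g, I i -> I j -> nested (c i) (tr g (c j))) ->
  nested_system (orb c I).
Proof.
move=> fI ci cn; split.
- move=> C [i Ii [g [->|->]]]; exists i => //; exists g; first by right.
  by left; rewrite -trC setCK.
- by move=> g C [i Ii [h [->|->]]]; exists i => //; exists (g * h);
    [left|right]; rewrite trM.
- move=> C D [i Ii [g CE]] [j Ij [h DE]].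
  have : nested (tr g (c i)) (tr h (c j)).
    by rewrite nested_trV -trM; exact: cn.
  by case: CE DE => -> [] ->; rewrite ?trC ?nestedCl ?nestedCr.
- move=> x y; apply: (@sub_finite_set _ _ [set C | exists2 i, I i &
    (((fun g => tr g (c i)) @` [set g | tr g (c i) x /\ ~ tr g (c i) y] `|`
     (fun g => tr g (~` c i)) @` [set g | tr g (~` c i) x /\ ~ tr g (~` c i) y]) C)]).
    move=> C [[i Ii [g CE]] Cx Cy]; exists i => //.
    by case: CE Cx Cy => -> Cx Cy; [left|right]; exists g.
  apply: finite_bigU => // i Ii; rewrite finite_setU.
  have [cc _ _] := ci i Ii.
  by split; apply: finite_image; apply: finite_sep_tr => //; exact: cutC.
- move=> C [i Ii [g [->|->]]]; have [cc _ _] := ci i Ii; apply: cut_tr => //.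
  exact: cutC.
- move=> C [i Ii [g CE]]; have [_ [x cx] [y ncy]] := ci i Ii.
  by case: CE => ->; [exists (g * x)|exists (g * y)]; rewrite mem_trM.
Qed.

Lemma chain_system c n I : chain c n -> I `<=` `I_n -> nested_system (orb c I).
Proof.
move=> ch In; apply: orb_nested_system.
- exact: sub_finite_set In (finite_II n).
- by move=> i /In ilt; exact: step_splits (ch _ ilt).
- by move=> i j g /In ilt /In jlt; exact: chain_nested ch ilt jlt.
Qed.

Lemma chain_optimal c n C : chain c n -> orb c `I_n C -> exists H, optimal S H C.
Proof.
move=> ch [i /= ilt [g CE]]; have [H [_ _ oH _ _]] := ch _ ilt.
exists (tr g H); case: CE => ->; apply: optimal_tr => //.
exact: optimalC.
Qed.

Lemma orb_bd c n : exists k, forall C, (forall i, (i < n)%N -> cut (c i)) ->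
  orb c `I_n C -> (bdsize S C <= k)%N.
Proof.
exists (\max_(i < n) bdsize S (c i)) => C cc [i /= ilt [g CE]].
have -> : bdsize S C = bdsize S (c i).
  have ci := cc i ilt; case: CE => ->; rewrite bdsize_tr //; last exact: cutC.
  exact: bdsizeC.
exact: (leq_bigmax (Ordinal ilt)).
Qed.

Section Vertex.
Variables (E : set (set G)) (H : set G).
Hypotheses (nsE : nested_system E) (vH : vst E H).

Lemma vst_group : [/\ H 1, forall g, H g -> H g^-1 &
  forall g h, H g -> H h -> H (g * h)].
Proof. by case: vH => [[_ ->]//|[C _ ->]]; exact: vstab_group. Qed.

Lemma vst_tr g : H g -> tr g H = H.
Proof.
have [H1 HV HM] := vst_group; move=> Hg; apply/seteqP; split=> x /=.
  by rewrite mem_tr => Hx; rewrite -(mulVKg g x); exact: HM.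
by move=> Hx; rewrite mem_tr; apply: HM => //; exact: HV.
Qed.

Lemma vst_side C : E C -> finite_set (H `\` C) \/ finite_set (H `&` C).
Proof.
move=> EC; case: vH => [[E0 _]|[D ED ->]]; first by rewrite E0 in EC.
have [tC|ntC] := pselect (tau E D C); [left|right].
  exact: vstab_tau_side.
exact: vstab_tau_side'.
Qed.

Lemma vst_separated g : H g \/
  exists C, [/\ E C, finite_set (H `\` C) & finite_set (tr g H `&` C)].
Proof.
case: vH => [[_ ->]|[D ED ->]]; first by left.
have [gD|ngD] := pselect (vstab (tau E D) g); [by left|right].
have [C [tC ntC]] : exists C, tau E D C /\ ~ trv g (tau E D) C.
  apply: contrapT => nex; apply: ngD; rewrite /vstab /= -tau_tr //.
  symmetry; apply: tau_eq_sub => //; first exact: (ns_tr nsE _ ED).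
  move=> C tC; apply: contrapT => ntC; apply: nex; exists C; split=> //.
  by rewrite -tau_tr.
exists C; split; [exact: tauE tC|exact: vstab_tau_side|].
rewrite -[C](trVK g) -trI; apply/finite_tr; apply: vstab_tau_side' => //.
by apply: (ns_tr nsE); exact: tauE tC.
Qed.

End Vertex.

(** The next cut is chosen by [enlarge_nested], so that the system stays nested and
    consists of smallest cuts. *)
Theorem chain_extend c n H : chain c n -> vst (orb c `I_n) H -> infinite_set H ->
  (exists A, splits H A) -> exists A, step c n A.
Proof.
move=> ch vH iH sH; have nsE := chain_system ch (@subset_refl _ `I_n).
have [k kP] := orb_bd c n.
have cc i : (i < n)%N -> cut (c i) by move=> /ch/step_splits[].
have [A [oA nA sA]] := @enlarge_nested G S Ssym Sgen (orb c `I_n) k H (nsC nsE)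
  (ns_tr nsE) (ns_nested nsE) (fun C => chain_optimal ch)
  (fun C => kP C cc) (vst_side nsE vH)
  (fun g => match vst_separated nsE vH g with
            | or_introl Hg => or_introl (vst_tr vH Hg)
            | or_intror ex => or_intror ex end) sH.
by exists A, H.
Qed.

(** Either the splitting process stops, or it produces an infinite chain. *)
Theorem chain_alternative :
  (forall c n H, chain c n -> vst (orb c `I_n) H -> infinite_set H ->
     exists A, splits H A) ->
  (exists c n, chain c n /\ forall H, vst (orb c `I_n) H -> finite_set H) \/
  (exists c, forall n, chain c n).
Proof.
move=> Hs; have [ex|nex] := pselect (exists c n, chain c n /\
  forall H, vst (orb c `I_n) H -> finite_set H); [by left|right].
have ext c n : chain c n -> exists A, step c n A.
  move=> ch; have [[H [vH iH]]|nH] := pselect (exists H,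
      vst (orb c `I_n) H /\ infinite_set H).
    by apply: chain_extend (Hs _ _ _ ch vH iH).
  case: nex; exists c, n; split=> // H vH; apply: contrapT => iH.
  by apply: nH; exists H.
pose nxt (s : seq (set G)) := xget set0 (step (nth set0 s) (size s)).
pose st n := iter n (fun s => rcons s (nxt s)) [::].
have szst n : size (st n) = n by elim: n => //= n IH; rewrite size_rcons IH.
pose c n := nxt (st n).
have stE n i : (i < n)%N -> nth set0 (st n) i = c i.
  elim: n => // n IH; rewrite ltnS leq_eqVlt => /orP[/eqP->|ilt] /=.
    by rewrite nth_rcons szst ltnn eqxx.
  by rewrite nth_rcons szst ilt IH.
have stepE n A : step (nth set0 (st n)) n A <-> step c n A.
  have orbE : orb (nth set0 (st n)) `I_n = orb c `I_n.
    by apply: orb_ext => i /= ilt; rewrite stE.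
  by rewrite /step orbE.
have cP n : chain c n.
  elim: n => // n IH k; rewrite ltnS leq_eqVlt => /orP[/eqP->|klt]; last exact: IH.
  apply/stepE; rewrite /c /nxt szst; have [A /stepE sA] := ext _ _ IH.
  exact: xgetPex (ex_intro _ A sA).
by exists c.
Qed.

(** An end of the last edge whose stabilizer is no larger than that of the edge
    would be a leaf at which all translates of the edge end, unless both ends of
    the edge are in one orbit; then the last cut would not split anything. *)
Theorem last_edge_loop c n C : chain c n.+1 -> C = c n \/ C = ~` c n ->
  vstab (tau (orb c `I_n.+1) C) `<=` [set g | tr g C = C] ->
  exists g, trv g (tau (orb c `I_n.+1) (~` C)) = tau (orb c `I_n.+1) C /\
            tr g (~` C) <> C.
Proof.
move=> ch CE vsub; apply: contrapT => nloop.
have nsE := chain_system ch (@subset_refl _ `I_n.+1).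
set E := orb c `I_n.+1 in nsE vsub nloop *.
have ch' := chainW (leqnSn n) ch; have nsE' := chain_system ch' (@subset_refl _ `I_n).
have [H [vH iH oH _ _]] := ch n (ltnSn n).
have EC : E C.
  by case: CE => ->; [apply: orb_mem|apply: orb_memC] => /=.
have sC : splits H C.
  by case: oH CE => oH _ [] ->//; exact: splitsC.
have [cC iC iCC] := sC.
pose EA := [set D | exists2 h, tr h H = H & D = tr h C \/ D = tr h (~` C)].
have EA_E D : EA D -> E D.
  by move=> [h _ [->|->]]; apply: (ns_tr nsE) => //; exact: (nsC nsE).
have EA_splits D : EA D -> splits H D.
  move=> [h hH DE]; rewrite -hH; case: DE => ->; apply: splits_tr => //.
  exact: splitsC.
have finsub X Y Z : finite_set (X `&` Y) -> Z `<=` Y -> finite_set (X `&` Z).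
  by move=> f ZY; apply: sub_finite_set f => x [Xx /ZY].
have between D F : EA D -> E F -> D `<=` F -> F `<=` C -> EA F.
  move=> ED EF DF FC; have [_ iD iDC] := EA_splits _ ED.
  case: (EF) => i /= ilt [g FE].
  have [ilt'|ige] := ltnP i n.
    have EF' : orb c `I_n F by exists i => //; exists g.
    have [f|f] := vst_side nsE' vH EF'.
      by case: iCC; apply: finsub f _ => x nCx /FC.
    by case: iD; exact: finsub f DF.
  have ieq : i = n by apply/eqP; rewrite eqn_leq ige andbT -ltnS.
  have FE' : F = tr g C \/ F = tr g (~` C).
    by move: FE; rewrite ieq; case: CE => ->; rewrite ?setCK //; case=> ->; [right|left].
  have [Hg|[C' [EC' f1 f2]]] := vst_separated nsE' vH g.
    by exists g => //; exact: vst_tr vH _ Hg.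
  have [_ iF iFC] : splits (tr g H) F.
    by case: FE' => ->; apply: splits_tr => //; exact: splitsC.
  have EC2 : E C' by apply: orb_sub EC' => k /= /leq_trans; apply.
  have [h|h|h|h] := ns_nested nsE EF EC2.
  - by case: iF; exact: finsub f2 h.
  - by case: iD; apply: finsub f1 _; exact: subset_trans DF h.
  - by case: iFC; exact: finsub f2 h.
  - case: iCC; apply: finsub f1 _ => x nCx C'x; apply: nCx; apply: FC.
    by apply: contrapT => /h.
have noD D : EA D -> D `<=` C -> D = C.
  move=> ED DC; apply: contrapT => nDC.
  have [d Dd] := ns_ne nsE (EA_E _ ED); have [x nCx] := ns_proper nsE EC.
  have fP : finite_set [set F | EA (~` F) /\ D `<=` ~` F /\ ~` F `<=` C /\ ~` F <> C].
    apply: sub_finite_set (ns_sep nsE x d) => F [EF [DF [FC _]]]; split.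
    - by rewrite -[F]setCK; apply: (nsC nsE); exact: EA_E.
    - by apply: contrapT => /FC.
    - exact: (DF _ Dd).
  have PD : [set F | EA (~` F) /\ D `<=` ~` F /\ ~` F `<=` C /\ ~` F <> C] (~` D).
    by rewrite /= setCK; split=> //; split; [exact: subset_refl|split].
  have [M [[EM [DM [MC nMC]]] _ mM]] := finite_minimal fP PD.
  have EM' := EA_E _ EM.
  have EMM : E M by rewrite -[M]setCK; exact: (nsC nsE EM').
  have tM : tau E C M.
    split=> //; right; split; first exact: subCl.
    by move=> ME; apply: nMC; rewrite ME setCK.
  have tauM : tau E M = tau E C.
    apply: tau_eq_min => // F [EF [CF|[CF nF]]] FM.
      have Cd : C d by exact: DC.
      by case: (DM _ Dd); exact/FM/CF.
    apply: mM => //; have FC : ~` F `<=` C by exact: subCl.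
    have DF : D `<=` ~` F by move=> z /DM nMz /FM.
    split; last by split=> //; split=> // FE; apply: nF; rewrite -FE setCK.
    by apply: between ED _ DF FC; exact: (nsC nsE EF).
  have MC' : M <> C by move=> ME; case: (DM _ Dd); rewrite ME; exact: DC.
  case: EM => h hH [ME|ME].
    by apply: nloop; exists h; rewrite -tau_tr // trC -ME setCK.
  have ME' : M = tr h C by rewrite -[M]setCK ME -trC setCK.
  by apply: MC'; rewrite ME'; apply: vsub; rewrite /vstab /= -tau_tr // -ME'.
have disj h : tr h H = H -> tr h C = C \/ tr h C `<=` ~` C.
  move=> hH; have [s|s|s|s] : nested (tr h C) C.
    by apply: (ns_nested nsE _ EC); exact: (ns_tr nsE _ EC).
  - by left; apply: noD => //; exists h => //; left.
  - by right.
  - right; rewrite -[X in ~` X](noD (tr h (~` C))) //; last by exists h => //; right.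
    by rewrite trC setCK.
  - left; have : tr h^-1 C = C.
      apply: noD; first by exists h^-1; [rewrite -{1}hH trK|left].
      by rewrite -(tr_sub h) trVK; apply/subCC.
    by move=> {1}<-; rewrite trVK.
apply: iC; have [[h0 [Hh0 Ch0]]|nex] := pselect (exists h, (H `&` C) h); last first.
  rewrite (_ : _ `&` _ = set0) //; apply/seteqP; split=> // h Ch.
  by apply: nex; exists h.
apply: (@sub_finite_set _ _ ((fun u => u * h0) @` [set u | tr u C = C])).
  move=> h [Hh Ch]; exists (h * h0^-1); rewrite /= ?grpE //.
  have [_ HV HM] := vst_group vH.
  have [//|dis] := disj (h * h0^-1) (vst_tr vH (HM _ _ Hh (HV _ Hh0))).
  by case: (dis h) => //; rewrite mem_tr !grpE.
apply: finite_image; exact: (ns_stab_finite nsE _ EC).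
Qed.

Lemma last_edge_not_inverted c n C : chain c n.+1 -> C = c n \/ C = ~` c n ->
  vstab (tau (orb c `I_n.+1) C) `<=` [set g | tr g C = C] ->
  forall t, tr t C <> ~` C.
Proof.
move=> ch CE vsub t tC; have [g [gC nC]] := last_edge_loop ch CE vsub.
have nsE := chain_system ch (@subset_refl _ `I_n.+1).
have EC : orb c `I_n.+1 C.
  by case: CE => ->; [apply: orb_mem|apply: orb_memC] => /=.
apply: nC; rewrite -tC -trM; apply: vsub; rewrite /vstab /= trvM -tau_tr //.
by rewrite tC.
Qed.

End Chains.

(** * Chains over a finitely presented group are bounded *)

Section LastCorners.
Local Open Scope classical_set_scope.
Local Open Scope group_scope.
Variables (G : groupType) (S : seq G).
Hypothesis Ssym : forall s, s \in S -> s^-1 \in S.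
Hypothesis Sgen : forall P : G -> Prop,
  P 1 -> (forall g s, s \in S -> P g -> P (g * s)) -> forall g, P g.
Implicit Types (A C D F H N : set G) (g h u v w x y : G).

(** The complex whose cells are the triangles of the Cayley graph has no first
    cohomology mod 2. *)
Definition triangle_coherent := forall c : G -> G -> bool,
  (forall u v w, u^-1 * v \in S -> v^-1 * w \in S -> u^-1 * w \in S ->
     c u v (+) c v w = c u w) ->
  exists a : G -> bool, forall u v, u^-1 * v \in S -> c u v = a u (+) a v.

Hypothesis coh : triangle_coherent.

(** A smallest cut has a connected coboundary for the relation of lying in a
    common triangle: a union of classes of this relation is again a coboundary,
    and either it or its complement would give a smaller cut that splits. *)
Lemma optimal_track H C (K : set (G * G)) : optimal S H C -> K `<=` bd S C ->
  (exists e, K e) ->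
  (forall u v w, C u -> ~ C v -> ~ C w -> u^-1 * v \in S -> u^-1 * w \in S ->
     K (u, v) -> K (u, w)) ->
  (forall u v w, C u -> C v -> ~ C w -> u^-1 * w \in S -> v^-1 * w \in S ->
     K (u, w) -> K (v, w)) ->
  K = bd S C.
Proof.
move=> [[cC iC iCC] mC] KC [e0 Ke0] K1 K2.
have sV u v : u^-1 * v \in S -> v^-1 * u \in S.
  by move=> /Ssym; rewrite invgM invgK.
pose k u v := `[< K (u, v) >] || `[< K (v, u) >].
have nK u v : (C u -> C v) -> `[< K (u, v) >] = false.
  by move=> uv; apply/asboolPn => /KC[/= /uv Cv nCv _].
have k0 u v : (C u <-> C v) -> k u v = false.
  by move=> [uv vu]; rewrite /k !nK.
have k1 u v : C u -> ~ C v -> k u v = `[< K (u, v) >].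
  by move=> Cu nCv; rewrite /k orbC nK.
have k2 u v : ~ C u -> C v -> k u v = `[< K (v, u) >].
  by move=> Cu nCv; rewrite /k nK.
have e1 u v w : C u -> ~ C v -> ~ C w -> u^-1 * v \in S -> u^-1 * w \in S ->
    `[< K (u, v) >] = `[< K (u, w) >].
  by move=> Cu nCv nCw uv uw; apply: asbool_equiv_eq; split; apply: K1.
have e2 u v w : C u -> C v -> ~ C w -> u^-1 * w \in S -> v^-1 * w \in S ->
    `[< K (u, w) >] = `[< K (v, w) >].
  by move=> Cu nCv nCw uv uw; apply: asbool_equiv_eq; split; apply: K2.
have [|a aP] := @coh k.
  move=> u v w uv vw uw.
  have [vu wv wu] : [/\ v^-1 * u \in S, w^-1 * v \in S & w^-1 * u \in S].
    by split; exact: sV.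
  have [Cu|nCu] := pselect (C u); have [Cv|nCv] := pselect (C v);
    have [Cw|nCw] := pselect (C w).
  - by rewrite !k0.
  - by rewrite (k0 u v) // (k1 v w) // (k1 u w) // addFb; exact: e2.
  - by rewrite (k0 u w) // (k1 u v) // (k2 v w) // (e2 u w v) // addbb.
  - by rewrite (k0 v w) // (k1 u v) // (k1 u w) // addbF; exact: e1.
  - by rewrite (k0 v w) // (k2 u v) // (k2 u w) // addbF; exact: e2.
  - by rewrite (k0 u w) // (k2 u v) // (k1 v w) // (e1 v u w) // addbb.
  - by rewrite (k0 u v) // (k2 v w) // (k2 u w) // addFb; exact: e1.
  - by rewrite !k0.
pose A := [set g | a g].
pose b g := `[< C g >] (+) a g.
pose C2 := [set g | b g].
have fC := bd_finite S cC; have fK : finite_set K by exact: sub_finite_set KC fC.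
pose fl (d : G -> bool) (e : G * G) := if d e.1 then e else (e.2, e.1).
have bdA : bd S A `<=` fl a @` K.
  move=> [u v] [/= au /negP/negbTE av sS]; change (is_true (a u)) in au.
  have : k u v by rewrite aP // au av.
  by move=> /orP[/asboolP|/asboolP] Ke; [exists (u, v)|exists (v, u)];
    rewrite // /fl /= ?au ?av.
have bdC2 : bd S C2 `<=` fl b @` (bd S C `\` K).
  move=> [u v] [/= bu /negP/negbTE bv sS]; change (is_true (b u)) in bu.
  have : `[< C u >] (+) `[< C v >] (+) k u v.
    rewrite aP //; move: bu bv; rewrite /b /=.
    by case: `[< C u >]; case: `[< C v >]; case: (a u); case: (a v).
  have [Cu|nCu] := pselect (C u); have [Cv|nCv] := pselect (C v).
  - by rewrite k0 // (asboolT Cu) (asboolT Cv).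
  - rewrite k1 // (asboolT Cu) (asboolF nCv) /= => /asboolPn nKe.
    by exists (u, v); rewrite // /fl /= bu.
  - rewrite k2 // (asboolT Cv) (asboolF nCu) /= => /asboolPn nKe.
    by exists (v, u); [split=> //; split=> //; exact: sV|rewrite /fl /= bv].
  - by rewrite k0 // (asboolF nCu) (asboolF nCv).
have cA : cut A.
  by apply: (cut_of_bd Sgen); apply: sub_finite_set bdA _; exact: finite_image.
have cC2 : cut C2.
  apply: (cut_of_bd Sgen); apply: sub_finite_set bdC2 _.
  by apply: finite_image; exact: finite_setD.
have szA : (bdsize S A <= ncard K)%N.
  apply: leq_trans (ncard_image_le (fl a) fK).
  by apply: ncard_sub bdA; exact: finite_image.
have szC2 : (bdsize S C2 <= ncard (bd S C `\` K))%N.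
  apply: leq_trans (ncard_image_le (fl b) _); last exact: finite_setD.
  by apply: ncard_sub bdC2; apply: finite_image; exact: finite_setD.
have [sA|nsA] := pselect (splits H A).
  apply/seteqP; split=> // e Ce; apply: contrapT => nKe.
  have := leq_trans (mC _ sA) szA; rewrite leqNgt => /negP; apply.
  exact: (@ncard_lt _ _ _ e).
have [sC2|nsC2] := pselect (splits H C2).
  exfalso; have := leq_trans (mC _ sC2) szC2; rewrite leqNgt => /negP; apply.
  by apply: (@ncard_lt _ _ _ e0); [exact: fC|exact: subDsetl|exact: KC|case].
exfalso.
have dich B : cut B -> ~ splits H B -> finite_set (H `&` B) \/ finite_set (H `&` ~` B).
  move=> cB nB; apply: contrapT => /not_orP[i1 i2]; by apply: nB; split.
have un X Y Z : finite_set (H `&` X) -> finite_set (H `&` Y) -> Z `<=` X `|` Y ->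
    finite_set (H `&` Z).
  move=> fX fY ZXY; apply: (@sub_finite_set _ _ ((H `&` X) `|` (H `&` Y))).
    by move=> z [Hz /ZXY[Xz|Yz]]; [left|right].
  by rewrite finite_setU.
case: (dich A cA nsA) (dich C2 cC2 nsC2) => fA [fC2|fC2].
- apply: iC; apply: (un _ _ _ fA fC2) => g Cg; rewrite /A /C2 /b /= (asboolT Cg).
  by case: (a g); [left|right].
- apply: iCC; apply: (un _ _ _ fA fC2) => g Cg; rewrite /A /C2 /b /= (asboolF Cg).
  by case: (a g); [left|right].
- apply: iCC; apply: (un _ _ _ fA fC2) => g Cg; rewrite /A /C2 /b /= (asboolF Cg).
  by case: (a g); [right|left].
- apply: iC; apply: (un _ _ _ fA fC2) => g Cg; rewrite /A /C2 /b /= (asboolT Cg).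
  by case: (a g); [right|left].
Qed.

(** Among the members of the system that separate a corner of a triangle from the
    other two, there is an outermost one, and every member is outermost at some
    corner: following the next member along the coboundary of [C] from triangle
    to triangle, one would otherwise find that it contains no neighbour of [C]. *)
Lemma chain_last_corner c n C : chain S c n -> orb c `I_n C ->
  exists g s t, [/\ s \in S, t \in S, C g, ~ C (g * s) & ~ C (g * t)] /\
    forall D, orb c `I_n D -> C `<=` D -> ~ D (g * s) -> ~ D (g * t) -> D = C.
Proof.
move=> ch EC; set E := orb c `I_n in EC *.
have nsE : nested_system E := chain_system ch (@subset_refl _ `I_n).
have [H oC] := chain_optimal Ssym ch EC.
apply: contrapT => nmax.
have next g x y : C g -> ~ C x -> ~ C y -> g^-1 * x \in S -> g^-1 * y \in S ->
    exists D, [/\ E D, C `<=` D, D <> C, ~ D x & ~ D y].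
  move=> Cg nCx nCy gx gy; apply: contrapT => nex; apply: nmax.
  exists g, (g^-1 * x), (g^-1 * y); rewrite !mulVKg; split=> // D ED CD nDx nDy.
  by apply: contrapT => nD; apply: nex; exists D.
pose P x := [set D | [/\ E D, C `<=` D, D <> C & ~ D x]].
have [c0 Cc0] := ns_ne nsE EC.
have fP x : finite_set (P x).
  by apply: sub_finite_set (ns_sep nsE c0 x) => D [ED CD _ nDx]; split=> //; exact: CD.
have comp D F x : E D -> E F -> C `<=` D -> C `<=` F -> ~ D x -> ~ F x ->
    D `<=` F \/ F `<=` D.
  move=> ED EF CD CF nD nF; have [h|h|h|h] := ns_nested nsE ED EF.
  - by left.
  - by case: (h c0); [exact: CD|exact: CF].
  - by case: nF; exact: h.
  - by right; apply/subCC.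
have [e0 Ce0] : exists e, bd S C e.
  apply: contrapT => nex; have [|C0|CT] := bd0 Sgen (A := C).
  - by apply/seteqP; split=> // e Ce; apply: nex; exists e.
  - by rewrite C0 in Cc0.
  - by have [x []] := ns_proper nsE EC; rewrite CT.
have [C1 nC2 sS] := Ce0.
have [D0 [ED0 CD0 nD0 nDx0 _]] := next _ _ _ C1 nC2 nC2 sS sS.
have PD0 : P e0.2 D0 by split.
have [N [PN _ mN]] := finite_minimal (fP e0.2) PD0.
have isN x : P x N -> (forall F, P x F -> F `<=` N -> F = N) ->
    forall F, P x F -> N `<=` F.
  move=> [EN CN nN nNx] m F PF; have [EF CF nF nFx] := PF.
  by case: (comp N F x) => // /(m F PF) ->.
have mN' := isN _ PN mN.
pose K := [set e | bd S C e /\ P e.2 N /\ forall F, P e.2 F -> N `<=` F].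
have KE : K = bd S C.
  apply: (optimal_track oC).
  - by move=> e [].
  - by exists e0.
  - move=> u v w Cu nCv nCw uv uw [_ [/= PvN mv]].
    have [D [ED CD nD nDv nDw]] := next _ _ _ Cu nCv nCw uv uw.
    have ND : N `<=` D by apply: mv; split.
    have [EN CN nN nNv] := PvN.
    have PwN : P w N by split=> // /ND.
    split; [by split|split=> //= F PF; have [EF CF nF nFw] := PF].
    have [//|FN] : N `<=` F \/ F `<=` N by apply: (comp _ _ w) => //; case: PwN.
    by apply: mv; split=> // /FN.
  - by move=> u v w Cu Cv nCw uw vw [_ H2]; split=> //; split.
have [EN CN nN _] := PN; apply: nN; symmetry.
have [H' oN] := chain_optimal Ssym ch EN.
apply: (optimal_conn Ssym Sgen oN CN); first by exists c0.
move=> g s sS' Cg Ng; apply: contrapT => nCg.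
have : K (g, g * s) by rewrite KE; split; rewrite //= mulKg.
by move=> [_ [[_ _ _]]].
Qed.

(** Each cut of a chain is outermost at a corner of a triangle at [1], and the pair of
    sides that it crosses there determines its orbit: the number of corners bounds the
    chain. *)
Theorem coherent_no_infinite_chain c : ~ forall n, chain S c n.
Proof.
move=> ch; pose n := (#|{: seq_sub S * seq_sub S}|).+1.
have nsE : nested_system (orb c `I_n) := chain_system (ch n) (@subset_refl _ `I_n).
have corner (i : 'I_n) : exists p : G * (seq_sub S * seq_sub S),
    [/\ c i p.1, ~ c i (p.1 * val p.2.1), ~ c i (p.1 * val p.2.2) &
    forall D, orb c `I_n D -> c i `<=` D -> ~ D (p.1 * val p.2.1) ->
      ~ D (p.1 * val p.2.2) -> D = c i].
  have [g [s [t [[sS tS Cg Cs Ct] m]]]] := chain_last_corner (ch n) (orb_mem c (ltn_ord i)).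
  by exists (g, (SeqSub sS, SeqSub tS)).
have /choice[f fP] := corner.
have inj : injective (fun i => (f i).2).
  have eqv i j : (f i).2 = (f j).2 ->
      exists g, c i = tr g (c j).
    move=> ij; have [Ci nCi1 nCi2 mi] := fP i; have [Cj nCj1 nCj2 mj] := fP j.
    move: nCj1 nCj2 mj; rewrite -ij; set s := val (f i).2.1; set t := val (f i).2.2.
    move=> nCj1 nCj2 mj.
    pose g := (f i).1 * (f j).1^-1; exists g.
    have Egj : orb c `I_n (tr g (c j)) by apply: (ns_tr nsE); exact: orb_mem (ltn_ord j).
    have Egi : orb c `I_n (tr g^-1 (c i)) by apply: (ns_tr nsE); exact: orb_mem (ltn_ord i).
    have gE x : tr g (c j) ((f i).1 * x) = c j ((f j).1 * x).
      by rewrite mem_tr /g !grpE.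
    have gE' x : tr g^-1 (c i) ((f j).1 * x) = c i ((f i).1 * x).
      by rewrite mem_tr /g !grpE.
    have [h|h|h|h] := ns_nested nsE (orb_mem c (ltn_ord i)) Egj.
    - by symmetry; apply: mi => //; rewrite -/s -/t gE.
    - by case: (h _ Ci); rewrite -[(f i).1]mulg1 gE mulg1.
    - by have := h _ nCi1; rewrite -/s gE.
    - have -> : c j = tr g^-1 (c i); last by rewrite trVK.
      by symmetry; apply: mj; rewrite ?gE' //; rewrite -(tr_sub g) trVK; apply/subCC.
  have lt (i j : 'I_n) : (i < j)%N -> (f i).2 = (f j).2 -> False.
    move=> ij /esym/eqv[g cj]; have [H [vH _ [[_ i1 i2] _] _ _]] := ch j.+1 _ (ltnSn j).
    have nsj := chain_system (ch j) (@subset_refl _ `I_j).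
    have : orb c `I_j (c j) by exists (nat_of_ord i) => //; exists g; left.
    by move=> /(vst_side nsj vH)[].
  move=> i j ij; apply/val_inj; case: (ltngtP i j) => // h.
    by case: (lt i j h ij).
  by case: (lt j i h (esym ij)).
by have := leq_card _ inj; rewrite card_ord ltnn.
Qed.

End LastCorners.

(** * Square-summable solutions of invariant linear systems *)

Section FiniteSums.
Local Open Scope ring_scope.
Variables (R : realType) (G : groupType).
Implicit Types (f : G -> R).

Definition fsup f := finite_set [set g | f g != 0]%classic.

Definition gsum f : R := \sum_(g <- fset_set [set g | f g != 0]%classic) f g.

Lemma fsupP f : fsup f <-> exists A : {fset G}, forall g, f g != 0 -> g \in A.
Proof.
split=> [ff|[A fA]]; last by apply: sub_finite_set (finite_fset A) => g /fA.
by exists (fset_set [set g | f g != 0]%classic) => g fg; rewrite in_fset_set // inE.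
Qed.

Lemma gsumE (A : {fset G}) f : (forall g, f g != 0 -> g \in A) ->
  gsum f = \sum_(g <- A) f g.
Proof.
move=> fA; have ff : fsup f by apply/fsupP; exists A.
apply: big_fset_incl.
  by apply/fsubsetP => g; rewrite in_fset_set // inE => /fA.
move=> g _; rewrite in_fset_set // => /negP; rewrite inE /= => /negP.
by rewrite negbK => /eqP.
Qed.

Lemma fsup_sub f f' : fsup f -> (forall g, f' g != 0 -> f g != 0) -> fsup f'.
Proof. by move=> /fsupP[A fA] ff'; apply/fsupP; exists A => g /ff'/fA. Qed.

Lemma fsupD f f' : fsup f -> fsup f' -> fsup (fun g => f g + f' g).
Proof.
move=> /fsupP[A fA] /fsupP[B fB]; apply/fsupP; exists (A `|` B)%fset => g nz.
rewrite in_fsetU; apply/orP; have [f0|/fA] := eqVneq (f g) 0; last by left.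
by right; apply: fB; move: nz; rewrite f0 add0r.
Qed.

Lemma gsumD f f' : fsup f -> fsup f' ->
  gsum (fun g => f g + f' g) = gsum f + gsum f'.
Proof.
move=> ff ff'; have [/fsupP[A fA] /fsupP[B fB]] := conj ff ff'.
rewrite (@gsumE (A `|` B)%fset); last first.
  move=> g nz; rewrite in_fsetU; apply/orP.
  have [f0|/fA] := eqVneq (f g) 0; last by left.
  by right; apply: fB; move: nz; rewrite f0 add0r.
rewrite big_split /= -!gsumE // => g; rewrite in_fsetU.
  by move=> /fB ->; rewrite orbT.
by move=> /fA ->.
Qed.

Lemma fsupMl f f' : fsup f' -> fsup (fun g => f g * f' g).
Proof. by move=> ff; apply: fsup_sub ff _ => g; rewrite mulf_eq0 negb_or => /andP[]. Qed.

Lemma fsupMr f f' : fsup f -> fsup (fun g => f g * f' g).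
Proof. by move=> ff; apply: fsup_sub ff _ => g; rewrite mulf_eq0 negb_or => /andP[]. Qed.

Lemma fsup0 : fsup (fun=> 0).
Proof. by apply/fsupP; exists fset0 => g; rewrite eqxx. Qed.

Lemma gsum0 : gsum (fun=> 0) = 0.
Proof. by rewrite (@gsumE fset0) ?big_seq_fset0 ?big_nil // => g; rewrite eqxx. Qed.

Lemma gsumZ (a : R) f : fsup f -> gsum (fun g => a * f g) = a * gsum f.
Proof.
move=> /fsupP[A fA]; rewrite !(@gsumE A) //; first by rewrite mulr_sumr.
by move=> g; rewrite mulf_eq0 negb_or => /andP[_ /fA].
Qed.

Lemma fsup_sum (K : Type) (r : seq K) (F : K -> G -> R) :
  (forall k, fsup (F k)) -> fsup (fun g => \sum_(k <- r) F k g).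
Proof.
move=> fF; elim: r => [|k r IH].
  by apply: fsup_sub fsup0 _ => g; rewrite big_nil eqxx.
by apply: fsup_sub (fsupD (fF k) IH) _ => g; rewrite big_cons.
Qed.

Lemma gsum_sum (K : Type) (r : seq K) (F : K -> G -> R) :
  (forall k, fsup (F k)) ->
  gsum (fun g => \sum_(k <- r) F k g) = \sum_(k <- r) gsum (F k).
Proof.
move=> fF; elim: r => [|k r IH].
  rewrite big_nil -[RHS]gsum0; congr gsum; apply/funext => g.
  by rewrite big_nil.
rewrite big_cons -IH -gsumD //; last exact: fsup_sum.
by congr gsum; apply/funext => g; rewrite big_cons.
Qed.

Lemma fsup_bij f (phi psi : G -> G) : cancel phi psi -> fsup f ->
  fsup (fun g => f (phi g)).
Proof.
move=> pK /fsupP[A fA]; apply/fsupP; exists (psi @` A)%fset => g /fA gA.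
by apply/imfsetP; exists (phi g).
Qed.

Lemma gsum_bij f (phi psi : G -> G) : cancel phi psi -> cancel psi phi ->
  fsup f -> gsum (fun g => f (phi g)) = gsum f.
Proof.
move=> pK qK ff; have [A fA] := (fsupP f).1 ff.
rewrite (@gsumE (psi @` A)%fset) ?(@gsumE A) //.
  rewrite big_imfset /=; last by move=> x y _ _; exact: can_inj qK _ _.
  by apply: eq_bigr => g _; rewrite qK.
by move=> g /fA gA; apply/imfsetP; exists (phi g).
Qed.

Lemma gsum_shift x f : fsup f -> gsum (fun g => f (g * x)%g) = gsum f.
Proof.
by apply: (@gsum_bij _ (fun g => g * x)%g (fun g => g * x^-1)%g) => g; rewrite !grpE.
Qed.

Lemma gsum_inv f : fsup f -> gsum (fun g => f (g^-1)%g) = gsum f.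
Proof. by apply: (@gsum_bij _ (fun g => g^-1)%g (fun g => g^-1)%g) => g; rewrite !grpE. Qed.

Lemma gsum_ge0 f : fsup f -> (forall g, 0 <= f g) -> 0 <= gsum f.
Proof. by move=> /fsupP[A fA] f0; rewrite (gsumE fA) sumr_ge0. Qed.

Lemma gsum_ge_sum (A : {fset G}) f : fsup f -> (forall g, 0 <= f g) ->
  \sum_(g <- A) f g <= gsum f.
Proof.
move=> ff f0; have [B fB] := (fsupP f).1 ff.
rewrite (@gsumE (A `|` B)%fset); last by move=> g /fB; rewrite in_fsetU orbC => ->.
have -> : \sum_(g <- A) f g = \sum_(g <- (A `|` B)%fset) if g \in A then f g else 0.
  transitivity (\sum_(g <- A) if g \in A then f g else 0).
    by apply: eq_big_seq => g ->.
  by apply: big_fset_incl; [exact: fsubsetUl|move=> g _ /negbTE ->].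
by apply: ler_sum => g _; case: ifP.
Qed.

Lemma gsum_le f f' : fsup f -> fsup f' -> (forall g, f g <= f' g) ->
  gsum f <= gsum f'.
Proof.
move=> ff ff' le; rewrite -subr_ge0 -[- _]mulN1r -gsumZ // -gsumD //; last exact: fsupMl.
apply: gsum_ge0; first by apply: fsupD => //; exact: fsupMl.
by move=> g; rewrite mulN1r subr_ge0.
Qed.

Lemma gsum_delta f x : (forall g, g <> x -> f g = 0) -> gsum f = f x.
Proof.
move=> f0; rewrite (@gsumE [fset x]%fset) ?big_seq_fset1 // => g nz.
by rewrite in_fset1; apply/eqP; apply: contra_neqP nz => /f0.
Qed.

Lemma gsum_exchange (f : G -> G -> R) (A B : {fset G}) :
  (forall g h, f g h != 0 -> (g \in A) && (h \in B)) ->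
  gsum (fun g => gsum (f g)) = gsum (fun h => gsum (f ^~ h)).
Proof.
move=> fAB.
have E1 g : gsum (f g) = \sum_(h <- B) f g h by apply: gsumE => h /fAB/andP[].
have E2 h : gsum (f ^~ h) = \sum_(g <- A) f g h by apply: gsumE => g /fAB/andP[].
rewrite (@gsumE A); last first.
  move=> g; apply: contra_neqT => gA; rewrite E1 big1_seq // => h _.
  by apply/eqP; apply: contraT => /fAB/andP[]; rewrite (negbTE gA).
rewrite (@gsumE B); last first.
  move=> h; apply: contra_neqT => hB; rewrite E2 big1_seq // => g _.
  by apply/eqP; apply: contraT => /fAB/andP[_]; rewrite (negbTE hB).
rewrite (eq_bigr _ (fun g _ => E1 g)) (eq_bigr _ (fun h _ => E2 h)).
exact: exchange_big.
Qed.

End FiniteSums.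

Section Convergence.
Local Open Scope ring_scope.
Variable R : realType.
Implicit Types (a b : nat -> R) (l e : R).

Definition conv a l := forall e, 0 < e -> exists N, forall n, (N <= n)%N -> `|a n - l| <= e.

Lemma conv_cst l : conv (fun=> l) l.
Proof. by move=> e e0; exists 0%N => n _; rewrite subrr normr0 ltW. Qed.

Lemma convD a b l l' : conv a l -> conv b l' -> conv (fun n => a n + b n) (l + l').
Proof.
move=> al bl e e0; have e2 : 0 < e / 2 by rewrite divr_gt0.
have [N1 H1] := al _ e2; have [N2 H2] := bl _ e2.
exists (maxn N1 N2) => n; rewrite geq_max => /andP[n1 n2].
rewrite opprD addrACA (le_trans (ler_normD _ _)) //.
by have h1 := H1 n n1; have h2 := H2 n n2; lra.
Qed.

Lemma convM a b l l' : conv a l -> conv b l' -> conv (fun n => a n * b n) (l * l').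
Proof.
move=> al bl e e0.
pose M := `|l'| + `|l| + 2; have M0 : 0 < M by rewrite ltr_wpDl // addr_ge0.
pose d := Num.min 1 (e / M); have d0 : 0 < d by rewrite lt_min ltr01 divr_gt0.
have [N1 H1] := al _ d0; have [N2 H2] := bl _ d0.
exists (maxn N1 N2) => n; rewrite geq_max => /andP[n1 n2].
have -> : a n * b n - l * l' = (a n - l) * (b n - l') + (a n - l) * l' + l * (b n - l').
  by ring.
have h1 := H1 n n1; have h2 := H2 n n2.
have d1 : d <= 1 by rewrite ge_min lexx.
have dM : d * M <= e by rewrite -ler_pdivlMr // ge_min lexx orbT.
apply: le_trans dM; apply: (le_trans (ler_normD _ _)).
apply: (le_trans (lerD (ler_normD _ _) (lexx _))); rewrite !normrM.
have e1 : `|a n - l| * `|b n - l'| <= d * 1 by apply: ler_pM => //; exact: le_trans h2 d1.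
have e2 : `|a n - l| * `|l'| <= d * `|l'| by apply: ler_wpM2r.
have e3 : `|l| * `|b n - l'| <= `|l| * d by apply: ler_wpM2l.
have : d * 1 + d * `|l'| + `|l| * d <= d * M.
  by rewrite /M; nra.
by apply: le_trans; apply: lerD => //; apply: lerD.
Qed.

Lemma conv_sum (K : Type) (r : seq K) (f : K -> nat -> R) (l : K -> R) :
  (forall k, conv (f k) (l k)) ->
  conv (fun n => \sum_(k <- r) f k n) (\sum_(k <- r) l k).
Proof.
move=> fl; elim: r => [|k r IH].
  rewrite big_nil; under eq_fun do rewrite big_nil; exact: conv_cst.
by rewrite big_cons; under eq_fun do rewrite big_cons; exact: convD.
Qed.

Lemma conv_le a l M : conv a l -> (forall n, a n <= M) -> l <= M.
Proof.
move=> al aM; rewrite leNgt; apply/negP => Ml.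
have d0 : 0 < (l - M) / 2 by rewrite divr_gt0 // subr_gt0.
have [N /(_ N (leqnn N))] := al _ d0; have := aM N.
by rewrite ler_norml => aN /andP[h _]; lra.
Qed.

Lemma conv_ge a l M : conv a l -> (forall n, M <= a n) -> M <= l.
Proof.
move=> al aM; rewrite leNgt; apply/negP => Ml.
have d0 : 0 < (M - l) / 2 by rewrite divr_gt0 // subr_gt0.
have [N /(_ N (leqnn N))] := al _ d0; have := aM N.
by rewrite ler_norml => aN /andP[_ h]; lra.
Qed.

Lemma conv_unique a l l' : conv a l -> conv a l' -> l = l'.
Proof.
move=> al al'; apply/eqP; rewrite -subr_eq0 -normr_eq0 eq_le normr_ge0 andbT.
rewrite leNgt; apply/negP => d.
have d0 : 0 < `|l - l'| / 3 by rewrite divr_gt0.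
have [N1 H1] := al _ d0; have [N2 H2] := al' _ d0.
have h1 := H1 (maxn N1 N2) (leq_maxl _ _); have h2 := H2 (maxn N1 N2) (leq_maxr _ _).
have : `|l - l'| <= `|l - l'| / 3 + `|l - l'| / 3.
  rewrite {1}(_ : l - l' = (a (maxn N1 N2) - l') - (a (maxn N1 N2) - l)); last by ring.
  by rewrite (le_trans (ler_normB _ _)) // lerD.
by lra.
Qed.

Lemma cauchy_conv a : (forall e, 0 < e -> exists N, forall m n, (N <= m)%N -> (m <= n)%N ->
  `|a m - a n| <= e) -> exists l, conv a l.
Proof.
move=> ca; pose E := [set x | exists N, forall n, (N <= n)%N -> x <= a n]%classic.
have bnd e : 0 < e -> exists N, [/\ forall n, (N <= n)%N -> `|a N - a n| <= e, E (a N - e) &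
    ubound E (a N + e)].
  move=> e0; have [N H] := ca e e0; exists N.
  have HN n : (N <= n)%N -> `|a N - a n| <= e by exact: H.
  split=> //.
    by exists N => n /HN; rewrite ler_norml => /andP[_]; lra.
  move=> x [N' H']; have := H' _ (leq_maxl N' N).
  by have := HN _ (leq_maxr N' N); rewrite ler_norml => /andP[h _]; lra.
have hE : has_sup E.
  have [N [_ EN uN]] := bnd 1 ltr01.
  by split; [exists (a N - 1)|exists (a N + 1)].
exists (sup E) => e e0; have e2 : 0 < e / 2 by rewrite divr_gt0.
have [N [HN EN uN]] := bnd _ e2; exists N => n Nn.
have h1 : a N - e / 2 <= sup E by apply: ub_le_sup => //; case: hE.
have h2 : sup E <= a N + e / 2 by apply: ge_sup => //; case: hE.
by have := HN n Nn; rewrite !ler_norml => /andP[h3 h4]; apply/andP; split; lra.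
Qed.

Lemma noninc_cauchy a : (forall n, 0 <= a n) -> (forall n, a n.+1 <= a n) ->
  forall e, 0 < e -> exists N, forall m n, (N <= m)%N -> (m <= n)%N -> a m - a n <= e.
Proof.
move=> a0 da e e0; have mon m n : (m <= n)%N -> a n <= a m.
  move=> /subnK <-; elim: (n - m)%N => [|k IH]; first by rewrite add0n.
  exact: le_trans (da _) IH.
apply: contrapT => nex.
have step N : exists n, (N <= n)%N && (a n <= a N - e).
  apply: contrapT => nn; apply: nex; exists N => m n Nm mn.
  rewrite leNgt; apply/negP => lt; apply: nn; exists n.
  by rewrite (leq_trans Nm mn) /=; have := mon _ _ Nm; lra.
have [k ke] : exists k : nat, a 0%N < k%:R * e.
  exists (Num.trunc (a 0%N / e)).+1.
  by rewrite -ltr_pdivrMr // truncnS_gt.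
have /(_ k)[n] : forall k : nat, exists n, a n <= a 0%N - k%:R * e.
  elim=> [|j [n IH]]; first by exists 0%N; rewrite mul0r subr0.
  have [n' /andP[_ H]] := step n; exists n'.
  by rewrite -natr1 mulrDl mul1r; lra.
by have := a0 n; lra.
Qed.

End Convergence.

Section InvariantOperators.
Local Open Scope ring_scope.
Variables (R : realType) (G : groupType).

(** The elements of [I -> G -> R] are the functions on [I * G], where [G] acts by
    left translation; [op b] is the invariant operator with kernel [b]. *)
Definition op (I J : finType) (b : I -> J -> G -> R) (u : I -> G -> R) : J -> G -> R :=
  fun j h => \sum_i gsum (fun x => b i j x * u i (h * x^-1)%g).

Definition adj (I J : finType) (b : I -> J -> G -> R) : J -> I -> G -> R :=
  fun j i x => b i j x^-1%g.

Definition cfs (I J : finType) (b : I -> J -> G -> R) := forall i j, fsup (b i j).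

Definition ffs (I : finType) (u : I -> G -> R) := forall i, fsup (u i).

Definition ip (I : finType) (u v : I -> G -> R) : R :=
  \sum_i gsum (fun g => u i g * v i g).

Definition addz (I : finType) (u : I -> G -> R) (a : R) (v : I -> G -> R) : I -> G -> R :=
  fun i g => u i g + a * v i g.

Definition delta (I : finType) (i0 : I) (g0 : G) : I -> G -> R :=
  fun i g => ((i == i0) && (g == g0))%:R.

Lemma cfs_adj (I J : finType) (b : I -> J -> G -> R) : cfs b -> cfs (adj b).
Proof. by move=> fb j i; apply: (@fsup_bij _ _ _ (fun x => x^-1)%g (fun x => x^-1)%g) => // x; rewrite invgK. Qed.

Section Inner.
Variable I : finType.
Implicit Types u v w : I -> G -> R.

Lemma ffs_addz u a v : ffs u -> ffs v -> ffs (addz u a v).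
Proof. by move=> fu fv i; apply: fsupD => //; exact: fsupMl. Qed.

Lemma ffs_delta i0 g0 : ffs (@delta I i0 g0).
Proof.
move=> i; apply/fsupP; exists [fset g0]%fset => g; rewrite in_fset1 /delta.
by case: (g == g0); rewrite // andbF eqxx.
Qed.

Lemma ipC u v : ip u v = ip v u.
Proof. by apply: eq_bigr => i _; congr gsum; apply/funext => g; rewrite mulrC. Qed.

Lemma ip_addzr u v a w : ffs u -> ip u (addz v a w) = ip u v + a * ip u w.
Proof.
move=> fu; rewrite /ip mulr_sumr -big_split; apply: eq_bigr => i _ /=.
have f1 : fsup (fun g => u i g * v i g) by exact: fsupMr.
have f2 : fsup (fun g => u i g * w i g) by exact: fsupMr.
have f3 : fsup (fun g => a * (u i g * w i g)) by exact: fsupMl.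
rewrite -(gsumZ a f2) -(gsumD f1 f3).
by congr gsum; apply/funext => g; rewrite /addz mulrDr mulrCA.
Qed.

Lemma ip_addzl u v a w : ffs u -> ip (addz v a w) u = ip v u + a * ip w u.
Proof. by move=> fu; rewrite ipC ip_addzr // (ipC u v) (ipC u w). Qed.

Lemma ip_ge0 u : ffs u -> 0 <= ip u u.
Proof.
by move=> fu; apply: sumr_ge0 => i _; apply: gsum_ge0 => [|g]; rewrite -?expr2 ?sqr_ge0 //; exact: fsupMr.
Qed.

Lemma ip_ge_sum u i (A : {fset G}) : ffs u -> \sum_(g <- A) u i g ^+ 2 <= ip u u.
Proof.
move=> fu; have fu2 i' : fsup (fun g => u i' g * u i' g) by exact: fsupMr.
rewrite /ip (bigD1 i) //= -[X in X <= _]addr0 lerD ?sumr_ge0 //.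
  by under eq_bigr do rewrite expr2; apply: gsum_ge_sum => // g; rewrite -expr2 sqr_ge0.
by move=> i' _; apply: gsum_ge0 => // g; rewrite -expr2 sqr_ge0.
Qed.

Lemma ip_ge u i g : ffs u -> u i g ^+ 2 <= ip u u.
Proof.
by move=> fu; have := ip_ge_sum i [fset g]%fset fu; rewrite big_seq_fset1.
Qed.

Lemma ip_delta u i g : ip (delta i g) u = u i g.
Proof.
rewrite /ip (bigD1 i) //= big1 ?addr0 => [|j ji].
  rewrite (@gsum_delta _ _ _ g) /delta ?eqxx ?mul1r // => h hg.
  by move/eqP/negbTE: hg => ->; rewrite andbF mul0r.
rewrite (_ : (fun _ => _) = fun=> 0) ?gsum0 //; apply/funext => h.
by rewrite /delta (negbTE ji) mul0r.
Qed.

End Inner.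

Section OneOperator.
Variables (I J : finType) (b : I -> J -> G -> R).
Hypothesis fb : cfs b.
Implicit Types (u v : I -> G -> R) (w : J -> G -> R).

Let fbu u i j h : fsup (fun x => b i j x * u i (h * x^-1)%g).
Proof. exact: fsupMr. Qed.

Lemma ffs_op u : ffs u -> ffs (op b u).
Proof.
move=> fu j; apply: fsup_sum => i; have /fsupP[A fA] := fu i; have /fsupP[B fB] := fb i j.
apply/fsupP; exists [fset (a * x)%g | a in A, x in B]%fset => h nz.
have [x bx ux] : exists2 x, b i j x != 0 & u i (h * x^-1)%g != 0.
  apply: contrapT => nex; move/negP: nz; apply; rewrite (_ : (fun _ => _) = fun=> 0) ?gsum0 //.
  apply/funext => x; apply/eqP; rewrite mulf_eq0; apply/orP.
  have [_|bx] := eqVneq (b i j x) 0; first by left.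
  by right; apply: contraT => ux; case: nex; exists x.
by apply/imfset2P; exists (h * x^-1)%g; [exact: fA|exists x; rewrite ?grpE //; exact: fB].
Qed.

Lemma op_addz u a v : op b (addz u a v) = addz (op b u) a (op b v).
Proof.
apply/funext => j; apply/funext => h; rewrite /op /addz mulr_sumr -big_split /=.
apply: eq_bigr => i _; rewrite -gsumZ // -gsumD //; last exact: fsupMl.
by congr gsum; apply/funext => x; rewrite mulrDr mulrCA.
Qed.

Lemma op_shift u a :
  op b (fun i g => u i (a * g)%g) = (fun j h => op b u j (a * h)%g).
Proof.
apply/funext => j; apply/funext => h; apply: eq_bigr => i _.
by congr gsum; apply/funext => x; rewrite mulgA.
Qed.

Lemma op_delta i j h : op b (delta i 1%g) j h = b i j h.
Proof.
rewrite /op (bigD1 i) //= big1 ?addr0 => [|i' ii'].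
  rewrite (@gsum_delta _ _ _ h) /delta ?eqxx ?mulgV ?eqxx ?mulr1 // => x xh.
  case: eqP => [hx|_]; last by rewrite andbF mulr0.
  by case: xh; rewrite -[x]mul1g -hx !grpE.
rewrite (_ : (fun _ => _) = fun=> 0) ?gsum0 //; apply/funext => x.
by rewrite /delta (negbTE ii') mulr0.
Qed.

Lemma op_adj u w : ffs u -> ffs w -> ip (op b u) w = ip u (op (adj b) w).
Proof.
move=> fu fw.
have E1 j : gsum (fun h => op b u j h * w j h) =
    \sum_i gsum (fun h => gsum (fun x => b i j x * u i (h * x^-1)%g * w j h)).
  rewrite -gsum_sum.
    congr gsum; apply/funext => h; rewrite /op mulr_suml; apply: eq_bigr => i _.
    rewrite mulrC -gsumZ //; congr gsum; apply/funext => x; by rewrite mulrC.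
  move=> i; apply: fsup_sub (fw j) _ => h; apply: contra_neq => ->.
  by rewrite (_ : (fun _ => _) = fun=> 0) ?gsum0 //; apply/funext => x; rewrite mulr0.
have E2 i : gsum (fun g => u i g * op (adj b) w i g) =
    \sum_j gsum (fun g => gsum (fun x => u i g * (b i j x * w j (g * x)%g))).
  rewrite -gsum_sum.
    congr gsum; apply/funext => g; rewrite /op mulr_sumr; apply: eq_bigr => j _.
    have f1 : fsup (fun x => b i j x * w j (g * x)%g) by exact: fsupMr.
    rewrite [RHS]gsumZ //; congr (_ * _); rewrite -(gsum_inv f1).
    by congr gsum; apply/funext => x; rewrite /adj.
  move=> j; apply: fsup_sub (fu i) _ => h; apply: contra_neq => ->.
  by rewrite (_ : (fun _ => _) = fun=> 0) ?gsum0 //; apply/funext => x; rewrite mul0r.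
rewrite /ip (eq_bigr _ (fun j _ => E1 j)) (eq_bigr _ (fun i _ => E2 i)) exchange_big /=.
apply: eq_bigr => i _; apply: eq_bigr => j _.
have /fsupP[A fA] := fu i; have /fsupP[B fB] := fb i j; have /fsupP[C fC] := fw j.
rewrite (@gsum_exchange _ _ _ C B); last first.
  by move=> h x; rewrite !mulf_eq0 !negb_or => /andP[/andP[/fB -> _] /fC ->].
rewrite [RHS](@gsum_exchange _ _ _ A B); last first.
  by move=> h x; rewrite !mulf_eq0 !negb_or => /andP[/fA -> /andP[/fB -> _]].
congr gsum; apply/funext => x.
have f1 : fsup (fun h => b i j x * u i (h * x^-1)%g * w j h) by exact: fsupMl.
rewrite -(gsum_shift x f1); congr gsum; apply/funext => g.
by rewrite !grpE; ring.
Qed.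

Lemma sq_sum_le (K : Type) (r : seq K) (y : K -> R) :
  (\sum_(k <- r) y k) ^+ 2 <= 2 ^+ size r * \sum_(k <- r) y k ^+ 2.
Proof.
elim: r => [|k r IH]; first by rewrite !big_nil expr0n mulr0.
rewrite !big_cons [size _]/= [2 ^+ _.+1]exprS; set s := \sum_(j <- r) y j in IH *.
set t := \sum_(j <- r) _ in IH *; set p := 2 ^+ size r in IH *.
have p1 : 1 <= p by rewrite exprn_ege1 // ler1n.
have t0 : 0 <= t by apply: sumr_ge0 => j _; exact: sqr_ge0.
have h1 : (y k + s) ^+ 2 <= 2 * y k ^+ 2 + 2 * s ^+ 2.
  rewrite -subr_ge0 (_ : _ - _ = (y k - s) ^+ 2) ?sqr_ge0 //; ring.
have h2 : y k ^+ 2 <= p * y k ^+ 2 by rewrite ler_peMl ?sqr_ge0.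
apply: le_trans h1 _; rewrite -mulrA [p * _]mulrDr mulrDr lerD //.
  by rewrite ler_pM2l.
by rewrite ler_pM2l.
Qed.

Lemma op_bound : exists2 c : R, 0 < c &
  forall u, ffs u -> ip (op b u) (op b u) <= c * ip u u.
Proof.
have [A fA] : exists A : {fset G}, forall i j x, b i j x != 0 -> x \in A.
  pose B := [set x | exists2 p : I * J, [set: I * J]%classic p & b p.1 p.2 x != 0]%classic.
  have ff : finite_set B.
    by apply: finite_bigU => [|p _]; [exact: finite_finset|exact: fb].
  exists (fset_set B) => i j x bx; rewrite (in_fset_set ff) inE.
  by exists (i, j).
pose c0 : R := 2 ^+ size (index_enum I) * 2 ^+ size A.
have c00 : 0 <= c0 by rewrite mulr_ge0 // exprn_ge0.
pose M := \sum_j \sum_i \sum_(x <- A) b i j x ^+ 2.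
have M0 : 0 <= M by do 3![apply: sumr_ge0 => ? _]; exact: sqr_ge0.
exists (c0 * M + 1); first by rewrite ltr_wpDl // mulr_ge0.
move=> u fu; have n0 := ip_ge0 fu.
apply: (@le_trans _ _ (c0 * M * ip u u)); last by rewrite ler_wpM2r // lerDl.
have pt j h : op b u j h * op b u j h <=
    \sum_i \sum_(x <- A) c0 * b i j x ^+ 2 * u i (h * x^-1)%g ^+ 2.
  rewrite -expr2 /op; apply: le_trans (sq_sum_le _ _) _.
  rewrite mulr_sumr; apply: ler_sum => i _.
  rewrite (@gsumE _ _ A); last by move=> x; rewrite mulf_eq0 negb_or => /andP[/fA].
  apply: le_trans (ler_wpM2l _ (sq_sum_le _ _)) _; first exact: exprn_ge0.
  rewrite mulrA -/c0 mulr_sumr; apply: ler_sum => x _.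
  by rewrite exprMn mulrA.
have f2 i x (a : R) : fsup (fun h => a * u i (h * x^-1)%g ^+ 2).
  apply: fsupMl; apply: (@fsup_sub _ _ (fun h => u i (h * x^-1)%g)).
    by apply: (@fsup_bij _ _ _ (fun h => h * x^-1)%g (fun h => h * x)%g) => // h; rewrite !grpE.
  by move=> h; rewrite expf_eq0.
rewrite [ip (op b u) _]/ip; have [Q QE] : exists Q, Q = ip u u by [exists (ip u u)]; rewrite -QE in n0 *; rewrite /M mulr_sumr mulr_suml; apply: ler_sum => j _.
have fop : fsup (fun g => op b u j g * op b u j g) by apply: fsupMr; exact: ffs_op.
apply: le_trans (gsum_le fop _ (pt j)) _.
  by apply: fsup_sum => i; apply: fsup_sum => x.
rewrite gsum_sum; last by move=> i; apply: fsup_sum => x.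
rewrite mulr_sumr mulr_suml; apply: ler_sum => i _.
rewrite gsum_sum // mulr_sumr mulr_suml; apply: ler_sum => x _.
have f3 : fsup (fun h => u i (h * x^-1)%g ^+ 2).
  by apply: fsup_sub (f2 i x 1) _ => h; rewrite mul1r.
rewrite gsumZ //; apply: ler_wpM2l; first by apply: mulr_ge0 => //; exact: sqr_ge0.
have f4 : fsup (fun h => u i h ^+ 2) by apply: fsup_sub (fu i) _ => h; rewrite expf_eq0.
have -> : gsum (fun h => u i (h * x^-1)%g ^+ 2) = gsum (fun g => u i g * u i g).
  rewrite (gsum_shift x^-1 f4); congr gsum; apply/funext => g; exact: expr2.
rewrite QE /ip (bigD1 i) //= -[X in X <= _]addr0 lerD //.
by apply: sumr_ge0 => i' _; apply: gsum_ge0 => [|g]; [exact: fsupMr|rewrite -expr2 sqr_ge0].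
Qed.

End OneOperator.

Lemma adjK (I J : finType) (b : I -> J -> G -> R) : adj (adj b) = b.
Proof. by apply/funext => i; apply/funext => j; apply/funext => x; rewrite /adj invgK. Qed.

(** One step of the iteration that converges to the projection onto the kernel
    of [op b]. *)
Definition descent (I J : finType) (b : I -> J -> G -> R) (c : R) (u : I -> G -> R) :=
  addz u (- c^-1) (op (adj b) (op b u)).

Section Descent.
Variables (I J : finType) (b : I -> J -> G -> R) (c : R).
Hypotheses (fb : cfs b) (c0 : 0 < c).
Let fb' : cfs (adj b) := cfs_adj fb.
Implicit Types (u v : I -> G -> R).
Local Notation T := (descent b c).

Lemma ffs_descent u : ffs u -> ffs (T u).
Proof. by move=> fu; apply: ffs_addz => //; do 2 apply: ffs_op => //. Qed.

Lemma ffs_iter n u : ffs u -> ffs (iter n T u).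
Proof. by move=> fu; elim: n => //= n; exact: ffs_descent. Qed.

Lemma descent_sym u v : ffs u -> ffs v -> ip (T u) v = ip u (T v).
Proof.
move=> fu fv; have [ou ov] : ffs (op b u) /\ ffs (op b v) by split; apply: ffs_op.
rewrite /descent ip_addzl // ip_addzr // op_adj // adjK; congr (_ + _ * _).
by rewrite -[op b v in LHS]/(op b v) op_adj.
Qed.

Lemma iter_sym n u v : ffs u -> ffs v -> ip (iter n T u) v = ip u (iter n T v).
Proof.
move=> fu; elim: n v => // n IH v fv.
by rewrite iterS descent_sym ?IH -?iterSr //; [exact: ffs_descent|exact: ffs_iter].
Qed.

Lemma descent_norm u : ffs u ->
  (forall w, ffs w -> ip (op (adj b) w) (op (adj b) w) <= c * ip w w) ->
  ip (T u) (T u) <= ip u u - c^-1 * ip (op b u) (op b u).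
Proof.
move=> fu cb; have ou : ffs (op b u) by exact: ffs_op.
have ou' : ffs (op (adj b) (op b u)) by exact: ffs_op.
have fT := ffs_descent fu.
rewrite {2}/descent ip_addzr // ip_addzl //; set p := op (adj b) (op b u) in ou' *.
have E1 : ip u p = ip (op b u) (op b u) by rewrite op_adj.
have E2 : ip (T u) p = ip u p + - c^-1 * ip p p by rewrite /descent ip_addzl.
rewrite E2 (ipC p u) E1; have := cb _ ou; rewrite -/p; set q := ip (op b u) _.
move=> le; have : c^-1 * ip p p <= q by rewrite ler_pdivrMl.
set r := ip p p; set s := ip u u; have c1 : 0 < c^-1 by rewrite invr_gt0.
have -> : s + - c^-1 * q + - c^-1 * (q + - c^-1 * r) =
  s - c^-1 * q - c^-1 * (q - c^-1 * r) by ring.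
by move=> h; rewrite gerBl mulr_ge0 ?subr_ge0 // ltW.
Qed.

Lemma ip_descent u v : ffs u -> ffs v ->
  ip u (T v) = ip u v - c^-1 * ip (op b u) (op b v).
Proof.
move=> fu fv; have ov : ffs (op b v) by exact: ffs_op.
by rewrite /descent ip_addzr // mulNr op_adj.
Qed.

Lemma descent_shift u a :
  T (fun i g => u i (a * g)%g) = (fun i g => T u i (a * g)%g).
Proof. by rewrite /descent !op_shift. Qed.

Lemma iter_shift n u a :
  iter n T (fun i g => u i (a * g)%g) = (fun i g => iter n T u i (a * g)%g).
Proof. by elim: n => //= n ->; exact: descent_shift. Qed.

Lemma descent_comm u : ffs u -> op b (T u) = descent (adj b) c (op b u).
Proof. by move=> fu; rewrite /descent op_addz // adjK. Qed.

Lemma iter_comm n u : ffs u -> op b (iter n T u) = iter n (descent (adj b) c) (op b u).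
Proof.
by move=> fu; elim: n => //= n IH; rewrite descent_comm ?IH //; exact: ffs_iter.
Qed.

End Descent.

(** The trace property: both sides are the trace of one product of the operators,
    cyclically permuted. *)
Lemma descent_trace (I J : finType) (b : I -> J -> G -> R) c n : cfs b -> 0 < c ->
  \sum_i ip (op b (delta i 1%g)) (iter n (descent (adj b) c) (op b (delta i 1%g))) =
  \sum_j ip (op (adj b) (delta j 1%g)) (iter n (descent b c) (op (adj b) (delta j 1%g))).
Proof.
move=> fb c0; have fb' := cfs_adj fb.
pose W i := iter n (descent (adj b) c) (op b (delta i 1%g)).
have fW i : ffs (W i).
  by apply: ffs_iter => //; apply: ffs_op => //; exact: ffs_delta.
have VE j i g : iter n (descent b c) (op (adj b) (delta j 1%g)) i g = W i j g^-1%g.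
  have fd : ffs (op (adj b) (@delta J j 1%g)) by apply: ffs_op => //; exact: ffs_delta.
  have fdi := @ffs_delta I i g.
  have -> : iter n (descent b c) (op (adj b) (delta j 1%g)) i g =
      ip (delta i g) (iter n (descent b c) (op (adj b) (delta j 1%g))).
    by rewrite ip_delta.
  rewrite -iter_sym // -op_adj //; [|exact: ffs_iter|exact: ffs_delta].
  rewrite ipC ip_delta iter_comm // /W.
  have -> : @delta I i g = (fun i' g' => @delta I i 1%g i' (g^-1 * g')%g).
    apply/funext => i'; apply/funext => g'; rewrite /delta; congr (_ && _)%:R.
    by apply/eqP/eqP => [->|h]; rewrite ?mulVg // -[g']mul1g -(mulgV g) -mulgA h mulg1.
  by rewrite op_shift iter_shift mulg1.
rewrite /ip exchange_big; apply: eq_bigr => j _; apply: eq_bigr => i _ /=.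
transitivity (gsum (fun h => b i j h * W i j h)).
  by congr gsum; apply/funext => h; rewrite op_delta.
rewrite -gsum_inv; last exact: fsupMr.
by congr gsum; apply/funext => g; rewrite VE op_delta.
Qed.

(** ** Dimension count *)

Definition avg (I : finType) (i : I) (K : set G) : I -> G -> R :=
  fun i' g => if (i' == i) && `[< K g >] then (ncard K)%:R^-1 else 0.

Lemma gsum_indicator (K : set G) (a : R) : finite_set K ->
  gsum (fun g => if `[< K g >] then a else 0) = (ncard K)%:R * a.
Proof.
move=> fK; rewrite (@gsumE _ _ (fset_set K)).
  rewrite (eq_big_seq (fun=> a)) ?big_const_seq ?count_predT.
    by rewrite /ncard iter_addr_0 mulr_natl cardfE cardE -?size_enum_val; congr (_ *+ _); rewrite -cardE -cardfE.
  by move=> g; rewrite in_fset_set // inE => /asboolT ->.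
by move=> g; rewrite in_fset_set //; case: asboolP => [Kg _|]; rewrite ?inE ?eqxx.
Qed.

Section Average.
Variables (I : finType) (i : I) (K : set G).
Hypotheses (fK : finite_set K) (K1 : K 1%g).

Let n0 : (ncard K)%:R != 0 :> R.
Proof. by rewrite pnatr_eq0 -lt0n (ncard_gt0 fK K1). Qed.

Let sumK (a : R) := gsum_indicator a fK.

Lemma ffs_avg : ffs (avg i K).
Proof.
move=> i'; apply: sub_finite_set fK => g /=; rewrite /avg.
by case: asboolP; rewrite ?andbF ?eqxx.
Qed.

Lemma ip_avg u : (forall k, K k -> u i k = u i 1%g) -> ip (avg i K) u = u i 1%g.
Proof.
move=> uK; rewrite /ip (bigD1 i) //= big1 ?addr0 => [|i' i'i].
  rewrite -[RHS](mulVKf n0) -sumK; congr gsum; apply/funext => g.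
  by rewrite /avg eqxx /=; case: asboolP => [/uK ->//|_]; rewrite mul0r.
rewrite (_ : (fun _ => _) = fun=> 0) ?gsum0 //; apply/funext => h.
by rewrite /avg (negbTE i'i) mul0r.
Qed.

Lemma ip_avg_avg : ip (avg i K) (avg i K) = (ncard K)%:R^-1.
Proof.
by rewrite ip_avg => [|k Kk]; rewrite /avg eqxx ?(asboolT K1) ?(asboolT Kk).
Qed.

Lemma op_avg (J : finType) (b : I -> J -> G -> R) : cfs b ->
  (forall j k x, K k -> b i j (k * x)%g = b i j x) ->
  op b (avg i K) = op b (delta i 1%g).
Proof.
move=> fb bK; apply/funext => j; apply/funext => h; rewrite op_delta // /op.
rewrite (bigD1 i) //= big1 ?addr0 => [|i' i'i]; last first.
  rewrite (_ : (fun _ => _) = fun=> 0) ?gsum0 //; apply/funext => x.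
  by rewrite /avg (negbTE i'i) mulr0.
pose f k := if `[< K k >] then b i j h * (ncard K)%:R^-1 else 0.
transitivity (gsum (fun x => f (h * x^-1)%g)).
  congr gsum; apply/funext => x; rewrite /avg eqxx /f /=; case: asboolP => [Kx|_].
    by rewrite -(bK j _ x Kx) !grpE.
  by rewrite mulr0.
rewrite (@gsum_bij _ _ f _ (fun k => k^-1 * h)%g); first by rewrite sumK mulrCA mulfV ?mulr1.
- by move=> x; rewrite !grpE.
- by move=> x; rewrite !grpE.
- by apply: sub_finite_set fK => k; rewrite /f /=; case: asboolP; rewrite ?eqxx.
Qed.

End Average.

Definition finite_subgroup (K : set G) := [/\ finite_set K, K 1%g,
  forall g, K g -> K g^-1%g & forall g h, K g -> K h -> K (g * h)%g].

(** An invariant system with fewer equations than unknowns, both counted with the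
    inverses of the orders of their stabilizers, has a square-summable solution:
    the trace of the iterates of the descent exceeds the difference of the counts. *)
Theorem l2_solution (I J : finType) (b : I -> J -> G -> R)
    (K : I -> set G) (N : J -> set G) : cfs b ->
  (forall i, finite_subgroup (K i)) -> (forall j, finite_subgroup (N j)) ->
  (forall i j k x, K i k -> b i j (k * x)%g = b i j x) ->
  (forall i j k x, N j k -> b i j (x * k)%g = b i j x) ->
  \sum_j (ncard (N j))%:R^-1 < \sum_i (ncard (K i))%:R^-1 :> R ->
  exists u : I -> G -> R, [/\ exists i g, u i g != 0,
    exists M, forall i (A : {fset G}), \sum_(g <- A) u i g ^+ 2 <= M,
    forall i k g, K i k -> u i (g * k)%g = u i g &
    forall j h, \sum_i gsum (fun x => b i j x * u i (h * x^-1)%g) = 0].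
Proof.
move=> fb sK sN bK bN lt; have fb' := cfs_adj fb.
have [c1 c10 Hc1] := op_bound fb; have [c2 c20 Hc2] := op_bound fb'.
pose c := c1 + c2; have c0 : 0 < c by rewrite addr_gt0.
have Hb u : ffs u -> ip (op b u) (op b u) <= c * ip u u.
  by move=> fu; apply: le_trans (Hc1 _ fu) _; rewrite ler_wpM2r ?ip_ge0 // lerDl ltW.
have Hb' u : ffs u -> ip (op (adj b) u) (op (adj b) u) <= c * ip u u.
  by move=> fu; apply: le_trans (Hc2 _ fu) _; rewrite ler_wpM2r ?ip_ge0 // lerDr ltW.
have fK i : finite_set (K i) by case: (sK i).
have fN j : finite_set (N j) by case: (sN j).
have K1 i : K i 1%g by case: (sK i).
have N1 j : N j 1%g by case: (sN j).
pose T := descent b c; pose T' := descent (adj b) c.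
pose e i := avg i (K i); pose f j := avg j (N j).
have fe i : ffs (e i) by exact: ffs_avg.
have ff j : ffs (f j) by exact: ffs_avg.
have fTe n i : ffs (iter n T (e i)) by exact: ffs_iter.
have opf j : op (adj b) (f j) = op (adj b) (delta j 1%g).
  apply: op_avg => // i k x Nk; rewrite /adj invgM bN //.
  by case: (sN j) => _ _ + _; apply.
have ope i : op b (e i) = op b (delta i 1%g) by apply: op_avg => // j k x; exact: bK.
pose t m := \sum_i ip (e i) (iter m T (e i)).
pose s m := \sum_j ip (f j) (iter m T' (f j)).
have tS m : t m - t m.+1 = s m - s m.+1.
  have tE : t m - t m.+1 = c^-1 * \sum_i ip (op b (delta i 1%g)) (iter m T' (op b (delta i 1%g))).
    rewrite /t -sumrB mulr_sumr; apply: eq_bigr => i _.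
    by rewrite iterS ip_descent // iter_comm // ope; ring.
  have sE : s m - s m.+1 = c^-1 * \sum_j ip (op (adj b) (delta j 1%g)) (iter m T (op (adj b) (delta j 1%g))).
    have fTf : forall j, ffs (iter m T' (f j)) by move=> j; exact: ffs_iter.
    rewrite /s -sumrB mulr_sumr; apply: eq_bigr => j _.
    by rewrite iterS ip_descent // iter_comm // adjK opf; ring.
  by rewrite tE sE descent_trace.
have ts m : t m - s m = t 0%N - s 0%N.
  by elim: m => // m IH; have := tS m; lra.
have s0 m : 0 <= s (m + m)%N.
  apply: sumr_ge0 => j _; rewrite iterD -iter_sym //; last exact: ffs_iter.
  by apply: ip_ge0; exact: ffs_iter.
pose nu i m := ip (iter m T (e i)) (iter m T (e i)).
have nuE i m n : ip (iter m T (e i)) (iter n T (e i)) = ip (e i) (iter (m + n) T (e i)).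
  by rewrite iter_sym // -iterD.
have nu0 i m : 0 <= nu i m by exact: ip_ge0.
have nuS i m : nu i m.+1 <= nu i m - c^-1 * ip (op b (iter m T (e i))) (op b (iter m T (e i))).
  by rewrite /nu iterS; apply: descent_norm.
have nud i m : nu i m.+1 <= nu i m.
  apply: le_trans (nuS i m) _; rewrite gerBl mulr_ge0 ?invr_ge0 ?(ltW c0) //.
  by apply: ip_ge0; exact: ffs_op.
have nudm i m n : (m <= n)%N -> nu i n <= nu i m.
  move=> /subnK <-; elim: (n - m)%N => [|k IH]; first by rewrite add0n.
  exact: le_trans (nud _ _) IH.
pose d := t 0%N - s 0%N.
have d0 : 0 < d.
  rewrite /d subr_gt0 /t /s /=.
  rewrite (eq_bigr _ (fun i _ => ip_avg_avg i (fK i) (K1 i))).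
  by rewrite (eq_bigr _ (fun j _ => ip_avg_avg j (fN j) (N1 j))).
have sumnu m : d <= \sum_i nu i m.
  have : t (m + m)%N = \sum_i nu i m by apply: eq_bigr => i _; rewrite -nuE.
  by move=> <-; have := ts (m + m)%N; have := s0 m; rewrite /d; lra.
have [i0 [eta eta0 He]] : exists i, exists2 eta, 0 < eta & forall m, eta <= nu i m.
  apply: contrapT => nex; pose eta := d / (#|I|.+1)%:R.
  have eta0 : 0 < eta by rewrite divr_gt0 ?ltr0n.
  have /choice[m mP] i : exists m, nu i m < eta.
    apply: contrapT => nm; apply: nex; exists i, eta => // m.
    by rewrite leNgt; apply/negP => h; apply: nm; exists m.
  have := sumnu (\max_i m i); rewrite leNgt => /negP; apply.
  apply: (@le_lt_trans _ _ (\sum_(i : I) eta)).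
    apply: ler_sum => i _; apply: le_trans (ltW (mP i)).
    by apply: nudm; exact: leq_bigmax.
  rewrite sumr_const -mulr_natr /eta mulrAC ltr_pdivrMr ?ltr0n //.
  by rewrite ltr_pM2l // ltr_nat.
pose w m := iter (m + m) T (e i0).
have fw m : ffs (w m) by exact: fTe.
have cauchy i g eps : 0 < eps -> exists N0, forall m n, (N0 <= m)%N -> (m <= n)%N ->
    `|w m i g - w n i g| <= eps.
  move=> eps0; have eps2 : 0 < eps ^+ 2 by rewrite exprn_gt0.
  have [N0 HN] := noninc_cauchy (nu0 i0) (nud i0) eps2; exists N0 => m n Nm mn.
  have le2 : (w m i g - w n i g) ^+ 2 <= eps ^+ 2.
    have fd : ffs (addz (w m) (-1) (w n)) by exact: ffs_addz.
    apply: (@le_trans _ _ (ip (addz (w m) (-1) (w n)) (addz (w m) (-1) (w n)))).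
      by have := ip_ge i g fd; rewrite /addz mulN1r.
    have nuD p q : ip (w p) (w q) = nu i0 (p + q)%N.
      by rewrite /w /nu !nuE; congr (ip _ (iter _ _ _)); lia.
    rewrite ip_addzr // !ip_addzl // !nuD.
    have h1 := HN (m + m)%N (n + n)%N (leq_trans Nm (leq_addr _ _)) (leq_add mn mn).
    have h2 := nudm i0 (m + n)%N (n + n)%N (leq_add mn (leqnn _)).
    by rewrite [(n + m)%N]addnC; lra.
  by rewrite -ler_sqr ?nnegrE ?normr_ge0 ?(ltW eps0) // -normrX ger0_norm ?sqr_ge0.
have /choice[u0 u0P] (p : I * G) : exists l, conv (fun m => w m p.1 p.2) l.
  exact: cauchy_conv (cauchy p.1 p.2).
pose u i g := u0 (i, g).
have uP i g : conv (fun m => w m i g) (u i g) by exact: (u0P (i, g)).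
exists u; split.
- apply: contrapT => nu'; have uz g : u i0 g = 0.
    by apply/eqP; apply: contrapT => /negP h; apply: nu'; exists i0, g.
  pose x m := \sum_(g <- fset_set (K i0)) (ncard (K i0))%:R^-1 * w m i0 g.
  have xE m : x m = nu i0 m.
    rewrite /nu nuE -/(w m) /ip (bigD1 i0) //= big1 ?addr0; last first.
      move=> i' i'i; rewrite (_ : (fun _ => _) = fun=> 0) ?gsum0 //; apply/funext => h.
      by rewrite /e /avg (negbTE i'i) mul0r.
    rewrite (@gsumE _ _ (fset_set (K i0))); last first.
      move=> g; rewrite /e /avg eqxx /= in_fset_set //.
      by case: asboolP => [Kg _|]; rewrite ?inE // mul0r eqxx.
    apply: eq_big_seq => g; rewrite in_fset_set // inE => /asboolT Kg.
    by rewrite /e /avg eqxx Kg.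
  have : conv x (\sum_(g <- fset_set (K i0)) (ncard (K i0))%:R^-1 * u i0 g).
    by apply: conv_sum => g; apply: convM; [exact: conv_cst|exact: uP].
  rewrite big1 => [|g _]; last by rewrite uz mulr0.
  move=> h; have : eta <= 0 by apply: (conv_ge h) => m; rewrite xE.
  by rewrite leNgt eta0.
- exists (nu i0 0%N) => i A.
  have : conv (fun m => \sum_(g <- A) w m i g * w m i g) (\sum_(g <- A) u i g * u i g).
    by apply: conv_sum => g; apply: convM; exact: uP.
  have -> : \sum_(g <- A) u i g ^+ 2 = \sum_(g <- A) u i g * u i g.
    by apply: eq_bigr => g _; exact: expr2.
  move=> /conv_le; apply => m.
  have -> : \sum_(g <- A) w m i g * w m i g = \sum_(g <- A) w m i g ^+ 2.
    by apply: eq_bigr => g _; rewrite expr2.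
  by apply: le_trans (ip_ge_sum i A (fw m)) _; exact: nudm.
- move=> i k g Kk; apply: conv_unique (uP i (g * k)%g) _.
  have wK m : w m i (g * k)%g = w m i g.
    rewrite /w; elim: (m + m)%N => [|q IH] /=.
      rewrite /e /avg; case: eqVneq => //= ii; rewrite -ii in Kk *.
      congr (if _ then _ else _); apply: asbool_equiv_eq.
      have [_ _ KV KM] := sK i; split=> [Kgk|Kg]; last exact: KM.
      by rewrite -(mulgK k g); apply: KM => //; exact: KV.
    rewrite /T /descent /addz IH; congr (_ + _ * _); rewrite /op.
    apply: eq_bigr => j _.
    rewrite -(@gsum_shift _ _ k); last exact: fsupMr.
    congr gsum; apply/funext => x; rewrite /adj !grpE; congr (_ * _).
    by rewrite bK //; case: (sK i) => _ _ + _; apply.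
  by move=> eps /(uP i g)[N0 H]; exists N0 => m /H; rewrite wK.
- move=> j h; apply: (@conv_unique _ (fun m => op b (w m) j h)).
    rewrite /op; apply: conv_sum => i; have /fsupP[A fA] := fb i j.
    rewrite (@gsumE _ _ A); last by move=> x; rewrite mulf_eq0 negb_or => /andP[/fA].
    under eq_fun do (rewrite (@gsumE _ _ A); last by move=> x; rewrite mulf_eq0 negb_or => /andP[/fA]).
    by apply: conv_sum => x; apply: convM; [exact: conv_cst|exact: uP].
  move=> eps eps0; have ep : 0 < c^-1 * eps ^+ 2 by rewrite mulr_gt0 ?invr_gt0 ?exprn_gt0.
  have [N0 HN] := noninc_cauchy (nu0 i0) (nud i0) ep; exists N0 => m Nm.
  rewrite subr0 -ler_sqr ?nnegrE ?normr_ge0 ?(ltW eps0) // -normrX ger0_norm ?sqr_ge0 //.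
  apply: le_trans (ip_ge j h (ffs_op fb (fw m))) _.
  have h1 := nuS i0 (m + m)%N; have h2 := HN (m + m)%N _ (leq_trans Nm (leq_addr _ _)) (leqnSn _).
  by rewrite -(ler_pM2l (x := c^-1)) ?invr_gt0 //; rewrite /w; lra.
Qed.

End InvariantOperators.

(** * Groups acting on trees *)

Section Trees.
Local Open Scope classical_set_scope.
Local Open Scope group_scope.

(** An oriented [G]-tree; [isE] singles out the edges among the elements of [B],
    and the vertices are the ends of the edges. That the graph is simply connected
    is expressed by the existence of potentials for labels in any group. *)
Record gtree (G : groupType) (V B : Type) (av : G -> V -> V) (ae : G -> B -> B)
    (isE : set B) (src tgt : B -> V) : Prop := GTree {
  gt_av1 : forall x, av 1 x = x;
  gt_avM : forall g h x, av (g * h) x = av g (av h x);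
  gt_ae1 : forall e, ae 1 e = e;
  gt_aeM : forall g h e, ae (g * h) e = ae g (ae h e);
  gt_isE : forall g e, isE e -> isE (ae g e);
  gt_src : forall g e, isE e -> src (ae g e) = av g (src e);
  gt_tgt : forall g e, isE e -> tgt (ae g e) = av g (tgt e);
  gt_pot : forall (L : groupType) (m : B -> L), exists Phi : V -> L,
    forall e, isE e -> Phi (tgt e) = Phi (src e) * m e;
  gt_conn : forall P : V -> Prop,
    (forall e, isE e -> P (src e) <-> P (tgt e)) ->
    forall e f, isE e -> isE f -> P (src e) -> P (src f) }.

Definition estab (G : groupType) (B : Type) (ae : G -> B -> B) (e : B) : set G :=
  [set g | ae g e = e].

End Trees.

(** Potentials take values in groups; real labels are put in this form. *)
Definition addgrp (R : realType) : Type := R.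

Section AdditiveGroup.
Local Open Scope ring_scope.
Variable R : realType.
HB.instance Definition _ := Choice.on (addgrp R).
Let addM (x y : addgrp R) : addgrp R := (x : R) + (y : R).
Let add1 : addgrp R := (0 : R).
Let addV (x : addgrp R) : addgrp R := - (x : R).
Let addA : associative addM. Proof. exact: addrA. Qed.
Let add1g : left_id add1 addM. Proof. exact: add0r. Qed.
Let addg1 : right_id add1 addM. Proof. exact: addr0. Qed.
Let addVg : left_inverse add1 addV addM. Proof. exact: addNr. Qed.
Let addgV : right_inverse add1 addV addM. Proof. exact: addrN. Qed.
HB.instance Definition _ := isGroup.Build (addgrp R) addA add1g addg1 addVg addgV.
Lemma addgrpE (x y : addgrp R) : (x * y)%g = (x : R) + (y : R) :> R.
Proof. by []. Qed.
End AdditiveGroup.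

Section EdgeBound.
Local Open Scope classical_set_scope.
Local Open Scope ring_scope.
Variables (R : realType) (G : groupType) (S : seq G).
Hypothesis Sgen : forall P : G -> Prop,
  P 1%g -> (forall g s, s \in S -> P g -> P (g * s)%g) -> forall g, P g.
Variables (V B : Type) (av : G -> V -> V) (ae : G -> B -> B) (isE : set B)
  (src tgt : B -> V).
Hypothesis T : gtree av ae isE src tgt.

Let pval (p : seq (B * R)) (u : B -> R) : R := \sum_(ea <- p) ea.2 * u ea.1.

Let potential (u : B -> R) (h : V -> R) := forall e, isE e -> h (tgt e) - h (src e) = u e.

Let ex_path e0 f : isE e0 -> isE f -> forall y, y = src f \/ y = tgt f -> exists p : seq (B * R),
  (forall ea, List.In ea p -> isE ea.1) /\
  forall u h, potential u h -> h y - h (src e0) = pval p u.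
Proof.
move=> E0 Ef; pose P y := exists p : seq (B * R), (forall ea, List.In ea p -> isE ea.1) /\
  forall u h, potential u h -> h y - h (src e0) = pval p u.
have PP e : isE e -> P (src e) <-> P (tgt e).
  move=> Ee; split=> -[p [pE pP]]; [exists ((e, 1) :: p)|exists ((e, -1) :: p)].
    split=> [ea /= [<-//|/pE]//|u h hu]; rewrite /pval big_cons -/(pval p u) /= mul1r.
    by rewrite -(pP u h hu) -(hu e Ee); ring.
  split=> [ea /= [<-//|/pE]//|u h hu]; rewrite /pval big_cons -/(pval p u) /= mulN1r.
  by rewrite -(pP u h hu) -(hu e Ee); ring.
have P0 : P (src e0) by exists [::]; split=> // u h _; rewrite subrr /pval big_nil.
have Pf := gt_conn T PP E0 Ef P0.
by move=> y [->|->] //; apply/PP.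
Qed.

Variables (I : finType) (e : I -> B).
Hypothesis eE : forall i, isE (e i).
Hypothesis e_onto : forall f, isE f -> exists i g, f = ae g (e i).
Hypothesis e_inj : forall i j g, e i = ae g (e j) -> i = j.
Hypothesis e_fin : forall i, finite_set (estab ae (e i)).
Variable i0 : I.
Let x0 := src (e i0).
Variables (J : finType) (w : J -> V).
Hypothesis w_vert : forall j, exists2 f, isE f & w j = src f \/ w j = tgt f.
Hypothesis w_fin : forall j, finite_set (estab av (w j)).
Hypothesis w_onto : forall f x, isE f -> x = src f \/ x = tgt f ->
  finite_set (estab av x) -> exists j g, x = av g (w j).

Let K i := estab ae (e i).

Let estab_subgroup (X : Type) (a : G -> X -> X) (x : X) :
  (forall y, a 1%g y = y) -> (forall g h y, a (g * h)%g y = a g (a h y)) ->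
  finite_set (estab a x) -> finite_subgroup (estab a x).
Proof.
move=> a1 aM f; split; [exact: f|exact: a1| |].
  by move=> g gx; rewrite /estab /= -{1}gx -aM mulVg a1.
by move=> g h gx hx; rewrite /estab /= aM hx gx.
Qed.

Let sK i : finite_subgroup (K i).
Proof. by apply: estab_subgroup => //; [exact: (gt_ae1 T)|exact: (gt_aeM T)]. Qed.

Let N (j : 'I_(size S) + J) : set G :=
  match j with inl _ => [set 1%g] | inr j => estab av (w j) end.

Let y (j : 'I_(size S) + J) : V :=
  match j with inl s => av (nth 1%g S s) x0 | inr j => w j end.

Let sN j : finite_subgroup (N j).
Proof.
case: j => [s|j] /=; last by apply: estab_subgroup => //; [exact: (gt_av1 T)|exact: (gt_avM T)].
split; [exact: finite_set1|by []|by move=> _ ->; rewrite invg1|].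
by move=> _ _ -> ->; rewrite mulg1.
Qed.

Let Ny j n : N j n -> av n (y j) = y j.
Proof. by case: j => [s|j] //= ->; exact: (gt_av1 T). Qed.

(** The number of orbits of edges, weighted by the orders of the stabilizers, is
    at most the number of generators plus the weighted number of orbits of
    vertices with finite stabilizers. Otherwise there would be a nonzero
    square-summable function on the edges whose potential vanishes on the orbit
    of a base point and at the vertices with finite stabilizers; being
    square-summable, it has potential zero at the other vertices as well. *)
Theorem tree_edge_bound :
  \sum_i (ncard (K i))%:R^-1 <= (size S)%:R + \sum_j (ncard (estab av (w j)))%:R^-1 :> R.
Proof.
rewrite leNgt; apply/negP => lt.
have /choice[p pP] : forall j, exists p : seq (B * R), (forall ea, List.In ea p -> isE ea.1) /\
    forall u h, potential u h -> h (y j) - h x0 = pval p u.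
  case=> [s|j] /=.
    apply: (ex_path (eE i0) (gt_isE T (nth 1%g S s) (eE i0))).
    by left; rewrite (gt_src T).
  by have [f Ef wf] := w_vert j; exact: ex_path (eE i0) Ef _ wf.
pose nK i : R := (ncard (K i))%:R; pose nN j : R := (ncard (N j))%:R.
have nK0 i : nK i != 0.
  by have [fK K1 _ _] := sK i; rewrite pnatr_eq0 -lt0n (ncard_gt0 fK K1).
have nN0 j : nN j != 0.
  by have [fN N1 _ _] := sN j; rewrite pnatr_eq0 -lt0n (ncard_gt0 fN N1).
pose pv j f : R := \sum_(n <- fset_set (N j)) \sum_(ea <- p j) (if `[< ae n ea.1 = f >] then ea.2 else 0).
pose b i j x := (nK i)^-1 * ((nN j)^-1 * pv j (ae x^-1%g (e i))).
pose c i f x : R := if `[< f = ae x^-1%g (e i) >] then (nK i)^-1 else 0.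
have cfin i f : finite_set [set x | f = ae x^-1%g (e i)].
  have [[x1 fx]|nex] := pselect (exists x, f = ae x^-1%g (e i)); last first.
    by rewrite (_ : mkset _ = set0) //; apply/seteqP; split=> // x fx; apply: nex; exists x.
  have [fK _ _ _] := sK i.
  apply: sub_finite_set (finite_image (fun k => (k^-1 * x1)%g) fK) => x fx'.
  exists (x1 * x^-1)%g; last by rewrite !grpE.
  rewrite /K /estab /= (gt_aeM T) -fx' fx -(gt_aeM T) mulgV; exact: (gt_ae1 T).
have cfs1 i f : fsup (c i f).
  by apply: sub_finite_set (cfin i f) => x /=; rewrite /c; case: asboolP; rewrite ?eqxx.
have bE i j x : b i j x = \sum_(n <- fset_set (N j)) \sum_(ea <- p j)
    (nN j)^-1 * ea.2 * c i (ae n ea.1) x.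
  rewrite /b mulrCA /pv mulr_sumr mulr_sumr; apply: eq_bigr => n _.
  rewrite mulr_sumr mulr_sumr; apply: eq_bigr => ea _; rewrite /c.
  by case: asboolP => _; ring.
have fb : cfs b.
  move=> i j; rewrite (_ : b i j = fun x => \sum_(n <- fset_set (N j)) \sum_(ea <- p j)
    (nN j)^-1 * ea.2 * c i (ae n ea.1) x); last by apply/funext => x; exact: bE.
  by apply: fsup_sum => n; apply: fsup_sum => ea; exact: fsupMl.
have bK i j k x : K i k -> b i j (k * x)%g = b i j x.
  move=> Kk; rewrite /b invgM (gt_aeM T) (_ : ae k^-1%g (e i) = e i) //.
  by case: (sK i) => _ _ KV _; exact: KV.
have bN i j k x : N j k -> b i j (x * k)%g = b i j x.
  move=> Nk; have [fN N1 NV NM] := sN j; rewrite /b; congr (_ * (_ * _)).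
  have AE : [fset (k * n)%g | n in fset_set (N j)]%fset = fset_set (N j).
    apply/fsetP => n; rewrite in_fset_set //; apply/imfsetP/idP => [[n' /=]|].
      by rewrite in_fset_set // !inE => Nn' ->; exact: NM.
    rewrite inE => Nn; exists (k^-1 * n)%g; rewrite ?mulVKg //=.
    by rewrite in_fset_set // inE; apply: NM => //; exact: NV.
  rewrite /pv invgM (gt_aeM T) -{2}AE big_imfset /=; last by move=> n n' _ _; exact: mulgI.
  apply: eq_bigr => n _; apply: eq_bigr => ea _; congr (if _ then _ else _).
  apply: asbool_equiv_eq; rewrite (gt_aeM T); split=> [->|].
    by rewrite -!(gt_aeM T) !grpE.
  by move=> /(congr1 (ae k^-1%g)); rewrite -!(gt_aeM T) !grpE.
have lt' : \sum_j (ncard (N j))%:R^-1 < \sum_i (ncard (K i))%:R^-1 :> R.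
  rewrite big_sumType /= (eq_bigr (fun=> 1)) ?sumr_const ?card_ord //.
  by move=> s _; rewrite /ncard fset_set1 cardfs1 invr1.
have [u [[i1 [g1 nz]] [M HM] uK ker]] := l2_solution fb sK sN bK bN lt'.
(* [u] descends to a function [uu] on the edges *)
have /choice[uu uuP] : forall f, exists a : R, forall i g, f = ae g (e i) -> a = u i g.
  move=> f; have [[i [g fE]]|nex] := pselect (exists i g, f = ae g (e i)); last first.
    by exists 0 => i g fE; case: nex; exists i, g.
  exists (u i g) => i' g' fE'.
  have ii' : i = i'.
    apply: (@e_inj _ _ (g^-1 * g')%g); rewrite (gt_aeM T) -fE' fE -(gt_aeM T) mulVg.
    by rewrite (gt_ae1 T).
  rewrite -ii' in fE' *; rewrite -(mulVKg g g') uK // /K /estab /= (gt_aeM T) -fE' fE -(gt_aeM T) mulVg.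
  exact: (gt_ae1 T).
have uuE i g : uu (ae g (e i)) = u i g by exact: uuP.
have [h0 h0P] := gt_pot T (uu : B -> addgrp R).
pose h x : R := (h0 x : R) - (h0 x0 : R).
have hP : potential uu h.
  by move=> f Ef; rewrite /h (h0P f Ef) addgrpE; ring.
have hx0 : h x0 = 0 by rewrite /h subrr.
have potg g : potential (fun f => uu (ae g f)) (fun x => h (av g x)).
  by move=> f Ef; rewrite -(gt_tgt T) // -(gt_src T) //; apply: hP; exact: (gt_isE T).
(* the equations of the system in terms of the potential *)
have csum f g : isE f -> \sum_i gsum (fun x => c i f x * u i (g * x^-1)%g) = uu (ae g f).
  move=> Ef; have [i [y1 fE]] := e_onto Ef.
  rewrite (bigD1 i) //= big1 ?addr0 => [|i' i'i].
    have fK : finite_set (K i) by case: (sK i).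
    transitivity (gsum (fun x => if `[< K i (y1^-1 * x^-1)%g >] then (nK i)^-1 * uu (ae g f) else 0)).
      congr gsum; apply/funext => x; rewrite /c.
      have -> : `[< f = ae x^-1%g (e i) >] = `[< K i (y1^-1 * x^-1)%g >].
        apply: asbool_equiv_eq; rewrite fE /K /estab /= (gt_aeM T); split=> [<-|E].
          by rewrite -(gt_aeM T) mulVg (gt_ae1 T).
        by rewrite -[in LHS]E -(gt_aeM T) mulgV (gt_ae1 T).
      case: asboolP => [Kx|_]; last by rewrite mul0r.
      congr (_ * _); rewrite -uuE; congr uu; rewrite (gt_aeM T); congr ae.
      by rewrite fE -[in RHS]Kx -(gt_aeM T) mulVKg.
    rewrite (@gsum_bij _ _ (fun k => if `[< K i k >] then (nK i)^-1 * uu (ae g f) else 0)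
      (fun x => y1^-1 * x^-1)%g (fun k => k^-1 * y1^-1)%g).
    - by rewrite gsum_indicator // mulrA mulfV ?mul1r // nK0.
    - by move=> x; rewrite !grpE.
    - by move=> x; rewrite !grpE.
    - by apply: sub_finite_set fK => k /=; case: asboolP; rewrite ?eqxx.
  rewrite (_ : (fun _ => _) = fun=> 0) ?gsum0 //; apply/funext => x.
  rewrite /c; case: asboolP => [fx|_]; last by rewrite mul0r.
  case/eqP: i'i; symmetry; apply: (@e_inj _ _ (y1^-1 * x^-1)%g).
  by rewrite (gt_aeM T) -fx fE -(gt_aeM T) mulVg (gt_ae1 T).
have eqn j g : \sum_(n <- fset_set (N j)) (h (av (g * n)%g (y j)) - h (av (g * n)%g x0)) = 0.
  have [pE pH] := pP j.
  transitivity (\sum_(n <- fset_set (N j)) \sum_(ea <- p j) ea.2 * uu (ae (g * n)%g ea.1)).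
    by apply: eq_bigr => n _; rewrite (pH _ _ (potg (g * n)%g)).
  rewrite -[RHS](mulr0 (nN j)) -[X in _ = _ * X](ker j g).
  have -> : \sum_i gsum (fun x => b i j x * u i (g * x^-1)%g) = \sum_(n <- fset_set (N j))
      \sum_(ea <- p j) (nN j)^-1 * ea.2 * \sum_i gsum (fun x => c i (ae n ea.1) x * u i (g * x^-1)%g).
    transitivity (\sum_i \sum_(n <- fset_set (N j)) \sum_(ea <- p j) (nN j)^-1 * ea.2 *
        gsum (fun x => c i (ae n ea.1) x * u i (g * x^-1)%g)).
      apply: eq_bigr => i _.
      have f1 n ea : fsup (fun x => (nN j)^-1 * ea.2 * (c i (ae n ea.1) x * u i (g * x^-1)%g)).
        by apply: fsupMl; exact: fsupMr.
      transitivity (gsum (fun x => \sum_(n <- fset_set (N j)) \sum_(ea <- p j)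
          (nN j)^-1 * ea.2 * (c i (ae n ea.1) x * u i (g * x^-1)%g))).
        congr gsum; apply/funext => x; rewrite bE mulr_suml; apply: eq_bigr => n _.
        by rewrite mulr_suml; apply: eq_bigr => ea _; rewrite mulrA.
      rewrite gsum_sum; last by move=> n; exact: fsup_sum.
      apply: eq_bigr => n _; rewrite gsum_sum //; apply: eq_bigr => ea _.
      by rewrite gsumZ //; exact: fsupMr.
    rewrite exchange_big; apply: eq_bigr => n _ /=; rewrite exchange_big.
    by apply: eq_bigr => ea _ /=; rewrite mulr_sumr.
  rewrite mulr_sumr; apply: eq_bigr => n _; rewrite mulr_sumr.
  elim: (p j) pE => [|ea r IH] pE; first by rewrite !big_nil.
  rewrite !big_cons IH; last by move=> ea' ?; apply: pE; right.
  congr (_ + _); rewrite csum; last by apply: (gt_isE T); apply: pE; left.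
  by rewrite !mulrA mulfV // mul1r -(gt_aeM T).
have hx g : h (av g x0) = 0.
  move: g; apply: Sgen; first by rewrite (gt_av1 T).
  move=> g s sS hg; have lts : (index s S < size S)%N by rewrite index_mem.
  have := eqn (inl (Ordinal lts)) g; rewrite /= fset_set1 big_seq_fset1 mulg1 nth_index //.
  by rewrite hg subr0 -(gt_avM T).
have hw j g : h (av g (w j)) = 0.
  have [fN N1 _ _] := sN (inr j); have := eqn (inr j) g.
  rewrite (eq_big_seq (fun=> h (av g (w j)))).
    rewrite big_const_seq count_predT iter_addr_0 => /eqP.
    rewrite mulrn_eq0 => /orP[/eqP n0|/eqP//].
    by have := nN0 (inr j); rewrite /nN /ncard n0 eqxx.
  move=> n; rewrite in_fset_set // inE => Nn.
  by rewrite hx subr0 (gt_avM T) (Ny (j := inr j) Nn).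
pose P x := forall g, h (av g x) = 0.
have Pinf f x z : isE f -> x = src f /\ z = tgt f \/ x = tgt f /\ z = src f -> P x -> P z.
  move=> Ef xz Px g; have zf : z = src f \/ z = tgt f by case: xz => -[_ ->]; [right|left].
  have [fz|iz] := pselect (finite_set (estab av z)).
    have [j [g' ->]] := w_onto Ef zf fz.
    by rewrite -(gt_avM T) hw.
  apply/eqP; apply: contrapT => /negP nz'; pose eta := h (av g z).
  have eta2 : 0 < eta ^+ 2 by rewrite exprn_even_gt0 // /eta.
  have uk k : estab av z k -> uu (ae (g * k)%g f) ^+ 2 = eta ^+ 2.
    move=> kz; rewrite -(potg (g * k)%g f Ef); have ez : h (av (g * k)%g z) = eta by rewrite (gt_avM T) kz.
    case: xz => -[xE zE]; rewrite -zE -xE ez Px; first by rewrite subr0.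
    by rewrite sub0r sqrrN.
  have [i [y1 fE]] := e_onto Ef.
  have [k ke] : exists k : nat, M < k%:R * eta ^+ 2.
    by exists (Num.trunc (M / eta ^+ 2)).+1; rewrite -ltr_pdivrMr // truncnS_gt.
  have [A Az Ak] := infinite_set_fset k iz.
  pose A' := [fset (g * a * y1)%g | a in A]%fset.
  have := HM i A'; rewrite leNgt => /negP; apply; apply: (lt_le_trans ke).
  rewrite big_imfset /=; last by move=> a a' _ _ /mulIg /mulgI.
  rewrite (eq_big_seq (fun=> eta ^+ 2)); last first.
    by move=> a /Az az; rewrite -uuE (gt_aeM T) -fE uk.
  rewrite big_const_seq count_predT iter_addr_0 -[X in _ <= X]mulr_natl ler_wpM2r ?sqr_ge0 //.
  by rewrite ler_nat.
have PP f : isE f -> P (src f) <-> P (tgt f).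
  by move=> Ef; split; apply: (Pinf f _ _ Ef); [left|right].
have P0 : P x0 by [].
move/eqP: nz; apply; rewrite -uuE -(hP _ (gt_isE T g1 (eE i1))).
have Pi := gt_conn T PP (eE i0) (eE i1) P0.
rewrite (gt_tgt T) // (gt_src T) // Pi; move/PP: Pi => -> //.
by rewrite subr0.
Qed.

End EdgeBound.

(** * The oriented tree of a family of cuts *)

Section OrbTree.
Local Open Scope classical_set_scope.
Local Open Scope group_scope.
Variables (G : groupType) (c : nat -> set G) (I : set nat).
Let E := orb c I.
Hypothesis nsE : nested_system E.

(** One orientation of each edge is chosen invariantly; the edges that the group
    inverts are taken with both, and cut in two at a midpoint, which is the
    vertex [inr] of the tree below. *)
Definition orb_pos : set (set G) := [set D | exists2 i, I i & exists g, D = tr g (c i)].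

Definition midpoint (D : set G) : set (set G) := [set F | F = D \/ F = ~` D].

Definition orb_tgt (D : set G) : set (set G) + set (set G) := inl (tau E D).

Definition orb_src (D : set G) : set (set G) + set (set G) :=
  if `[< orb_pos (~` D) >] then inr (midpoint D) else inl (tau E (~` D)).

Definition orb_av (g : G) (x : set (set G) + set (set G)) : set (set G) + set (set G) :=
  match x with inl v => inl (trv g v) | inr v => inr (trv g v) end.

Lemma orb_pos_E D : orb_pos D -> E D.
Proof. by move=> [i Ii [g ->]]; exists i => //; exists g; left. Qed.

Lemma orb_pos_or D : E D -> orb_pos D \/ orb_pos (~` D).
Proof.
move=> [i Ii [g [->|->]]]; [left|right]; exists i => //; exists g => //.
by rewrite -trC setCK.
Qed.

Lemma orb_pos_tr g D : orb_pos D -> orb_pos (tr g D).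
Proof. by move=> [i Ii [h ->]]; exists i => //; exists (g * h); rewrite trM. Qed.

Lemma orb_pos_trE g D : orb_pos (tr g D) <-> orb_pos D.
Proof. by split=> [/(orb_pos_tr g^-1)|]; [rewrite trK|exact: orb_pos_tr]. Qed.

Lemma midpointC D : midpoint (~` D) = midpoint D.
Proof.
by apply/seteqP; split=> F [->|->]; rewrite /midpoint /= ?setCK; tauto.
Qed.

Lemma midpoint_tr g D : midpoint (tr g D) = trv g (midpoint D).
Proof.
apply/seteqP; split=> F; rewrite /midpoint /trv /=.
  by case=> ->; [left; rewrite trK|right; rewrite -trC trK].
by case=> FE; [left|right]; rewrite -[F](trVK g) FE.
Qed.

Lemma midpoint_inj D F : midpoint D = midpoint F -> D = F \/ D = ~` F.
Proof.
move=> DF; have : midpoint F D by rewrite -DF; left.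
by case=> ->; [left|right].
Qed.

(** The potentials and the connectedness of the tree carry over from the nested system;
    at an inverted edge the label is spread over its two halves. *)
Theorem orb_gtree : gtree orb_av (@tr G) orb_pos orb_src orb_tgt.
Proof.
have proper D : E D -> D <> ~` D.
  by move=> /(ns_ne nsE)[x Dx] DC; have := Dx; rewrite {1}DC; exact.
split.
- by case=> v /=; rewrite trv1.
- by move=> g h [v|v] /=; rewrite trvM.
- exact: tr1.
- exact: trM.
- exact: orb_pos_tr.
- move=> g D oD; rewrite /orb_src -trC.
  have -> : `[< orb_pos (tr g (~` D)) >] = `[< orb_pos (~` D) >].
    by apply: asbool_equiv_eq; exact: orb_pos_trE.
  by case: asboolP => _ /=; rewrite ?midpoint_tr ?tau_tr.
- by move=> g D oD; rewrite /orb_tgt /= tau_tr.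
- move=> L m.
  pose m' D := if `[< orb_pos D >] then
    (if `[< orb_pos (~` D) >] then (m (~` D))^-1 * m D else m D)
    else (m (~` D))^-1.
  have m'C D : E D -> m' (~` D) = (m' D)^-1.
    move=> /orb_pos_or; rewrite /m' setCK; case: asboolP; case: asboolP => oD oD' // o.
    - by rewrite !grpE.
    - by rewrite invgK.
    - by case: o.
  have [Phi PhiE] := tau_potential nsE m'C.
  pose Psi (v : set (set G)) := if pselect (exists D, [/\ orb_pos D, orb_pos (~` D) & v = midpoint D])
    is left ex then let D := projT1 (cid ex) in Phi (tau E D) * (m D)^-1 else 1.
  exists (fun x => match x with inl v => Phi v | inr v => Psi v end) => D oD.
  have ED := orb_pos_E oD.
  rewrite /orb_src /orb_tgt; case: asboolP => [oD'|noD']; last first.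
    by rewrite PhiE // /m' (asboolT oD) (asboolF noD').
  rewrite /Psi; case: pselect => [ex|[]]; last by exists D.
  case: cid => F [oF oF' /esym/midpoint_inj DF] /=.
  case: DF => [<-|FD]; first by rewrite !grpE.
  have -> : D = ~` F by rewrite FD setCK.
  have EF := orb_pos_E oF.
  by rewrite (PhiE F EF) /m' (asboolT oF) (asboolT oF') !grpE.
- move=> P PE e f oe of_.
  pose P0 v := P (inl v).
  have P0E C : E C -> P0 (tau E C) <-> P0 (tau E (~` C)).
    move=> EC; have [oC|noC] := pselect (orb_pos C); have [oC'|noC'] := pselect (orb_pos (~` C)).
    - have := PE _ oC; have := PE _ oC'; rewrite /orb_src /orb_tgt setCK (asboolT oC) (asboolT oC') midpointC.
      by rewrite /P0; tauto.
    - by have := PE _ oC; rewrite /orb_src /orb_tgt (asboolF noC') /P0; tauto.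
    - by have := PE _ oC'; rewrite /orb_src /orb_tgt setCK (asboolF noC) /P0; tauto.
    - by case: (orb_pos_or EC).
  move=> /(PE e oe) Pe; apply/(PE f of_).
  exact: (tau_connected nsE P0E (orb_pos_E oe) (orb_pos_E of_) Pe).
Qed.

End OrbTree.

(** * Infinite chains with bounded edge stabilizers *)

Section SetSizes.
Local Open Scope classical_set_scope.
Local Open Scope group_scope.

Lemma ncard_coset (G : groupType) (K N : set G) g : finite_set N -> K `<=` N ->
  K 1 -> (forall h k, K h -> K k -> K (h * k)) -> (forall h, K h -> K h^-1) ->
  (forall h, K h -> N (g * h)) -> ~ K g -> (2 * ncard K <= ncard N)%N.
Proof.
move=> fN KN K1 KM KV Ng nKg; have fK : finite_set K by exact: sub_finite_set fN.
pose K' := (fun h => g * h) @` K.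
have fK' : finite_set K' by exact: finite_image.
have cK' : ncard K' = ncard K.
  by rewrite /ncard fset_set_image // card_imfset //=; exact: mulgI.
have : (ncard (K `|` K') + ncard (K `&` K') = ncard K + ncard K')%N by exact: ncardUI.
have -> : K `&` K' = set0.
  apply/seteqP; split=> // x [Kx [h Kh hx]]; apply: nKg.
  by have -> : g = x * h^-1; [rewrite -hx mulgK|apply: KM => //; exact: KV].
rewrite {2}/ncard fset_set0 cardfs0 addn0 cK' addnn -mul2n => <-.
apply: ncard_sub => // x [/KN//|[h Kh <-]]; exact: Ng.
Qed.

Lemma infinite_pigeonhole (T : finType) (P : set nat) (f : nat -> T) :
  infinite_set P -> exists i j, [/\ P i, P j, (i < j)%N & f i = f j].
Proof.
move=> iP; have [A AP cA] := infinite_set_fset #|T|.+1 iP.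
have [i [j [iA jA ij fij]]] : exists i j, [/\ i \in A, j \in A, i <> j & f i = f j].
  apply: contrapT => nex.
  have inj : {in A &, injective f}.
    by move=> i j iA jA fij; apply: contrapT => ij; apply: nex; exists i, j.
  have u : uniq [seq f x | x <- A] by rewrite map_inj_in_uniq ?fset_uniq.
  have sub : {subset [seq f x | x <- A] <= enum T} by move=> x _; rewrite mem_enum.
  by have := uniq_leq_size u sub; rewrite size_map -cardE leqNgt cA.
have [lt|lt|] := ltngtP i j => //.
- by exists i, j; split=> //; exact: AP.
- by exists j, i; split=> //; exact: AP.
Qed.

Lemma increasing_sequence (P : nat -> nat -> Prop) :
  (forall m, exists2 i, (m < i)%N & P m i) ->
  exists f : nat -> nat, (forall n, (f n < f n.+1)%N) /\ forall n, P (f n) (f n.+1).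
Proof.
move=> H.
have /choice[nx nxP] : forall m, exists i, (m < i)%N /\ P m i.
  by move=> m; have [i lt Pi] := H m; exists i.
by exists (fun n => iter n nx 0%N); split=> n; have [] := nxP (iter n nx 0%N).
Qed.

End SetSizes.

Section Conjugation.
Local Open Scope classical_set_scope.
Local Open Scope group_scope.

Lemma vstab_conj (G : groupType) (g : G) (v : set (set G)) : vstab (trv g v) = (fun h => g * h * g^-1) @` vstab v.
Proof.
apply/seteqP; split=> [h hv|_ [h hv <-]].
  exists (g^-1 * h * g); last by rewrite !grpE.
  by rewrite /vstab /= !trvM hv trvK.
by rewrite /vstab /= -!trvM !grpE trvM hv.
Qed.

End Conjugation.

Section Subchains.
Local Open Scope classical_set_scope.
Local Open Scope group_scope.
Variables (G : groupType) (S : seq G).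
Hypothesis Ssym : forall s, s \in S -> s^-1 \in S.
Hypothesis Sgen : forall P : G -> Prop,
  P 1 -> (forall g s, s \in S -> P g -> P (g * s)) -> forall g, P g.
Variable c0 : nat -> set G.
Hypothesis ch : forall n, chain S c0 n.
Variable f : nat -> nat.
Hypothesis f_lt : forall n, (f n < f n.+1)%N.

Let c n := c0 (f n).
Let E n := orb c `I_n.
Let K j : set G := [set g | tr g (c j) = c j].
Let side j (C : set G) := C = c j \/ C = ~` c j.

Lemma f_mono i j : (i < j)%N -> (f i < f j)%N.
Proof.
elim: j => // j IH; rewrite ltnS leq_eqVlt => /orP[/eqP->//|/IH lt].
exact: ltn_trans lt (f_lt j).
Qed.

Lemma sub_orb n : E n.+1 `<=` orb c0 `I_(f n).+1.
Proof.
move=> D [i /= ilt [g DE]]; exists (f i) => /=; last by exists g.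
by move: ilt; rewrite !ltnS leq_eqVlt => /orP[/eqP->//|/f_mono/ltnW].
Qed.

Lemma sub_nested n I : I `<=` `I_n -> nested_system (orb c I).
Proof.
move=> In; apply: orb_nested_system.
- exact: sub_finite_set In (finite_II n).
- by move=> i _; exact: step_splits (ch (ltnSn (f i))).
- move=> i j g _ _; apply: (@chain_nested _ S c0 (maxn (f i) (f j)).+1) => //;
  by rewrite ltnS ?leq_maxl ?leq_maxr.
Qed.

Let nsE n : nested_system (E n) := sub_nested (@subset_refl _ `I_n).

Let sideE n j C : (j < n)%N -> side j C -> E n C.
Proof. by move=> jn [->|->]; [apply: orb_mem|apply: orb_memC]. Qed.

Let side_stab j C g : side j C -> (tr g C = C) <-> K j g.
Proof.
case=> ->; split=> // H; last by rewrite trC H.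
by rewrite /K /= -[c j]setCK trC H.
Qed.

Lemma K_finite j : finite_set (K j).
Proof.
have Ec : E j.+1 (c j) by apply: (sideE (ltnSn j)); left.
exact: (ns_stab_finite (nsE j.+1) (c j) Ec).
Qed.

Let KM j g h : K j g -> K j h -> K j (g * h).
Proof. by move=> Kg Kh; rewrite /K /= trM Kh Kg. Qed.

Let KV j g : K j g -> K j g^-1.
Proof. by move=> Kg; exact: tr_eqV. Qed.

Let K1 j : K j 1. Proof. exact: tr1. Qed.

Lemma sub_distinct i j g : tr g (c i) = c j \/ tr g (~` c i) = c j -> i = j.
Proof.
have key i' j' g' : (i' < j')%N -> tr g' (c i') = c j' \/ tr g' (~` c i') = c j' -> False.
  move=> /f_mono lt cij; have [H [vH _ [[_ i1 i2] _] _ _]] := ch (ltnSn (f j')).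
  have : orb c0 `I_(f j') (c0 (f j')).
    by exists (f i') => //; exists g'; case: cij => e; [left|right]; exact: esym e.
  move=> /(vst_side (chain_system (@ch (f j')) (@subset_refl _ _)) vH).
  by case.
move=> cij; have [lt|lt|//] := ltngtP i j; first by case: (key _ _ _ lt cij).
case: (key j i g^-1 lt); case: cij => <-; [left|right]; rewrite ?trK //.
by rewrite [tr g^-1 _]trC trK setCK.
Qed.

Lemma sub_last_loop n C : side n C -> vstab (tau (E n.+1) C) `<=` K n ->
  (exists g, trv g (tau (E n.+1) (~` C)) = tau (E n.+1) C) /\
  forall t, tr t C <> ~` C.
Proof.
move=> sC vsub; have ns0 := chain_system (@ch (f n).+1) (@subset_refl _ _).
have EC := sideE (ltnSn n) sC; have EC' := nsC (nsE n.+1) EC.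
have vsub0 : vstab (tau (orb c0 `I_(f n).+1) C) `<=` [set g | tr g C = C].
  move=> g /(vstab_collapse (nsE n.+1) ns0 (@sub_orb n) EC) /vsub Kg.
  by apply/(side_stab _ sC).
split.
  have [g [gC _]] := last_edge_loop (@ch _) sC vsub0.
  exists g; exact: (trv_collapse (nsE n.+1) ns0 (@sub_orb n) EC' EC gC).
exact: (last_edge_not_inverted (@ch _) sC vsub0).
Qed.

Lemma top_edge n D : E n D -> exists j C g,
  [/\ (j < n)%N, side j C, tau (E n) D = trv g (tau (E n) C) &
      forall D', E n D' -> tau (E n) D' = tau (E n) C -> E j.+1 D'].
Proof.
move=> ED.
pose Q := fun p : nat * set G * G => [/\ (p.1.1 < n)%N, side p.1.1 p.1.2 &
  tau (E n) D = trv p.2 (tau (E n) p.1.2)].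
have idx D' : E n D' -> exists j C g, [/\ (j < n)%N, side j C & D' = tr g C].
  move=> [j jn [g [->|->]]]; first by exists j, (c j), g; split=> //; left.
  by exists j, (~` c j), g; split=> //; right.
have QD : exists p, Q p.
  have [j [C [g [jn sC DE]]]] := idx D ED; exists (j, C, g); split=> //=.
  by rewrite DE tau_tr.
have [[[j C] g] [/= jn sC tD] mj] := ex_measure_min (fun p => (n - p.1.1)%N) QD.
exists j, C, g; split=> // D' ED' tD'.
have [i [C' [h [iln sC' D'E]]]] := idx D' ED'.
have /mj /= : Q (i, C', g * h).
  by split=> //=; rewrite trvM -tau_tr // -D'E tD' -tD.
move=> le; exists i; first by rewrite /= ltnS; move: le jn iln; clear; lia.
by exists h; case: sC' D'E => -> ->; [left|right].
Qed.

Lemma top_edge_vstab n j C : (j < n)%N -> side j C ->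
  (forall D', E n D' -> tau (E n) D' = tau (E n) C -> E j.+1 D') ->
  vstab (tau (E j.+1) C) = vstab (tau (E n) C).
Proof.
move=> jn sC star; apply: vstab_expand => //; last exact: (sideE (ltnSn j)).
by apply: orb_sub => i /= /leq_trans; apply.
Qed.

Let finite_vstab_conj (g : G) (v : set (set G)) : finite_set (vstab v) -> finite_set (vstab (trv g v)).
Proof. by move=> fv; rewrite vstab_conj; exact: finite_image. Qed.

(** If at each step one of the new vertices has infinite stabilizer, the orbits of
    finite vertices weigh at most half as much as the orbits of edges. *)
Theorem no_infinite_good_chain (R : realType) k :
  (forall j, exists2 C, side j C & infinite_set (vstab (tau (E j.+1) C))) ->
  (forall j, (ncard (K j) <= k)%N) -> False.
Proof.
move=> good Kk; pose n := (2 * size S * k).+1.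
have ns := nsE n; have T := orb_gtree ns.
pose inv j := exists t, tr t (c j) = ~` c j.
pose Cw (j : nat) := if pselect (finite_set (vstab (tau (E j.+1) (c j)))) then c j else ~` c j.
have sCw j : side j (Cw j) by rewrite /Cw; case: pselect => ?; [left|right].
pose w (j : 'I_n) : set (set G) + set (set G) :=
  if pselect (inv j) then inr (midpoint (c j)) else inl (tau (E n) (Cw j)).
pose P (j : 'I_n) := `[< inv j \/ (finite_set (vstab (tau (E n) (Cw j))) /\
  forall D', E n D' -> tau (E n) D' = tau (E n) (Cw j) -> E j.+1 D') >].
have posE (j : 'I_n) g : orb_pos c `I_n (tr g (c j)).
  by exists (nat_of_ord j); [exact: ltn_ord|exists g].
have pos_inv (j : 'I_n) : orb_pos c `I_n (~` c j) -> inv j.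
  move=> [i /= iln [g cE]]; have ij : j = i :> nat.
    apply/esym/(@sub_distinct i j g); right; rewrite trC -cE setCK //.
  by exists g; rewrite ij -cE ij.
have inv_side j C : inv j -> side j C -> exists t, tr t C = ~` C.
  move=> [t tE] [->|->]; first by exists t.
  by exists t^-1; rewrite setCK -tE trK.
have inv_fin j C : inv j -> side j C -> ~ finite_set (vstab (tau (E j.+1) C)).
  move=> ij sC fC; have [C' sC' []] := good j.
  have [<-//|->] : C = C' \/ C' = ~` C.
    by case: sC sC' => -> [] ->; rewrite ?setCK; [left|right|right|left].
  have [t <-] := inv_side j C ij sC.
  by rewrite tau_tr //; exact: finite_vstab_conj.
have noninv_fin j C : side j C -> finite_set (vstab (tau (E j.+1) C)) ->
    ~ finite_set (vstab (tau (E j.+1) (~` C))).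
  move=> sC fC fC'; have [C' sC' []] := good j.
  by case: sC sC' fC fC' => -> [] ->; rewrite ?setCK.
have CwE j C : side j C -> finite_set (vstab (tau (E j.+1) C)) -> Cw j = C.
  move=> sC fC; rewrite /Cw; case: pselect => fc; case: sC fC => -> //.
  by move=> /(noninv_fin j (c j) (or_introl erefl) fc).
(* the vertex stabilizers are at least twice as large as those of the edges *)
have big (j : 'I_n) : P j -> finite_set (estab (@orb_av G) (w j)) /\
    (2 * ncard (K j) <= ncard (estab (@orb_av G) (w j)))%N.
  have wM g h : estab (@orb_av G) (w j) g -> estab (@orb_av G) (w j) h ->
      estab (@orb_av G) (w j) (g * h).
    by move=> gw hw; rewrite /estab /= (gt_avM T) hw.
  move=> /asboolP Pj; rewrite /w in wM *; case: pselect wM => [[t tE]|ninv] wM.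
    have sub : K j `<=` estab (@orb_av G) (inr (midpoint (c j))).
      by move=> g Kg; rewrite /estab /= -midpoint_tr Kg.
    have tw : estab (@orb_av G) (inr (midpoint (c j))) t.
      by rewrite /estab /= -midpoint_tr tE midpointC.
    have fw : finite_set (estab (@orb_av G) (inr (midpoint (c j)))).
      have Ec : E n (c j) by apply: sideE => //; left.
      apply: (@sub_finite_set _ _ (K j `|` [set g | tr g (c j) = ~` c j])); last first.
        by rewrite finite_setU; split; [exact: K_finite|exact: (ns_stab_finite ns _ Ec)].
      move=> g; rewrite /estab /= -midpoint_tr => -[/midpoint_inj[]] H; [by left|by right].
    split=> //; apply: (@ncard_coset _ _ _ t) => //; first exact: KM.
    - exact: KV.
    - by move=> h /sub; exact: wM.
    - rewrite /K /= tE => tK; have [x cx] : exists x, c j x.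
        by have [_ ? _] := step_splits (ch (ltnSn (f j))).
      by have := cx; rewrite -{1}tK; exact.
  case: Pj => // -[fw star].
  have estE : estab (@orb_av G) (inl (tau (E n) (Cw j))) = vstab (tau (E n) (Cw j)).
    by apply/seteqP; split=> g; rewrite /estab /vstab /=; [case|move=> ->].
  rewrite estE in wM *; split=> //.
  have vE := top_edge_vstab (ltn_ord j) (sCw j) star.
  have sub : K j `<=` vstab (tau (E n) (Cw j)).
    by move=> g /(side_stab g (sCw j)) gC; rewrite /vstab /= -tau_tr // gC.
  have [g vg nKg] : exists2 g, vstab (tau (E n) (Cw j)) g & ~ K j g.
    apply: contrapT => nex.
    have vsub : vstab (tau (E j.+1) (Cw j)) `<=` K j.
      by rewrite vE => g vg; apply: contrapT => nK; apply: nex; exists g.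
    have [[g gC] _] := sub_last_loop (sCw j) vsub.
    have fC : finite_set (vstab (tau (E j.+1) (Cw j))) by rewrite vE.
    apply: (noninv_fin j _ (sCw j) fC).
    have <- : trv g^-1 (tau (E j.+1) (Cw j)) = tau (E j.+1) (~` Cw j).
      by rewrite -gC trvK.
    exact: finite_vstab_conj.
  apply: (@ncard_coset _ _ _ g) => //; first exact: KM.
  - exact: KV.
  - by move=> h /sub; exact: wM.
have conj_fin g x : finite_set (estab (@orb_av G) (orb_av g x)) -> finite_set (estab (@orb_av G) x).
  move=> fx; apply: sub_finite_set (finite_image (fun h => g^-1 * h * g) fx) => h hx.
  exists (g * h * g^-1); last by rewrite !grpE.
  by rewrite /estab /= -(gt_avM T) !grpE (gt_avM T) hx.
have inl_vstab v : estab (@orb_av G) (inl v) = vstab v.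
  by apply/seteqP; split=> g; rewrite /estab /vstab /=; [case|move=> ->].
have inl_onto D : E n D -> finite_set (vstab (tau (E n) D)) ->
    exists j g, P j /\ inl (tau (E n) D) = orb_av g (w j).
  move=> ED fD; have [j [C [g [jn sC tD star]]]] := top_edge ED.
  have vE := top_edge_vstab jn sC star.
  have fC : finite_set (vstab (tau (E j.+1) C)).
    by rewrite vE -[tau _ C](trvK g) -tD; exact: finite_vstab_conj.
  have nij : ~ inv j by move=> ij; exact: inv_fin ij sC fC.
  have CE := CwE j C sC fC.
  exists (Ordinal jn), g; split.
    by apply/asboolP; right; rewrite /= CE -vE.
  by rewrite /w; case: pselect => [/nij//|?]; rewrite /= CE tD.
pose J := {j : 'I_n | P j}.
have KE (j : 'I_n) : estab (@tr G) (c j) = K j by [].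
have wv (j : J) : exists2 D, orb_pos c `I_n D &
    w (val j) = orb_src c `I_n D \/ w (val j) = orb_tgt c `I_n D.
  have cpos : orb_pos c `I_n (c (val j)) by rewrite -[c _]tr1.
  exists (c (val j)) => //; rewrite /w; case: pselect => [[t tE]|nij].
    left; rewrite /orb_src asboolT //.
    by rewrite -tE; exact: posE.
  have [->|->] := sCw (val j); first by right.
  by left; rewrite /orb_src asboolF // => /pos_inv.
have wonto D x : orb_pos c `I_n D -> x = orb_src c `I_n D \/ x = orb_tgt c `I_n D ->
    finite_set (estab (@orb_av G) x) -> exists (j : J) g, x = orb_av g (w (val j)).
  move=> oD xD fx; have ED := orb_pos_E oD.
  have inl_case F : E n F -> x = inl (tau (E n) F) ->
      exists (j : J) g, x = orb_av g (w (val j)).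
    move=> EF xF; move: fx; rewrite xF inl_vstab => /(inl_onto F EF)[j [g [Pj ->]]].
    by exists (Sub j Pj), g.
  case: xD => [|/(inl_case D ED)//]; rewrite /orb_src; case: asboolP => [oD'|_]; last first.
    exact: inl_case (nsC ns ED).
  move=> xm; case: oD oD' xm => [i /= iln [g ->]]; rewrite -trC => /orb_pos_trE oD' ->.
  have Pi : P (Ordinal iln) by apply/asboolP; left; exact: pos_inv (Ordinal iln) oD'.
  exists (Sub (Ordinal iln) Pi), g; rewrite /w /=; case: pselect => [?|[]].
    by rewrite midpoint_tr.
  exact: pos_inv (Ordinal iln) oD'.
have cpos (j : 'I_n) : orb_pos c `I_n (c j) by rewrite -[c _]tr1; exact: posE.
have bound := tree_edge_bound R Sgen T (e := fun j : 'I_n => c j) cpos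
  (fun D oD => let: ex_intro2 i iln (ex_intro g De) := oD in
     ex_intro _ (Ordinal iln) (ex_intro _ g De))
  (fun i j g e => val_inj (esym (sub_distinct (or_introl (esym e)))))
  (fun j => K_finite j) ord0 wv (fun j => (big _ (valP j)).1) wonto.
have Kpos j : (0 < ncard (K j))%N by apply: (ncard_gt0 (K_finite j)); exact: K1.
pose a j : R := ((ncard (K j))%:R^-1)%R.
have a_ge0 j : (0 <= a j)%R by rewrite invr_ge0 ler0n.
have half : (\sum_(j : J) (ncard (estab (@orb_av G) (w (val j))))%:R^-1 <=
    2^-1 * \sum_(j < n) a j :> R)%R.
  apply: (@le_trans _ _ (\sum_(j : J) 2^-1 * a (val j))%R).
    apply: ler_sum => j _; rewrite /a -invfM -natrM lef_pV2 ?posrE ?ltr0n ?ler_nat ?muln_gt0 ?Kpos //.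
      exact: (big _ (valP j)).2.
    by apply: leq_trans (big _ (valP j)).2; rewrite muln_gt0 Kpos.
  rewrite -mulr_sumr ler_wpM2l ?invr_ge0 ?ler0n //.
  rewrite -(big_sub_cond (fun j => P j) xpredT (fun j : 'I_n => a j)) /=.
  by rewrite big_mkcond; apply: ler_sum => j _; case: ifP.
have low : (n%:R / k%:R <= \sum_(j < n) a j :> R)%R.
  have -> : (n%:R / k%:R = \sum_(j < n) k%:R^-1 :> R)%R.
    by rewrite sumr_const card_ord -[RHS]mulr_natl.
  apply: ler_sum => j _; rewrite /a lef_pV2 ?posrE ?ltr0n ?ler_nat //.
  exact: leq_trans (Kpos j) (Kk j).
have kpos : (0 < k)%N := leq_trans (Kpos 0%N) (Kk 0%N).
have kR : (0 < k%:R :> R)%R by rewrite ltr0n.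
have : (n%:R / k%:R <= 2 * (size S)%:R :> R)%R.
  by move: bound half low; rewrite /a; lra.
rewrite ler_pdivrMr // -!natrM ler_nat /n; lia.
Qed.

End Subchains.

Section BoundedChains.
Local Open Scope classical_set_scope.
Local Open Scope group_scope.
Variables (G : groupType) (S : seq G).
Hypothesis Sgen : forall P : G -> Prop,
  P 1 -> (forall g s, s \in S -> P g -> P (g * s)) -> forall g, P g.
Variable c : nat -> set G.
Hypothesis ch : forall n, chain S c n.

Let E n := orb c `I_n.
Let side j (C : set G) := C = c j \/ C = ~` c j.

Lemma splits_conj g (K : set G) (B : set G) :
  splits ((fun h => g * h * g^-1) @` K) B -> splits K (tr g^-1 B).
Proof.
move=> [cB i1 i2]; have cB' := cut_tr g^-1 cB.
have key A : cut A -> infinite_set ((fun h => g * h * g^-1) @` K `&` A) ->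
    infinite_set (K `&` tr g^-1 A).
  move=> cA iA fA; apply: iA; have cA' := cut_tr g^-1 cA.
  apply: (@sub_finite_set _ _ ((fun h => g * h * g^-1) @`
    ((K `&` tr g^-1 A) `|` [set h | exists2 k, tr g^-1 A k /\ ~ tr g^-1 A (k * g) & h = k * g]))).
    move=> _ [[h Kh <-] Ah]; exists h => //; have [Bh|nBh] := pselect (tr g^-1 A h); first by left.
    right; exists (h * g^-1); last by rewrite !grpE.
    by split; rewrite ?mulgVK // mem_tr invgK; move: Ah; rewrite !grpE.
  apply: finite_image; rewrite finite_setU; split=> //.
  apply: sub_finite_set (finite_image (fun k => k * g) (cA' g)) => _ [k [Ak nAk] ->].
  by exists k.
split=> //; first exact: key.
by rewrite -trC; apply: key => //; exact: cutC.
Qed.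

(** A vertex that is split late carries one of finitely many earlier edges; the
    same edge cannot serve twice, as the first cut stays in the tree. *)
Theorem no_infinite_bounded_chain (R : realType) k :
  (forall j, (ncard [set g | tr g (c j) = c j] <= k)%N) -> False.
Proof.
move=> ck.
pose good j := exists2 C, side j C & infinite_set (vstab (tau (E j.+1) C)).
have nsE n : nested_system (E n) := chain_system (@ch n) (@subset_refl _ _).
have [n0 n0P] : exists n0, forall j, good j -> (j < n0)%N.
  apply: contrapT => nb.
  have H m : exists2 i, (m < i)%N & good i.
    apply: contrapT => nm; apply: nb; exists m.+1 => j gj; rewrite ltnS leqNgt.
    by apply/negP => mj; apply: nm; exists j.
  have [f [f_lt fP]] := increasing_sequence (P := fun _ i => good i) H.
  pose f' n := f n.+1.
  have f'_lt n : (f' n < f' n.+1)%N by exact: f_lt.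
  apply: (@no_infinite_good_chain G S Sgen c ch f' f'_lt R k) => j; last exact: ck.
  have [C sC iC] := fP j; exists C => // fC; apply: iC.
  have nsS := sub_nested ch f' (@subset_refl _ `I_j.+1).
  apply: sub_finite_set fC; apply: (vstab_collapse nsS (nsE _) (@sub_orb _ _ _ f'_lt j)).
  by case: sC => ->; [apply: (@orb_mem _ (fun i => c (f' i)) `I_j.+1 j (ltnSn j))
      |apply: (@orb_memC _ (fun i => c (f' i)) `I_j.+1 j (ltnSn j))].
have split_edge n : (0 < n)%N -> exists j C g,
  [/\ (j < n)%N /\ side j C, good j, splits (vstab (tau (E n) C)) (tr g^-1 (c n)) &
    forall D', E n D' -> tau (E n) D' = tau (E n) C -> E j.+1 D'].
  move=> n0'; have [H [vH iH [sH _] _ _]] := ch (ltnSn n).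
  have [D ED HD] : exists2 D, E n D & H = vstab (tau (E n) D).
    case: vH => [[E0 _]|//]; have : E n (c 0%N) by exact: orb_mem.
    by rewrite /E E0.
  have [j [C [g [jn sC tD star]]]] := top_edge ch (f := id) ED.
  exists j, C, g; have HC : H = (fun h => g * h * g^-1) @` vstab (tau (E n) C).
    by rewrite HD tD vstab_conj.
  split=> //; last by apply: splits_conj; rewrite -HC.
  exists C => //; rewrite (top_edge_vstab ch (f := id) jn sC star) => fC.
  by apply: iH; rewrite HC; exact: finite_image.
pose cut_of (p : 'I_n0 * bool) : set G := if p.2 then c p.1 else ~` c p.1.
have idx n : exists p : 'I_n0 * bool, exists g,
  [/\ (p.1 < n.+1)%N, splits (vstab (tau (E n.+1) (cut_of p))) (tr g^-1 (c n.+1)) &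
    forall D', E n.+1 D' -> tau (E n.+1) D' = tau (E n.+1) (cut_of p) -> E p.1.+1 D'].
  have [j [C [g [[jn sC] gj sp star]]]] := split_edge n.+1 isT.
  have [CE|CE] := sC; [exists (Ordinal (n0P j gj), true)|exists (Ordinal (n0P j gj), false)];
  by exists g; rewrite /cut_of /= -CE.
have [q qP] := choice idx.
have [m [n [_ _ mn qmn]]] := infinite_pigeonhole q infinite_nat.
have [g [jm sp starm]] := qP m; have [_ [_ _ starn]] := qP n; rewrite -qmn in starn.
set C := cut_of (q m) in sp starm starn; set j : nat := (q m).1 in jm starm starn.
have sC : side j C by rewrite /C /cut_of /j; case: (q m).2; [left|right].
have vm := top_edge_vstab ch (f := id) jm sC starm.
have jn : (j < n.+1)%N by apply: leq_trans jm _; rewrite ltnS ltnW.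
have vn := top_edge_vstab ch (f := id) jn sC starn.
have EC i : (j < i)%N -> E i C.
  by move=> ji; case: sC => ->; [apply: orb_mem|apply: orb_memC].
have sub : vstab (tau (E m.+1) C) `<=` vstab (tau (E m.+2) C).
  have -> : vstab (tau (E m.+1) C) = vstab (tau (E n.+1) C) by rewrite -[LHS]vm -[RHS]vn.
  apply: (vstab_collapse (nsE _) (nsE _)); last by apply: EC; exact: ltnW.
  by apply: orb_sub => i /= /leq_trans; apply.
have EB : E m.+2 (tr g^-1 (c m.+1)) by exists m.+1; [exact: ltnSn|exists g^-1; left].
have vH : vst (E m.+2) (vstab (tau (E m.+2) C)) by right; exists C => //; apply: EC; exact: ltnW.
have [_ i1 i2] := sp.
have [fB|fB] := vst_side (nsE m.+2) vH EB; [apply: i2|apply: i1];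
by apply: sub_finite_set fB => x [/sub Hx Bx].
Qed.

End BoundedChains.

(** * Vertex stabilizers as coarse retracts *)

Section Retraction.
Local Open Scope classical_set_scope.
Local Open Scope group_scope.
Variable G : groupType.

(** [rho] maps [G] to [H] and moves points of [H] a bounded amount; it is coarsely
    Lipschitz, and locally constant except near [H]. *)
Record coarse_retraction (H : set G) (rho : G -> G) : Prop := CoarseRetraction {
  cr_in : forall g, H (rho g);
  cr_step : forall s, exists2 W, finite_set W &
    forall g, rho g <> rho (g * s) -> W ((rho g)^-1 * g) /\ W ((rho (g * s))^-1 * g);
  cr_id : exists2 W, finite_set W & forall h, H h -> W ((rho h)^-1 * h) }.

Section Vertex.
Variables (c : nat -> set G) (n : nat) (C0 : set G).
Let E := orb c `I_n.
Hypothesis nsE : nested_system E.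
Hypothesis EC0 : E C0.
Let H := vstab (tau E C0).

Let at_v D := E D /\ tau E D = tau E C0.
Let misses g D := at_v D /\ ~ D g.

Let at_v_nested D D' : at_v D -> at_v D' -> D = D' \/ ~` D `<=` D'.
Proof.
move=> [ED tD] [ED' tD']; have tt : tau E D = tau E D' by rewrite tD.
have [DD'|DD'|DD'|/subCC DD'] := ns_nested nsE ED ED'.
- by left; apply: (tau_antisym nsE ED' _ DD'); rewrite -tt; exact: tau_self.
- have := tau_up (tau_self ED) (nsC nsE ED') DD'; rewrite tt.
  by move=> /(tau_nand nsE ED' (tau_self ED')).
- by right.
- by left; apply/esym; apply: (tau_antisym nsE ED _ DD'); rewrite tt; exact: tau_self.
Qed.

Let misses_uniq g D D' : misses g D -> misses g D' -> D = D'.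
Proof. by move=> [vD nD] [vD' nD']; have [//|/(_ g nD)] := at_v_nested vD vD'. Qed.

Let at_v_tr h D : H h -> at_v D -> at_v (tr h D).
Proof.
move=> Hh [ED tD]; split; first exact: (ns_tr nsE).
by rewrite (tau_tr nsE) tD Hh.
Qed.

Let Hgrp := vstab_group E C0.
Let HM g h : H g -> H h -> H (g * h). Proof. by have [_ _] := Hgrp; apply. Qed.
Let HV g : H g -> H g^-1. Proof. by have [_ HV _] := Hgrp; apply: HV. Qed.

(* finitely many edges represent the edges at the vertex up to its stabilizer *)
Let ex_reps : exists reps : set (set G), [/\ finite_set reps, forall D, reps D -> at_v D &
  forall D, at_v D -> exists2 h, H h & reps (tr h^-1 D)].
Proof.
pose C (p : 'I_n * bool) := if p.2 then c p.1 else ~` c p.1.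
pose Q (p : 'I_n * bool) D := at_v D /\ exists g, D = tr g (C p).
have exr (p : 'I_n * bool) : exists D, (exists D', Q p D') -> Q p D.
  by have [[D QD]|nQ] := pselect (exists D', Q p D'); [exists D|exists setT => /nQ].
have [r rP] := choice exr.
exists [set D | exists2 p, [set p | exists D', Q p D'] p & D = r p]; split.
- apply: (@sub_finite_set _ _ (r @` setT)); last exact/finite_image/finite_finset.
  by move=> D [p _ ->]; exists p.
- by move=> D [p /rP[vD _] ->].
- move=> D vD; have [[i ilt [g DE]] _] := vD.
  have [p [DEp]] : exists p, D = tr g (C p).
    by case: DE => DE; [exists (Ordinal ilt, true)|exists (Ordinal ilt, false)].
  have Qp : exists D', Q p D' by exists D; split=> //; exists g.
  have [[Er tr_] [g' rE]] := rP p Qp; have [_ tD] := vD.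
  have DrE : D = tr (g * g'^-1) (r p) by rewrite rE DEp trM trK.
  exists (g * g'^-1); last by exists p => //; rewrite DrE trK.
  by rewrite /H /vstab /= -{1}tr_ -(tau_tr nsE) -DrE tD.
Qed.

Lemma vstab_coarse_retraction : exists rho, coarse_retraction H rho.
Proof.
have [reps [frep rv repsP]] := ex_reps.
have exk D : exists h, at_v D -> H h /\ reps (tr h^-1 D).
  have [/repsP[h Hh rh]|nv] := pselect (at_v D); first by exists h.
  by exists 1 => /nv.
have [kap kapP] := choice exk.
have [g0 g0P] : exists g0, (exists g, ~ exists D, misses g D) -> ~ exists D, misses g0 D.
  have [[g gP]|ng] := pselect (exists g, ~ exists D, misses g D); first by exists g.
  by exists 1 => /ng.
pose rho g := if pselect (exists D, misses g D) is left e then kap (projT1 (cid e))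
  else g * g0^-1.
have rhoE g D : misses g D -> rho g = kap D.
  move=> mD; rewrite /rho; case: pselect => [e|[]]; last by exists D.
  by case: cid => D' mD' /=; rewrite (misses_uniq mD mD').
have rhoN g : ~ (exists D, misses g D) -> rho g = g * g0^-1 by rewrite /rho; case: pselect.
have full g D : ~ (exists D, misses g D) -> tau E C0 D -> D g.
  move=> ng tD; apply: contrapT => nDg; apply: ng.
  have [M [tM MD tME]] := tau_exmin nsE EC0 tD; exists M; split; last by move=> /MD.
  by split=> //; exact: tauE tM.
have fullP g D : ~ (exists D, misses g D) -> E D -> D g -> tau E C0 D.
  move=> ng ED Dg; apply: contrapT => /(tau_nor nsE EC0 ED) /(full g _ ng); exact.
have rhoH g : H (rho g).
  have [[D mD]|ng] := pselect (exists D, misses g D).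
    by rewrite (rhoE g D mD); have [vD _] := mD; have [] := kapP D vD.
  have ng0 := g0P (ex_intro _ g ng); rewrite rhoN //; apply/seteqP; split=> D.
    rewrite /trv /= => tD; have ED := tauE tD.
    have ED' : E D by rewrite -[D](trVK (g * g0^-1)); exact: (ns_tr nsE).
    apply: (fullP g D ng ED'); have := full g0 _ ng0 tD.
    by rewrite mem_tr !grpE.
  move=> tD; rewrite /trv /=; apply: (fullP g0 _ ng0).
    by apply: (ns_tr nsE); exact: tauE tD.
  by rewrite mem_tr !grpE; exact: full g D ng tD.
exists rho; split=> //.
- move=> s.
  pose W := [set x | exists2 D, reps D & D x /\ ~ D (x * s) \/ ~ D x /\ D (x * s)]
    `|` [set g0; g0 * s^-1].
  have fW : finite_set W.
    rewrite finite_setU; split; last by rewrite finite_setU; split; exact: finite_set1.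
    apply: finite_bigU => // D /rv[ED _]; have cD := ns_cut nsE ED.
    apply: (@sub_finite_set _ _ ([set x | D x /\ ~ D (x * s)] `|`
      [set x | (~` D) x /\ ~ (~` D) (x * s)])).
      by move=> x [?|[? ?]]; [left|right; split=> //; exact].
    by rewrite finite_setU; split; [exact: cD|exact: (cutC cD)].
  exists W => // g neq.
  have inW D x : at_v D -> D x <> D (x * s) -> W ((kap D)^-1 * x).
    move=> vD neqx; left; have [_ rD] := kapP D vD; exists (tr (kap D)^-1 D) => //.
    rewrite !mem_tr !grpE; have [Dx|nDx] := pselect (D x); [left|right]; split=> //.
      by move=> Dxs; apply: neqx; exact/propext.
    by apply: contrapT => nDxs; apply: neqx; exact/propext.
  have [[D mD]|ng] := pselect (exists D, misses g D);
  have [[D' mD']|ngs] := pselect (exists D, misses (g * s) D).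
  + have [vD nD] := mD; have [vD' nD'] := mD'.
    have DD' : D <> D' by move=> e; apply: neq; rewrite (rhoE g D mD) (rhoE _ D' mD') e.
    rewrite (rhoE g D mD) (rhoE _ D' mD'); have [//|sub] := at_v_nested vD vD'.
    split; apply: inW => // e.
      by have [/esym//|sub'] := at_v_nested vD' vD; apply: nD; rewrite e; exact: sub'.
    by apply: nD'; rewrite -e; exact: sub.
  + have [vD nD] := mD; rewrite (rhoE g D mD) (rhoN _ ngs); split.
      apply: inW => // e; apply: nD; rewrite e; apply: (full _ _ ngs).
      by case: vD => ED <-; exact: tau_self.
    by right; right; rewrite !grpE.
  + have [vD' nD'] := mD'; rewrite (rhoE _ D' mD') (rhoN _ ng); split.
      by right; left; rewrite !grpE.
    apply: inW => // e; apply: nD'; rewrite -e; apply: (full _ _ ng).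
    by case: vD' => ED <-; exact: tau_self.
  + by rewrite (rhoN _ ng) (rhoN _ ngs); split; right; [left|right]; rewrite !grpE.
- have [[D mD]|n1] := pselect (exists D, misses 1 D); last first.
    exists [set g0]; first exact: finite_set1.
    move=> h Hh; rewrite rhoN ?grpE // => -[D [vD nD]]; apply: n1.
    exists (tr h^-1 D); split; first exact/at_v_tr/vD/HV.
    by rewrite mem_tr !grpE.
  have [vD nD] := mD.
  exists [set x | exists2 F, reps F & exists2 F', reps F' & exists2 f, tr f F = F' &
    x = f * (kap D)^-1].
    apply: finite_bigU => // F /rv[EF _]; apply: finite_bigU => // F' _.
    apply: sub_finite_set (finite_image (fun f => f * (kap D)^-1) (ns_stab_finite nsE F' EF)).
    by move=> _ [f fF ->]; exists f.
  move=> h Hh; have mh : misses h (tr h D).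
    by split; [exact: at_v_tr|rewrite mem_tr mulVg].
  rewrite (rhoE h _ mh); have [vhD _] := mh.
  exists (tr (kap D)^-1 D); first by have [] := kapP D vD.
  exists (tr (kap (tr h D))^-1 (tr h D)); first by have [] := kapP _ vhD.
  exists ((kap (tr h D))^-1 * h * kap D); last by rewrite !grpE.
  by rewrite -!trM !grpE.
Qed.

End Vertex.

Lemma vst_coarse_retraction (c : nat -> set G) n H : nested_system (orb c `I_n) ->
  vst (orb c `I_n) H -> exists rho, coarse_retraction H rho.
Proof.
move=> nsE [[_ ->]|[C EC ->]]; last exact: vstab_coarse_retraction.
exists id; split=> // [s|].
  exists [set 1; s^-1]; first by rewrite finite_setU; split; exact: finite_set1.
  by move=> g _; split; rewrite ?grpE; [left|right].
by exists [set 1]; [exact: finite_set1|move=> h _; rewrite grpE].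
Qed.

Section Consequences.
Variables (S : seq G).
Hypothesis Sgen : forall P : G -> Prop,
  P 1 -> (forall g s, s \in S -> P g -> P (g * s)) -> forall g, P g.
Variables (H : set G) (rho : G -> G).
Hypothesis H1 : H 1.
Hypothesis HV : forall g, H g -> H g^-1.
Hypothesis HM : forall g h, H g -> H h -> H (g * h).
Hypothesis cr : coarse_retraction H rho.

Let cr_quot s : exists2 W, finite_set W & forall g, W ((rho g)^-1 * rho (g * s)).
Proof.
have [W fW WP] := cr_step cr s.
exists ([set 1] `|` [set x | exists2 y, W y & exists2 z, W z & x = y * z^-1]).
  rewrite finite_setU; split; first exact: finite_set1.
  apply: finite_bigU => // y _; apply: sub_finite_set (finite_image (fun z => y * z^-1) fW).
  by move=> _ [z Wz ->]; exists z.
move=> g; have [->|/WP[W1 W2]] := pselect (rho g = rho (g * s)).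
  by left; rewrite /= mulVg.
right; exists ((rho g)^-1 * g) => //; exists ((rho (g * s))^-1 * g) => //.
by rewrite !grpE.
Qed.

(** A path from [1] to [h] in the Cayley graph of [G] is mapped by [rho] to a chain of
    points of [H] with steps in a finite set. *)
Theorem retract_generated : exists SH : seq G, [/\ forall s, s \in SH -> H s,
  forall s, s \in SH -> s^-1 \in SH &
  forall P : G -> Prop, P 1 -> (forall g s, H g -> s \in SH -> P g -> P (g * s)) ->
    forall h, H h -> P h].
Proof.
have [W fW WP] : exists2 W, finite_set W & forall g s, s \in S -> W ((rho g)^-1 * rho (g * s)).
  have [F FP] := choice (fun s => let: ex_intro2 W fW WP := cr_quot s in
    ex_intro (fun W => finite_set W /\ forall g, W ((rho g)^-1 * rho (g * s))) W (conj fW WP)).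
  exists [set x | exists2 s, [set s | s \in S] s & F s x].
    by apply: finite_bigU => [|s _]; [exact: finite_seq|have [] := FP s].
  by move=> g s sS; exists s => //; have [_] := FP s.
have [W' fW' W'P] := cr_id cr.
pose U := H `&` ([set rho 1] `|` W `|` W').
have fU : finite_set U.
  apply: (@sub_finite_set _ _ ([set rho 1] `|` W `|` W')); first by move=> x [].
  by rewrite !finite_setU; split=> //; split=> //; exact: finite_set1.
have /finite_seqP[u uE] : finite_set (U `|` [set g^-1 | g in U]).
  by rewrite finite_setU; split=> //; exact: finite_image.
have inu x : (x \in u) <-> (U `|` [set g^-1 | g in U]) x by rewrite uE.
exists u; split.
- by move=> s /inu[[]//|[g [Hg _] <-]]; exact: HV.
- move=> s /inu us; apply/inu; case: us => [Us|[g Ug <-]].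
    by right; exists s.
  by left; rewrite invgK.
move=> P P1 PM h Hh.
have PU g s : H g -> P g -> U s -> P (g * s) by move=> Hg Pg Us; apply: PM => //; apply/inu; left.
have Prho g : P (rho g).
  apply: (Sgen (P := fun g => P (rho g))) => [|{}g s sS Pg].
    rewrite -[rho 1]mul1g; apply: PU => //; split; first exact: (cr_in cr).
    by left; left.
  rewrite -(mulKg (rho g)^-1 (rho (g * s))) invgK; apply: PU => //; first exact: (cr_in cr).
  split; last by left; right; exact: WP.
  by apply: HM; [apply: HV|]; exact: (cr_in cr).
rewrite -(mulKg (rho h)^-1 h) invgK; apply: PU => //; first exact: (cr_in cr).
split; last by right; exact: W'P.
by apply: HM => //; apply: HV; exact: (cr_in cr).
Qed.

(** The preimage of the set under [rho] is a cut: a generator moves the value of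
    [rho] only near [H], and there by a bounded amount. *)
Theorem retract_splits A : (forall x, H x -> finite_set [set h | [/\ H h, A h & ~ A (h * x)]]) ->
  infinite_set (H `&` A) -> infinite_set (H `&` ~` A) -> exists B, splits H B.
Proof.
move=> cA i1 i2; exists [set g | A (rho g)].
have cA' x : H x -> finite_set [set h | [/\ H h, ~ A h & A (h * x)]].
  move=> Hx; apply: sub_finite_set (finite_image (fun k => k * x^-1) (cA x^-1 (HV Hx))).
  move=> h [Hh nA Ax]; exists (h * x); last by rewrite !grpE.
  by split=> //; [exact: HM|rewrite !grpE].
have [W fW WP] := cr_id cr.
have near (B : set G) : (forall x, H x -> finite_set [set h | [/\ H h, B h & ~ B (h * x)]]) ->
    infinite_set (H `&` B) -> infinite_set (H `&` [set g | B (rho g)]).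
  move=> cB iB fB; apply: iB; apply: (@sub_finite_set _ _ ((H `&` [set g | B (rho g)]) `|`
    [set h | exists2 w, (W `&` H) w & [/\ H h, B h & ~ B (h * w^-1)]])).
    move=> h [Hh Bh]; have [Br|nBr] := pselect (B (rho h)); first by left.
    right; exists ((rho h)^-1 * h).
      by split; [exact: WP|apply: HM => //; apply: HV; exact: (cr_in cr)].
    by split=> //; rewrite !grpE.
  rewrite finite_setU; split=> //; apply: finite_bigU => [|w [_ Hw]].
    by apply: sub_finite_set fW => x [].
  by apply: cB; exact: HV.
split; last by apply: (near (~` A)) => // x Hx; apply: sub_finite_set (cA' x Hx) => h [? ? /contrapT].
  move=> s; have [Ws fWs WsP] := cr_step cr s; have [Wq fWq WqP] := cr_quot s.
  apply: (@sub_finite_set _ _ [set g | exists2 x, (Wq `&` H) x & exists2 w, Ws w &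
    exists2 h, [/\ H h, A h & ~ A (h * x)] & g = h * w]).
    move=> g [Ag nAg]; exists ((rho g)^-1 * rho (g * s)).
      by split; [exact: WqP|apply: HM; [apply: HV|]; exact: (cr_in cr)].
    have neq : rho g <> rho (g * s) by move=> e; apply: nAg; rewrite /= -e.
    have [W1 _] := WsP g neq; exists ((rho g)^-1 * g) => //.
    exists (rho g); last by rewrite !grpE.
    by split=> //; [exact: (cr_in cr)|rewrite !grpE].
  apply: finite_bigU => [|x [_ Hx]]; first by apply: sub_finite_set fWq => x [].
  apply: finite_bigU => // w _; apply: sub_finite_set (finite_image (fun h => h * w) (cA x Hx)).
  by move=> _ [h hP ->]; exists h.
exact: near.
Qed.

(** The positive powers of [a], multiplied by finitely many representatives, form
    an almost invariant half of [H]. *)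
Theorem virtually_Z_splits a (X : set G) : H a ->
  injective (fun k => a ^+ k) -> finite_set X ->
  (forall h, H h -> exists2 x, X x & exists k m, h = a ^- k * a ^+ m * x) ->
  exists B, splits H B.
Proof.
move=> Ha ainj fX HX.
have HaX k : H (a ^+ k) by elim: k => // k IH; rewrite expgS; exact: HM.
pose A : set G := [set h | exists2 x, X x & exists k, h = a ^+ k * x].
apply: (@retract_splits A).
- move=> y Hy.
  have exl x : exists l, H x -> exists2 x', X x' & exists m, x * y = a ^- l * a ^+ m * x'.
    have [Hx|nHx] := pselect (H x); last by exists 0%N.
    have [x' Xx' [k [m e]]] := HX _ (HM Hx Hy); exists k => _; exists x' => //; by exists m.
  have [l lP] := choice exl.
  apply: (@sub_finite_set _ _ [set h | exists2 x, X x & exists2 k, `I_(l x) k & h = a ^+ k * x]).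
    move=> h [Hh [x Xx [k hE]] nA]; exists x => //; exists k => //=.
    rewrite ltnNge; apply/negP => lk; apply: nA.
    have Hx : H x.
      by rewrite -(mulKg (a ^+ k) x) -hE; apply: HM => //; exact: HV.
    have [x' Xx' [m e]] := lP x Hx; exists x' => //; exists (k - l x + m)%N.
    rewrite hE -mulgA e -{1}(subnK lk) expgnDr !mulgA mulgK expgnDr.
    by [].
  apply: finite_bigU => // x _; apply: sub_finite_set
    (finite_image (fun k => a ^+ k * x) (finite_II (l x))) => _ [k kl ->].
  by exists k.
- move=> fA; apply: infinite_nat; have [x Xx [k [m e]]] := HX 1 H1.
  apply: (@sub_finite_set _ _ ((fun i => a ^+ (i + k)) @^-1` (H `&` A))).
    move=> i _; split; first exact: HaX.
    exists x => //; exists (i + m)%N.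
    by rewrite !expgnDr -[a ^+ k]mulg1 e !grpE.
  apply: finite_preimage fA => i j _ _ /ainj /addIn; exact.
- have fZ : finite_set [set i | A (a ^- i)].
    apply: (@sub_finite_set _ _ [set i | exists2 x, X x & exists k, a ^- i = a ^+ k * x]).
      by move=> i [x Xx [k e]]; exists x => //; exists k.
    apply: finite_bigU => // x _.
    have [[i0 [k0 e0]]|ne] := pselect (exists i k, a ^- i = a ^+ k * x); last first.
      by apply: (@sub_finite_set _ _ set0) => // i [k e]; apply: ne; exists i, k.
    apply: (@sub_finite_set _ _ `I_(k0 + i0).+1); last exact: finite_II.
    move=> i [k e]; have kiE j l : a ^- j = a ^+ l * x -> a ^+ (j + l) = x^-1.
      by move=> ee; rewrite expgnDr -[a ^+ j * _](mulgK x) -[_ * _ * x]mulgA -ee !grpE.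
    have /ainj : a ^+ (i + k) = a ^+ (i0 + k0) by rewrite !kiE.
    by rewrite /= ltnS => kk; rewrite [(k0 + i0)%N]addnC -kk leq_addr.
  move=> fA; apply: infinite_nat.
  apply: (@sub_finite_set _ _ ([set i | A (a ^- i)] `|` (fun i => a ^- i) @^-1` (H `&` ~` A))).
    move=> i _; have [Ai|nAi] := pselect (A (a ^- i)); [by left|right; split=> //].
    exact/HV/HaX.
  rewrite finite_setU; split=> //; apply: finite_preimage fA => i j _ _.
  by move=> /(congr1 (fun g => g^-1)); rewrite !invgK => /ainj.
Qed.

End Consequences.

End Retraction.

(** * Subquadratic growth *)

Section Languages.
Local Open Scope classical_set_scope.
Local Open Scope nat_scope.
Variables (d : nat) (L : set (seq 'I_d)).
Hypothesis L_factor : forall u v w, L (u ++ v ++ w) -> L v.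
Hypothesis L_inf : infinite_set L.

Let Lx w := forall N, exists2 v, (N <= size v) & L (w ++ v).

Let Lx_nil : Lx [::].
Proof.
move=> N; apply: contrapT => nL; apply: L_inf.
apply: (@sub_finite_set _ _ [set w | exists2 n, `I_N n & ((fun t : n.-tuple 'I_d => tval t) @` setT) w]).
  move=> w Lw; exists (size w); last by exists (in_tuple w).
  by rewrite /= ltnNge; apply/negP => Nw; apply: nL; exists w.
apply: finite_bigU => [|n _]; first exact: finite_II.
exact/finite_image/finite_finset.
Qed.

Let Lx_ext w : Lx w -> exists x, Lx (rcons w x).
Proof.
move=> Lw; apply: contrapT => nx.
have H x : exists N, forall v, L (rcons w x ++ v) -> size v < N.
  apply: contrapT => nN; apply: nx; exists x => N; apply: contrapT => nv; apply: nN.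
  by exists N => v Lv; rewrite ltnNge; apply/negP => Nv; apply: nv; exists v.
have [N NP] := choice H.
have [[|x v] //= Nv Lv] := Lw (\max_x N x).+1.
have := NP x v; rewrite cat_rcons => /(_ Lv); rewrite ltnNge => /negP; apply.
exact: leq_trans (leq_bigmax x) Nv.
Qed.

Let Lx_factor u v w : Lx (u ++ v ++ w) -> Lx v.
Proof.
move=> H N; have [v' Nv'] := H N; rewrite -!catA => Lv'.
exists (w ++ v'); first by rewrite size_cat (leq_trans Nv') ?leq_addl.
by apply: (@L_factor u _ [::]); rewrite cats0.
Qed.

Let Lx_sub w : Lx w -> L w.
Proof. by move=> /(_ 0)[v _]; rewrite -[w ++ v]cat0s => /L_factor. Qed.

Let W m : {set m.-tuple 'I_d} := finset (fun t : m.-tuple 'I_d => `[< Lx t >]).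

Let inW m (t : m.-tuple 'I_d) : (t \in W m) = `[< Lx t >].
Proof. by rewrite inE. Qed.

(** If the language has no more words of length [m.+1] than of length [m], then a
    word of length [m] determines the next letter, and infinite words are
    eventually periodic (Morse and Hedlund). *)
Theorem power_or_linear_growth :
  (exists u, 0 < size u /\ forall k, L (flatten (nseq k u))) \/
  forall m, exists f : nat -> seq 'I_d,
    (forall i j, i <= m -> j <= m -> f i = f j -> i = j) /\
    forall i, i <= m -> size (f i) = m /\ L (f i).
Proof.
have [[m bm]|grow] := pselect (exists m, #|W m.+1| <= #|W m|); [left|right]; last first.
  have card m : m < #|W m|.
    elim: m => [|m IH].
      by rewrite card_gt0; apply/set0Pn; exists [tuple]; rewrite inE; exact/asboolP/Lx_nil.
    by apply: leq_trans (_ : #|W m| < _); rewrite // ltnNge; apply/negP => le; apply: grow; exists m.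
  move=> m; exists (fun i => val (enum_val (widen_ord (card m) (inord i)))); split.
    move=> i j im jm /val_inj /enum_val_inj /(congr1 val) /=.
    by rewrite !inordK.
  move=> i im; split; first by rewrite size_tuple.
  by have := enum_valP (widen_ord (card m) (inord i)); rewrite inW => /asboolP /Lx_sub.
have exe w : exists x, Lx w -> Lx (rcons w x).
  have [/Lx_ext[x Lwx]|nLw] := pselect (Lx w); first by exists x.
  by have [x0 _] := Lx_ext Lx_nil; exists x0.
have [e eP] := choice exe.
pose ext (t : m.-tuple 'I_d) := [tuple of rcons t (e t)].
have ext_inj : injective ext.
  by move=> t t' /(congr1 val) /= /rcons_inj[/val_inj].
have WE : imset ext (mem (W m)) = W m.+1.
  apply/eqP; rewrite eqEcard card_imset // bm andbT.
  apply/fintype.subsetP => _ /imsetP[t tW ->]; have /asboolP Lt : `[< Lx t >] by rewrite -inW.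
  by rewrite inW; apply/asboolP => /=; exact: eP.
have det w x : size w = m -> Lx (rcons w x) -> x = e w.
  move=> /eqP sw Lwx; pose t := Tuple sw.
  have : [tuple of rcons t x] \in W m.+1 by rewrite inW; apply/asboolP.
  rewrite -WE => /imsetP[t' _ /(congr1 val) /= /rcons_inj[wt' ->]].
  by rewrite wt'.
pose pre := fix pre k := if k is k'.+1 then rcons (pre k') (e (pre k')) else [::].
pose x k := e (pre k).
have preE k : pre k = map x (iota 0 k).
  by elim: k => // k IH; rewrite -[in RHS]addn1 iotaD map_cat cats1 add0n -IH.
have Lpre k : Lx (pre k) by elim: k => [|k IH] /=; [exact: Lx_nil|exact: eP].
have Lwin i k : Lx (map x (iota i k)).
  apply: (@Lx_factor (map x (iota 0 i)) _ [::]); rewrite cats0 -map_cat.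
  by rewrite -[i in iota i k]add0n -iotaD -preE.
have xE i : x (i + m) = e (map x (iota i m)).
  apply: det; first by rewrite size_map size_iota.
  by rewrite -map_rcons -cats1 -[[:: _]]/(iota (i + m) 1) -iotaD.
pose win i : m.-tuple 'I_d := [tuple of map x (iota_tuple m i)].
have [i [j [_ _ ij wij]]] := infinite_pigeonhole win infinite_nat.
have winE k : map x (iota (i + k) m) = map x (iota (j + k) m).
  elim: k => [|k IH]; first by rewrite !addn0; exact: (congr1 val wij).
  have step l : map x (iota l.+1 m) = behead (map x (iota l m.+1)) by [].
  have cat l : map x (iota l m.+1) = rcons (map x (iota l m)) (x (l + m)).
    by rewrite -addn1 iotaD map_cat cats1.
  by rewrite !addnS !step !cat !xE IH.
have xper k : x (i + m + k) = x (j + m + k).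
  by rewrite -!addnA [m + k]addnC !addnA !xE winE.
exists (map x (iota (i + m) (j - i))); split; first by rewrite size_map size_iota subn_gt0.
move=> k; apply: Lx_sub.
suff -> : flatten (nseq k (map x (iota (i + m) (j - i)))) = map x (iota (i + m) (k * (j - i))).
  exact: Lwin.
elim: k => //= k ->; rewrite mulSn iotaD map_cat; congr (_ ++ _).
have shift p l : map x (iota p l) = map (fun r => x (p + r)) (iota 0 l).
  by rewrite -[in LHS](addn0 p) iotaDl -map_comp.
rewrite shift [RHS]shift; apply: eq_map => l.
by rewrite xper; congr x; move: ij; clear; lia.
Qed.
End Languages.

Section Growth.
Local Open Scope classical_set_scope.
Local Open Scope group_scope.
Variables (R : realType) (G : groupType) (H : set G) (SH : seq G) (p : G -> R).
Hypothesis H1 : H 1.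
Hypothesis HV : forall g, H g -> H g^-1.
Hypothesis HM : forall g h, H g -> H h -> H (g * h).
Hypothesis SH_H : forall s, s \in SH -> H s.
Hypothesis SH_gen : forall P : G -> Prop, P 1 ->
  (forall g s, H g -> s \in SH -> P g -> P (g * s)) -> forall h, H h -> P h.
Hypothesis H_inf : infinite_set H.
Hypothesis p1 : p 1 = 0%R.
Hypothesis p_ge0 : forall g, (0 <= p g)%R.
Hypothesis pM : forall g h, H g -> H h -> (p (g * h) <= p g + p h)%R.

(** Subquadratic growth of the balls of [p], in a form that counts without
    cardinals. *)
Hypothesis p_growth : forall C : R, ~ forall n : nat,
  exists f : 'I_n * 'I_n -> G, injective f /\
    forall x, H (f x) /\ (p (f x) <= C * n%:R)%R.

Let C : R := (\sum_(s <- SH) p s)%R.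

Let C_ge0 : (0 <= C)%R. Proof. exact: sumr_ge0. Qed.

Let pC s : s \in SH -> (p s <= C)%R.
Proof. by move=> sS; rewrite /C (big_rem s sS) /= lerDl; exact: sumr_ge0. Qed.

Let d := size SH.
Let word (w : seq 'I_d) : G := foldr (fun (i : 'I_d) g => nth 1 SH i * g) 1 w.

Let word_cat u v : word (u ++ v) = word u * word v.
Proof. by elim: u => [|i u IH] /=; rewrite ?mul1g // IH mulgA. Qed.

Let wordH w : H (word w).
Proof. by elim: w => //= i w IH; apply: HM => //; apply: SH_H; exact: mem_nth. Qed.

Let word_onto h : H h -> exists w, word w = h.
Proof.
move=> Hh; apply: (SH_gen (P := fun h => exists w, word w = h)) Hh => [|g s Hg sS [w <-]].
  by exists [::].
have idx : (index s SH < d)%N by rewrite index_mem.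
by exists (rcons w (Ordinal idx)); rewrite -cats1 word_cat /= mulg1 nth_index.
Qed.

Let word_p w : (p (word w) <= C * (size w)%:R)%R.
Proof.
elim: w => [|i w IH]; first by rewrite /= p1 mulr0.
apply: (@le_trans _ _ (C + C * (size w)%:R)%R).
  apply: le_trans (pM (SH_H (mem_nth 1 (ltn_ord i))) (wordH w)) _.
  by apply: lerD => //; apply: pC; exact: mem_nth.
by rewrite /= -natr1; lra.
Qed.

(* the position of a word in the shortlex order *)
Let code (w : seq 'I_d) : nat := foldl (fun a (i : 'I_d) => a * d.+1 + i.+1)%N 0%N w.

Let code_rcons w i : code (rcons w i) = (code w * d.+1 + i.+1)%N.
Proof. by rewrite /code -cats1 foldl_cat. Qed.

Let code_cat u v : code (u ++ v) = (code u * d.+1 ^ size v + code v)%N.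
Proof.
elim/last_ind: v => [|v i IH]; first by rewrite cats0 muln1 addn0.
by rewrite -rcons_cat !code_rcons IH size_rcons expnS; ring.
Qed.

Let code_inj : injective code.
Proof.
elim/last_ind => [|u i IH] v; elim/last_ind: v => [|v j _] //; rewrite ?code_rcons //;
  try by rewrite addnS.
move=> e; have := congr1 (fun n => n %% d.+1)%N e.
rewrite !modnMDl !modn_small ?ltnS // => -[/val_inj ij].
by move: e; rewrite ij => /addIn /eqP; rewrite eqn_pmul2r // => /eqP /IH ->.
Qed.

Let code_size u v : (size u < size v)%N -> (code u < code v)%N.
Proof.
have lt w : (code w < d.+1 ^ size w)%N.
  elim/last_ind: w => [//|w i IH]; rewrite code_rcons size_rcons expnS.
  have := ltn_ord i; move: IH; move: (code w) (d.+1 ^ size w)%N => a b; nia.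
have ge w : w <> [::] -> (d.+1 ^ size w <= d.+1 * code w)%N.
  elim/last_ind: w => [//|w i IH] _; rewrite code_rcons size_rcons expnS leq_mul2l /=.
  have [->|/eqP/IH] := eqVneq w [::]; first by rewrite expn0; lia.
  by move: (code w) (d.+1 ^ size w)%N => a b; nia.
case: v ge => [|i v] ge; first by [].
move=> uv; have le : (d.+1 ^ size (i :: v) <= d.+1 * code (i :: v))%N by exact: ge.
have := lt u; have : (d.+1 * d.+1 ^ size u <= d.+1 ^ size (i :: v))%N.
  by rewrite -expnS leq_pexp2l.
by move: le; move: (code u) (d.+1 ^ size u)%N (d.+1 ^ size (i :: v))%N => a b c; nia.
Qed.

(** The shortlex-least words of the elements of [H] form a language that is closed
    under taking factors; if it contains all powers of a word, they represent
    distinct elements. *)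
Theorem ex_infinite_order : exists2 a, H a & injective (fun k => a ^+ k).
Proof.
pose L := [set w | forall w', word w' = word w -> (code w <= code w')%N].
have L_inj u v : L u -> L v -> word u = word v -> u = v.
  by move=> Lu Lv uv; apply: code_inj; apply/eqP; rewrite eqn_leq Lu // Lv.
have L_factor u v w : L (u ++ v ++ w) -> L v.
  move=> Luvw v' vv'; have := Luvw (u ++ v' ++ w); rewrite !word_cat vv' => /(_ erefl).
  rewrite !code_cat !size_cat leqNgt => /negP H0; rewrite leqNgt; apply/negP => lt; apply: H0.
  have le : (size v' <= size v)%N.
    by rewrite leqNgt; apply/negP => /code_size /(ltn_trans lt); rewrite ltnn.
  have : (d.+1 ^ (size v' + size w) <= d.+1 ^ (size v + size w))%N.
    by rewrite leq_pexp2l // leq_add2r.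
  have : (0 < d.+1 ^ size w)%N by rewrite expn_gt0.
  move: (d.+1 ^ (size v' + size w))%N (d.+1 ^ (size v + size w))%N (d.+1 ^ size w)%N => a b e.
  by move: (code u) (code v) (code v') (code w) lt => x y y' z; clear; nia.
have L_onto h : H h -> exists2 w, L w & word w = h.
  move=> Hh; have [w [wh mw]] := ex_measure_min code (word_onto Hh).
  by exists w => // w' w'E; apply: mw; rewrite w'E.
have L_inf : infinite_set L.
  move=> fL; apply: H_inf; apply: sub_finite_set (finite_image word fL) => h /L_onto[w Lw <-].
  by exists w.
have [[u [u0 Lu]]|lin] := power_or_linear_growth L_factor L_inf; last first.
  case: (@p_growth (2 * C)%R) => n.
  have [f fP] := choice lin.
  have le (x : 'I_n * 'I_n) : (x.2 <= n + x.1)%N by apply: leq_trans (ltnW (ltn_ord _)) (leq_addr _ _).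
  have fL x := (fP _).2 _ (le x).
  exists (fun x : 'I_n * 'I_n => word (f (n + x.1)%N x.2)); split.
    move=> x x' /(L_inj _ _ (fL x).2 (fL x').2) e.
    have ii' : x.1 = x'.1.
      by apply/val_inj/(@addnI n); have := congr1 size e; rewrite (fL x).1 (fL x').1.
    move: (le x) (le x') e; case: x x' ii' => [i j] [i' j'] /= -> lj lj'.
    by move=> /(fP _).1 => /(_ lj lj') /val_inj ->.
  move=> x; split; first exact: wordH.
  apply: le_trans (word_p _) _; rewrite (fL x).1.
  have : ((n + x.1)%:R <= 2 * n%:R :> R)%R.
    by rewrite -natrM ler_nat; have := ltn_ord x.1; clear; lia.
  have := C_ge0; move: ((n + x.1)%:R)%R => z c0 zn.
  by rewrite mulrAC [(_ * C)%R]mulrC ler_wpM2l.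
exists (word u); first exact: wordH.
have powE k : word u ^+ k = word (flatten (nseq k u)).
  by elim: k => // k IH; rewrite expgS IH /= word_cat.
have sz k : size (flatten (nseq k u)) = (k * size u)%N.
  by elim: k => //= k IH; rewrite size_cat IH.
move=> k l /=; rewrite !powE => /(L_inj _ _ (Lu k) (Lu l)) /(congr1 size).
by rewrite !sz => /eqP; rewrite eqn_pmul2r // => /eqP.
Qed.

Section Cosets.
Variable a : G.
Hypothesis Ha : H a.
Hypothesis a_inj : injective (fun k => a ^+ k).

Let eqv x y := exists k m, x = a ^- k * a ^+ m * y.

Let eqv_refl x : eqv x x. Proof. by exists 0%N, 0%N; rewrite expg0 !grpE. Qed.

Let aC k m : a ^+ m * a ^- k = a ^- k * a ^+ m.
Proof.
have : commute (a ^+ m) (a ^+ k)^-1.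
  by apply: commuteV; apply: commuteX2; exact: commute_refl.
by [].
Qed.

Let eqv_trans x y z : eqv x y -> eqv y z -> eqv x z.
Proof.
move=> [k [m ->]] [k' [m' ->]]; exists (k' + k)%N, (m + m')%N.
rewrite !expgnDr invgM !mulgA; congr (_ * _ * _).
by rewrite -!mulgA -aC !mulgA.
Qed.

Let eqv_mulr x y g : eqv x y -> eqv (x * g) (y * g).
Proof. by move=> [k [m ->]]; exists k, m; rewrite !mulgA. Qed.

Let eqv_sym x y : eqv x y -> eqv y x.
Proof. by move=> [k [m ->]]; exists m, k; rewrite !mulgA mulgK mulVg mul1g. Qed.

Let ball := fix ball j : set G := if j is j'.+1 then
  ball j' `|` [set g | exists2 s, [set s | s \in SH] s & ((fun x => x * s) @` ball j') g]
  else [set 1].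

Let ballS j : ball j `<=` ball j.+1. Proof. by move=> g; left. Qed.

Let ball_mono i j : (i <= j)%N -> ball i `<=` ball j.
Proof.
elim: j => [|j IH]; first by rewrite leqn0 => /eqP->.
by rewrite leq_eqVlt => /orP[/eqP->//|/IH sub]; apply: subset_trans sub (@ballS j).
Qed.

Let ball_finite j : finite_set (ball j).
Proof.
elim: j => [|j IH]; first exact: finite_set1.
rewrite finite_setU; split=> //; apply: finite_bigU => [|s _]; first exact: finite_seq.
exact: finite_image.
Qed.

Let ballP j g : ball j g -> H g /\ (p g <= C * j%:R)%R.
Proof.
elim: j g => [g ->|j IH g [/IH[Hg pg]|[s sS [h /IH[Hh ph] <-]]]].
- by rewrite p1 mulr0.
- by split=> //; apply: le_trans pg _; rewrite ler_wpM2l // ler_nat.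
split; first by apply: HM => //; exact: SH_H.
apply: le_trans (pM Hh (SH_H sS)) _; rewrite -natr1 mulrDr mulr1.
by apply: lerD => //; exact: pC.
Qed.

(** If a ball in the word metric meets the same cosets of [<a>] as the next one, it
    meets all of them. Otherwise the ball of radius [n] meets at least [n] cosets, and
    multiplication by the first [n] powers of [a] gives quadratic growth. *)
Theorem virtually_Z : exists2 X : set G, finite_set X &
  forall h, H h -> exists2 x, X x & exists k m, h = a ^- k * a ^+ m * x.
Proof.
have [[j jP]|nj] := pselect (exists j, forall x, ball j.+1 x -> exists2 y, ball j y & eqv x y).
  exists (ball j) => // h; apply: (SH_gen (P := fun h => exists2 x, ball j x & eqv h x)).
    by exists 1; [exact: (@ball_mono 0%N)|exact: eqv_refl].
  move=> g s Hg sS [x bx /(@eqv_mulr _ _ s) gx].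
  have [|y byy xy] := jP (x * s); first by right; exists s => //; exists x.
  by exists y => //; exact: eqv_trans gx xy.
have ex j : exists x, ball j.+1 x /\ forall y, ball j y -> ~ eqv x y.
  apply: contrapT => nx; apply: nj; exists j => x bx; apply: contrapT => ny.
  by apply: nx; exists x; split=> // y byy xy; apply: ny; exists y.
have [x xP] := choice ex.
have x_inj i j : eqv (x i) (x j) -> i = j.
  have lt k l : (k < l)%N -> ~ eqv (x l) (x k).
    by move=> kl; apply: (xP l).2; exact: ball_mono kl _ (xP k).1.
  by move=> e; have [/lt|/lt|//] := ltngtP i j; case=> //; exact: eqv_sym.
have HaX k : H (a ^+ k) by elim: k => // k IH; rewrite expgS; exact: HM.
have paX k : (p (a ^+ k) <= p a * k%:R)%R.
  elim: k => [|k IH]; first by rewrite expg0 p1 mulr0.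
  rewrite expgSr -natr1 mulrDr mulr1; apply: le_trans (pM (HaX k) Ha) _.
  by rewrite lerD2r.
(* the products of the powers and the representatives are distinct and of linear size *)
case: (@p_growth (p a + C)%R) => n; exists (fun ij : 'I_n * 'I_n => a ^+ ij.1 * x ij.2); split.
  move=> [i j] [i' j'] /= e.
  have /x_inj /val_inj jj : eqv (x j) (x j').
    by exists i, i'; rewrite -mulgA -e mulKg.
  by move: e; rewrite jj => /mulIg /a_inj /val_inj ->.
move=> [i j] /=; have [bj _] := xP j; have [Hx px] := ballP bj.
split; first exact: HM.
apply: le_trans (pM (HaX i) Hx) _; rewrite mulrDl; apply: lerD.
  by apply: le_trans (paX i) _; rewrite ler_wpM2l // ler_nat ltnW.
by apply: le_trans px _; rewrite ler_wpM2l // ler_nat.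
Qed.

End Cosets.

End Growth.

(** * Hyperbolic geometry *)

Section HyperbolicFunctions.
Local Open Scope ring_scope.
Variable R : realType.
Implicit Types x y t : R.

Definition ch x : R := (expR x + expR (- x)) / 2.
Definition sh x : R := (expR x - expR (- x)) / 2.

Lemma ch_expR x : ch x = (expR x + expR (- x)) / 2. Proof. by []. Qed.
Lemma sh_expR x : sh x = (expR x - expR (- x)) / 2. Proof. by []. Qed.

Lemma ch_sh x : ch x ^+ 2 = 1 + sh x ^+ 2.
Proof.
have e0 := lt0r_neq0 (expR_gt0 x); rewrite /ch /sh expRN.
by field.
Qed.

Lemma chD x y : ch (x + y) = ch x * ch y + sh x * sh y.
Proof. by rewrite /ch /sh opprD !expRD; field. Qed.

Lemma shD x y : sh (x + y) = sh x * ch y + ch x * sh y.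
Proof. by rewrite /ch /sh opprD !expRD; field. Qed.

Lemma shN x : sh (- x) = - sh x. Proof. by rewrite /sh opprK; field. Qed.
Lemma chN x : ch (- x) = ch x. Proof. by rewrite /ch opprK addrC. Qed.
Lemma sh0 : sh 0 = 0. Proof. by rewrite /sh oppr0 subrr mul0r. Qed.
Lemma ch_add_sh x : ch x + sh x = expR x. Proof. by rewrite /ch /sh; field. Qed.
Lemma ch_sub_sh x : ch x - sh x = expR (- x). Proof. by rewrite /ch /sh; field. Qed.

Lemma sh_lt x y : x < y -> sh x < sh y.
Proof.
move=> xy; have : expR x < expR y by rewrite ltr_expR.
have : expR (- y) < expR (- x) by rewrite ltr_expR ltrN2.
by rewrite /sh; lra.
Qed.

Lemma sh_le x y : x <= y -> sh x <= sh y.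
Proof. by rewrite le_eqVlt => /orP[/eqP->//|/sh_lt/ltW]. Qed.

Lemma sh_ge0 x : 0 <= x -> 0 <= sh x.
Proof. by move=> x0; rewrite -[X in X <= _]sh0; exact: sh_le. Qed.

Lemma sh_gt0 x : 0 < x -> 0 < sh x.
Proof. by move=> x0; rewrite -[X in X < _]sh0; exact: sh_lt. Qed.

Lemma ch_gt0 x : 0 < ch x.
Proof. by rewrite divr_gt0 // addr_gt0 // expR_gt0. Qed.

Lemma ch_half x : ch x = 1 + 2 * sh (x / 2) ^+ 2.
Proof.
have {1}-> : x = x / 2 + x / 2 by field.
by rewrite chD; have := ch_sh (x / 2); move: (ch _) (sh _) => a b; lra.
Qed.

Lemma ch_ge1 x : 1 <= ch x.
Proof. by rewrite ch_half lerDl mulr_ge0 ?sqr_ge0. Qed.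

Lemma ch_mono x y : 0 <= x -> x <= y -> ch x <= ch y.
Proof.
move=> x0 xy; rewrite !ch_half lerD2l ler_wpM2l // lerXn2r ?nnegrE ?sh_ge0 ?divr_ge0 //.
  exact: le_trans xy.
by apply: sh_le; rewrite ler_pM2r.
Qed.

Lemma ch_le x y : 0 <= y -> ch x <= ch y -> x <= y.
Proof.
move=> y0 cxy; rewrite leNgt; apply/negP => yx.
have lt : sh (y / 2) < sh (x / 2) by apply: sh_lt; rewrite ltr_pM2r.
have s0 : 0 <= sh (y / 2) by apply: sh_ge0; rewrite divr_ge0.
by move: cxy; rewrite !ch_half; move: (sh _) (sh _) lt s0 => a b; nra.
Qed.

Lemma ch_inj x y : 0 <= x -> 0 <= y -> ch x = ch y -> x = y.
Proof. by move=> x0 y0 e; apply/eqP; rewrite eq_le; apply/andP; split; apply: ch_le => //; rewrite e. Qed.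

Lemma arcosh_ge0 (u : R) : 1 <= u -> 0 <= arcosh u.
Proof.
move=> u1; rewrite /arcosh ln_ge0 //; apply: le_trans u1 _.
by rewrite lerDl sqrtr_ge0.
Qed.

Lemma ch_arcosh (u : R) : 1 <= u -> ch (arcosh u) = u.
Proof.
move=> u1; set v := Num.sqrt (u ^+ 2 - 1).
have vE : v ^+ 2 = u ^+ 2 - 1 by rewrite sqr_sqrtr // subr_ge0 expr_ge1 // (le_trans ler01).
have v0 : 0 <= v by exact: sqrtr_ge0.
have uv : 0 < u + v by rewrite ltr_wpDr // (lt_le_trans ltr01).
rewrite /ch /arcosh -/v expRN lnK ?posrE //.
have -> : (u + v)^-1 = u - v.
  by apply: (mulfI (lt0r_neq0 uv)); rewrite divff ?lt0r_neq0 //; move: vE; clear; lra.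
by field.
Qed.

Lemma arcosh_ch t : 0 <= t -> arcosh (ch t) = t.
Proof.
by move=> t0; apply: ch_inj; rewrite ?arcosh_ge0 ?ch_arcosh ?ch_ge1.
Qed.

End HyperbolicFunctions.

Opaque ch sh.

Section Ptolemy.
Local Open Scope ring_scope.
Variable R : realType.

(** A half-plane point is recorded by its height [p], the distance [r] to the
    vertical axis and its squared norm [q]. *)
Lemma triangle_coordinates (a b l : R) : 0 <= a -> 0 <= b -> 0 < l ->
  a <= b + l -> b <= a + l -> l <= a + b -> exists r p : R,
  [/\ 0 <= r, 0 < p, (r ^+ 2 + p ^+ 2 + 1) = 2 * p * ch a &
    r ^+ 2 + p ^+ 2 + expR l ^+ 2 = 2 * p * expR l * ch b].
Proof.
move=> a0 b0 l0 abl bal lab.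
have sl := sh_gt0 l0.
have eE := ch_sub_sh l; set e := expR (- l) in eE.
have e0 : 0 < e by exact: expR_gt0.
have chb : ch b <= ch a * ch l + sh a * sh l by rewrite -chD; exact: ch_mono.
have cha : ch a * ch l - sh a * sh l <= ch b.
  have -> : ch a * ch l - sh a * sh l = ch (a - l) by rewrite chD chN shN mulrN.
  have [al|al] := leP l a; first by apply: ch_mono; lra.
  by rewrite -chN; apply: ch_mono; lra.
have aE := ch_sub_sh a; have ea : 0 < expR (- a) by exact: expR_gt0.
have aE' := ch_add_sh a; have ea' : 0 < expR a by exact: expR_gt0.
have aa : expR a * expR (- a) = 1 by rewrite -expRD subrr expR0.
pose D := ch b - e * ch a.
have D1 : D <= expR a * sh l by rewrite /D -eE -aE'; move: chb; nra.
have D2 : expR (- a) * sh l <= D by rewrite /D -eE -aE; move: cha; nra.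
have D0 : 0 < D by apply: lt_le_trans D2; exact: mulr_gt0.
pose p := sh l / D; have p0 : 0 < p by exact: divr_gt0.
have pD : p * D = sh l by rewrite /p divfK // gt_eqF.
have p1 : expR (- a) <= p by rewrite /p ler_pdivlMr //; nra.
have p2 : p <= expR a.
  by rewrite /p ler_pdivrMr // -[sh l]mul1r -aa -mulrA ler_wpM2l // ltW.
have r2 : 0 <= 2 * p * ch a - 1 - p ^+ 2.
  have -> : 2 * p * ch a - 1 - p ^+ 2 = (p - expR (- a)) * (expR a - p).
    by move: aa; rewrite -aE -aE'; lra.
  by rewrite mulr_ge0 // subr_ge0.
exists (Num.sqrt (2 * p * ch a - 1 - p ^+ 2)), p; rewrite sqrtr_ge0 p0 sqr_sqrtr //.
split=> //; first by ring.
have lE := ch_add_sh l; have le : expR l * e = 1 by rewrite -expRD subrr expR0.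
have le2 : expR l - e = 2 * sh l by rewrite -lE -eE; ring.
have chb' : ch b = D + e * ch a by rewrite /D; ring.
rewrite chb' mulrDr.
have -> : 2 * p * expR l * D = expR l * (expR l - e) by rewrite le2 -pD; ring.
rewrite mulrBr le; have -> : 2 * p * expR l * (e * ch a) = (expR l * e) * (2 * p * ch a) by ring.
by rewrite le; ring.
Qed.

(** The angles at the common vertex add up to at least a straight angle. *)
Lemma straight_angle (X X' r r' A A' : R) : 0 <= r -> 0 <= r' ->
  0 <= A -> 0 <= A' -> A ^+ 2 = X ^+ 2 + 4 * r ^+ 2 -> A' ^+ 2 = X' ^+ 2 + 4 * r' ^+ 2 ->
  r' * X + r * X' <= 0 -> (r + r' = 0 -> X <= 0) -> A' * X + A * X' <= 0.
Proof.
have key (Y Y' s s' B B' : R) : 0 <= s -> 0 <= s' -> 0 <= B -> 0 <= B' ->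
    B ^+ 2 = Y ^+ 2 + 4 * s ^+ 2 -> B' ^+ 2 = Y' ^+ 2 + 4 * s' ^+ 2 ->
    Y <= 0 -> 0 <= Y' -> s' * Y + s * Y' <= 0 -> B' * Y + B * Y' <= 0.
  move=> s0 s0' B0 B0' BE BE' Y0 Y0' H.
  suff : B * Y' <= B' * - Y by rewrite mulrN; lra.
  rewrite -(@ler_pXn2r _ 2) ?nnegrE ?mulr_ge0 ?oppr_ge0 //.
  rewrite !exprMn BE BE' sqrrN.
  have : (s * Y') ^+ 2 <= (s' * - Y) ^+ 2.
    by rewrite lerXn2r ?nnegrE ?mulr_ge0 ?oppr_ge0 // mulrN; lra.
  by rewrite !exprMn sqrrN; lra.
move=> r0 r0' A0 A0' AE AE' H H0.
have [X0|X0] := leP X 0; have [X0'|X0'] := leP X' 0.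
- by have := mulr_ge0_le0 A0' X0; have := mulr_ge0_le0 A0 X0'; lra.
- by apply: (key X X' r r' A A') => //; exact: ltW.
- by rewrite addrC; apply: (key _ _ r' r) => //; [exact: ltW|lra].
have [rr|rr] := eqVneq (r + r') 0; first by have := H0 rr; lra.
have [r00|rn] := eqVneq r 0.
  have r'p : 0 < r' by rewrite lt_def r0' andbT; move: rr; rewrite r00 add0r.
  by have := mulr_gt0 r'p X0; move: H; rewrite r00 mul0r; lra.
have rp : 0 < r by rewrite lt_def rn.
by have := mulr_gt0 rp X0'; have := mulr_ge0 r0' (ltW X0); lra.
Qed.

(** Ptolemy's inequality when the quadrilateral is not convex at [x]. *)
Lemma ptolemy_straight (a a' b b' l : R) : 0 <= a -> 0 <= a' -> 0 <= b -> 0 <= b' -> 0 <= l ->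
  b <= b' + (a + a') -> b' <= b + (a + a') ->
  sh (a + a') * ch l <= sh a' * ch b + sh a * ch b' ->
  sh (l / 2) * sh ((a + a') / 2) <= sh (a / 2) * sh (b' / 2) + sh (a' / 2) * sh (b / 2).
Proof.
move=> a0 a0' b0 b0' l0 bb bb' N.
have half0 (x : R) : 0 <= x -> 0 <= sh (x / 2) by move=> x0; rewrite sh_ge0 // divr_ge0.
have shE (x : R) : sh x = 2 * (sh (x / 2) * ch (x / 2)).
  by have {1}-> : x = x / 2 + x / 2 by [field]; rewrite shD; ring.
set A := sh (a / 2); set A' := sh (a' / 2); set B := sh (b / 2); set B' := sh (b' / 2).
set L := sh (l / 2); set S := sh _.
set M := ch (a / 2); set M' := ch (a' / 2); pose K := ch ((a + a') / 2).
have aaE : (a + a') / 2 = a / 2 + a' / 2 by field.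
have SE : S = A * M' + M * A' by rewrite /S aaE shD.
have KE : K = M * M' + A * A' by rewrite /K aaE chD.
have K2 : K ^+ 2 = 1 + S ^+ 2 by exact: ch_sh.
have M2 : M ^+ 2 = 1 + A ^+ 2 by exact: ch_sh.
have M2' : M' ^+ 2 = 1 + A' ^+ 2 by exact: ch_sh.
have [A0 A0' B0 B0'] : [/\ 0 <= A, 0 <= A', 0 <= B & 0 <= B'] by split; exact: half0.
have L0 : 0 <= L := half0 _ l0; have S0 : 0 <= S by apply: half0; exact: addr_ge0.
have K0 : 0 < K := ch_gt0 _.
have N' : S * K * L ^+ 2 + A * A' * S <= A' * M' * B ^+ 2 + A * M * B' ^+ 2.
  move: N; rewrite (shE (a + a')) (shE a) (shE a') (ch_half l) (ch_half b) (ch_half b').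
  rewrite -/A -/A' -/B -/B' -/L -/S -/M -/M' -/K => N.
  have : S * K = A * M * (1 + 2 * A' ^+ 2) + A' * M' * (1 + 2 * A ^+ 2).
    have -> : S * K = A * M * (M' ^+ 2 + A' ^+ 2) + A' * M' * (A ^+ 2 + M ^+ 2).
      by rewrite SE KE; ring.
    by rewrite M2 M2'; ring.
  by move: N; rewrite SE; lra.
have T : B ^+ 2 + B' ^+ 2 - 2 * K * (B * B') <= S ^+ 2.
  have tri (x y : R) : 0 <= x -> 0 <= y -> x <= y + (a + a') ->
      K * sh (y / 2) <= sh (x / 2) ->
      sh (x / 2) ^+ 2 + sh (y / 2) ^+ 2 - 2 * K * (sh (x / 2) * sh (y / 2)) <= S ^+ 2.
    move=> x0 y0 xy; have : sh (x / 2) <= sh (y / 2 + (a + a') / 2).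
      by apply: sh_le; rewrite -mulrDl ler_pM2r.
    rewrite shD -/K -/S; have := ch_sh (y / 2); have := ch_gt0 (y / 2).
    move: (ch (y / 2)) (sh (y / 2)) (sh (x / 2)) => c s t c0 cE le1 le2.
    have : (t - K * s) ^+ 2 <= (c * S) ^+ 2.
      apply: lerXn2r; rewrite ?nnegrE; [by rewrite subr_ge0|by rewrite mulr_ge0 // ltW|lra].
    by rewrite exprMn cE; move: K2; nra.
  have [le|lt] := leP (K * B') B; first exact: tri.
  have [le|lt'] := leP (K * B) B'.
    by have := tri b' b b0' b0 bb' le; rewrite -/B -/B' [B' * B]mulrC; lra.
  by have := sqr_ge0 S; nra.
rewrite -(@ler_pXn2r _ 2) //; last 2 first.
- exact: (mulr_ge0 L0 S0).
- exact: addr_ge0 (mulr_ge0 A0 B0') (mulr_ge0 A0' B0).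
rewrite -(ler_pM2l K0).
have -> : K * (L * S) ^+ 2 = S * (S * K * L ^+ 2) by ring.
apply: (@le_trans _ _ (S * (A' * M' * B ^+ 2 + A * M * B' ^+ 2 - A * A' * S))).
  by rewrite ler_wpM2l //; lra.
have E1 : S * M' - A' * K = A by rewrite SE KE; move: M2'; nra.
have E2 : S * M - A * K = A' by rewrite SE KE; move: M2; nra.
have -> : S * (A' * M' * B ^+ 2 + A * M * B' ^+ 2 - A * A' * S) =
   A' * B ^+ 2 * (S * M' - A' * K) + A * B' ^+ 2 * (S * M - A * K) +
   K * (A' ^+ 2 * B ^+ 2 + A ^+ 2 * B' ^+ 2) - A * A' * S ^+ 2 by ring.
by rewrite E1 E2; have := ler_wpM2l (mulr_ge0 A0 A0') T; lra.
Qed.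

Lemma ptolemy_plane (x1 x2 y1 y2 z1 z2 w1 w2 exy exz exw eyz eyw ezw : R) :
  0 <= exy -> 0 <= exz -> 0 <= exw -> 0 <= eyz -> 0 <= eyw -> 0 <= ezw ->
  exy ^+ 2 = (x1 - y1) ^+ 2 + (x2 - y2) ^+ 2 -> exz ^+ 2 = (x1 - z1) ^+ 2 + (x2 - z2) ^+ 2 ->
  exw ^+ 2 = (x1 - w1) ^+ 2 + (x2 - w2) ^+ 2 -> eyz ^+ 2 = (y1 - z1) ^+ 2 + (y2 - z2) ^+ 2 ->
  eyw ^+ 2 = (y1 - w1) ^+ 2 + (y2 - w2) ^+ 2 -> ezw ^+ 2 = (z1 - w1) ^+ 2 + (z2 - w2) ^+ 2 ->
  exz * eyw <= exy * ezw + exw * eyz.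
Proof.
move=> xy0 xz0 xw0 yz0 yw0 zw0 xyE xzE xwE yzE ywE zwE.
have tri (a1 a2 b1 b2 a b c : R) : 0 <= a -> 0 <= b -> 0 <= c ->
    a ^+ 2 = a1 ^+ 2 + a2 ^+ 2 -> b ^+ 2 = b1 ^+ 2 + b2 ^+ 2 ->
    c ^+ 2 = (a1 + b1) ^+ 2 + (a2 + b2) ^+ 2 -> c <= a + b.
  move=> a0 b0 c0 aE bE cE; rewrite -(@ler_pXn2r _ 2) ?nnegrE ?addr_ge0 //.
  have : a1 * b1 + a2 * b2 <= a * b.
    apply: le_trans (ler_norm _) _; rewrite -(@ler_pXn2r _ 2) ?nnegrE ?mulr_ge0 ?normr_ge0 //.
    rewrite real_normK ?num_real // exprMn aE bE.
    by have := sqr_ge0 (a1 * b2 - a2 * b1); nra.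
  by move: aE bE cE; nra.
apply: (tri ((x1 - y1) * (z1 - w1) - (x2 - y2) * (z2 - w2))
  ((x1 - y1) * (z2 - w2) + (x2 - y2) * (z1 - w1))
  ((x1 - w1) * (y1 - z1) - (x2 - w2) * (y2 - z2))
  ((x1 - w1) * (y2 - z2) + (x2 - w2) * (y1 - z1))); rewrite ?mulr_ge0 //;
  rewrite exprMn ?xyE ?xzE ?xwE ?yzE ?ywE ?zwE; ring.
Qed.

End Ptolemy.

Section CatPtolemy.
Local Open Scope ring_scope.
Variables (R : realType) (X : metricType R).
Hypothesis cat : CAT_minus_1 X.
Implicit Types x y z w : X.

Definition hsin (T : metricType R) (x y : T) : R := sh (mdist x y / 2).

Lemma hsinC x y : hsin x y = hsin y x. Proof. by rewrite /hsin metric_sym. Qed.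

Lemma hsin_ge0 x y : 0 <= hsin x y.
Proof. by rewrite sh_ge0 // divr_ge0 // mdist_ge0. Qed.

Lemma hsinxx x : hsin x x = 0.
Proof. by rewrite /hsin mdistxx mul0r sh0. Qed.

Lemma ch_mdist x y : ch (mdist x y) = 1 + 2 * hsin x y ^+ 2.
Proof. exact: ch_half. Qed.

Let hp (r p : R) (p0 : 0 < p) : hplane R := exist _ (r, p) p0.

Let hdist_eq r p (p0 : 0 < p) r' p' (p0' : 0 < p') t : 0 <= t ->
  2 * p * p' * (ch t - 1) = (r - r') ^+ 2 + (p - p') ^+ 2 -> hdist (hp r p0) (hp r' p0') = t.
Proof.
move=> t0 tE; rewrite /hdist /= -tE -[RHS](arcosh_ch t0); congr arcosh.
by field; rewrite !gt_eqF.
Qed.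

Let coords (a b l r p : R) := [/\ 0 <= r, 0 < p, r ^+ 2 + p ^+ 2 + 1 = 2 * p * ch a &
  r ^+ 2 + p ^+ 2 + expR l ^+ 2 = 2 * p * expR l * ch b].

Let ex_coords x y z : 0 < mdist x z -> exists r p, coords (mdist x y) (mdist y z) (mdist x z) r p.
Proof.
move=> l0; apply: triangle_coordinates; rewrite ?mdist_ge0 //.
- by rewrite addrC (metric_sym y z); exact: metric_triangle.
- by rewrite (metric_sym x y); exact: metric_triangle.
- exact: metric_triangle.
Qed.

Let cat_point x y z c r p s : geodesic x z c ->
  coords (mdist x y) (mdist y z) (mdist x z) r p -> 0 <= s <= mdist x z ->
  2 * p * expR s * ch (mdist y (c s)) <= r ^+ 2 + p ^+ 2 + expR s ^+ 2.
Proof.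
move=> gc [r0 p0 Ea Eb] /andP[s0 sl]; have [gs cmp] := cat.
have [c2 g2] := gs z y; have [c3 g3] := gs y x.
have ep (t : R) : 0 < expR t := expR_gt0 t.
pose ax t := hp 0 (ep t).
have axd t t' : t <= t' -> hdist (ax t) (ax t') = t' - t.
  move=> tt'; apply: hdist_eq; first by rewrite subr_ge0.
  have e1 : expR t * expR (- t) = 1 by rewrite -expRD subrr expR0.
  have e2 : expR t' * expR (- t') = 1 by rewrite -expRD subrr expR0.
  rewrite ch_expR opprB !expRD subrr expr0n add0r.
  move: e1 e2; move: (expR t) (expR t') (expR (- t)) (expR (- t')) => f f' g g' e1 e2.
  have -> : 2 * f * f' * ((f' * g + f * g') / 2 - 1) =
    f' ^+ 2 * (f * g) + f ^+ 2 * (f' * g') - 2 * f * f' by field.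
  by rewrite e1 e2; ring.
have [_ c2y _] := g2.
have mle : mdist (c s) y <= hdist (ax s) (hp r p0).
  apply: (cmp x z y c c2 c3 (ax 0) (ax (mdist x z)) (hp r p0)) => //.
  - by rewrite axd ?mdist_ge0 // subr0.
  - apply: hdist_eq; rewrite ?mdist_ge0 // (metric_sym z y).
    by move: Eb; move: (expR _) => e Eb; lra.
  - apply: hdist_eq; rewrite ?mdist_ge0 // (metric_sym y x) expR0.
    by move: Ea; lra.
  - by apply: Or31; exists s; rewrite s0 sl !axd // subr0.
  apply: Or32; exists (mdist z y); rewrite mdist_ge0 lexx subrr; split=> //.
    apply: hdist_eq; rewrite ?mdist_ge0 // (metric_sym z y).
    by move: Eb; move: (expR _) => e Eb; lra.
  by apply: hdist_eq => //; rewrite ch_expR oppr0 expR0; field.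
have [t [t0 tE]] : exists t, 0 <= t /\ 2 * expR s * p * (ch t - 1) = (0 - r) ^+ 2 + (expR s - p) ^+ 2.
  pose u := 1 + ((0 - r) ^+ 2 + (expR s - p) ^+ 2) / (2 * expR s * p).
  have u1 : 1 <= u.
    by rewrite lerDl divr_ge0 ?addr_ge0 ?sqr_ge0 // !mulr_ge0 // ltW.
  exists (arcosh u); split; first exact: arcosh_ge0.
  by rewrite ch_arcosh // /u; field; rewrite !gt_eqF.
have : ch (mdist y (c s)) <= ch t.
  by apply: ch_mono; rewrite ?mdist_ge0 // metric_sym -(hdist_eq (ep s) p0 t0 tE).
have pp := p0; move: tE (ep s) pp; move: (ch _) (ch _) (expR s) => A B e tE e0 p0' AB.
have := ler_wpM2l (ltW (mulr_gt0 e0 p0')) AB; lra.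
Qed.

Let ptolemy_at x y z w r p r' p' : 0 < mdist x z ->
  coords (mdist x y) (mdist y z) (mdist x z) r p ->
  coords (mdist x w) (mdist w z) (mdist x z) r' p' ->
  r' * (r ^+ 2 + p ^+ 2 - 1) + r * (r' ^+ 2 + p' ^+ 2 - 1) <= 0 ->
  (r + r' = 0 -> r ^+ 2 + p ^+ 2 <= 1) ->
  hsin x z * hsin y w <= hsin x y * hsin z w + hsin x w * hsin y z.
Proof.
move=> l0 [r0 p0 Ea Eb] [r0' p0' Ea' Eb'] H H0.
have dyw : mdist y w <= mdist x y + mdist x w.
  by rewrite (metric_sym x y); exact: metric_triangle.
apply: (@le_trans _ _ (sh (mdist x z / 2) * sh ((mdist x y + mdist x w) / 2))).
  by rewrite ler_wpM2l ?hsin_ge0 //; apply: sh_le; rewrite ler_pM2r.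
have -> : hsin z w = sh (mdist w z / 2) by rewrite hsinC.
have tyz : mdist y z <= mdist w z + (mdist x y + mdist x w).
  by apply: le_trans (metric_triangle y w z) _; rewrite addrC lerD2l.
have twz : mdist w z <= mdist y z + (mdist x y + mdist x w).
  by apply: le_trans (metric_triangle w y z) _; rewrite addrC lerD2l metric_sym.
apply: ptolemy_straight; rewrite ?mdist_ge0 //.
move: (mdist x y) (mdist x w) (mdist y z) (mdist w z) (mdist x z) l0 (mdist_ge0 x y) (mdist_ge0 x w)
  Ea Eb Ea' Eb' => a a' b b' l l0 a0 a0' Ea Eb Ea' Eb'.
have A2 (c t q : R) : 0 < q -> t ^+ 2 + q ^+ 2 + 1 = 2 * q * ch c ->
    (2 * q * sh c) ^+ 2 = (t ^+ 2 + q ^+ 2 - 1) ^+ 2 + 4 * t ^+ 2.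
  move=> q0 E; have -> : (2 * q * sh c) ^+ 2 = (2 * q * ch c) ^+ 2 - 4 * q ^+ 2.
    by have := ch_sh c; move: (ch c) (sh c) => C S CS; rewrite !exprMn CS; ring.
  by rewrite -E; ring.
have sgn : 2 * p' * sh a' * (r ^+ 2 + p ^+ 2 - 1) + 2 * p * sh a * (r' ^+ 2 + p' ^+ 2 - 1) <= 0.
  apply: (straight_angle r0 r0') => //; try exact: A2.
  - by apply: mulr_ge0; [apply: mulr_ge0 => //; exact: ltW|exact: sh_ge0].
  - by apply: mulr_ge0; [apply: mulr_ge0 => //; exact: ltW|exact: sh_ge0].
  - by move=> /H0; rewrite subr_le0.
have bE (c t q f : R) : 0 < q -> t ^+ 2 + q ^+ 2 + 1 = 2 * q * ch c ->
    t ^+ 2 + q ^+ 2 + expR l ^+ 2 = 2 * q * expR l * ch f ->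
    2 * q * ch f = 2 * q * ch c * ch l - (t ^+ 2 + q ^+ 2 - 1) * sh l.
  move=> q0 E E'; have e1 : expR l * expR (- l) = 1 by rewrite -expRD subrr expR0.
  apply: (mulfI (lt0r_neq0 (expR_gt0 l))).
  have -> : expR l * (2 * q * ch f) = 2 * q * expR l * ch f by ring.
  rewrite -E' -E ch_expR sh_expR; move: e1; move: (expR l) (expR (- l)) => e g e1.
  have -> : e * ((t ^+ 2 + q ^+ 2 + 1) * ((e + g) / 2) - (t ^+ 2 + q ^+ 2 - 1) * ((e - g) / 2)) =
    (t ^+ 2 + q ^+ 2) * (e * g) + e ^+ 2 by field.
  by rewrite e1; ring.
have B1 := bE _ _ _ _ p0 Ea Eb; have B2 := bE _ _ _ _ p0' Ea' Eb'.
have c0 : 0 < 4 * p * p' by rewrite !mulr_gt0.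
rewrite -(ler_pM2l c0).
have -> : 4 * p * p' * (sh a' * ch b + sh a * ch b') =
   2 * p' * sh a' * (2 * p * ch b) + 2 * p * sh a * (2 * p' * ch b') by ring.
rewrite B1 B2 shD; have := sh_gt0 l0.
have -> : 2 * p' * sh a' * (2 * p * ch a * ch l - (r ^+ 2 + p ^+ 2 - 1) * sh l) +
  2 * p * sh a * (2 * p' * ch a' * ch l - (r' ^+ 2 + p' ^+ 2 - 1) * sh l) =
  4 * p * p' * ((sh a * ch a' + ch a * sh a') * ch l) -
  (2 * p' * sh a' * (r ^+ 2 + p ^+ 2 - 1) + 2 * p * sh a * (r' ^+ 2 + p' ^+ 2 - 1)) * sh l by ring.
move=> sl; rewrite lerBrDr gerDl.
by rewrite mulr_le0_ge0 // ltW.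
Qed.

(* two points on either side of the axis, seen from a point of their geodesic *)
Let crossing (r r' p p' h cc d1 d2 : R) : 0 <= r -> 0 <= r' -> 0 < p -> 0 < p' -> 0 < h ->
  0 <= d1 -> 0 <= d2 ->
  r ^+ 2 + p ^+ 2 = 2 * cc * r + h ^+ 2 -> r' ^+ 2 + p' ^+ 2 = - (2 * cc * r') + h ^+ 2 ->
  2 * p * h * ch d1 = r ^+ 2 + p ^+ 2 + h ^+ 2 -> 2 * p' * h * ch d2 = r' ^+ 2 + p' ^+ 2 + h ^+ 2 ->
  2 * p * p' * ch (d1 + d2) = (r + r') ^+ 2 + p ^+ 2 + p' ^+ 2.
Proof.
move=> r0 r0' p0 p0' h0 d0 d0' Q Q' E E'.
pose rho := Num.sqrt (cc ^+ 2 + h ^+ 2).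
have rho2 : rho ^+ 2 = cc ^+ 2 + h ^+ 2 by rewrite sqr_sqrtr // addr_ge0 ?sqr_ge0.
have rho0 : 0 <= rho by exact: sqrtr_ge0.
have shE (t q c d : R) : 0 <= t -> 0 < q -> 0 <= d -> t ^+ 2 + q ^+ 2 = 2 * c * t + h ^+ 2 ->
    c ^+ 2 = cc ^+ 2 -> 2 * q * h * ch d = t ^+ 2 + q ^+ 2 + h ^+ 2 -> q * h * sh d = t * rho.
  move=> t0 q0 d0'' Qt cE Et; apply/eqP; rewrite -(@eqrXn2 _ 2) //.
  - apply/eqP; have S2 : sh d ^+ 2 = ch d ^+ 2 - 1 by rewrite ch_sh; ring.
    have -> : (q * h * sh d) ^+ 2 = q ^+ 2 * h ^+ 2 * (sh d ^+ 2) by ring.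
    have -> : q ^+ 2 * h ^+ 2 * sh d ^+ 2 = (2 * q * h * ch d) ^+ 2 / 4 - q ^+ 2 * h ^+ 2.
      by rewrite S2; field.
    have -> : (t * rho) ^+ 2 = t ^+ 2 * rho ^+ 2 by ring.
    rewrite Et rho2 -cE; have -> : q ^+ 2 = 2 * c * t + h ^+ 2 - t ^+ 2 by rewrite -Qt; ring.
    by field.
  - by apply: mulr_ge0; [apply: mulr_ge0; exact: ltW|exact: sh_ge0].
  - exact: mulr_ge0.
have S1 := shE r p cc d1 r0 p0 d0 Q erefl E.
have S2 : p' * h * sh d2 = r' * rho.
  by apply: (shE r' p' (- cc)) => //; [rewrite Q'; ring|rewrite sqrrN].
apply: (mulfI (lt0r_neq0 (mulr_gt0 h0 h0))).
have -> : h * h * (2 * p * p' * ch (d1 + d2)) =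
   (2 * p * h * ch d1) * (2 * p' * h * ch d2) / 2 + 2 * (p * h * sh d1) * (p' * h * sh d2).
  by rewrite chD; field.
rewrite E E' S1 S2.
have -> : 2 * (r * rho) * (r' * rho) = 2 * r * r' * rho ^+ 2 by ring.
rewrite rho2 Q Q'.
have -> : (r + r') ^+ 2 + p ^+ 2 + p' ^+ 2 = (r ^+ 2 + p ^+ 2) + (r' ^+ 2 + p' ^+ 2) + 2 * r * r' by ring.
by rewrite Q Q'; field.
Qed.

(** In the convex case the two comparison triangles, laid on the two sides of the
    diagonal, form a quadrilateral of the half-plane whose other diagonal is at least
    as long; there [sh (d / 2)] is the Euclidean distance over the square roots of
    the heights, so that the inequality is the Euclidean one. *)
Theorem ptolemy x y z w :
  hsin x z * hsin y w <= hsin x y * hsin z w + hsin x w * hsin y z.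
Proof.
have [l0|] := ltP 0 (mdist x z); last first.
  move=> l0; have -> : hsin x z = 0.
    have -> : mdist x z = 0 -> hsin x z = 0 by move=> e; rewrite /hsin e mul0r sh0.
      by [].
    by apply/eqP; rewrite eq_le l0 mdist_ge0.
  by rewrite mul0r addr_ge0 // mulr_ge0 ?hsin_ge0.
have [r [p cy]] := ex_coords y l0; have [r' [p' cw]] := ex_coords w l0.
have [[c gc]] : (exists c, geodesic x z c) /\ True by have [gs _] := cat; split=> //; exact: gs.
move=> _; have [r0 p0 Ea Eb] := cy; have [r0' p0' Ea' Eb'] := cw.
set e := expR (mdist x z) in Eb Eb'; have e0 : 0 < e := expR_gt0 _.
pose q := r ^+ 2 + p ^+ 2; pose q' := r' ^+ 2 + p' ^+ 2.
have q0 : 0 < q by rewrite ltr_wpDl ?sqr_ge0 // exprn_gt0.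
have q0' : 0 < q' by rewrite ltr_wpDl ?sqr_ge0 // exprn_gt0.
have [[N1 N2]|Nx] := pselect (r' * (q - 1) + r * (q' - 1) <= 0 /\ (r + r' = 0 -> q <= 1)).
  exact: ptolemy_at l0 cy cw N1 N2.
have [[N1 N2]|Nz] := pselect (r' * (e ^+ 2 - q) + r * (e ^+ 2 - q') <= 0 /\ (r + r' = 0 -> e ^+ 2 <= q)).
  have invc v t s : coords (mdist x v) (mdist v z) (mdist x z) t s ->
      coords (mdist z v) (mdist v x) (mdist z x) (t * e / (t ^+ 2 + s ^+ 2)) (s * e / (t ^+ 2 + s ^+ 2)).
    move=> [t0 s0 F F']; have f0 : 0 < t ^+ 2 + s ^+ 2 by rewrite ltr_wpDl ?sqr_ge0 // exprn_gt0.
    have sq : (t * e / (t ^+ 2 + s ^+ 2)) ^+ 2 + (s * e / (t ^+ 2 + s ^+ 2)) ^+ 2 = e ^+ 2 / (t ^+ 2 + s ^+ 2).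
      by field; rewrite gt_eqF.
    rewrite -/e in F'; split.
    - by rewrite divr_ge0 ?(ltW f0) // mulr_ge0 // ltW.
    - by rewrite divr_gt0 // mulr_gt0.
    - rewrite sq (metric_sym z v).
      have -> : 2 * (s * e / (t ^+ 2 + s ^+ 2)) * ch (mdist v z) =
        (2 * s * e * ch (mdist v z)) / (t ^+ 2 + s ^+ 2) by field; rewrite gt_eqF.
      by rewrite -F'; field; rewrite gt_eqF.
    - rewrite sq (metric_sym z x) (metric_sym v x) -/e.
      have -> : 2 * (s * e / (t ^+ 2 + s ^+ 2)) * e * ch (mdist x v) =
        e ^+ 2 * (2 * s * ch (mdist x v)) / (t ^+ 2 + s ^+ 2) by field; rewrite gt_eqF.
      by rewrite -F; field; rewrite gt_eqF.
  have l0' : 0 < mdist z x by rewrite metric_sym.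
  have sq (t s : R) : 0 < t ^+ 2 + s ^+ 2 ->
      (t * e / (t ^+ 2 + s ^+ 2)) ^+ 2 + (s * e / (t ^+ 2 + s ^+ 2)) ^+ 2 = e ^+ 2 / (t ^+ 2 + s ^+ 2).
    by move=> ts; field; rewrite gt_eqF.
  suff : hsin z x * hsin y w <= hsin z y * hsin x w + hsin z w * hsin y x.
    by rewrite (hsinC z x) (hsinC z y) (hsinC y x) => le; lra.
  apply: (ptolemy_at l0' (invc _ _ _ cy) (invc _ _ _ cw)); rewrite !sq // -/q -/q'.
    have -> : r' * e / q' * (e ^+ 2 / q - 1) + r * e / q * (e ^+ 2 / q' - 1) =
      e / (q * q') * (r' * (e ^+ 2 - q) + r * (e ^+ 2 - q')) by field; rewrite !gt_eqF.
    by rewrite mulr_ge0_le0 // divr_ge0 ?mulr_ge0 // ltW.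
  move=> rr; rewrite ler_pdivrMr // mul1r; apply: N2.
  have re : 0 <= r * e / q by rewrite divr_ge0 ?mulr_ge0 // ltW.
  have re' : 0 <= r' * e / q' by rewrite divr_ge0 ?mulr_ge0 // ltW.
  have z0 (t s : R) : 0 < s -> t * e / s = 0 -> t = 0.
    move=> s0 /eqP; rewrite !mulf_eq0 invr_eq0 (gt_eqF e0) (gt_eqF s0) !orbF.
    by move=> /eqP.
  move: rr => /eqP; rewrite paddr_eq0 // => /andP[/eqP e1 /eqP e2].
  by rewrite (z0 r q q0 e1) (z0 r' q' q0' e2) addr0.
have [s [d1 [d2 [s_int d10 d20 [D1 D2] D12]]]] : exists s d1 d2 : R,
  [/\ 0 <= s <= mdist x z, 0 <= d1, 0 <= d2,
   2 * p * expR s * ch d1 = q + expR s ^+ 2 /\ 2 * p' * expR s * ch d2 = q' + expR s ^+ 2 &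
   2 * p * p' * ch (d1 + d2) = (r + r') ^+ 2 + p ^+ 2 + p' ^+ 2].
  have exd (t f h : R) : 0 < f -> 0 < h -> exists d, 0 <= d /\ 2 * f * h * ch d = t ^+ 2 + f ^+ 2 + h ^+ 2.
    move=> f0 h0; pose u := (t ^+ 2 + f ^+ 2 + h ^+ 2) / (2 * f * h).
    have u1 : 1 <= u.
      rewrite ler_pdivlMr ?mul1r; last by rewrite !mulr_gt0.
      by have := sqr_ge0 (f - h); have := sqr_ge0 t; lra.
    exists (arcosh u); rewrite arcosh_ge0 // ch_arcosh // /u; split=> //.
    by field; rewrite !gt_eqF.
  have [rr|rr] := eqVneq (r + r') 0.
    have r00 : r = 0 by lra. have r00' : r' = 0 by lra.
    have qp : q = p ^+ 2 by rewrite /q r00 expr0n add0r.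
    have p1 : 1 <= p.
      rewrite leNgt; apply/negP => lt; apply: Nx; rewrite r00 r00' !mul0r addr0; split=> // _.
      by rewrite qp exprn_ile1 // ltW.
    have pe : p <= e.
      rewrite leNgt; apply/negP => lt; apply: Nz; rewrite r00 r00' !mul0r addr0; split=> // _.
      by rewrite qp lerXn2r ?nnegrE ?ltW.
    have [d2 [d20 D2]] := exd r' p' p p0' p0.
    exists (ln p), 0, d2; rewrite lnK ?posrE // ln_ge0 // d20 lexx; split=> //.
    - by rewrite -ler_expR lnK ?posrE.
    - by rewrite ch_expR oppr0 expR0 qp; split=> //; field.
    - by rewrite add0r; move: D2; rewrite r00 r00'; lra.
  have rr0 : 0 < r + r' by rewrite lt_def rr addr_ge0.
  pose h2 := (q * r' + q' * r) / (r + r').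
  have h2E : h2 * (r + r') = q * r' + q' * r by rewrite /h2 divfK.
  have h21 : 1 < h2.
    rewrite ltNge; apply/negP => le; apply: Nx; split; last by move=> e00; rewrite e00 eqxx in rr.
    by have := ler_wpM2r (ltW rr0) le; rewrite h2E; lra.
  have h2e : h2 < e ^+ 2.
    rewrite ltNge; apply/negP => le; apply: Nz; split; last by move=> e00; rewrite e00 eqxx in rr.
    by have := ler_wpM2r (ltW rr0) le; rewrite h2E; lra.
  pose h := Num.sqrt h2; have hE : h ^+ 2 = h2 by rewrite sqr_sqrtr // ltW // (lt_trans ltr01).
  have h0 : 0 < h by rewrite sqrtr_gt0 (lt_trans ltr01).
  have h1 : 1 <= h by rewrite -(@ler_pXn2r _ 2) ?nnegrE ?(ltW h0) // hE expr1n ltW.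
  have he : h <= e by rewrite -(@ler_pXn2r _ 2) ?nnegrE ?(ltW h0) ?(ltW e0) // hE ltW.
  have [d1 [d10 D1]] := exd r p h p0 h0; have [d2 [d20 D2]] := exd r' p' h p0' h0.
  exists (ln h), d1, d2; rewrite lnK ?posrE // ln_ge0 //; split=> //.
    by rewrite -ler_expR lnK ?posrE.
  apply: (crossing (cc := (q - q') / (2 * (r + r'))) r0 r0' p0 p0' h0 d10 d20 _ _ D1 D2).
    by rewrite hE /h2 -/q; field.
  by rewrite hE /h2 -/q'; field.
have dyw : mdist y w <= d1 + d2.
  apply: le_trans (metric_triangle y (c s) w) _; apply: lerD.
    apply: ch_le => //; have := cat_point gc cy s_int; rewrite -/q -D1.
    by rewrite ler_pM2l // !mulr_gt0 // expR_gt0.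
  rewrite metric_sym; apply: ch_le => //; have := cat_point gc cw s_int; rewrite -/q' -D2.
  by rewrite ler_pM2l // !mulr_gt0 // expR_gt0.
have s0 (t : R) : 0 < t -> 0 < Num.sqrt t /\ Num.sqrt t ^+ 2 = t.
  by move=> t0; rewrite sqrtr_gt0 sqr_sqrtr // ltW.
have [a0 aE] := s0 p p0; have [a0' aE'] := s0 p' p0'; have [b0 bE] := s0 e e0.
set f := Num.sqrt p in a0 aE; set f' := Num.sqrt p' in a0' aE'; set g := Num.sqrt e in b0 bE.
pose T := Num.sqrt ((r + r') ^+ 2 + (p - p') ^+ 2).
have TE : T ^+ 2 = (r + r') ^+ 2 + (p - p') ^+ 2 by rewrite sqr_sqrtr // addr_ge0 ?sqr_ge0.
have yw : 2 * f * f' * hsin y w <= T.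
  rewrite -(@ler_pXn2r _ 2) ?nnegrE ?sqrtr_ge0 //; last first.
    by apply: mulr_ge0 (hsin_ge0 _ _); rewrite !mulr_ge0 // ltW.
  have : ch (mdist y w) <= ch (d1 + d2) by apply: ch_mono; rewrite ?mdist_ge0.
  rewrite ch_mdist TE !exprMn aE aE' => le.
  have := ler_wpM2l (ltW (mulr_gt0 p0 p0')) le; move: D12; lra.
have xz2 : 2 * e * (2 * hsin x z ^+ 2) = (e - 1) ^+ 2.
  have := ch_mdist x z; rewrite ch_expR; have : e * expR (- mdist x z) = 1 by rewrite -expRD subrr expR0.
  rewrite -/e; move: (expR _) => e' ee; move: (hsin x z) => u uE.
  have -> : 2 * u ^+ 2 = (e + e') / 2 - 1 by rewrite uE; ring.
  by move: ee; lra.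
have Pt : 2 * g * hsin x z * T <= 2 * f * hsin x y * (2 * f' * g * hsin z w) +
    2 * f' * hsin x w * (2 * f * g * hsin y z).
  have n2 (t u : R) : 0 < t -> 0 <= u -> 0 <= 2 * t * u by move=> t0 u0; rewrite !mulr_ge0 // ltW.
  have n3 (t t' u : R) : 0 < t -> 0 < t' -> 0 <= u -> 0 <= 2 * t * t' * u.
    by move=> t0 t0' u0; rewrite !mulr_ge0 // ltW.
  have sqr2 (t u : R) : (2 * t * u) ^+ 2 = 4 * t ^+ 2 * u ^+ 2 by ring.
  have sqr3 (t t' u : R) : (2 * t * t' * u) ^+ 2 = 4 * t ^+ 2 * t' ^+ 2 * u ^+ 2 by ring.
  move: Ea Eb Ea' Eb'; rewrite !ch_mdist => Ea Eb Ea' Eb'.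
  apply: (@ptolemy_plane _ 0 1 r p 0 e (- r') p'); rewrite ?sqrtr_ge0 ?n2 ?n3 ?hsin_ge0 //.
  - by rewrite sqr2 aE; move: Ea; lra.
  - by rewrite sqr2 bE; move: xz2; lra.
  - by rewrite sqr2 aE'; move: Ea'; lra.
  - by rewrite sqr3 aE bE; move: Eb; lra.
  - by rewrite TE opprK.
  - by rewrite sqr3 aE' bE (hsinC z w); move: Eb'; lra.
have c0 : 0 < 4 * f * f' * g by rewrite !mulr_gt0.
rewrite -(ler_pM2l c0); have u0 : 0 <= 2 * g * hsin x z.
  by apply: mulr_ge0 (hsin_ge0 _ _); apply: mulr_ge0 => //; exact: ltW.
by have := ler_wpM2l u0 yw; lra.
Qed.

End CatPtolemy.

Section Busemann.
Local Open Scope classical_set_scope.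
Local Open Scope ring_scope.
Variables (R : realType) (X : metricType R) (I : Type) (F : set_system I).
Hypothesis cat : CAT_minus_1 X.
Context {FF : ProperFilter F}.
Variables (o : X) (y : I -> X).

(** Along [F] the points [y i] go to infinity and form a Cauchy family for the metric
    [hsin x z / (hsin o x * hsin o z)] provided by Ptolemy's inequality. *)
Hypothesis F_cauchy : forall e : R, 0 < e -> exists2 A, F A &
  forall i j, A i -> A j -> 0 < hsin o (y i) /\ hsin (y i) (y j) <= e * (hsin o (y i) * hsin o (y j)).

Let rat x i := hsin x (y i) / hsin o (y i).

(* the exponential of half the Busemann function of the limit point *)
Definition busemann x : R := sup [set t | F [set i | t <= rat x i]].

Let ratC x e : 0 < e -> exists2 A, F A & forall i j, A i -> A j ->
  0 < hsin o (y i) /\ rat x i <= rat x j + e.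
Proof.
move=> e0; pose c := hsin x o + 1.
have c0 : 0 < c by rewrite ltr_wpDl // hsin_ge0.
have [A FA AP] := F_cauchy (divr_gt0 e0 c0); exists A => // i j Ai Aj.
have [ai uij] := AP i j Ai Aj; have [aj _] := AP j i Aj Ai; split=> //.
have pt := ptolemy cat x o (y i) (y j).
rewrite /rat ler_pdivrMr // -(ler_pM2r aj) !mulrDl.
have -> : hsin x (y j) / hsin o (y j) * hsin o (y i) * hsin o (y j) = hsin x (y j) * hsin o (y i).
  by field; rewrite gt_eqF.
apply: le_trans pt _; rewrite addrC lerD2l.
have x0 := hsin_ge0 x o; have xu := ler_wpM2l x0 uij.
have xe : hsin x o * (e / c) <= e.
  by rewrite mulrA ler_pdivrMr // mulrC ler_wpM2l ?(ltW e0) // /c lerDl.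
have := ler_wpM2r (ltW (mulr_gt0 ai aj)) xe; lra.
Qed.

Lemma busemannP x e : 0 < e -> F [set i | 0 < hsin o (y i) /\
  `|hsin x (y i) - busemann x * hsin o (y i)| <= e * hsin o (y i)].
Proof.
move=> e0; have [A FA AP] := ratC x (divr_gt0 e0 (@ltr0Sn R 1)).
have [i0 Ai0] := filter_ex FA.
have lo : F [set i | rat x i0 - e / 2 <= rat x i].
  by apply: filterS FA => i Ai /=; have [_] := AP i0 i Ai0 Ai; rewrite lerBlDr.
have hi : ubound [set t | F [set i | t <= rat x i]] (rat x i0 + e / 2).
  move=> t Ft; have [i [/= ti Ai]] := filter_ex (filterI Ft FA).
  by apply: le_trans ti _; have [_] := AP i i0 Ai Ai0.
have s1 : rat x i0 - e / 2 <= busemann x by apply: ub_le_sup => //; exists (rat x i0 + e / 2).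
have s2 : busemann x <= rat x i0 + e / 2 by apply: ge_sup => //; exists (rat x i0 - e / 2).
apply: filterS FA => i Ai /=; have [ai ri] := AP i i0 Ai Ai0; have [_ ri'] := AP i0 i Ai0 Ai.
split=> //; have -> : hsin x (y i) = rat x i * hsin o (y i) by rewrite /rat divfK // gt_eqF.
rewrite -mulrBl normrM (gtr0_norm ai) ler_wpM2r ?(ltW ai) // ler_norml.
by apply/andP; split; lra.
Qed.

Lemma busemann_near x e : 0 < e -> F [set i | [/\ 0 < hsin o (y i),
  (busemann x - e) * hsin o (y i) <= hsin x (y i) &
  hsin x (y i) <= (busemann x + e) * hsin o (y i)]].
Proof.
move=> e0; apply: filterS (busemannP x e0) => i /= [ai].
rewrite ler_norml => /andP[lo hi]; split=> //; lra.
Qed.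

Lemma busemann_eq x l : (forall e, 0 < e -> F [set i | 0 < hsin o (y i) ->
  `|hsin x (y i) - l * hsin o (y i)| <= e * hsin o (y i)]) -> busemann x = l.
Proof.
move=> H; apply/eqP; rewrite -subr_eq0 -normr_le0 leNgt; apply/negP => n0.
have e0 : 0 < `|busemann x - l| / 4 by rewrite divr_gt0.
have [i [/= [ai H1] H2]] := filter_ex (filterI (busemannP x e0) (H _ e0)).
have := lerD (H2 ai) H1; rewrite -[X in _ + X <= _]normrN => /(le_trans (ler_normD _ _)).
rewrite (_ : _ + - _ = (busemann x - l) * hsin o (y i)); last by ring.
rewrite normrM (gtr0_norm ai) -mulrDl ler_pM2r //.
by move: n0; lra.
Qed.

Lemma busemann_ge0 x : 0 <= busemann x.
Proof.
rewrite leNgt; apply/negP => n0; have e0 : 0 < - busemann x / 2 by rewrite divr_gt0 // oppr_gt0.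
have [i [ai _ hi]] := filter_ex (busemann_near x e0).
by have := hsin_ge0 x (y i); nra.
Qed.

Lemma busemann_base : busemann o = 1.
Proof.
apply: busemann_eq => e e0; apply: filterE => i /= ai.
by rewrite mul1r subrr normr0 mulr_ge0 // ltW.
Qed.

Lemma busemann_ptolemy x w z :
  hsin x z * busemann w <= hsin x w * busemann z + hsin w z * busemann x.
Proof.
rewrite leNgt; apply/negP => lt.
pose gap := hsin x z * busemann w - (hsin x w * busemann z + hsin w z * busemann x).
pose c := hsin x z + hsin x w + hsin w z + 1.
have xz := hsin_ge0 x z; have xw := hsin_ge0 x w; have wz := hsin_ge0 w z.
have c0 : 0 < c by rewrite /c; lra.
have e0 : 0 < gap / c by rewrite divr_gt0 // subr_gt0.
have [i [[ai w1 _] [[_ _ z2] [_ _ x2]]]] := filter_ex (filterI (busemann_near w e0)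
  (filterI (busemann_near z e0) (busemann_near x e0))).
have pt := ptolemy cat x w z (y i).
have := ler_wpM2l xz w1; have := ler_wpM2l xw z2; have := ler_wpM2l wz x2.
have gE : gap / c * c = gap by rewrite divfK // gt_eqF.
move: gE; rewrite /c; move: (gap / c) e0 => e e0 gE h1 h2 h3.
have : gap * hsin o (y i) <= e * (hsin x z + hsin x w + hsin w z) * hsin o (y i).
  by rewrite /gap; move: pt h1 h2 h3; rewrite (mulrC (hsin x (y i))); lra.
by rewrite ler_pM2r // -gE; lra.
Qed.

Lemma busemann_cocycle (g : isom X) x :
  (forall e, 0 < e -> exists2 A, F A & forall i, A i -> 0 < hsin o (isomV g (y i)) /\
    hsin (y i) (isomV g (y i)) <= e * (hsin o (y i) * hsin o (isomV g (y i)))) ->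
  busemann (g x) = busemann x * busemann (g o).
Proof.
move=> H; apply: busemann_eq => e e0.
have gE v i : hsin (g v) (y i) = hsin v (isomV g (y i)).
  by rewrite /hsin -{1}(isomVK g (y i)) isom_mdist.
pose b := busemann (g o); pose c := (hsin x o + busemann x + 1) * (b + 1) + b + 1.
have b0 : 0 <= b := busemann_ge0 _; have x0 := busemann_ge0 x; have xo := hsin_ge0 x o.
have c1 : 1 <= c by rewrite /c; nra.
pose e1 := Num.min (e / c) 1.
have ec : 0 < e / c by rewrite divr_gt0 //; lra.
have e10 : 0 < e1 by rewrite lt_min ec ltr01.
have e11 : e1 <= 1 by rewrite ge_min lexx orbT.
have e1c : e1 * c <= e by rewrite -ler_pdivlMr ?ge_min ?lexx //; lra.
have [A FA AP] := H e1 e10.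
apply: filterS (filterI FA (filterI (busemannP x e10) (busemannP (g o) e10))).
move=> i /= [Ai [[ai hx] [_ ho]]] _; have [vi uvi] := AP i Ai.
have pt1 := ptolemy cat x o (y i) (isomV g (y i)).
have pt2 := ptolemy cat x o (isomV g (y i)) (y i).
rewrite gE; move: ho; rewrite gE -/b.
rewrite (hsinC (isomV g (y i)) (y i)) in pt2.
have xo1 := ler_wpM2l xo uvi.
move: pt1 pt2 hx xo1 ai vi; move: (hsin x (y i)) (hsin x (isomV g (y i))) (hsin o (y i))
  (hsin o (isomV g (y i))) (hsin (y i) (isomV g (y i))) => U V a a' D pt1 pt2 hx xo1 a0 a0' ho.
rewrite -(ler_pM2r a0).
have -> : `|V - busemann x * b * a| * a = `|(V - busemann x * b * a) * a|.
  by rewrite normrM (gtr0_norm a0).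
have -> : (V - busemann x * b * a) * a =
  (V * a - U * a') + (U - busemann x * a) * a' + busemann x * (a' - b * a) * a by ring.
move: hx ho; rewrite !ler_norml => /andP[x1 x2] /andP[k1 k2].
have a'b : a' <= (b + 1) * a by have := ler_wpM2r (ltW a0) e11; lra.
have aa : 0 <= a * a by rewrite mulr_ge0 // ltW.
have tot : e1 * (hsin x o * a' * a + a' * a + busemann x * (a * a)) <= e * a * a.
  apply: (@le_trans _ _ (e1 * c * (a * a))); last by rewrite -[e * a * a]mulrA ler_wpM2r.
  have := ler_wpM2r (ltW a0) (ler_wpM2l xo a'b); have := ler_wpM2r (ltW a0) a'b.
  rewrite /c => m1 m2; rewrite -[X in _ <= X]mulrA ler_wpM2l ?(ltW e10) //.
  by have := mulr_ge0 (mulr_ge0 x0 b0) aa; have := mulr_ge0 b0 aa; lra.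
have p1 := ler_wpM2r (ltW a0') x1; have p2 := ler_wpM2r (ltW a0') x2.
have p3 := ler_wpM2r (ltW a0) (ler_wpM2l x0 k1); have p4 := ler_wpM2r (ltW a0) (ler_wpM2l x0 k2).
by apply/andP; split; lra.
Qed.

End Busemann.

Section Orbit.
Local Open Scope classical_set_scope.
Local Open Scope group_scope.
Variables (R : realType) (X : metricType R) (G : groupType) (act : {multiplicative G -> isom X}) (o : X).
Hypothesis cat : CAT_minus_1 X.
Variables (S : seq G).
Hypothesis Ssym : forall s, s \in S -> s^-1 \in S.
Hypothesis Sgen : forall P : G -> Prop,
  P 1 -> (forall g s, s \in S -> P g -> P (g * s)) -> forall g, P g.

Definition pt (g : G) : X := act g o.
Definition disp (g : G) : R := mdist o (pt g).
Definition size_of (g : G) : R := hsin o (pt g).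

(** The Poincare series converges at an exponent less than one. *)
Variables (s M : R).
Hypothesis s0 : (0 < s)%R.
Hypothesis s1 : (s < 1)%R.
Hypothesis sumM : forall p : seq G, uniq p -> (\sum_(g <- p) expR (- s * disp g) <= M)%R.

Let actM g h x : act (g * h) x = act g (act h x). Proof. by rewrite gmulfM. Qed.
Let act1 : act 1 = 1.
Proof. by apply: (mulgI (act 1)); rewrite -gmulfM !mulg1. Qed.
Let actV g : act g^-1 = isomV (act g).
Proof. by apply: (mulgI (act g)); rewrite -gmulfM mulgV act1; apply/esym; exact: (mulgV (act g)). Qed.
Lemma pt1 : pt 1 = o. Proof. by rewrite /pt act1. Qed.
Lemma ptM g h : pt (g * h) = act g (pt h). Proof. exact: actM. Qed.

Lemma hsin_act (f : isom X) x y : hsin (f x) (f y) = hsin x y.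
Proof. by rewrite /hsin isom_mdist. Qed.

Lemma hsin_pt g h : hsin (pt g) (pt h) = size_of (g^-1 * h).
Proof. by rewrite -(hsin_act (act g^-1)) -!ptM mulVg pt1. Qed.

Lemma dispV g : disp g^-1 = disp g.
Proof.
rewrite /disp -(isom_mdist (act g)) -ptM mulgV pt1 metric_sym; congr mdist.
Qed.

Lemma size_ofV g : size_of g^-1 = size_of g.
Proof. by have := dispV g; rewrite /disp /size_of /hsin => ->. Qed.

Lemma size_ge0 g : (0 <= size_of g)%R. Proof. exact: hsin_ge0. Qed.

Lemma disp_ge0 g : (0 <= disp g)%R. Proof. exact: mdist_ge0. Qed.

Lemma disp_mul g h : (disp (g * h) <= disp g + disp h)%R.
Proof.
apply: le_trans (metric_triangle _ (pt g) _) _; rewrite lerD2l.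
by rewrite /disp ptM -[X in (_ <= X)%R](isom_mdist (act g)).
Qed.

Lemma finite_ball r : finite_set [set g | (disp g <= r)%R].
Proof.
apply: contrapT => inf.
have e0 : (0 < expR (- s * r))%R by exact: expR_gt0.
pose n := Num.truncn (M / expR (- s * r)).
have [A AP cA] := infinite_set_fset n.+1 inf.
have size_sum (p : seq G) c : (forall g, g \in p -> (c <= expR (- s * disp g))%R) ->
    (c * (size p)%:R <= \sum_(g <- p) expR (- s * disp g))%R.
  elim: p => [|g p IH] pc; first by rewrite big_nil mulr0.
  rewrite big_cons /= -natr1 mulrDr mulr1 addrC lerD // ?pc ?mem_head // IH // => h hp.
  by rewrite pc // inE hp orbT.
have : (expR (- s * r) * n.+1%:R <= M)%R.
  apply: le_trans (sumM (fset_uniq A)); apply: le_trans (size_sum A (expR (- s * r)) _).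
    by rewrite ler_wpM2l ?(ltW e0) // ler_nat.
  move=> g gA; rewrite ler_expR !mulNr lerN2 ler_wpM2l ?(ltW s0) //; exact: AP.
rewrite mulrC -ler_pdivlMr // leNgt => /negP; apply.
by rewrite /n truncnS_gt.
Qed.

Lemma sum_tail e : (0 < e)%R -> exists2 F : set G, finite_set F &
  forall p : seq G, uniq p -> (forall g, g \in p -> ~ F g) ->
    (\sum_(g <- p) expR (- s * disp g) <= e)%R.
Proof.
move=> e0; apply: contrapT => nF.
have H n : exists2 p : seq G, uniq p & (e * n%:R <= \sum_(g <- p) expR (- s * disp g))%R.
  elim: n => [|n [p up ple]]; first by exists [::]; rewrite // big_nil mulr0.
  have [q [uq dq qe]] : exists q : seq G, [/\ uniq q, forall g, g \in q -> g \notin p &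
      (e < \sum_(g <- q) expR (- s * disp g))%R].
    apply: contrapT => nq; apply: nF; exists [set` p]; first exact: finite_seq.
    move=> q uq dq; rewrite leNgt; apply/negP => lt; apply: nq; exists q; split=> // g /dq.
    by move=> /= np; apply/negP => gp; apply: np.
  exists (p ++ q); last by rewrite big_cat /= -natr1 mulrDr mulr1 lerD // ltW.
  rewrite cat_uniq up uq andbT /=; apply/hasPn => g /dq.
  by [].
have M0 : (0 <= M)%R by have := sumM (p := [::]) isT; rewrite big_nil.
have [p up le] := H (Num.truncn (M / e)).+1.
have := le_trans le (sumM up); rewrite mulrC -ler_pdivlMr // leNgt => /negP; apply.
by rewrite truncnS_gt.
Qed.

Lemma size_growth (H : set G) (C : R) : ~ forall n : nat,
  exists f : 'I_n * 'I_n -> G, injective f /\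
    forall x, H (f x) /\ (size_of (f x) <= C * n%:R)%R.
Proof.
move=> Hf; pose K := (1 + 2 * `|C|)%R; have K0 : (0 < K)%R by rewrite /K ltr_wpDr // mulr_ge0.
have K1 : (1 <= K)%R by rewrite /K lerDl mulr_ge0.
have bnd n : (0 < n)%N -> (expR (2 * (1 - s) * ln n%:R) <= M * expR (2 * s * ln K))%R.
  move=> n0; have [f [fi fP]] := Hf n; have nR : (0 < n%:R :> R)%R by rewrite ltr0n.
  have each x : (expR (- s * (2 * ln (K * n%:R))) <= expR (- s * disp (f x)))%R.
    rewrite ler_expR !mulNr lerN2 ler_wpM2l ?(ltW s0) //.
    have [_ le] := fP x; have d0 := disp_ge0 (f x).
    suff : (disp (f x) / 2 <= ln (K * n%:R))%R by lra.
    rewrite -ler_expR lnK ?posrE ?mulr_gt0 // -ch_add_sh.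
    have : (ch (disp (f x) / 2) <= 1 + sh (disp (f x) / 2))%R.
      have h0 : (0 <= sh (disp (f x) / 2))%R by rewrite sh_ge0 // divr_ge0.
      have := ch_sh (disp (f x) / 2); have := ch_gt0 (disp (f x) / 2).
      by move: (ch _) (sh _) h0 => c h; nra.
    have : (sh (disp (f x) / 2) <= `|C| * n%:R)%R.
      by apply: le_trans le _; rewrite ler_wpM2r ?ler0n // ler_norm.
    have : (1 <= n%:R :> R)%R by rewrite ler1n.
    rewrite /K mulrDl mul1r -mulrA; move: (`|C| * _)%R (ch _) (sh _) => a b c; lra.
  have : (expR (- s * (2 * ln (K * n%:R))) * (n * n)%:R <= M)%R.
    apply: le_trans (sumM (p := [seq f x | x <- enum {: 'I_n * 'I_n}]) _).
      rewrite big_map big_enum /= mulr_natr.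
      apply: (@le_trans _ _ (\sum_(x : 'I_n * 'I_n) expR (- s * (2 * ln (K * n%:R))))%R).
        by rewrite sumr_const card_prod card_ord.
      by apply: ler_sum => x _.
    by rewrite map_inj_uniq // enum_uniq.
  have -> : ((n * n)%:R = expR (2 * ln n%:R) :> R)%R.
    by rewrite mulr_natl mulr2n expRD lnK ?posrE // natrM.
  rewrite -expRD lnM ?posrE // => le.
  have -> : (2 * (1 - s) * ln n%:R = (- s * (2 * (ln K + ln n%:R)) + 2 * ln n%:R) + 2 * s * ln K)%R.
    by ring.
  by rewrite expRD ler_wpM2r // ltW // expR_gt0.
have M0 : (0 < M)%R.
  by have := bnd 1%N isT; rewrite ln1 mulr0 expR0; have := expR_gt0 (2 * s * ln K)%R; nra.
pose T := (ln (M * expR (2 * s * ln K)) / (2 * (1 - s)))%R.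
have t0 : (0 < 2 * (1 - s))%R by rewrite mulr_gt0 // subr_gt0.
pose n := (Num.truncn (expR T)).+1.
have nT : (expR T < n%:R)%R by exact: truncnS_gt.
have := bnd n isT; rewrite leNgt => /negP; apply.
rewrite -[X in (X < _)%R]lnK ?posrE ?mulr_gt0 ?expR_gt0 // ltr_expR.
rewrite -ltr_pdivrMl // mulrC -/T -[X in (X < _)%R]expRK ltr_ln ?posrE ?expR_gt0 //.
Qed.

(** If no cut splits [H], almost all of [H] lies in one component outside any finite
    set, and the convergence of the series makes [H] a Cauchy family. *)
Section Unsplit.
Variable H : set G.
Hypothesis H1 : H 1.
Hypothesis HV : forall g, H g -> H g^-1.
Hypothesis HM : forall g h, H g -> H h -> H (g * h).
Hypothesis H_inf : infinite_set H.
Hypothesis H_unsplit : forall A, ~ splits H A.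

Let F : set_system G := [set A | finite_set (H `\` A)].

Let F_filter : ProperFilter F.
Proof.
apply: Build_ProperFilter.
  by move=> F0; apply: H_inf; apply: sub_finite_set F0 => h Hh; split.
split.
- by rewrite /F /= setDT.
- by move=> A B FA FB; rewrite /F /= setDIr finite_setU.
- by move=> A B AB; apply: sub_finite_set => x [Hx nB]; split=> // /AB.
Qed.

Let edge (W : set G) : rel G := fun x y => `[< ~ W y /\ exists2 t, t \in S & y = x * t >].

Let edge_bound : exists2 W, finite_set W & exists C : R, forall x y, ~ W x -> edge W x y ->
  (0 < size_of y)%R /\
  (size_of (x^-1 * y) <= C * expR (- s * disp y) * (size_of x * size_of y))%R.
Proof.
pose C0 := (\sum_(t <- S) size_of t * expR (disp t / 2))%R.
exists [set g | (disp g <= 2)%R]; first exact: finite_ball.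
exists (16 * C0)%R => x y nx /asboolP[ny [t tS yE]].
have big g : ~ (disp g <= 2)%R -> (expR (disp g / 2) / 4 <= size_of g)%R.
  move=> /negP; rewrite -ltNge => d2; rewrite /size_of /hsin -/(disp g) sh_expR.
  have : (expR (- (disp g / 2)) <= expR (disp g / 2) / 2)%R.
    have e1 : (2 <= expR (disp g / 2) :> R)%R.
      by apply: le_trans (expR_ge1Dx _); lra.
    rewrite expRN; have e0 : (0 < expR (disp g / 2) :> R)%R by lra.
    rewrite -(ler_pM2l e0) mulfV ?gt_eqF //; nra.
  by lra.
have yx := big y ny; have xx := big x nx.
have epos (r : R) : (0 < expR r)%R by exact: expR_gt0.
have y0 : (0 < size_of y)%R by apply: lt_le_trans yx; rewrite divr_gt0.
split=> //; rewrite yE mulKg -yE.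
have tC : (size_of t * expR (disp t / 2) <= C0)%R.
  rewrite /C0 (big_rem t tS) /= lerDl; apply: sumr_ge0 => r _.
  by apply: mulr_ge0; [exact: size_ge0|exact: ltW].
have dy : (disp y <= disp x + disp t)%R by rewrite yE disp_mul.
have prod : (expR (disp y) * expR (- (disp t / 2)) / 16 <= size_of x * size_of y)%R.
  apply: (@le_trans _ _ ((expR (disp x / 2) / 4) * (expR (disp y / 2) / 4))%R).
    have -> : (expR (disp x / 2) / 4 * (expR (disp y / 2) / 4) =
       expR (disp x / 2 + disp y / 2) / 16 :> R)%R by rewrite expRD; field.
    by rewrite -expRD ler_pM2r // ler_expR; lra.
  by apply: ler_pM => //; rewrite divr_ge0 // ltW.
have es : (expR (- disp y) <= expR (- s * disp y))%R.
  by rewrite ler_expR mulNr lerN2 -[X in (_ <= X)%R]mul1r ler_wpM2r ?disp_ge0 // ltW.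
have C00 : (0 <= C0)%R by apply: le_trans tC; apply: mulr_ge0; [exact: size_ge0|exact: ltW].
have st : (size_of t <= C0 * expR (- (disp t / 2)))%R.
  by rewrite expRN -(ler_pM2r (epos (disp t / 2)%R)) divfK ?gt_eqF.
apply: le_trans st _.
have ee : (expR (disp y) * expR (- disp y) = 1 :> R)%R by rewrite -expRD subrr expR0.
have p0 : (0 <= size_of x * size_of y)%R by apply: mulr_ge0; exact: size_ge0.
apply: (@le_trans _ _ (16 * C0 * expR (- disp y) * (size_of x * size_of y))%R); last first.
  by rewrite ler_wpM2r // ler_wpM2l // mulr_ge0.
have := ler_wpM2l (mulr_ge0 (mulr_ge0 (ler0n R 16) C00) (ltW (epos (- disp y))%R)) prod.
move=> le; apply: le_trans le.
have -> : (16 * C0 * expR (- disp y) * (expR (disp y) * expR (- (disp t / 2)) / 16) =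
  C0 * (expR (disp y) * expR (- disp y)) * expR (- (disp t / 2)))%R by field.
by rewrite ee mulr1.
Qed.

Let conn_in (W : set G) x y := exists2 p, path (edge W) x p & y = last x p.

Let comp_cut W x : finite_set W -> ~ W x -> cut [set y | conn_in W x y].
Proof.
move=> fW nx.
have step y t : t \in S -> finite_set [set g | conn_in W x g /\ ~ conn_in W x (g * t)].
  move=> tS; apply: sub_finite_set (finite_mulr t fW) => g [[p px ->] nc] /=.
  apply: contrapT => nW; apply: nc; exists (rcons p (last x p * t)); last by rewrite last_rcons.
  by rewrite rcons_path px; apply/asboolP; split=> //; exists t.
move=> z; apply: (Sgen (P := fun z => finite_set [set g | conn_in W x g /\ ~ conn_in W x (g * z)])) z.
  by apply: (@sub_finite_set _ _ set0) => // g []; rewrite mulg1.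
move=> z t tS fz; apply: (@sub_finite_set _ _
  ([set g | conn_in W x g /\ ~ conn_in W x (g * z)] `|`
   [set g | [set g | conn_in W x g /\ ~ conn_in W x (g * t)] (g * z)])).
  move=> g [cg nc]; have [cz|ncz] := pselect (conn_in W x (g * z)); [right|by left].
  by split=> //; rewrite -mulgA.
by rewrite finite_setU; split=> //; apply: finite_mulr; exact: step.
Qed.

Let one_component W : finite_set W -> exists x, ~ W x /\ finite_set (H `\` [set y | conn_in W x y]).
Proof.
move=> fW0; have [W' [fW' W'1 WW']] : exists W', [/\ finite_set W', W' 1 & W `<=` W'].
  exists (W `|` [set 1]); split; [by rewrite finite_setU; split=> //; exact: finite_set1|by right|by left].
have cmono x y : conn_in W' x y -> conn_in W x y.
  move=> [p px ->]; exists p => //; apply: sub_path px => a b /asboolP[nW' e].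
  by apply/asboolP; split=> // /WW'.
suff [x [nx fx]] : exists x, ~ W' x /\ finite_set (H `\` [set y | conn_in W' x y]).
  exists x; split; first by move=> /WW'.
  by apply: sub_finite_set fx => y [Hy nc]; split=> // /cmono.
pose B := [set y | exists2 w, W' w & exists2 t, t \in S & y = w * t] `\` W'.
have fB : finite_set B.
  apply: sub_finite_set (_ : finite_set [set y | exists2 t, [set` S] t & ((fun w => w * t) @` W') y]).
    by move=> y [[w Ww [t tS ->]] _]; exists t => //; exists w.
  by apply: finite_bigU => [|t _]; [exact: finite_seq|exact: finite_image].
have cover g : W' g \/ exists2 y, B y & conn_in W' y g.
  apply: (Sgen (P := fun g => W' g \/ exists2 y, B y & conn_in W' y g)) g; first by left.
  move=> g t tS IH; have [Wgt|nWgt] := pselect (W' (g * t)); [by left|right].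
  have [Wg|[y By [p py gE]]] := IH.
    by exists (g * t); [split=> //; exists g => //; exists t|exists [::]].
  exists y => //; exists (rcons p (g * t)); last by rewrite last_rcons.
  by rewrite rcons_path py -gE; apply/asboolP; split=> //; exists t.
have [x Bx ix] : exists2 x, B x & infinite_set (H `&` [set y | conn_in W' x y]).
  apply: contrapT => nx; apply: H_inf; apply: (@sub_finite_set _ _
    (W' `|` [set h | exists2 y, B y & (H `&` [set z | conn_in W' y z]) h])).
    by move=> h Hh; have [Wh|[y By yh]] := cover h; [left|right; exists y].
  rewrite finite_setU; split=> //; apply: finite_bigU => // y By.
  by apply: contrapT => iy; apply: nx; exists y.
have [_ nx] := Bx; exists x; split=> //; apply: contrapT => iC.
by apply: (H_unsplit (A := [set y | conn_in W' x y])); split=> //; exact: comp_cut.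
Qed.

Let F_cauchy e : (0 < e)%R -> exists2 A, F A & forall i j, A i -> A j ->
  (0 < hsin o (pt i))%R /\ (hsin (pt i) (pt j) <= e * (hsin o (pt i) * hsin o (pt j)))%R.
Proof.
move=> e0; have [W fW [C CP]] := edge_bound.
have [W2 fW2 tail] : exists2 W2, finite_set W2 & forall p : seq G, uniq p ->
    (forall g, g \in p -> ~ W2 g) -> (\sum_(g <- p) C * expR (- s * disp g) <= e / 2)%R.
  have c0 : (0 < `|C| + 1)%R by rewrite ltr_wpDl.
  have [W2 fW2 W2P] := sum_tail (divr_gt0 (divr_gt0 e0 (@ltr0Sn R 1)) c0).
  exists W2 => // p up pW; rewrite -mulr_sumr.
  have le := W2P p up pW; have q0 : (0 <= \sum_(g <- p) expR (- s * disp g))%R.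
    by apply: sumr_ge0 => g _; exact: ltW (expR_gt0 _).
  move: le; rewrite ler_pdivlMr // => le; apply: le_trans le.
  by rewrite mulrC ler_wpM2l // ler_wpDr // ler_norm.
pose V := W `|` W2 `|` [set g | (disp g <= 0)%R].
have fV : finite_set V by rewrite !finite_setU; split; [split|exact: finite_ball].
have apos g : ~ V g -> (0 < size_of g)%R.
  move=> nV; rewrite /size_of /hsin sh_gt0 // divr_gt0 //.
  by rewrite ltNge; apply/negP => le; apply: nV; right.
have [x [nx fx]] := one_component fV.
have chain p z : ~ V z -> path (edge V) z p ->
    (size_of (z^-1 * last z p) <= (\sum_(g <- p) C * expR (- s * disp g)) * (size_of z * size_of (last z p)))%R.
  elim: p z => [|y p IH] z nz /=.
    by rewrite mulVg big_nil mul0r /size_of pt1 hsinxx.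
  move=> /andP[zy yp]; have /asboolP[ny ey] := zy.
  have Ezy : edge W z y by apply/asboolP; split=> // Wy; apply: ny; left; left.
  have nWz : ~ W z by move=> Wz; apply: nz; left; left.
  have [y0 le1] := CP z y nWz Ezy; have le2 := IH y ny yp.
  rewrite big_cons; set Q := (\sum_(g <- p) _)%R in le2 *; set c := (C * _)%R in le1 *.
  have lastV : ~ V (last y p).
    by case/lastP: p yp {IH le2 Q} => [//|p v]; rewrite rcons_path last_rcons => /andP[_ /asboolP[]].
  have := ptolemy cat (pt z) (pt y) (pt (last y p)) o.
  rewrite !hsin_pt ![hsin _ o]hsinC -!/(size_of _) => pto.
  have zl := apos _ lastV; have z0 := apos _ nz.
  rewrite -(ler_pM2r y0); apply: le_trans pto _.
  have := ler_wpM2r (ltW zl) le1; have := ler_wpM2l (ltW z0) le2; lra.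
have conn_e i : conn_in V x i -> ~ V i /\ (size_of (x^-1 * i) <= e / 2 * (size_of x * size_of i))%R.
  move=> [p px ->]; case/shortenP: px => q xq /= /andP[xnq uq] _; split.
    case/lastP: q xq {xnq uq} => [//|q v]; rewrite rcons_path last_rcons => /andP[_ /asboolP[]].
    by [].
  apply: le_trans (chain q x nx xq) _; apply: ler_wpM2r.
    by apply: mulr_ge0; exact: size_ge0.
  apply: tail => // g gq W2g.
  have [u [v [_ eg]]] : exists u v, q = u ++ g :: v /\ edge V (last x u) g.
    by case/splitPr: gq xq => u v; rewrite cat_path /= => /and3P[_ eg _]; exists u, v.
  by move/asboolP: eg => [nVg _]; apply: nVg; left; right.
exists [set i | conn_in V x i] => // i j ci cj.
have [nVi xi] := conn_e i ci; have [nVj xj] := conn_e j cj.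
have i0 := apos _ nVi; have j0 := apos _ nVj; have x0 := apos _ nx.
split; first exact: i0.
have := ptolemy cat (pt i) (pt x) (pt j) o.
rewrite !hsin_pt ![hsin _ o]hsinC -!/(size_of _) => pto.
rewrite -[size_of (i^-1 * x)]size_ofV !grpE in pto.
rewrite -(ler_pM2r x0); apply: le_trans pto _.
have := ler_wpM2r (ltW j0) xi; have := ler_wpM2r (ltW i0) xj; lra.
Qed.

Let lam := busemann F o pt.

Let lamM g h : H g -> lam (pt (g * h)) = (lam (pt h) * lam (pt g))%R.
Proof.
move=> Hg; rewrite ptM; apply: (busemann_cocycle cat (FF := F_filter) F_cauchy) => e e0.
have [A FA AP] := F_cauchy e0.
exists (A `&` [set i | A (g^-1 * i)]).
  rewrite /F /= setDIr finite_setU; split=> //.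
  apply: sub_finite_set (finite_image (fun i => g * i) FA) => i [Hi nA].
  by exists (g^-1 * i); [split=> //; apply: HM => //; exact: HV|rewrite !grpE].
move=> i [Ai Agi]; rewrite -actV -ptM; have [ai le] := AP _ _ Ai Agi.
by have [agi _] := AP _ _ Agi Agi.
Qed.

Let lam1 : lam (pt 1) = 1%R.
Proof. by rewrite pt1; exact: (busemann_base cat (FF := F_filter) F_cauchy). Qed.

Let lam_one h : H h -> lam (pt h) = 1%R.
Proof.
move=> Hh; have HX n : H (h ^+ n) by elim: n => // n IH; rewrite expgS; exact: HM.
have lamX n : lam (pt (h ^+ n)) = (lam (pt h) ^+ n)%R.
  elim: n => [|n IH]; first by rewrite expg0 lam1.
  by rewrite expgSr lamM // IH exprS.
have l0 : (0 <= lam (pt h))%R by exact: (busemann_ge0 cat (FF := F_filter) F_cauchy).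
have [inj|ninj] := pselect (injective (fun n => h ^+ n)); last first.
  have [n n0 hn] : exists2 n, (0 < n)%N & h ^+ n = 1.
    apply: contrapT => nn; apply: ninj.
    have key k l : (k < l)%N -> h ^+ k <> h ^+ l.
      move=> kl e; apply: nn; exists (l - k)%N; first by rewrite subn_gt0.
      by apply: (mulgI (h ^+ k)); rewrite -expgnDr subnKC ?(ltnW kl) // mulg1.
    by move=> k l e; have [/key|/key|//] := ltngtP k l; case.
  have e1 : (lam (pt h) ^+ n == 1)%R by rewrite -lamX hn lam1.
  by move: e1; rewrite (pexpr_eq1 n0 l0) => /eqP.
(* the powers of [h] and those of its inverse tend to the same point, so the ratio
   of consecutive sizes tends both to the multiplier and to its inverse *)
have near (P : set G) : F P -> exists N, forall n, (N <= n)%N -> P (h ^+ n) /\ P (h ^- n).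
  move=> FP; have fin : finite_set [set n | ~ P (h ^+ n) \/ ~ P (h ^- n)].
    apply: (@sub_finite_set _ _ ((fun n => h ^+ n) @^-1` (H `\` P) `|`
      (fun n => h ^- n) @^-1` (H `\` P))).
      by move=> n [nP|nP]; [left|right]; split=> //; exact: HV.
    rewrite finite_setU; split; apply: finite_preimage FP => i j _ _ //.
      exact: inj.
    by move=> /(congr1 (fun g => g^-1)); rewrite !invgK => /inj.
  have /finite_seqP[sq sqE] := fin; exists (\max_(k <- sq) k).+1 => n Nn.
  have nbad : ~ [set n | ~ P (h ^+ n) \/ ~ P (h ^- n)] n.
    rewrite sqE => /= nsq; have : (id n <= \max_(k <- sq) id k)%N by exact: leq_bigmax_seq.
    by rewrite leqNgt Nn.
  by split; apply: contrapT => nP; apply: nbad; [left|right].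
have ratio e : (0 < e)%R -> exists N, forall n, (N <= n)%N ->
    [/\ (0 < size_of (h ^+ n))%R,
        (`|size_of (h ^+ n.+1) - lam (pt h) * size_of (h ^+ n)| <= e * size_of (h ^+ n))%R &
        (`|size_of (h ^+ n) - lam (pt h) * size_of (h ^+ n.+1)| <= e * size_of (h ^+ n.+1))%R].
  move=> e0; have [N NP] := near _ (busemannP cat (FF := F_filter) F_cauchy (pt h) e0).
  exists N => n Nn; have [_ [/= a0 le1]] := NP n Nn.
  have [[a1 le2] _] := NP n.+1 (leqW Nn).
  move: a0 le1 le2; rewrite -!/(size_of _) !hsin_pt size_ofV => a0.
  rewrite -[size_of (h^-1 * h ^- n)]size_ofV !grpE -expgSr expgS mulKg -expgS => le1 le2.
  by split.
apply/eqP; rewrite eq_le; apply/andP; split; rewrite leNgt; apply/negP => lt.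
  pose e := ((lam (pt h) - 1) / 2)%R; have e0 : (0 < e)%R by rewrite divr_gt0 // subr_gt0.
  have [N NP] := ratio e e0; have [a0 le1 le2] := NP N (leqnn N).
  have b0 := size_ge0 (h ^+ N.+1).
  move: le1 le2; rewrite !ler_norml => /andP[l1 _] /andP[l2 _].
  have : (0 < (lam (pt h) - 1) * (size_of (h ^+ N) + size_of (h ^+ N.+1)))%R.
    by rewrite mulr_gt0 ?subr_gt0 // ltr_wpDr.
  by move: l1 l2; rewrite /e; lra.
pose e := ((1 - lam (pt h)) / 2)%R; have e0 : (0 < e)%R by rewrite divr_gt0 // subr_gt0.
have [N NP] := ratio e e0; have [a0 le1 le2] := NP N (leqnn N).
have b0 := size_ge0 (h ^+ N.+1).
move: le1 le2; rewrite !ler_norml => /andP[_ l1] /andP[_ l2].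
have : (0 < (1 - lam (pt h)) * (size_of (h ^+ N) + size_of (h ^+ N.+1)))%R.
  by rewrite mulr_gt0 ?subr_gt0 // ltr_wpDr.
by move: l1 l2; rewrite /e; lra.
Qed.

(** As the limit point is fixed and the multipliers are trivial, Ptolemy's inequality
    with the fourth point at infinity is the triangle inequality for [size_of].
    The multipliers are trivial because the powers of an element and of its inverse
    tend to the same point. *)
Theorem unsplit_subadditive g h : H g -> H h -> (size_of (g * h) <= size_of g + size_of h)%R.
Proof.
move=> Hg Hh; have := busemann_ptolemy cat (FF := F_filter) F_cauchy o (pt g) (pt (g * h)).
rewrite -/lam !lam_one //; last exact: HM.
have -> : lam o = 1%R by exact: (busemann_base cat (FF := F_filter) F_cauchy).
by rewrite !mulr1 hsin_pt mulKg.
Qed.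

End Unsplit.

(** An infinite vertex stabilizer that no cut splits would be virtually cyclic by the
    growth of [size_of], but then it is split. *)
Theorem vertex_splits (c : nat -> set G) n H : nested_system (orb c `I_n) ->
  vst (orb c `I_n) H -> infinite_set H -> exists A, splits H A.
Proof.
move=> nsE vH iH; apply: contrapT => nA.
have [H1 HV HM] := vst_group vH.
have sub := unsplit_subadditive H1 HV HM iH (fun A sA => nA (ex_intro _ A sA)).
have [rho cr] := vst_coarse_retraction nsE vH.
have [SH [SHH _ SHgen]] := retract_generated Sgen H1 HV HM cr.
have p1 : size_of 1 = 0%R by rewrite /size_of pt1 hsinxx.
have gr C := @size_growth H C.
have [a Ha ainj] := ex_infinite_order H1 HM SHH SHgen iH p1 size_ge0 sub gr.
have [X0 fX XP] := virtually_Z H1 HM SHH SHgen p1 size_ge0 sub gr Ha ainj.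
by apply: nA; exact: (virtually_Z_splits H1 HV HM cr Ha ainj fX XP).
Qed.
End Orbit.

(** * Groups from trees *)

Section Constructions.
Local Open Scope classical_set_scope.
Local Open Scope group_scope.

Section Subgroup.
Variables (G : groupType) (P : set G).
Hypotheses (P1 : P 1) (PV : forall g, P g -> P g^-1)
  (PM : forall g h, P g -> P h -> P (g * h)).
Let mem : {pred G} := fun x => `[< P x >].
Let memM : mulg_closed mem.
Proof. by move=> x y /asboolP Px /asboolP Py; apply/asboolP; exact: PM. Qed.
Let mem1 : (1%g : G) \in mem. Proof. exact/asboolP. Qed.
Let memV : invg_closed mem.
Proof. by move=> x /asboolP Px; apply/asboolP; exact: PV. Qed.
Definition subgroup_of : groupClosed G :=
  HB.pack_for (groupClosed G) mem (isMulClosed.Build _ _ memM)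
    (isMul1Closed.Build _ _ mem1) (isInvClosed.Build _ _ memV).
Lemma subgroup_ofE x : (x \in subgroup_of) = `[< P x >].
Proof. by []. Qed.
End Subgroup.

Variables (G H : groupType) (f : G -> H) (fM : {morph f : x y / x * y}).
Definition hom_of : {multiplicative G -> H} :=
  HB.pack_for {multiplicative G -> H} f (isMultiplicative.Build G H f fM).
Lemma hom_ofE x : hom_of x = f x. Proof. by []. Qed.

End Constructions.

Section ParentTree.
Variables (Y : fin_graph) (T : {set gedge Y}) (r : gvert Y) (rk : gvert Y -> nat)
  (par : gvert Y -> gvert Y) (eps : gvert Y -> gedge Y).
Hypothesis par_lt : forall j, j != r -> (rk (par j) < rk j)%N.
Hypothesis eps_T : forall j, j != r -> eps j \in T.
Hypothesis eps_ends : forall j, j != r ->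
  gsrc (eps j) = j /\ gtgt (eps j) = par j \/ gsrc (eps j) = par j /\ gtgt (eps j) = j.
Hypothesis T_eps : forall e, e \in T -> exists2 j, j != r & e = eps j.

Let up (a : gedge Y * bool) := (rk (edge_tgt a) < rk (edge_src a))%N.

Let stepP a : a.1 \in T -> exists2 j, j != r & a.1 = eps j /\
  (if up a then edge_src a = j /\ edge_tgt a = par j else edge_src a = par j /\ edge_tgt a = j).
Proof.
case: a => e b /= /T_eps[j jr ->]; exists j => //; split=> //; rewrite /up /edge_src /edge_tgt /=.
have lt := par_lt jr; have ge : (rk j < rk (par j))%N = false by rewrite ltnNge (ltnW lt).
by case: (eps_ends jr) => -[-> ->]; case: b; rewrite ?lt ?ge.
Qed.

(* after a step away from the root, the only step towards it goes back *)
Let down_up a b : a.1 \in T -> b.1 \in T -> ~~ up a -> up b -> edge_tgt a = edge_src b ->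
  b = (a.1, ~~ a.2).
Proof.
move=> aT bT nua ub ab.
have [j jr [aE ]] := stepP aT; rewrite (negbTE nua) => -[_ aj].
have [k kr [bE ]] := stepP bT; rewrite ub => -[bk _].
have jk : k = j by rewrite -bk -ab aj.
have e1 : b.1 = a.1 by rewrite bE aE jk.
case: a b e1 nua ub {aT bT ab aE aj bE bk} => [e b] [e' b'] /= ->.
by case: b b' => [] [] //; rewrite /up => /negP.
Qed.

Let down_path v s w : is_walk v s w -> walk_in T s -> no_backtracking s ->
  (if s is a :: _ then ~~ up a else false) -> (rk v < rk w)%N.
Proof.
elim: s v => [//|a s IH] v /= /andP[/eqP av sw] /andP[aT sT] nb nua.
have va : (rk v < rk (edge_tgt a))%N.
  have [j jr [_]] := stepP aT; rewrite (negbTE nua) => -[src tgt].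
  by rewrite -av src tgt; exact: par_lt.
case: s IH sw sT nb => [|b s] IH sw sT nb; first by move: sw => /= /eqP <-.
apply: ltn_trans va (IH _ sw sT _ _); first by move: nb => /= /andP[].
apply/negP => ub; move: sw => /= /andP[/eqP ba _]; move: sT => /= /andP[bT _].
by move: nb; rewrite /= (down_up aT bT nua ub (esym ba)) eqxx.
Qed.

Let up_or_last v s w : s <> [::] -> is_walk v s w -> walk_in T s -> no_backtracking s ->
  (if s is a :: _ then up a else false) /\ (rk w < rk v)%N \/ exists s' b, s = rcons s' b /\ ~~ up b.
Proof.
elim: s v => [//|a s IH] v _ /= /andP[/eqP av sw] /andP[aT sT] nb.
case: s IH sw sT nb => [|b s] IH sw sT nb.
  case ua : (up a); last by right; exists [::], a; rewrite ua.
  by left; split=> //; move: sw ua => /= /eqP <-; rewrite -av.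
have nb' : no_backtracking (b :: s) by move: nb => /= /andP[].
have [[ub lt]|[s' [x [-> ux]]]] := IH _ (fun e => ltac:(discriminate e)) sw sT nb'; last first.
  by right; exists (a :: s'), x.
case ua : (up a).
  by left; split=> //; apply: ltn_trans lt _; rewrite -av.
move: sw sT => /= /andP[/eqP ba _] /andP[bT _].
by move: nb; rewrite /= (down_up aT bT (negbT ua) ub (esym ba)) eqxx.
Qed.

Let walk_cat (v : gvert Y) s w s' u : is_walk v s w -> is_walk w s' u -> is_walk v (s ++ s') u.
Proof.
elim: s v => [|a s IH] v /=; first by move=> /eqP->.
by move=> /andP[-> sw] /(IH _ sw).
Qed.

Let walk_split (v : gvert Y) s a u : is_walk v (rcons s a) u -> is_walk v s (edge_src a) /\ edge_tgt a = u.
Proof.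
elim: s v => [|b s IH] v /=; first by move=> /andP[/eqP-> /eqP->].
by move=> /andP[-> /IH[-> ->]].
Qed.

(** Following parents joins every vertex to the root. A path without backtracking goes
    down towards the root first and then away from it, so it is not closed. *)
Theorem parents_maximal_tree : maximal_tree T.
Proof.
split; first by exists r.
- have to_root j : exists2 s, is_walk j s r /\ is_walk r (rev [seq (a.1, ~~ a.2) | a <- s]) j & walk_in T s.
    have [n] := ubnP (rk j); elim: n j => // n IH j; rewrite ltnS => jn.
    have [->|jr] := eqVneq j r; first by exists [::] => //; split; exact: eqxx.
    have [s [s1 s2] sT] := IH _ (leq_trans (par_lt jr) jn).
    have [b [bj bp]] : exists b, edge_src (eps j, b) = j /\ edge_tgt (eps j, b) = par j.
      by case: (eps_ends jr) => -[e1 e2]; [exists true|exists false]; rewrite /edge_src /edge_tgt.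
    exists ((eps j, b) :: s); last by rewrite /= eps_T.
    split; first by rewrite /= bj bp eqxx.
    rewrite /= rev_cons -cats1; apply: (walk_cat s2).
    rewrite /= /edge_src /edge_tgt /= in bj bp *.
    by case: b bj bp => /= -> ->; rewrite !eqxx.
  move=> v w; have [s [s1 _] sT] := to_root v; have [s' [_ s2] s'T] := to_root w.
  exists (s ++ rev [seq (a.1, ~~ a.2) | a <- s']); first exact: walk_cat s1 s2.
  by rewrite /walk_in all_cat all_rev all_map; apply/andP; split; [exact: sT|exact: s'T].
move=> v s; have [n] := ubnP (size s); elim: n v s => // n IH v s; rewrite ltnS => sn sw sT nb.
have [//|s0] := eqVneq s [::]; have [[ua lt]|[s' [b [sE ub]]]] := up_or_last (elimN eqP s0) sw sT nb.
  by rewrite ltnn in lt.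
case: s sE s0 sw sT nb sn => [//|a s1] sE _ sw sT nb sn.
have ua : up a.
  by apply: contraT => nua; have := down_path sw sT nb nua; rewrite ltnn.
case: s' sE => [[aE _]|a' s2 [aE s1E]]; first by rewrite -aE ua in ub.
rewrite s1E in sw sT nb sn.
move: sw sT => /= /andP[/eqP av /walk_split[w2 bv]]; rewrite /walk_in /= all_rcons => /and3P[aT bT s2T].
have [j jr [aj]] := stepP aT; rewrite ua => -[sj tj].
have [k kr [bk]] := stepP bT; rewrite (negbTE ub) => -[sk tk].
have jk : k = j by rewrite -tk bv -av sj.
rewrite tj sk jk in w2.
have nb2 : no_backtracking s2.
  by move: nb; rewrite /no_backtracking /= => /path_sorted; rewrite -cats1; exact: sorted_catl || move=> /cat_sorted2[].
have s20 : s2 = [::].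
  by apply: (IH (par j)) => //; move: sn; rewrite /= size_rcons; apply: ltn_trans.
move: nb; rewrite s20 /= andbT => /negP; case.
have key d c c' : up (d, c) -> ~~ up (d, c') -> c' = ~~ c.
  by case: c c' => [] []; rewrite /up /edge_src /edge_tgt //= => ->.
apply/eqP; rewrite [b]surjective_pairing bk jk -aj; congr (_, _); apply: (key a.1).
  by rewrite -surjective_pairing.
by rewrite aj -jk -bk -surjective_pairing.
Qed.

End ParentTree.

Section TreeGroups.
Local Open Scope classical_set_scope.
Local Open Scope group_scope.
Variables (G : groupType) (V B : Type) (av : G -> V -> V) (ae : G -> B -> B)
  (isE : set B) (src tgt : B -> V).
Hypothesis T : gtree av ae isE src tgt.

Let stab x := estab av x.
Let stabM x g h : stab x g -> stab x h -> stab x (g * h).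
Proof. by move=> gx hx; rewrite /stab /estab /= (gt_avM T) hx. Qed.
Let stab1 x : stab x 1. Proof. exact: (gt_av1 T). Qed.
Let avK g x : av g^-1 (av g x) = x.
Proof. by rewrite -(gt_avM T) mulVg (gt_av1 T). Qed.
Let stabV x g : stab x g -> stab x g^-1.
Proof. by move=> gx; rewrite /stab /estab /= -{1}gx avK. Qed.

(** A choice of representatives of the orbits: [x] for the vertices, [e] for the
    edges, with the source of [e i] among the former. *)
Record tree_domain m n (x : 'I_m -> V) (e : 'I_n -> B) (sv tv : 'I_n -> 'I_m)
    (t : 'I_n -> G) : Prop := TreeDomain {
  td_inj : forall v w g, x v = av g (x w) -> v = w;
  td_vert : forall v, exists2 f, isE f & x v = src f \/ x v = tgt f;
  td_E : forall i, isE (e i);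
  td_onto : forall f, isE f -> exists i g, f = ae g (e i);
  td_einj : forall i j g, e i = ae g (e j) -> i = j;
  td_src : forall i, src (e i) = x (sv i);
  td_tgt : forall i, tgt (e i) = av (t i) (x (tv i)) }.

Section Domain.
Variables (m n : nat) (x : 'I_m -> V) (e : 'I_n -> B) (sv tv : 'I_n -> 'I_m) (t : 'I_n -> G).
Hypothesis D : tree_domain x e sv tv t.
Variables (i0 : 'I_n).

Let same v h k : av h (x v) = av k (x v) -> stab (x v) (k^-1 * h).
Proof. by move=> hk; rewrite /stab /estab /= (gt_avM T) hk avK. Qed.

Let ends (P : V -> Prop) :
  (forall h i, P (av h (x (sv i))) <-> P (av (h * t i) (x (tv i)))) ->
  forall v h, (exists2 f, isE f & av h (x v) = src f \/ av h (x v) = tgt f) ->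
  P (x (sv i0)) -> P (av h (x v)).
Proof.
move=> H v h [f Ef vf] P0.
have PE b : isE b -> P (src b) <-> P (tgt b).
  move=> /(td_onto D)[i [g ->]]; rewrite (gt_src T g (td_E D i)) (gt_tgt T g (td_E D i)).
  by rewrite (td_src D) (td_tgt D) -(gt_avM T); exact: H.
have P0' : P (src (e i0)) by rewrite (td_src D).
have Pf := gt_conn T PE (td_E D i0) Ef P0'.
by case: vf => ->; [|apply/(PE f Ef)].
Qed.

(** Connectedness of the tree: the translates of the representatives by the subgroup
    generated form a subset closed under adjacency. *)
Theorem tree_generated (Q : G -> Prop) :
  Q 1 -> (forall g h, Q g -> Q h -> Q (g * h)) -> (forall g, Q g -> Q g^-1) ->
  (forall v a, stab (x v) a -> Q a) -> (forall i, Q (t i)) -> forall g, Q g.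
Proof.
move=> Q1 QM QV Qstab Qt g.
pose P y := exists v k, y = av k (x v) /\ Q k.
have [|||v [k [gE Qk]]] := @ends P _ (sv i0) g _ _.
- have step i u k : Q u -> av k (x i) = av u (x i) -> Q k.
    move=> Qu ku; rewrite -(mulVKg u k); apply: QM => //.
    exact: Qstab (same ku).
  move=> h i; split=> -[v [k [hE Qk]]].
    have vE : v = sv i by apply/esym/(@td_inj _ _ _ _ _ _ _ D _ _ (h^-1 * k)); rewrite (gt_avM T) -hE avK.
    exists (tv i), (h * t i); split=> //; apply: QM => //.
    by apply: (step (sv i) k) => //; rewrite hE vE.
  have vE : v = tv i.
    by apply/esym/(@td_inj _ _ _ _ _ _ _ D _ _ ((h * t i)^-1 * k)); rewrite (gt_avM T) -hE avK.
  exists (sv i), h; split=> //; rewrite -(mulgK (t i) h); apply: QM; last exact: QV.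
  by apply: (step (tv i) k) => //; rewrite hE vE.
- exists (ae g (e i0)); first exact: (gt_isE T g (td_E D i0)).
  by left; rewrite (gt_src T g (td_E D i0)) (td_src D).
- by exists (sv i0), 1; rewrite (gt_av1 T).
have vE : v = sv i0 by apply/esym/(@td_inj _ _ _ _ _ _ _ D _ _ (g^-1 * k)); rewrite (gt_avM T) -gE avK.
rewrite -(mulVKg k g); apply: QM => //; apply: (Qstab v).
by apply: same; rewrite -gE vE.
Qed.

Section Homs.
Variables (L : groupType) (F : 'I_m -> G -> L) (s : 'I_n -> L).
Hypothesis FM : forall v a b, stab (x v) a -> stab (x v) b -> F v (a * b) = F v a * F v b.
Hypothesis compat : forall i a, estab ae (e i) a ->
  s i * F (tv i) ((t i)^-1 * a * t i) = F (sv i) a * s i.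

Let F1 v : F v 1 = 1.
Proof. by apply: (mulgI (F v 1)); rewrite -FM ?mulg1 //; exact: stab1. Qed.

(** The label of an edge says how the wanted morphism changes from one end to the
    other; a potential for these labels is the morphism up to a translation. *)
Lemma ex_developing : exists Psi : G -> 'I_m -> L,
  (forall g v a, stab (x v) a -> Psi (g * a) v = Psi g v * F v a) /\
  forall h i, Psi (h * t i) (tv i) = Psi h (sv i) * s i.
Proof.
have exg (p : V * 'I_m) : exists g, (exists g', p.1 = av g' (x p.2)) -> p.1 = av g (x p.2).
  have [[g' gE]|ng] := pselect (exists g', p.1 = av g' (x p.2)); first by exists g'.
  by exists 1 => /ng.
have [g0 g0P] := choice exg.
have gvP y v k : y = av k (x v) -> y = av (g0 (y, v)) (x v) by move=> ->; apply: (g0P (_, v)); exists k.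
have exe f : exists p : 'I_n * G, isE f -> f = ae p.2 (e p.1).
  have [/(td_onto D)[i [g fE]]|nE] := pselect (isE f); first by exists (i, g).
  by exists (i0, 1).
have [p pP] := choice exe.
pose lab f := let i := (p f).1 in let h := (p f).2 in
  F (sv i) ((g0 (src f, sv i))^-1 * h) * s i * (F (tv i) ((g0 (tgt f, tv i))^-1 * (h * t i)))^-1.
have [Phi PhiE] := gt_pot T lab.
pose Psi g v := Phi (av g (x v)) * F v ((g0 (av g (x v), v))^-1 * g).
have st g v : stab (x v) ((g0 (av g (x v), v))^-1 * g).
  by apply: same; rewrite -(gvP _ v g).
exists Psi; split=> [g v a ax|h i].
  have ga : av (g * a) (x v) = av g (x v) by rewrite (gt_avM T) ax.
  by rewrite /Psi ga mulgA FM // mulgA.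
set f := ae h (e i); have Ef : isE f by exact: (gt_isE T h (td_E D i)).
have sE : av h (x (sv i)) = src f by rewrite /f (gt_src T h (td_E D i)) (td_src D).
have tE : av (h * t i) (x (tv i)) = tgt f.
  by rewrite /f (gt_tgt T h (td_E D i)) (td_tgt D) (gt_avM T).
have fE := pP f Ef; have iE : (p f).1 = i.
  by apply/esym/(@td_einj _ _ _ _ _ _ _ D _ _ (h^-1 * (p f).2)); rewrite (gt_aeM T) -fE -(gt_aeM T) mulVg (gt_ae1 T).
set h' := (p f).2 in fE; rewrite iE in fE.
have st' : estab ae (e i) (h'^-1 * h).
  by rewrite /estab /= (gt_aeM T) -/f fE -(gt_aeM T) mulVg (gt_ae1 T).
have ss a : estab ae (e i) a -> stab (x (sv i)) a.
  by move=> ai; rewrite /stab /estab /= -(td_src D) -(gt_src T a (td_E D i)) ai.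
have ts a : estab ae (e i) a -> stab (x (tv i)) ((t i)^-1 * a * t i).
  move=> ai; rewrite /stab /estab /= !(gt_avM T) -(td_tgt D) -(gt_tgt T a (td_E D i)) ai.
  by rewrite (td_tgt D) avK.
have h'E : h = h' * (h'^-1 * h) by rewrite !grpE.
set a := h'^-1 * h in st' h'E.
have s1 : stab (x (sv i)) ((g0 (src f, sv i))^-1 * h').
  apply: same; rewrite -(gvP _ _ h) ?sE // -sE h'E (gt_avM T) (ss _ st').
  by [].
have t1 : stab (x (tv i)) ((g0 (tgt f, tv i))^-1 * (h' * t i)).
  apply: same; rewrite -(gvP _ _ (h * t i)) ?tE // -tE h'E.
  rewrite (_ : h' * a * t i = h' * t i * ((t i)^-1 * a * t i)); last by rewrite !grpE.
  have -> : av (h' * t i * ((t i)^-1 * a * t i)) (x (tv i)) = av (h' * t i) (x (tv i)).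
    by rewrite (gt_avM T) (ts _ st').
  by [].
rewrite /Psi sE tE (PhiE f Ef) /lab iE -/h'.
rewrite (_ : (g0 (tgt f, tv i))^-1 * (h * t i) =
  ((g0 (tgt f, tv i))^-1 * (h' * t i)) * ((t i)^-1 * a * t i)); last by rewrite {1}h'E !grpE.
rewrite (_ : (g0 (src f, sv i))^-1 * h = ((g0 (src f, sv i))^-1 * h') * a); last by rewrite {1}h'E !grpE.
have gen (q0 a0 s0 c0 d0 b0 : L) : s0 * d0 = b0 * s0 ->
    q0 * (a0 * s0 * c0^-1) * (c0 * d0) = q0 * (a0 * b0) * s0.
  by move=> sd; rewrite !mulgA mulgVK -[_ * s0 * d0]mulgA sd !mulgA.
rewrite (FM t1 (ts _ st')) (FM s1 (ss _ st')); exact: gen (compat st').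
Qed.

(** The universal property of the fundamental group: a potential for the prescribed
    labels is equivariant up to the wanted morphism, as the group acts on the set of
    potentials and two of them differ by a constant. *)
Theorem tree_hom : exists (phi : {multiplicative G -> L}) (Psi : G -> 'I_m -> L),
  [/\ forall g v a, stab (x v) a -> Psi (g * a) v = Psi g v * F v a,
      forall h i, Psi (h * t i) (tv i) = Psi h (sv i) * s i &
      forall g h v, (exists2 f, isE f & av h (x v) = src f \/ av h (x v) = tgt f) ->
        Psi (g * h) v = phi g * Psi h v].
Proof.
have [Psi [P1 P2]] := ex_developing.
pose phi0 g := Psi g (sv i0) * (Psi 1 (sv i0))^-1.
have phiP g h v : (exists2 f, isE f & av h (x v) = src f \/ av h (x v) = tgt f) ->
    Psi (g * h) v = phi0 g * Psi h v.
  move=> hv; pose P y := forall w k, y = av k (x w) -> Psi (g * k) w = phi0 g * Psi k w.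
  have one k w : Psi (g * k) w = phi0 g * Psi k w -> P (av k (x w)).
    move=> kw u l /esym lk.
    have uw : u = w by apply: (td_inj D (g := l^-1 * k)); rewrite (gt_avM T) -lk avK.
    rewrite uw in lk *; have st := same lk.
    have lE : l = k * (k^-1 * l) by rewrite mulgA mulgV mul1g.
    by rewrite lE mulgA (P1 (g * k)) // (P1 k) // kw mulgA.
  suff : P (av h (x v)) by move=> /(_ v h erefl).
  apply: (@ends P _ v h hv) => [k i|]; last first.
    by rewrite -[x _](gt_av1 T); apply: one; rewrite mulg1 /phi0 mulgVK.
  split=> Pk; apply: one.
    by rewrite (mulgA g k) !P2 (Pk (sv i) k erefl) mulgA.
  apply: (mulIg (s i)); rewrite -P2 -[RHS]mulgA -P2 -mulgA.
  exact: Pk.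
have phiM : {morph phi0 : g h / g * h}.
  move=> g h; rewrite {1}/phi0 phiP ?mulgA //.
  exists (ae h (e i0)); first exact: (gt_isE T h (td_E D i0)).
  by left; rewrite (gt_src T h (td_E D i0)) (td_src D).
by exists (hom_of phiM), Psi; split.
Qed.

End Homs.

End Domain.

Variables (n : nat) (e : 'I_n -> B) (i0 : 'I_n).
Hypothesis eE : forall i, isE (e i).
Hypothesis e_onto : forall f, isE f -> exists i g, f = ae g (e i).
Hypothesis e_inj : forall i j g, e i = ae g (e j) -> i = j.

(* the first [k] vertices, each with an edge to an earlier one *)
Let config k (x : nat -> V) (f : nat -> B) (p : nat -> nat) :=
  [/\ forall i, (i < k)%N -> exists2 b, isE b & x i = src b \/ x i = tgt b,
      forall i j g, (i < k)%N -> (j < k)%N -> x i = av g (x j) -> i = j &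
      forall j, (0 < j < k)%N -> [/\ (p j < j)%N, isE (f j) &
        src (f j) = x j /\ tgt (f j) = x (p j) \/ src (f j) = x (p j) /\ tgt (f j) = x j]].

Let vert_orbit y : (exists2 b, isE b & y = src b \/ y = tgt b) ->
  exists (q : 'I_n * bool) g, y = av g (if q.2 then src (e q.1) else tgt (e q.1)).
Proof.
move=> [b /e_onto[i [g ->]] yb]; case: yb => ->.
  by exists (i, true), g; rewrite /= (gt_src T g (eE i)).
by exists (i, false), g; rewrite /= (gt_tgt T g (eE i)).
Qed.

Let ex_config : exists m x f p, [/\ (0 < m)%N, config m x f p &
  forall y, (exists2 b, isE b & y = src b \/ y = tgt b) -> exists j g, (j < m)%N /\ y = av g (x j)].
Proof.
pose ok k := `[< (0 < k)%N /\ exists x f p, config k x f p >].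
have ok1 : exists k, ok k.
  exists 1%N; apply/asboolP; split=> //; exists (fun=> src (e i0)), (fun=> e i0), id; split.
  - by move=> i _; exists (e i0) => //; left.
  - by move=> i j g; rewrite !ltnS !leqn0 => /eqP-> /eqP->.
  - by case.
have bnd k : ok k -> (k <= #|{: 'I_n * bool}|)%N.
  move=> /asboolP[_ [x [f [p [xv xi _]]]]].
  have exq (i : 'I_k) : exists q : 'I_n * bool, exists g, x i = av g (if q.2 then src (e q.1) else tgt (e q.1)).
    exact: vert_orbit (xv i (ltn_ord i)).
  have [q qP] := choice exq.
  have qi : injective q.
    move=> i j qij; have [g gE] := qP i; have [h hE] := qP j; apply: val_inj.
    apply: (xi i j (g * h^-1)) => //; rewrite (gt_avM T) hE avK gE qij.
    by [].
  by have := leq_card q qi; rewrite card_ord.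
have [m /asboolP[m0 [x [f [p cf]]]] mmax] := ex_maxnP ok1 bnd.
exists m, x, f, p; split=> //; apply: contrapT => nall.
have [xv xi xf] := cf.
pose P y := exists j g, (j < m)%N /\ y = av g (x j).
have Ptr g y : P (av g y) <-> P y.
  split=> -[j [h [jm E]]]; exists j.
    by exists (g^-1 * h); rewrite (gt_avM T) -E avK.
  by exists (g * h); rewrite (gt_avM T) -E.
(* an edge leaving the union of the orbits *)
have [b [Eb leave]] : exists b, isE b /\ (P (src b) /\ ~ P (tgt b) \/ ~ P (src b) /\ P (tgt b)).
  apply: contrapT => nb; apply: nall => y [b Eb yb].
  have PE c : isE c -> P (src c) <-> P (tgt c).
    move=> Ec; split=> Pc; apply: contrapT => nP; apply: nb; exists c; tauto.
  have [c Ec xc] := xv 0%N m0.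
  have P0 : P (x 0%N) by exists 0%N, 1; rewrite (gt_av1 T).
  have Pc : P (src c) by case: xc => xc; [rewrite -xc|apply/(PE c Ec); rewrite -xc].
  have Pb := gt_conn T PE Ec Eb Pc.
  by case: yb => ->; [|apply/(PE b Eb)].
have [c [y [j [Ec jm ny cy]]]] : exists c y j, [/\ isE c, (j < m)%N, ~ P y &
    src c = y /\ tgt c = x j \/ src c = x j /\ tgt c = y].
  case: leave => -[Pin Pout].
    have [j [g [jm bE]]] := Pin; exists (ae g^-1 b), (av g^-1 (tgt b)), j.
    split; [exact: (gt_isE T)|exact: jm|by move=> /Ptr|].
    by right; rewrite (gt_src T _ Eb) (gt_tgt T _ Eb) bE avK.
  have [j [g [jm bE]]] := Pout; exists (ae g^-1 b), (av g^-1 (src b)), j.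
  split; [exact: (gt_isE T)|exact: jm|by move=> /Ptr|].
  by left; rewrite (gt_src T _ Eb) (gt_tgt T _ Eb) bE avK.
pose x' k := if (k < m)%N then x k else y.
have x'E k : (k < m)%N -> x' k = x k by rewrite /x' => ->.
have x'm : x' m = y by rewrite /x' ltnn.
suff /mmax : ok m.+1 by rewrite ltnn.
apply/asboolP; split=> //; exists x', (fun k => if (k < m)%N then f k else c),
  (fun k => if (k < m)%N then p k else j); split.
- move=> i; rewrite ltnS leq_eqVlt => /orP[/eqP->|im]; last by rewrite x'E //; exact: xv.
  by rewrite x'm; exists c => //; case: cy => -[c1 c2]; [left|right].
- have yx i g : (i < m)%N -> y <> av g (x i) by move=> im e'; apply: ny; exists i, g.
  move=> i k g; rewrite !ltnS => ile kle.
  have last l : (l <= m)%N -> (m <= l)%N -> l = m by move=> ? ?; apply/eqP; rewrite eqn_leq; exact/andP.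
  have [im|/(last i ile) im] := ltnP i m; have [km|/(last k kle) km] := ltnP k m.
  + by rewrite !x'E //; exact: xi.
  + rewrite km x'm x'E // => xy; case: (yx i g^-1 im).
    by rewrite xy avK.
  + by rewrite im x'm x'E // => /(yx _ _ km).
  + by rewrite im km.
- move=> k /andP[k0]; rewrite ltnS leq_eqVlt => /orP[/eqP->|km].
    by rewrite ltnn x'm x'E.
  rewrite km x'E //; have [pk Ek ek] := xf k (introT andP (conj k0 km)).
  by rewrite x'E //; exact: ltn_trans pk km.
Qed.

(** Vertex representatives are chosen along a tree of edges, which then have
    [t i = 1] and form a maximal tree of the quotient. *)
Theorem ex_tree_domain : exists m (x : 'I_m.+1 -> V) (e' : 'I_n -> B) sv tv t (Tr : {set 'I_n}),
  [/\ tree_domain x e' sv tv t, forall i, exists g, e' i = ae g (e i),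
      forall i, i \in Tr -> t i = 1 &
      maximal_tree (Y := FinGraph sv tv) Tr].
Proof.
have [[|m] [x [f [p [// _ [xv xi xf] xall]]]]] := ex_config.
have exj i : exists q : 'I_m.+1 * 'I_m.+1 * B * G * option 'I_m.+1,
  let: (v, w, b, t, o) := q in
  [/\ exists g, b = ae g (e i), src b = x v, tgt b = av t (x w) &
     if o is Some j then [/\ (0 < j)%N, b = f j, t = 1 &
       v = j /\ w = p j :> nat \/ v = p j :> nat /\ w = j]
     else forall j g, (0 < j < m.+1)%N -> f j <> ae g (e i)].
  have [[j [jm [g fg]]]|nj] := pselect (exists j, (0 < j < m.+1)%N /\ exists g, f j = ae g (e i)).
    have [pj Ej ends] := xf j jm; have /andP[j0 jm1] := jm; have pm := ltn_trans pj jm1.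
    case: ends => -[sE tE].
      exists (Ordinal jm1, Ordinal pm, f j, 1, Some (Ordinal jm1)); split=> //=.
      - by exists g.
      - by rewrite (gt_av1 T).
      - by split=> //; left.
    exists (Ordinal pm, Ordinal jm1, f j, 1, Some (Ordinal jm1)); split=> //=.
    - by exists g.
    - by rewrite (gt_av1 T).
    - by split=> //; right.
  have [v [g [vm sE]]] := xall (src (e i)) (ex_intro2 _ _ (e i) (eE i) (or_introl erefl)).
  have [w [h [wm tE]]] := xall (tgt (e i)) (ex_intro2 _ _ (e i) (eE i) (or_intror erefl)).
  exists (Ordinal vm, Ordinal wm, ae g^-1 (e i), g^-1 * h, None); split=> /=.
  - by exists g^-1.
  - by rewrite (gt_src T _ (eE i)) sE avK.
  - by rewrite (gt_tgt T _ (eE i)) tE (gt_avM T).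
  - by move=> j g' jm fj; apply: nj; exists j; split=> //; exists g'.
have [q qP] := choice exj.
pose sv i := (q i).1.1.1.1; pose tv i := (q i).1.1.1.2; pose e' i := (q i).1.1.2.
pose t i := (q i).1.2; pose o i := (q i).2.
have QP i : [/\ exists g, e' i = ae g (e i), src (e' i) = x (sv i), tgt (e' i) = av (t i) (x (tv i)) &
     if o i is Some j then [/\ (0 < j)%N, e' i = f j, t i = 1 &
       sv i = j /\ tv i = p j :> nat \/ sv i = p j :> nat /\ tv i = j]
     else forall j g, (0 < j < m.+1)%N -> f j <> ae g (e i)].
  by have := qP i; rewrite /sv /tv /e' /t /o; case: (q i) => [[[[? ?] ?] ?] ?].
exists m, (fun v : 'I_m.+1 => x v), e', sv, tv, t, (finset (fun i => o i != None)); split.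
- split=> //.
  + by move=> v w g /(xi v w g (ltn_ord v) (ltn_ord w)) /val_inj.
  + by move=> v; exact: xv.
  + by move=> i; have [[g ->] _ _ _] := QP i; exact: (gt_isE T).
  + move=> b /e_onto[i [g ->]]; have [[h eh] _ _ _] := QP i; exists i, (g * h^-1).
    by rewrite (gt_aeM T) eh -(gt_aeM T h^-1) mulVg (gt_ae1 T).
  + move=> i j g; have [[h ->] _ _ _] := QP i; have [[k ->] _ _ _] := QP j.
    move=> E; apply: (e_inj (g := h^-1 * (g * k))).
    by rewrite (gt_aeM T) (gt_aeM T g) -E -(gt_aeM T) mulVg (gt_ae1 T).
  + by move=> i; have [_ ? _ _] := QP i.
  + by move=> i; have [_ _ ? _] := QP i.
- by move=> i; have [? _ _ _] := QP i.
- by move=> i; rewrite inE; have [_ _ _] := QP i; case: (o i) => // j [].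
have exeps (j : 'I_m.+1) : exists i, j != ord0 -> o i = Some j.
  have [->|j0] := eqVneq j ord0; first by exists i0.
  have jm : (0 < j < m.+1)%N by rewrite lt0n (ltn_ord j) andbT.
  have [_ Ej _] := xf j jm; have [i [g fE]] := e_onto Ej; exists i => _.
  have [[h eh] _ _] := QP i; case oE : (o i) => [k|]; last by move=> /(_ j g jm).
  move=> [k0 ek _ _]; congr Some; apply: val_inj => /=.
  have km : (0 < k < m.+1)%N by rewrite k0 ltn_ord.
  have [pk _ endk] := xf k km; have [pj _ endj] := xf j jm.
  (* the larger end of an edge determines it *)
  have fkj : f k = ae (h * g^-1) (f j).
    by rewrite -ek eh fE -(gt_aeM T) mulgVK.
  have pos a b c : (a < m.+1)%N -> (b < m.+1)%N -> x a = av c (x b) -> a = b.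
    by move=> am bm E; exact: (xi a b c am bm E).
  have sk := gt_src T (h * g^-1) Ej; have tk := gt_tgt T (h * g^-1) Ej; rewrite -fkj in sk tk.
  have jm1 := ltn_ord j; have km1 := ltn_ord k.
  have pjm := ltn_trans pj jm1; have pkm := ltn_trans pk km1.
  case: endk sk tk => -[-> ->]; case: endj => -[-> ->] /pos sk /pos tk.
  - exact: sk.
  - by have := sk km1 pjm; have := tk pkm jm1; move: pj pk; clear; lia.
  - by have := sk pkm jm1; have := tk km1 pjm; move: pj pk; clear; lia.
  - exact: tk.
have [eps epsP] := choice exeps.
have QPs i j : o i = Some j -> [/\ (0 < j)%N, e' i = f j, t i = 1 &
       sv i = j /\ tv i = p j :> nat \/ sv i = p j :> nat /\ tv i = j].
  by move=> oi; have [_ _ _] := QP i; rewrite oi.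
have pm (j : 'I_m.+1) : j != ord0 -> (p j < j)%N.
  by move=> j0; have [|? _ _] := xf j; rewrite ?lt0n ?(ltn_ord j) ?andbT.
apply: (@parents_maximal_tree (FinGraph sv tv) _ ord0 (fun j : 'I_m.+1 => val j)
  (fun j : 'I_m.+1 => inord (p j)) eps).
- by move=> j j0; rewrite /= inordK ?pm //; apply: ltn_trans (pm j j0) (ltn_ord j).
- by move=> j j0; rewrite inE (epsP j j0).
- move=> j j0 /=; have [_ _ _ ends] := QPs _ _ (epsP j j0).
  have pE (u : 'I_m.+1) : u = p j :> nat -> u = inord (p j) by move=> <-; rewrite inord_val.
  by case: ends => -[a b]; [left|right]; split=> //; exact: pE.
- move=> i; rewrite inE; case oi : (o i) => [j|//] _; exists j.
    by have [j0 _ _ _] := QPs _ _ oi; apply/eqP => je; rewrite je in j0.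
  have jn0 : j != ord0.
    by have [j0 _ _ _] := QPs _ _ oi; apply/eqP => je; rewrite je in j0.
  have [_ ei _ _] := QPs _ _ oi; have [_ ej _ _] := QPs _ _ (epsP j jn0).
  have [[g gi] _ _ _] := QP i; have [[h hj] _ _ _] := QP (eps j).
  apply: (e_inj (g := g^-1 * h)).
  by rewrite (gt_aeM T) -hj ej -ei gi -(gt_aeM T) mulVg (gt_ae1 T).
Qed.

End TreeGroups.

Section GraphOfTree.
Local Open Scope classical_set_scope.
Local Open Scope group_scope.

Lemma left_cosetM (G : groupType) (g h : G) A : left_coset g (left_coset h A) = left_coset (g * h) A.
Proof.
apply/seteqP; split=> [_ [_ [a Aa <-] <-]|_ [a Aa <-]]; first by exists a; rewrite ?mulgA.
by exists (h * a); [exists a|rewrite mulgA].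
Qed.

Lemma left_coset_eq (G : groupType) (P : set G) g h : P 1 ->
  (forall a b, P a -> P b -> P (a * b)) -> (forall a, P a -> P a^-1) ->
  left_coset g P = left_coset h P <-> P (g^-1 * h).
Proof.
move=> P1 PM PV; split=> [gh|Pgh].
  have : left_coset g P h by rewrite gh; exists 1; rewrite ?mulg1.
  by move=> [a Pa <-]; rewrite mulKg.
apply/seteqP; split=> [_ [a Pa <-]|_ [a Pa <-]].
  exists ((g^-1 * h)^-1 * a); first by apply: PM => //; exact: PV.
  by rewrite !grpE.
by exists (g^-1 * h * a); [exact: PM|rewrite !grpE].
Qed.

Lemma finite_subgrp (G : groupType) (H : groupClosed G) :
  finite_set [set` H] -> finite_set [set: subgrp H].
Proof.
move=> fH; have -> : [set: subgrp H] = (fun a : subgrp H => a : G) @^-1` [set` H].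
  by apply/seteqP; split=> // a _; exact: subgrp_valP.
by apply: finite_preimage fH => a b _ _; exact: val_inj.
Qed.

Definition incl (G : groupType) (H : groupClosed G) : {multiplicative subgrp H -> G} :=
  hom_of (fun a b : subgrp H => erefl (val (a * b))).

Variables (G : groupType) (V B : Type) (av : G -> V -> V) (ae : G -> B -> B)
  (isE : set B) (src tgt : B -> V).
Hypothesis T : gtree av ae isE src tgt.

Let stabM x g h : estab av x g -> estab av x h -> estab av x (g * h).
Proof. by move=> gx hx; rewrite /estab /= (gt_avM T) hx. Qed.
Let stab1 x : estab av x 1. Proof. exact: (gt_av1 T). Qed.
Let stabV x g : estab av x g -> estab av x g^-1.
Proof. by move=> gx; rewrite /estab /= -{1}gx -(gt_avM T) mulVg (gt_av1 T). Qed.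
Let estabM x g h : estab ae x g -> estab ae x h -> estab ae x (g * h).
Proof. by move=> gx hx; rewrite /estab /= (gt_aeM T) hx. Qed.
Let estab1 x : estab ae x 1. Proof. exact: (gt_ae1 T). Qed.
Let estabV x g : estab ae x g -> estab ae x g^-1.
Proof. by move=> gx; rewrite /estab /= -{1}gx -(gt_aeM T) mulVg (gt_ae1 T). Qed.

Variables (m n : nat) (x : 'I_m -> V) (e : 'I_n -> B) (sv tv : 'I_n -> 'I_m) (t : 'I_n -> G).
Hypothesis D : tree_domain av ae isE src tgt x e sv tv t.

Let SV v : groupClosed G := subgroup_of (@stab1 (x v)) (@stabV (x v)) (@stabM (x v)).
Let SE i : groupClosed G := subgroup_of (@estab1 (e i)) (@estabV (e i)) (@estabM (e i)).

Let SVP v (a : subgrp (SV v)) : estab av (x v) (val a).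
Proof. by have := subgrp_valP a; rewrite subgroup_ofE => /asboolP. Qed.
Let SEP i (a : subgrp (SE i)) : estab ae (e i) (val a).
Proof. by have := subgrp_valP a; rewrite subgroup_ofE => /asboolP. Qed.

Let src_stab i a : estab ae (e i) a -> a \in SV (sv i).
Proof.
by move=> ai; apply/asboolP; rewrite /estab /= -(td_src D) -(gt_src T a (td_E D i)) ai.
Qed.

Let tgt_stab i a : estab ae (e i) a -> (t i)^-1 * a * t i \in SV (tv i).
Proof.
move=> ai; apply/asboolP; rewrite /estab /= !(gt_avM T) -(td_tgt D) -(gt_tgt T a (td_E D i)) ai.
by rewrite (td_tgt D) -(gt_avM T) mulVg (gt_av1 T).
Qed.

Let esrcM i : {morph (fun a : subgrp (SE i) => Subgrp (src_stab (SEP a))) : a b / a * b}.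
Proof. by move=> a b; apply: val_inj. Qed.

Let etgtM i : {morph (fun a : subgrp (SE i) => Subgrp (tgt_stab (SEP a))) : a b / a * b}.
Proof. by move=> a b; apply: val_inj => /=; rewrite !grpE. Qed.

Let esrc_i i : injective (hom_of (@esrcM i)).
Proof. by move=> a b /(congr1 val) /= ab; exact: val_inj. Qed.

Let etgt_i i : injective (hom_of (@etgtM i)).
Proof. by move=> a b /(congr1 val) /= /mulIg /mulgI ab; exact: val_inj. Qed.

Definition tree_graph : graph_of_groups :=
  @GraphOfGroups (FinGraph sv tv) (fun v => subgrp (SV v)) (fun i => subgrp (SE i))
    (fun i => hom_of (@esrcM i)) (fun i => hom_of (@etgtM i)) esrc_i etgt_i.

Definition tree_incl (v : gvert tree_graph) : {multiplicative vgrp v -> G} := incl (SV v).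

(** The uniqueness is that the stabilizers and the edge elements generate, and the
    existence is [tree_hom]. *)
Theorem tree_is_pi1 (i0 : 'I_n) (Tr : {set 'I_n}) : (forall i, i \in Tr -> t i = 1) ->
  maximal_tree (Y := FinGraph sv tv) Tr -> @is_pi1 tree_graph Tr G tree_incl t.
Proof.
move=> Tr1 [_ Trc _]; split.
  by split=> [i a|//]; rewrite /= !mulgA mulgV mul1g mulgK.
move=> K f s [rel relT].
pose F v g : K := if pselect (g \in SV v) is left p then f v (Subgrp p) else 1.
have FE v (a : subgrp (SV v)) : F v (val a) = f v a.
  rewrite /F; case: pselect => [p|np]; last by case: np; exact: subgrp_valP.
  by congr (f v _); exact: val_inj.
have FE' v a (p : a \in SV v) : F v a = f v (Subgrp p) by rewrite -FE.
have SVi v a : estab av (x v) a -> a \in SV v by move=> ax; apply/asboolP.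
have FM v a b : estab av (x v) a -> estab av (x v) b -> F v (a * b) = F v a * F v b.
  move=> /SVi ax /SVi bx; rewrite (FE' v a ax) (FE' v b bx) -gmulfM -FE.
  by [].
have SEi i a : estab ae (e i) a -> a \in SE i by move=> ax; apply/asboolP.
have compat i a : estab ae (e i) a -> s i * F (tv i) ((t i)^-1 * a * t i) = F (sv i) a * s i.
  move=> /SEi ai; have := rel i (Subgrp ai); rewrite -!FE /= => H.
  by rewrite -H mulgVK.
have [phi [Psi [P1 P2 P3]]] := tree_hom T D i0 FM compat.
have hv h v : exists2 b, isE b & av h (x v) = src b \/ av h (x v) = tgt b.
  have [b Eb xb] := td_vert D v; exists (ae h b); first exact: (gt_isE T).
  by rewrite (gt_src T h Eb) (gt_tgt T h Eb); case: xb => ->; [left|right].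
pose z := Psi 1 (sv i0).
have zE v : Psi 1 v = z.
  have [w ww wT] := Trc v (sv i0); rewrite /z; elim: w v ww wT => [|a w IH] v /=.
    by move=> /eqP->.
  move=> /andP[/eqP <- ww] /andP[aT wT]; rewrite -(IH _ ww wT).
  have := P2 1 a.1; rewrite (Tr1 _ aT) (relT _ aT) !mulg1.
  by rewrite /edge_src /edge_tgt; case: (a.2).
have phiS v a : estab av (x v) a -> z^-1 * phi a * z = F v a.
  move=> ax; have := P3 a 1 v (hv 1 v); rewrite mulg1 -{1}[a]mul1g (P1 _ _ _ ax) zE => E.
  by rewrite -mulgA -E mulKg.
have phit i : z^-1 * phi (t i) * z = s i.
  have := P3 (t i) 1 (tv i) (hv 1 (tv i)); rewrite mulg1 -{1}[t i]mul1g P2 !zE => E.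
  by rewrite -mulgA -E mulKg.
have phiM : {morph (fun g => z^-1 * phi g * z) : g h / g * h}.
  by move=> g h /=; rewrite gmulfM !grpE.
split.
  exists (hom_of phiM); split=> [v a|i]; last exact: phit.
  by rewrite -FE; exact: (phiS v (val a) (SVP a)).
move=> phi1 phi2 [v1 t1] [v2 t2] g.
have one (ph : {multiplicative G -> K}) : ph 1 = 1 by apply: (mulgI (ph 1)); rewrite -gmulfM !mulg1.
have inv (ph : {multiplicative G -> K}) h : ph h^-1 = (ph h)^-1.
  by apply: (mulgI (ph h)); rewrite -gmulfM !mulgV one.
apply: (tree_generated T D i0 (Q := fun g => phi1 g = phi2 g)) => [|a b e1 e2|a e1|v a ax|i].
- by rewrite !one.
- by rewrite !gmulfM e1 e2.
- by rewrite !inv e1.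
- by have := v1 v (Subgrp (SVi v a ax)); rewrite -(v2 v) /=.
- by rewrite t1 t2.
Qed.

(** An edge whose collapse would simplify the quotient graph of groups. *)
Definition tree_collapsible b := isE b /\ ~ (exists h, av h (src b) = tgt b) /\
  (estab ae b = estab av (src b) \/ estab ae b = estab av (tgt b)).

(** The edges and vertices of the Bass-Serre tree, as cosets, correspond to those of the
    given tree with the same stabilizers. *)
Theorem tree_graph_reduced : (forall b, ~ tree_collapsible b) ->
  reduced (A := tree_graph) tree_incl t.
Proof.
move=> red i g [nl col]; apply: (red (ae g (e i))).
have rV v : range (tree_incl v) = estab av (x v).
  apply/seteqP; split=> [_ [a _ <-]|a ax]; first exact: SVP.
  have aS : a \in SV v by apply/asboolP.
  by exists (Subgrp aS).
have rE : range (fun a : subgrp (SE i) => tree_incl (sv i) (hom_of (@esrcM i) a)) = estab ae (e i).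
  apply/seteqP; split=> [_ [a _ <-]|a ax]; first exact: SEP.
  have aS : a \in SE i by apply/asboolP.
  by exists (Subgrp aS).
have cV v h k : left_coset h (estab av (x v)) = left_coset k (estab av (x v)) <-> av h (x v) = av k (x v).
  rewrite left_coset_eq //; [|exact: stabM|exact: stabV]; rewrite /estab /= (gt_avM T).
  split=> [E|<-]; last by rewrite -(gt_avM T) mulVg (gt_av1 T).
  by rewrite -{1}E -(gt_avM T) mulgV (gt_av1 T).
have cE h k : left_coset h (estab ae (e i)) = left_coset k (estab ae (e i)) <-> ae h (e i) = ae k (e i).
  rewrite left_coset_eq //; [|exact: estabM|exact: estabV]; rewrite /estab /= (gt_aeM T).
  split=> [E|<-]; last by rewrite -(gt_aeM T) mulVg (gt_ae1 T).
  by rewrite -{1}E -(gt_aeM T) mulgV (gt_ae1 T).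
have sE := gt_src T g (td_E D i); have tE := gt_tgt T g (td_E D i).
rewrite (td_src D) in sE; rewrite (td_tgt D) -(gt_avM T) in tE.
split; first exact: (gt_isE T g (td_E D i)).
split.
  move=> [h hE]; apply: nl; exists h; rewrite sE tE -(gt_avM T) in hE.
  have vw : sv i = tv i by apply: (td_inj D (g := (h * g)^-1 * (g * t i))); rewrite (gt_avM T) -hE -(gt_avM T) mulVg (gt_av1 T).
  rewrite /bs_act /bs_src /bs_tgt /bs_vertex /= !rV left_cosetM vw.
  by congr (_, _); apply/cV; rewrite -hE vw.
have stabV' v k : bs_stab (v, left_coset k (estab av (x v))) = estab av (av k (x v)).
  apply/seteqP; split=> h; rewrite /bs_stab /bs_act /estab /= left_cosetM -(gt_avM T).
    by case=> /cV.
  by move=> /cV ->.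
have stabE' : bs_stab (bs_edge (A := tree_graph) tree_incl i g) = estab ae (ae g (e i)).
  apply/seteqP; split=> h; rewrite /bs_stab /bs_act /bs_edge /estab /= rE left_cosetM -(gt_aeM T).
    by case=> /cE.
  by move=> /cE ->.
move: col; rewrite stabE' /bs_src /bs_tgt /bs_vertex /= !rV !stabV' -sE -tE.
by [].
Qed.

Lemma tree_graph_finite i : finite_set (estab ae (e i)) -> finite_set [set: @egrp tree_graph i].
Proof.
move=> fi; apply: finite_subgrp; apply: sub_finite_set fi => a /= aS.
by apply/asboolP; rewrite -(subgroup_ofE (@estab1 (e i)) (@estabV (e i)) (@estabM (e i))).
Qed.

End GraphOfTree.

Section Accessible.
Local Open Scope classical_set_scope.
Local Open Scope group_scope.

Theorem accessible_tree_bound (G : groupType) : accessible_over_finite G -> exists N,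
  forall (V B : Type) av ae isE (src tgt : B -> V) (T : gtree (G := G) av ae isE src tgt) n (e : 'I_n -> B),
  (forall i, isE (e i)) -> (forall f, isE f -> exists i g, f = ae g (e i)) ->
  (forall i j g, e i = ae g (e j) -> i = j) -> (forall i, finite_set (estab ae (e i))) ->
  (forall b, ~ tree_collapsible av ae isE src tgt b) -> (n <= N)%N.
Proof.
move=> [N NP]; exists N => V B av ae isE src tgt T [//|n] e eE eo ei ef red.
have [m [x [e' [sv [tv [t [Tr [D ee' t1 mT]]]]]]]] := ex_tree_domain T ord0 eE eo ei.
have := NP (tree_graph T D) Tr (tree_incl (T := T) (D := D)) t mT (tree_is_pi1 T D ord0 t1 mT).
rewrite /= card_ord; apply; last exact: tree_graph_reduced.
move=> i; have [g gE] := ee' i.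
apply: (@tree_graph_finite G V B av ae isE src tgt T m.+1 n.+1 x e' sv tv t D i); rewrite gE.
apply: sub_finite_set (finite_image (fun h => g * h * g^-1) (ef i)) => h hE.
exists (g^-1 * h * g); last by rewrite !grpE.
by rewrite /estab /= !(gt_aeM T) hE -(gt_aeM T) mulVg (gt_ae1 T).
Qed.

Variables (G : groupType) (S : seq G) (c0 : nat -> set G).
Hypothesis ch : forall n, chain S c0 n.

Section Increasing.
Variable f : nat -> nat.
Hypothesis f_lt : forall n, (f n < f n.+1)%N.
Let c n := c0 (f n).
Let E n := orb c `I_n.
Let K j : set G := [set g | tr g (c j) = c j].
Hypothesis K_lt : forall n, (ncard (K n) < ncard (K n.+1))%N.

Let K_mono i j : (i < j)%N -> (ncard (K i) < ncard (K j))%N.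
Proof.
elim: j => // j IH; rewrite ltnS leq_eqVlt => /orP[/eqP->//|/IH lt].
exact: ltn_trans lt (K_lt j).
Qed.

(** At a vertex with the stabilizer of the [j]-th edge only the first [j] orbits
    of edges can end, as the other edges have larger stabilizers; so the vertex is
    the one at which the [j]-th edge was created. *)
Let full_vertex_loop n j C : (j < n)%N -> C = c j \/ C = ~` c j ->
  vstab (tau (E n) C) `<=` K j ->
  (exists g, trv g (tau (E n) (~` C)) = tau (E n) C) /\ forall t, tr t C <> ~` C.
Proof.
move=> jn sC vsub.
have nsn : nested_system (E n) := sub_nested ch f (@subset_refl _ `I_n).
have nsj : nested_system (E j.+1) := sub_nested ch f (@subset_refl _ `I_j.+1).
have sub : E j.+1 `<=` E n by apply: orb_sub => i /= /leq_trans; apply.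
have star D' : E n D' -> tau (E n) D' = tau (E n) C -> E j.+1 D'.
  move=> ED' tD'; have [i /= iln [h D'E]] := ED'.
  have le : (ncard (K i) <= ncard (K j))%N.
    have Kj : finite_set (K j) by exact: (K_finite ch).
    apply: leq_trans (ncard_sub Kj vsub); rewrite -tD'.
    have fv : finite_set (vstab (tau (E n) D')) by rewrite tD'; exact: sub_finite_set Kj.
    apply: leq_trans (ncard_image_le (fun g => h^-1 * g * h) fv).
    apply: ncard_sub; first exact: finite_image.
    move=> g Kg; exists (h * g * h^-1); last by rewrite !grpE.
    rewrite /vstab /= -(tau_tr nsn) //; congr tau.
    by case: D'E => ->; rewrite !trM trK ?trC Kg.
  have ij : (i <= j)%N by rewrite leqNgt; apply/negP => /K_mono; rewrite ltnNge le.
  by exists i; [rewrite /= ltnS|exists h].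
have vE := top_edge_vstab ch (f := f) jn sC star.
have vsub' : vstab (tau (E j.+1) C) `<=` K j by rewrite [vstab _]vE.
have [[g gE] ninv] := sub_last_loop ch f_lt sC vsub'.
split=> //; exists g.
have ECj : E j.+1 C by case: sC => ->; [apply: orb_mem|apply: orb_memC]; exact: ltnSn.
have gE' : trv g^-1 (tau (E j.+1) C) = tau (E j.+1) (~` C) by rewrite -gE trvK.
by rewrite -(trv_expand nsj nsn sub ECj (nsC nsj ECj) star gE') trvVK.
Qed.

Lemma no_increasing_chain : accessible_over_finite G -> False.
Proof.
move=> /accessible_tree_bound[N NP]; pose n := N.+1.
have nsn : nested_system (E n) := sub_nested ch f (@subset_refl _ `I_n).
have T := orb_gtree nsn.
have cpos (j : 'I_n) : orb_pos c `I_n (c j).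
  by exists (nat_of_ord j); [exact: ltn_ord|exists 1; rewrite tr1].
suff : (n <= N)%N by rewrite ltnn.
apply: (NP _ _ _ _ _ _ _ T n (fun j : 'I_n => c j)) => //.
- by move=> D [i iln [g ->]]; exists (Ordinal iln), g.
- move=> i j g ij; apply/val_inj/esym/(sub_distinct ch f_lt (g := g)).
  by left; exact: esym ij.
- by move=> j; exact: (K_finite ch).
move=> D [oD [nl col]]; have ED := orb_pos_E oD; have [j /= jn [g DE]] := oD.
have Dne : D <> ~` D.
  by have [y Dy] := ns_ne nsn ED; move=> e; have := Dy; rewrite {1}e; exact.
have inv_t : orb_pos c `I_n (~` D) -> exists t, tr t D = ~` D.
  move=> [i iln [h hE]]; have ij : j = i.
    apply: (sub_distinct ch f_lt (g := h^-1 * g)); right; rewrite trM trC -DE hE.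
    by rewrite trK.
  by exists (h * g^-1); rewrite trM hE -ij {1}DE trK.
have ninv_pos : (forall t, tr t (c j) <> ~` c j) -> ~ orb_pos c `I_n (~` D).
  move=> nt /inv_t[t tD]; apply: (nt (g^-1 * t * g)).
  by rewrite !trM -DE tD DE -trC trK.
have noloop C : C = c j \/ C = ~` c j -> vstab (tau (E n) C) `<=` K j -> False.
  move=> sC vsub; have [[k kE] ninv] := full_vertex_loop jn sC vsub.
  have nt : forall t, tr t (c j) <> ~` c j.
    move=> t tE; case: sC => CE; first by apply: (ninv t); rewrite CE.
    by apply: (ninv t); rewrite CE trC tE.
  apply: nl; rewrite /orb_src /orb_tgt (asboolF (ninv_pos nt)).
  have tD : tau (E n) D = trv g (tau (E n) (c j)) by rewrite DE tau_tr.
  have tD' : tau (E n) (~` D) = trv g (tau (E n) (~` c j)) by rewrite DE -trC tau_tr.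
  case: sC kE => ->; rewrite ?setCK => kE.
    exists (g * k * g^-1); rewrite /= tD tD' -kE.
    by rewrite -!trvM !grpE.
  exists (g * k^-1 * g^-1); rewrite /= tD tD' -kE.
  by rewrite -!trvM !grpE.
have estE v : estab (@orb_av G) (inl v) = vstab v.
  by apply/seteqP; split=> a; rewrite /estab /vstab /=; [case|move=> ->].
have conj C : estab (@tr G) D = vstab (trv g (tau (E n) C)) -> vstab (tau (E n) C) `<=` K j.
  move=> eD a aC; have : estab (@tr G) D (g * a * g^-1).
    by rewrite eD /vstab /= -!trvM !grpE trvM aC.
  rewrite /estab /= DE -!trM !grpE trM => /tr_inj; exact.
case: col; last first.
  rewrite /orb_tgt estE {2}DE tau_tr // => /conj; apply: noloop.
  by left.
rewrite /orb_src; case: asboolP => [oD'|_] eD; last first.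
  apply: (noloop (~` c j)); first by right.
  by apply: conj; rewrite eD estE {1}DE -trC tau_tr.
have [t tD] := inv_t oD'; have : estab (@tr G) D t.
  by rewrite eD /estab /= -midpoint_tr tD midpointC.
by rewrite /estab /= tD => /esym.
Qed.

End Increasing.

(** An infinite chain has bounded edge stabilizers, or a subchain with increasing
    ones; the trees of the latter are reduced. *)
Theorem accessible_no_infinite_chain (R : realType) :
  (forall P : G -> Prop, P 1 -> (forall g s, s \in S -> P g -> P (g * s)) -> forall g, P g) ->
  accessible_over_finite G -> False.
Proof.
move=> Sgen acc; pose K j : set G := [set g | tr g (c0 j) = c0 j].
have [[k kP]|unb] := pselect (exists k, forall j, (ncard (K j) <= k)%N).
  exact: (no_infinite_bounded_chain Sgen ch R kP).
have big k : exists j, (k < ncard (K j))%N.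
  apply: contrapT => nj; apply: unb; exists k => j; rewrite leqNgt.
  by apply/negP => lt; apply: nj; exists j.
have inc m : exists2 i, (m < i)%N & (ncard (K m) < ncard (K i))%N.
  have [i iP] := big (\max_(l < m.+1) ncard (K l)).
  have le l : (l <= m)%N -> (ncard (K l) <= \max_(l < m.+1) ncard (K l))%N.
    by rewrite -ltnS => lm; exact: (leq_bigmax (Ordinal lm)).
  exists i; last exact: leq_ltn_trans (le m (leqnn m)) iP.
  by rewrite ltnNge; apply/negP => /le; rewrite leqNgt iP.
have [f [f_lt fK]] := increasing_sequence inc.
exact: (no_increasing_chain f_lt fK acc).
Qed.

End Accessible.

(** * Finite vertex stabilizers *)

Section VirtuallyFree.
Local Open Scope classical_set_scope.
Local Open Scope group_scope.

(** An equivariant injection on an invariant subset extends to one more orbit as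
    long as it is not surjective, because orbits of free actions are all alike. *)
Lemma free_actions_isomorphic (G : groupType) (A : set G) (O : finType) (r1 r2 : G -> {perm O}) :
  A 1 -> (forall a b, A a -> A b -> A (a * b)) -> (forall a, A a -> A a^-1) ->
  (forall a b, A a -> A b -> r1 (a * b) = r1 a * r1 b) ->
  (forall a b, A a -> A b -> r2 (a * b) = r2 a * r2 b) ->
  (forall a w, A a -> r1 a w = w -> a = 1) -> (forall a w, A a -> r2 a w = w -> a = 1) ->
  exists s : {perm O}, forall a, A a -> s * r2 a = r1 a * s.
Proof.
move=> A1 AM AV r1M r2M f1 f2.
have one (r : G -> {perm O}) : (forall a b, A a -> A b -> r (a * b) = r a * r b) -> r 1 = 1.
  by move=> rM; apply: (mulgI (r 1)); rewrite -rM // !mulg1.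
have act (r : G -> {perm O}) a b w : (forall a b, A a -> A b -> r (a * b) = r a * r b) ->
    A a -> A b -> r (a * b) w = r b (r a w) by move=> rM Aa Ab; rewrite rM // permM.
have inj (r : G -> {perm O}) a b w : (forall a b, A a -> A b -> r (a * b) = r a * r b) ->
    (forall a w, A a -> r a w = w -> a = 1) -> A a -> A b -> r a w = r b w -> a = b.
  move=> rM fr Aa Ab e; apply: (mulIg b^-1); rewrite mulgV; apply: (fr _ w); first exact/AM/AV.
  by rewrite act ?e -?act ?mulgV ?one ?perm1 //; exact: AV.
(* an equivariant injection defined on an invariant set [U] *)
pose ok (U : {set O}) (s : O -> O) := [/\ {in U &, injective s},
  forall w a, A a -> w \in U -> r1 a w \in U & forall w a, A a -> w \in U -> s (r1 a w) = r2 a (s w)].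
suff [s [si _ sE]] : exists s, ok [set: O]%SET s.
  have sinj : injective s by move=> u v; apply: si; rewrite finset.in_setT.
  exists (perm sinj) => a Aa; apply/permP => w; rewrite !permM !permE sE // finset.in_setT.
suff grow k : (k <= #|O|)%N -> exists U s, ok U s /\ (k <= #|U|)%N.
  have [U [s [oU le]]] := grow _ (leqnn _); exists s.
  by have <- : U = [set: O]%SET by apply/eqP; rewrite eqEcard finset.subsetT cardsT.
elim: k => [|k IH] kO.
  by exists finset.set0, id; split=> //; split=> // w; rewrite ?inE // => ? ?; rewrite inE.
have [U [s [[si sU sE] le]]] := IH (ltnW kO).
have [lt|ge] := ltnP k #|U|; first by exists U, s.
have Uk : #|U| = k by apply/eqP; rewrite eqn_leq ge.
have [w1 nw1] : exists w, w \notin U.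
  apply: contrapT => nw; have : #|O| = k.
    by rewrite -Uk; apply: eq_card => w; apply/esym; apply: contrapT => nU; apply: nw; exists w; apply/negP => H; apply: nU.
  by move=> Ok; rewrite Ok ltnn in kO.
have [w2 nw2] : exists w, w \notin s @: U.
  apply: contrapT => nw; have : (#|O| <= #|s @: U|)%N.
    by apply: subset_leq_card; apply/fintype.subsetP => w _; apply: contraT => nU; case: nw; exists w.
  by move=> H; have := leq_trans (leq_trans kO H) (leq_imset_card s U); rewrite Uk ltnn.
pose orb1 := [pred w | `[< exists2 a, A a & w = r1 a w1 >]].
pose s' w := if pselect (exists2 a, A a & w = r1 a w1) is left p then r2 (s2val (cid2 p)) w2 else s w.
have s'E a : A a -> s' (r1 a w1) = r2 a w2.
  move=> Aa; rewrite /s'; case: pselect => [p|[]]; last by exists a.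
  case: (cid2 p) => b Ab /= e; congr (r2 _ w2).
  by apply: (inj r1 b a w1 r1M f1 Ab Aa).
have Uorb w : w \in U -> ~ exists2 a, A a & w = r1 a w1.
  move=> wU [a Aa wE]; case/negP: nw1.
  by have := sU _ a^-1 (AV _ Aa) wU; rewrite wE -act // ?mulgV ?one ?perm1 //; exact: AV.
have s'U w : w \in U -> s' w = s w by move=> /Uorb; rewrite /s'; case: pselect.
have no2 w a : w \in U -> A a -> s w <> r2 a w2.
  move=> wU Aa e; case/negP: nw2; apply/imsetP; exists (r1 a^-1 w).
    by apply: sU => //; exact: AV.
  by rewrite sE ?e -?act ?mulgV ?one ?perm1 //; exact: AV.
exists (U :|: finset (fun w => orb1 w)), s'; split; last first.
  apply: (@leq_trans #|w1 |: U|); first by rewrite cardsU1 nw1 Uk.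
  apply: subset_leq_card; apply/fintype.subsetP => w; rewrite !inE => /orP[/eqP->|->//].
  by apply/orP; right; apply/asboolP; exists 1 => //; rewrite one // perm1.
have mem w : w \in U :|: finset (fun w => orb1 w) -> w \in U \/ exists2 a, A a & w = r1 a w1.
  by rewrite !inE => /orP[->|/asboolP]; [left|right].
split.
- move=> u v /mem[uU|[a Aa ->]] /mem[vU|[b Ab ->]].
  + by rewrite !s'U //; exact: si.
  + by rewrite (s'U u) // s'E // => /(no2 u b uU Ab).
  + by rewrite (s'U v) // s'E // => /esym /(no2 v a vU Aa).
  + by rewrite !s'E // => e; rewrite (inj r2 a b w2 r2M f2 Aa Ab e).
- move=> w a Aa /mem[wU|[b Ab ->]]; rewrite !inE; first by rewrite sU.
  by apply/orP; right; apply/asboolP; exists (b * a); [exact: AM|rewrite act].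
- move=> w a Aa /mem[wU|[b Ab ->]]; first by rewrite !s'U ?sE //; exact: sU.
  by rewrite -act // !s'E ?act //; exact: AM.
Qed.

Variables (G : groupType) (V B : Type) (av : G -> V -> V) (ae : G -> B -> B)
  (isE : set B) (src tgt : B -> V).
Hypothesis T : gtree av ae isE src tgt.

(** Trivial stabilizers make the group free on the elements [t i] off the maximal
    tree. *)
Theorem trivial_stab_free n (e : 'I_n.+1 -> B) : (forall i, isE (e i)) ->
  (forall f, isE f -> exists i g, f = ae g (e i)) ->
  (forall i j g, e i = ae g (e j) -> i = j) ->
  (forall b g, isE b -> av g (src b) = src b \/ av g (tgt b) = tgt b -> g = 1) -> free_group G.
Proof.
move=> eE eo ei triv.
have [m [x [e' [sv [tv [t [Tr [D ee' t1 mT]]]]]]]] := ex_tree_domain T ord0 eE eo ei.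
have stab1 v a : estab av (x v) a -> a = 1.
  move=> ax; have [b Eb xb] := td_vert D v; apply: (triv b) => //.
  by case: xb ax => ->; [left|right].
exists [set g | exists2 i, i \notin Tr & g = t i] => K f.
have [|i a ai|phi [Psi [P1 P2 P3]]] := @tree_hom _ _ _ _ _ _ _ _ T _ _ _ _ _ _ _ D ord0 K
  (fun _ _ => 1) (fun i => if i \in Tr then 1 else f (t i)).
- by move=> *; rewrite mulg1.
- by rewrite mulg1 mul1g.
have hv h v : exists2 b, isE b & av h (x v) = src b \/ av h (x v) = tgt b.
  have [b Eb xb] := td_vert D v; exists (ae h b); first exact: (gt_isE T).
  by rewrite (gt_src T h Eb) (gt_tgt T h Eb); case: xb => ->; [left|right].
pose z := Psi 1 (sv ord0).
have zE v : Psi 1 v = z.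
  have [_ Trc _] := mT; have [w ww wT] := Trc v (sv ord0); rewrite /z; elim: w v ww wT => [|a w IH] v /=.
    by move=> /eqP->.
  move=> /andP[/eqP <- ww] /andP[aT wT]; rewrite -(IH _ ww wT).
  have := P2 1 a.1; rewrite (t1 _ aT) aT !mulg1.
  by rewrite /edge_src /edge_tgt; case: (a.2).
have phit i : i \notin Tr -> z^-1 * phi (t i) * z = f (t i).
  move=> iT; have := P3 (t i) 1 (tv i) (hv 1 (tv i)); rewrite mulg1 -{1}[t i]mul1g P2 !zE (negbTE iT) => E.
  by rewrite -mulgA -E mulKg.
have phiM : {morph (fun g => z^-1 * phi g * z) : g h / g * h}.
  by move=> g h /=; rewrite gmulfM !grpE.
split.
  by exists (hom_of phiM) => g; rewrite inE => -[i iT ->]; exact: phit.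
move=> phi1 phi2 e1 e2 g.
have one (ph : {multiplicative G -> K}) : ph 1 = 1 by apply: (mulgI (ph 1)); rewrite -gmulfM !mulg1.
have inv (ph : {multiplicative G -> K}) h : ph h^-1 = (ph h)^-1.
  by apply: (mulgI (ph h)); rewrite -gmulfM !mulgV one.
apply: (tree_generated T D ord0 (Q := fun g => phi1 g = phi2 g)) => [|a b d1 d2|a d1|v a ax|i].
- by rewrite !one.
- by rewrite !gmulfM d1 d2.
- by rewrite !inv d1.
- by rewrite (stab1 v a ax) !one.
have [iT|iT] := boolP (i \in Tr); first by rewrite t1 // !one.
have tS : t i \in [set g | exists2 i, i \notin Tr & g = t i] by rewrite inE; exists i.
by rewrite e1 // e2.
Qed.

Lemma ex_edge_reps N (e0 : 'I_N.+1 -> B) : (forall i, isE (e0 i)) ->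
  (forall f, isE f -> exists i g, f = ae g (e0 i)) ->
  exists n (e : 'I_n.+1 -> B), [/\ forall i, isE (e i),
    forall f, isE f -> exists i g, f = ae g (e i) & forall i j g, e i = ae g (e j) -> i = j].
Proof.
move=> eE cov; have aeV g b : ae g^-1 (ae g b) = b by rewrite -(gt_aeM T) mulVg (gt_ae1 T).
pose J : {set 'I_N.+1} := finset (fun i => `[< forall (j : 'I_N.+1) g, e0 i = ae g (e0 j) -> (i <= j)%N >]).
have toJ i : exists2 j, j \in J & exists g, e0 i = ae g (e0 j).
  have [n] := ubnP (nat_of_ord i); elim: n i => // n IH i; rewrite ltnS => ilt.
  have [iJ|niJ] := boolP (i \in J); first by exists i => //; exists 1; rewrite (gt_ae1 T).
  have [j [g [eij ji]]] : exists j g, e0 i = ae g (e0 j) /\ (j < i)%N.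
    apply: contrapT => nj; case/negP: niJ; rewrite inE; apply/asboolP => j g eij.
    by rewrite leqNgt; apply/negP => ji; apply: nj; exists j, g.
  have [k kJ [h ejk]] := IH j (leq_trans ji ilt); exists k => //; exists (g * h).
  by rewrite eij ejk (gt_aeM T).
have J0 : (0 < #|J|)%N.
  by have [j jJ _] := toJ ord0; rewrite card_gt0; apply/set0Pn; exists j.
case EJ : #|J| J0 => [//|n] _; exists n, (fun i => e0 (enum_val (cast_ord (esym EJ) i))); split.
- by move=> i; exact: eE.
- move=> f /cov[i [g ->]]; have [j jJ [h ->]] := toJ i.
  exists (cast_ord EJ (enum_rank_in jJ j)), (g * h).
  by rewrite cast_ordK enum_rankK_in // (gt_aeM T).
move=> i j g ee; apply: (@cast_ord_inj _ _ (esym EJ)); apply: enum_val_inj; apply: val_inj.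
have := enum_valP (cast_ord (esym EJ) i); have := enum_valP (cast_ord (esym EJ) j).
rewrite !inE => /asboolP jmin /asboolP imin; apply/eqP; rewrite eqn_leq (imin _ _ ee) /=.
by apply: (jmin _ g^-1); rewrite ee aeV.
Qed.

End VirtuallyFree.

Section FiniteIndex.
Local Open Scope classical_set_scope.
Local Open Scope group_scope.
Variables (G : groupType) (V B : Type) (av : G -> V -> V) (ae : G -> B -> B)
  (isE : set B) (src tgt : B -> V).
Hypothesis T : gtree av ae isE src tgt.

Variables (n : nat) (e : 'I_n.+1 -> B).
Hypothesis eE : forall i, isE (e i).
Hypothesis e_onto : forall f, isE f -> exists i g, f = ae g (e i).
Hypothesis e_inj : forall i j g, e i = ae g (e j) -> i = j.
Hypothesis finV : forall b x, isE b -> x = src b \/ x = tgt b -> finite_set (estab av x).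

(** A morphism to a finite group that is injective on the stabilizers: each of them
    acts freely on the product of all of them. *)
Theorem ex_finite_quotient : exists (O : finType) (phi : {multiplicative G -> {perm O}}),
  forall b x g, isE b -> x = src b \/ x = tgt b -> av g x = x -> phi g = 1 -> g = 1.
Proof.
have [m [x [e' [sv [tv [t [Tr [D ee' t1 mT]]]]]]]] := ex_tree_domain T ord0 eE e_onto e_inj.
pose P v : set G := estab av (x v).
have fP v : finite_set (P v) by have [b Eb xb] := td_vert D v; exact: (finV Eb xb).
have P1 v : P v 1 by exact: (gt_av1 T).
have PM v a b : P v a -> P v b -> P v (a * b).
  by move=> ax bx; rewrite /P /estab /= (gt_avM T) bx.
have PV v a : P v a -> P v a^-1.
  by move=> ax; rewrite /P /estab /= -{1}ax -(gt_avM T) mulVg (gt_av1 T).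
pose Q : set {ffun 'I_m.+1 -> G} := [set w | forall v, P v (w v)].
have fQ : finite_set Q.
  have fU : finite_set [set g | exists2 v, [set: 'I_m.+1] v & P v g].
    by apply: finite_bigU => //; exact: finite_finset.
  pose W := fset_set [set g | exists2 v, [set: 'I_m.+1] v & P v g].
  apply: (@sub_finite_set _ _ ((fun w : {ffun 'I_m.+1 -> W} => [ffun v => val (w v)]) @` setT)).
    move=> w Qw; have wW v : w v \in W by rewrite in_fset_set // inE; exists v.
    by exists [ffun v => [` wW v]%fset] => //; apply/ffunP => v; rewrite !ffunE.
  exact/finite_image/finite_finset.
pose O : {fset {ffun 'I_m.+1 -> G}} := fset_set Q.
have OQ (w : O) : Q (val w) by have := valP w; rewrite in_fset_set // inE.
pose shift v a (w : {ffun 'I_m.+1 -> G}) := [ffun u => if u == v then w u * a else w u].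
have shiftQ v a (w : O) : P v a -> shift v a (val w) \in O.
  move=> ax; rewrite in_fset_set // inE => u; rewrite ffunE.
  by case: eqP => [->|_]; [apply: PM => //|]; exact: OQ.
pose rho v a (w : O) : O := insubd w (shift v a (val w)).
have rhoE v a w : P v a -> val (rho v a w) = shift v a (val w).
  by move=> ax; rewrite insubdK //; exact: shiftQ.
have rho_inj v a : P v a -> injective (rho v a).
  move=> ax w w' /(congr1 val); rewrite !rhoE // => /ffunP ww; apply/val_inj/ffunP => u.
  by have := ww u; rewrite !ffunE; case: eqP => // _ /mulIg.
pose F v a : {perm O} := if pselect (P v a) is left p then perm (rho_inj v a p) else 1.
have FE v a w : P v a -> F v a w = rho v a w.
  by move=> ax; rewrite /F; case: pselect => // p; rewrite permE.
have FM v a b : P v a -> P v b -> F v (a * b) = F v a * F v b.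
  move=> ax bx; apply/permP => w; rewrite permM !FE //; last exact: PM.
  apply/val_inj; rewrite !rhoE //; last exact: PM.
  by apply/ffunP => u; rewrite !ffunE; case: eqP => // _; rewrite mulgA.
have Ffree v a w : P v a -> F v a w = w -> a = 1.
  move=> ax; rewrite FE // => /(congr1 val); rewrite rhoE // => /ffunP /(_ v).
  by rewrite ffunE eqxx -{2}[val w v]mulg1 => /mulgI.
have ss i a : estab ae (e' i) a -> P (sv i) a.
  by move=> ai; rewrite /P /estab /= -(td_src D) -(gt_src T a (td_E D i)) ai.
have ts i a : estab ae (e' i) a -> P (tv i) ((t i)^-1 * a * t i).
  move=> ai; rewrite /P /estab /= !(gt_avM T) -(td_tgt D) -(gt_tgt T a (td_E D i)) ai.
  by rewrite (td_tgt D) -(gt_avM T) mulVg (gt_av1 T).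
have exs i : exists s : {perm O}, forall a, estab ae (e' i) a ->
    s * F (tv i) ((t i)^-1 * a * t i) = F (sv i) a * s.
  apply: (@free_actions_isomorphic G (estab ae (e' i)) O (F (sv i)) (fun a => F (tv i) ((t i)^-1 * a * t i))).
  - exact: (gt_ae1 T).
  - by move=> a b ai bi; rewrite /estab /= (gt_aeM T) bi.
  - by move=> a ai; rewrite /estab /= -{1}ai -(gt_aeM T) mulVg (gt_ae1 T).
  - by move=> a b /ss ai /ss bi; exact: FM.
  - move=> a b /ts ai /ts bi; rewrite -FM //; congr (F _ _); by rewrite !grpE.
  - by move=> a w /ss ai; exact: Ffree.
  - move=> a w /ts ai /Ffree => /(_ ai) e1.
    by apply: (mulgI (t i)^-1); apply: (mulIg (t i)); rewrite e1 mulg1 mulVg.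
have [s sP] := choice exs.
have [phi [Psi [Q1 Q2 Q3]]] := tree_hom T D ord0 FM sP.
exists O, phi => b y g Eb yb gy phg.
have [v [h yE]] : exists v h, y = av h (x v).
  have [i [k bE]] := td_onto D Eb; case: yb => ->; rewrite bE.
    by exists (sv i), k; rewrite (gt_src T k (td_E D i)) (td_src D).
  by exists (tv i), (k * t i); rewrite (gt_tgt T k (td_E D i)) (td_tgt D) (gt_avM T).
pose a := h^-1 * g * h.
have aP : P v a.
  by rewrite /P /estab /= !(gt_avM T) -yE gy yE -(gt_avM T) mulVg (gt_av1 T).
have hv : exists2 f, isE f & av h (x v) = src f \/ av h (x v) = tgt f by exists b; rewrite -?yE.
have := Q3 g h v hv; rewrite phg mul1g (_ : g * h = h * a); last by rewrite /a !grpE.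
rewrite Q1 // -{2}[Psi h v]mulg1 => /mulgI Fa.
have w0 : O.
  have w0O : [ffun _ => 1] \in O by rewrite in_fset_set // inE => u; rewrite ffunE.
  exact: [` w0O]%fset.
have a1 : a = 1 by apply: (Ffree v a w0 aP); rewrite Fa perm1.
have -> : g = h * a * h^-1 by rewrite /a !grpE.
by rewrite a1 mulg1 mulgV.
Qed.

(** The kernel of the morphism of [ex_finite_quotient] meets no stabilizer, so it acts
    freely on the tree and has finite index. *)
Theorem finite_stab_virtually_free : virtually_free G.
Proof.
have [Om [phi phiP]] := ex_finite_quotient.
have ph1 : phi 1 = 1 by apply: (mulgI (phi 1)); rewrite -gmulfM !mulg1.
have phV h : phi h^-1 = (phi h)^-1.
  by apply: (mulgI (phi h)); rewrite -gmulfM !mulgV ph1.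
pose N : groupClosed G := subgroup_of (P := [set g | phi g = 1]) ph1
  (fun g (gN : phi g = 1) => ltac:(by rewrite /= phV gN invg1))
  (fun g h (gN : phi g = 1) (hN : phi h = 1) => ltac:(by rewrite /= gmulfM gN hN mulg1)).
have NP g : (g \in N) <-> phi g = 1 by rewrite subgroup_ofE; split=> /asboolP.
(* representatives of the values of [phi] *)
have exr (p : {perm Om}) : exists r, (exists g, phi g = p) -> phi r = p.
  by have [[g gp]|np] := pselect (exists g, phi g = p); [exists g|exists 1 => /np].
have [r rP] := choice exr.
have rphi g : phi (r (phi g)) = phi g by apply: rP; exists g.
exists N.
  apply: (@sub_finite_set _ _ ((fun p => left_coset (r p) [set` N]) @` setT)).
    move=> _ [g _ <-]; exists (phi g) => //.
    rewrite /left_coset; apply/seteqP; split=> _ [a /NP aN <-].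
      exists (g^-1 * r (phi g) * a); last by rewrite !grpE.
      by apply/NP; rewrite !gmulfM aN phV rphi mulg1 mulVg.
    exists ((r (phi g))^-1 * g * a); last by rewrite !grpE.
    by apply/NP; rewrite !gmulfM aN phV rphi mulg1 mulVg.
  exact/finite_image/finite_finset.
pose av' (g : subgrp N) y := av (val g) y; pose ae' (g : subgrp N) b := ae (val g) b.
have T' : gtree av' ae' isE src tgt.
  split; rewrite /av' /ae'.
  - exact: (gt_av1 T).
  - by move=> g h y; exact: (gt_avM T).
  - exact: (gt_ae1 T).
  - by move=> g h b; exact: (gt_aeM T).
  - by move=> g b; exact: (gt_isE T).
  - by move=> g b; exact: (gt_src T).
  - by move=> g b; exact: (gt_tgt T).
  - exact: (gt_pot T).
  - exact: (gt_conn T).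
pose I : finType := ('I_n.+1 * {perm Om})%type.
pose e1 (q : I) := ae (r q.2) (e q.1).
have cI : (0 < #|I|)%N by rewrite (cardD1 (ord0, 1)).
case EI : #|I| cI => [//|k] _.
pose e2 (i : 'I_k.+1) := e1 (enum_val (cast_ord (esym EI) i)).
have cover f : isE f -> exists i (g : subgrp N), f = ae' g (e2 i).
  move=> /e_onto[i [g ->]].
  have gN : g * (r (phi g))^-1 \in N by apply/NP; rewrite gmulfM phV rphi mulgV.
  exists (cast_ord EI (enum_rank (i, phi g))), (Subgrp gN).
  by rewrite /e2 cast_ordK enum_rankK /ae' /e1 /= -(gt_aeM T) mulgVK.
have [k' [e3 [E1 E2 E3]]] := ex_edge_reps T' (e0 := e2) (fun i => gt_isE T _ (eE _)) cover.
apply: (trivial_stab_free T' E1 E2 E3) => b g Eb gb.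
apply: val_inj => /=; have /NP gN := subgrp_valP g.
by case: gb => gb; [apply: (phiP b (src b)) => //; left|apply: (phiP b (tgt b)) => //; right].
Qed.


End FiniteIndex.

(** * Finite presentations *)

Section Generators.
Local Open Scope classical_set_scope.
Local Open Scope group_scope.

Lemma generates_ind (G : groupType) (S : set G) : generates S -> forall P : G -> Prop,
  P 1 -> (forall g s, S s -> P g -> P (g * s)) -> (forall g s, S s -> P g -> P (g * s^-1)) ->
  forall g, P g.
Proof.
move=> gS P P1 PM PV.
pose Q := [set x | (forall g, P g -> P (g * x)) /\ forall g, P g -> P (g * x^-1)].
have Q1 : Q 1 by split=> g; rewrite ?invg1 mulg1.
have QV x : Q x -> Q x^-1 by move=> [q1 q2]; split=> g; rewrite ?invgK; [exact: q2|exact: q1].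
have QM x y : Q x -> Q y -> Q (x * y).
  move=> [x1 x2] [y1 y2]; split=> g Pg; first by rewrite mulgA; apply/y1/x1.
  by rewrite invgM mulgA; apply/x2/y2.
move=> g; have /asboolP[Qg _] : g \in subgroup_of Q1 QV QM.
  by apply: gS => s Ss; apply/asboolP; split=> h; [exact: PM|exact: PV].
by rewrite -[g]mul1g; exact: Qg.
Qed.

Lemma finitely_generated_seq (G : groupType) : finitely_generated G -> exists S : seq G,
  (forall s, s \in S -> s^-1 \in S) /\
  forall P : G -> Prop, P 1 -> (forall g s, s \in S -> P g -> P (g * s)) -> forall g, P g.
Proof.
move=> [S0 fS gS]; have /finite_seqP[S SE] : finite_set (S0 `|` [set s^-1 | s in S0]).
  by rewrite finite_setU; split=> //; exact: finite_image.
have inS s : (s \in S) <-> (S0 `|` [set s^-1 | s in S0]) s by rewrite SE.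
exists S; split.
  move=> s /inS sS; apply/inS; case: sS => [sS|[x xS <-]]; first by right; exists s.
  by left; rewrite invgK.
move=> P P1 PM; apply: (generates_ind gS) => // g s sS; apply: PM; apply/inS; first by left.
by right; exists s.
Qed.

(* the evident retraction onto the subgroup generated by a basis is the identity *)
Lemma free_basis_generates (F : groupType) (S : set F) : free_basis S -> generates S.
Proof.
move=> bS H SH; pose f x : subgrp H := if pselect (x \in H) is left p then Subgrp p else 1.
have [[phi phiE] _] := bS _ f; have [_ uniq] := bS F id.
have psiM : {morph (fun x => val (phi x)) : x y / x * y} by move=> x y /=; rewrite gmulfM.
pose psi := hom_of psiM.
pose idm : {multiplicative F -> F} := hom_of (f := id) (fun x y => erefl).
have e1 : {in S, psi =1 id}.
  move=> s sS; rewrite hom_ofE phiE //; have sH := SH s (set_mem sS).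
  by rewrite /f; case: pselect.
have e2 : {in S, idm =1 id} by [].
by move=> x; have := uniq psi idm e1 e2 x; rewrite [psi x]hom_ofE [idm x]hom_ofE => <-; exact: subgrp_valP.
Qed.

End Generators.

(** The wreath product of the group of order two with [G]. *)
Definition wreath (G : groupType) : Type := ((G -> bool) * G)%type.

Section Wreath.
Variable G : groupType.
Local Open Scope group_scope.
HB.instance Definition _ := gen_eqMixin (wreath G).
HB.instance Definition _ := gen_choiceMixin (wreath G).
Let wM (x y : wreath G) : wreath G := (fun u => x.1 u (+) y.1 (u * x.2), x.2 * y.2).
Let w1 : wreath G := (fun=> false, 1).
Let wV (x : wreath G) : wreath G := (fun u => x.1 (u * x.2^-1), x.2^-1).
Let wA : associative wM.
Proof.
move=> x y z; rewrite /wM /=; congr (_, _); last by rewrite mulgA.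
by apply/funext => u; rewrite addbA mulgA.
Qed.
Let w1w : left_id w1 wM.
Proof. by case=> f g; rewrite /wM /= mul1g; congr (_, _); apply/funext => u; rewrite mulg1. Qed.
Let ww1 : right_id w1 wM.
Proof. by case=> f g; rewrite /wM /= mulg1; congr (_, _); apply/funext => u; rewrite addbF. Qed.
Let wVw : left_inverse w1 wV wM.
Proof. by case=> f g; rewrite /wM /= mulVg; congr (_, _); apply/funext => u; rewrite addbb. Qed.
Let wwV : right_inverse w1 wV wM.
Proof. by case=> f g; rewrite /wM /= mulgV; congr (_, _); apply/funext => u; rewrite mulgK addbb. Qed.
HB.instance Definition _ := isGroup.Build (wreath G) wA w1w ww1 wVw wwV.
Lemma wreath_mul1 (x y : wreath G) u : (x * y).1 u = x.1 u (+) y.1 (u * x.2).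
Proof. by []. Qed.
Lemma wreath_mul2 (x y : wreath G) : (x * y).2 = x.2 * y.2. Proof. by []. Qed.
Lemma wreath_inv1 (x : wreath G) u : (x^-1).1 u = x.1 (u * x.2^-1). Proof. by []. Qed.
Lemma wreath_one : (1 : wreath G) = (fun=> false, 1). Proof. by []. Qed.
End Wreath.

Section FinitePresentation.
Local Open Scope classical_set_scope.
Local Open Scope group_scope.

(** With the generating set a ball that contains the relators, a function on edges
    that is additive on triangles gives a morphism from the free group to the wreath
    product: it records the sum of the function along the paths with a given label.
    It vanishes on the relators, hence on the kernel. *)
Theorem finitely_presented_coherent (G : groupType) : finitely_presented G -> exists S : seq G,
  [/\ forall s, s \in S -> s^-1 \in S,
  forall P : G -> Prop, P 1 -> (forall g s, s \in S -> P g -> P (g * s)) -> forall g, P g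
  & triangle_coherent S].
Proof.
move=> [F [S0 [rels [pi [fS bS fR pi_surj kerE]]]]].
have gS := free_basis_generates bS.
pose A := S0 `|` [set s^-1 | s in S0].
have fA : finite_set A by rewrite finite_setU; split=> //; exact: finite_image.
have AV s : A s -> A s^-1 by case=> [sS|[x xS <-]]; [right; exists s|left; rewrite invgK].
pose wprod (w : seq F) : F := foldr (fun x y => x * y) 1 w.
have wprod_cat u v : wprod (u ++ v) = wprod u * wprod v.
  by elim: u => [|x u IH] /=; rewrite ?mul1g // IH mulgA.
pose ball k : set F := [set x | exists w, [/\ (size w <= k)%N, forall s, s \in w -> A s & x = wprod w]].
have ballS k x s : ball k x -> A s -> ball k.+1 (x * s).
  move=> [w [sw wA ->]] As; exists (rcons w s); split.
  - by rewrite size_rcons.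
  - by move=> y; rewrite mem_rcons inE => /orP[/eqP->//|/wA].
  - by rewrite -cats1 wprod_cat /= mulg1.
have ballW k l x : (k <= l)%N -> ball k x -> ball l x.
  by move=> kl [w [sw wA ->]]; exists w; split=> //; exact: leq_trans kl.
have ball1 k : ball k 1 by exists [::].
have ball_finite k : finite_set (ball k).
  elim: k => [|k IH].
    apply: (@sub_finite_set _ _ [set 1]); last exact: finite_set1.
    by move=> x [[|y w] [//= _ _ ->]].
  apply: (@sub_finite_set _ _ ([set 1] `|` [set x | exists2 s, A s & ((fun y => s * y) @` ball k) x])).
    move=> x [[|s w] [sw wA ->]]; [by left|right]; exists s; first by apply: wA; rewrite mem_head.
    by exists (wprod w) => //; exists w; split=> // y yw; apply: wA; rewrite inE yw orbT.
  by rewrite finite_setU; split; [exact: finite_set1|apply: finite_bigU => // s _; exact: finite_image].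
have ballV k x : ball k x -> ball k x^-1.
  move=> [w [sw wA ->]]; exists (rev [seq y^-1 | y <- w]); split.
  - by rewrite size_rev size_map.
  - by move=> s; rewrite mem_rev => /mapP[y yw ->]; exact/AV/wA.
  - elim: w {sw wA} => [|y w IH] /=; first by rewrite invg1.
    by rewrite invgM IH rev_cons -cats1 wprod_cat /= mulg1.
have ex_ball x : exists k, ball k x.
  apply: (generates_ind gS (P := fun x => exists k, ball k x)) x; first by exists 0%N.
    by move=> g s sS [k bk]; exists k.+1; apply: ballS => //; left.
  by move=> g s sS [k bk]; exists k.+1; apply: ballS => //; right; exists s.
have [rad radP] := choice ex_ball.
have /finite_seqP[rs rsE] := fR; pose l := (\max_(r <- rs) rad r).+1.
have relB r : rels r -> ball l r.
  rewrite rsE => /= rrs; apply: ballW (radP r); rewrite ltnW // ltnS.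
  by have : (rad r <= \max_(r <- rs) rad r)%N by exact: leq_bigmax_seq.
have pi1 : pi 1 = 1 by apply: (mulgI (pi 1)); rewrite -gmulfM !mulg1.
have piV x : pi x^-1 = (pi x)^-1 by apply: (mulgI (pi x)); rewrite -gmulfM !mulgV pi1.
have /finite_seqP[S SE] : finite_set (pi @` ball l) by exact: finite_image.
have inS g : (g \in S) <-> (pi @` ball l) g by rewrite SE.
have AB s : A s -> ball l s.
  move=> As; rewrite -[s]mul1g; apply: (@ballW 1%N); first by [].
  exact: ballS.
exists S; split.
- by move=> s /inS[x bx <-]; apply/inS; exists x^-1; [exact: ballV|exact: piV].
- move=> P P1 PM g; have [x _ <-] := pi_surj g I.
  apply: (generates_ind gS (P := fun x => P (pi x))) x; first by rewrite pi1.
    by move=> y s sS Py; rewrite gmulfM; apply: PM => //; apply/inS; exists s => //; apply: AB; left.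
  move=> y s sS Py; rewrite gmulfM; apply: PM => //; apply/inS; exists s^-1 => //.
  by apply: AB; right; exists s.
move=> c cS.
have S1 : 1 \in S by apply/inS; exists 1; [exact: ball1|exact: pi1].
have cuu u : c u u = false.
  by have := cS u u u; rewrite mulVg S1 => /(_ isT isT isT); rewrite addbb => <-.
have csym u v : u^-1 * v \in S -> c v u = c u v.
  move=> uv; have vu : v^-1 * u \in S.
    have : (u^-1 * v)^-1 \in S by move/inS: uv => [x bx <-]; apply/inS; exists x^-1; [exact: ballV|exact: piV].
    by rewrite invgM invgK.
  have := cS u v u uv vu; rewrite mulVg S1 => /(_ isT); rewrite cuu.
  by case: (c u v); case: (c v u).
pose f s : wreath G := (fun u => c u (u * pi s), pi s).
have [[Th ThE] _] := bS (wreath G) f.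
have ThV s : (Th s) * (Th s^-1) = 1.
  rewrite -gmulfM mulgV; apply: (mulgI (Th 1)); by rewrite -gmulfM !mulg1.
have Th1 : Th 1 = 1 by apply: (mulgI (Th 1)); rewrite -gmulfM !mulg1.
have ThVE s : Th s^-1 = (Th s)^-1 by apply: (mulgI (Th s)); rewrite ThV mulgV.
have ThS s : S0 s -> Th s = f s by move=> sS; apply: ThE; exact/mem_set.
have Th2 x : (Th x).2 = pi x.
  apply: (generates_ind gS (P := fun x => (Th x).2 = pi x)) x; first by rewrite Th1 pi1.
    by move=> y s sS Py; rewrite !gmulfM wreath_mul2 Py ThS.
  by move=> y s sS Py; rewrite !gmulfM wreath_mul2 Py ThVE ThS // piV.
have ThA s u : A s -> (Th s).1 u = c u (u * pi s).
  move=> As; case: (As) => [sS|[x xS xE]]; first by rewrite ThS.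
  rewrite -xE ThVE wreath_inv1 Th2 ThS //= mulgVK piV; apply/esym/csym.
  by rewrite invgM invgK mulgVK; apply/inS; exists x => //; apply: AB; left.
have Thw w : (size w <= l)%N -> (forall s, s \in w -> A s) ->
    forall u, (Th (wprod w)).1 u = c u (u * pi (wprod w)).
  elim/last_ind: w => [|w s IH] sw wA u; first by rewrite Th1 pi1 mulg1 cuu.
  have As : A s by apply: wA; rewrite mem_rcons mem_head.
  have wA' y : y \in w -> A y by move=> yw; apply: wA; rewrite mem_rcons inE yw orbT.
  rewrite size_rcons in sw; have bw : ball l (wprod w) by exists w; split=> //; exact: ltnW.
  have bws : ball l (wprod w * s).
    by exists (rcons w s); split; rewrite ?size_rcons // -cats1 wprod_cat /= mulg1.
  rewrite -cats1 wprod_cat /= mulg1 gmulfM wreath_mul1 IH // ?(ltnW sw) // Th2 ThA //.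
  rewrite gmulfM mulgA; apply: cS; rewrite ?mulKg; apply/inS.
  - by exists (wprod w).
  - by exists s => //; exact: AB.
  - by exists (wprod w * s) => //; rewrite gmulfM !mulgA mulVg mul1g.
have ThB x u : ball l x -> (Th x).1 u = c u (u * pi x) by move=> [w [sw wA ->]]; exact: Thw.
have kerTh x : pi x = 1 -> Th x = 1.
  move=> px; have : Defs.kernel pi x by [].
  pose N : groupClosed F := subgroup_of (P := [set g | Th g = 1]) Th1
    (fun g (gN : Th g = 1) => ltac:(by rewrite /= ThVE gN invg1))
    (fun g h (gN : Th g = 1) (hN : Th h = 1) => ltac:(by rewrite /= gmulfM gN hN mulg1)).
  rewrite kerE => /(_ N) H; suff /asboolP : x \in N by [].
  apply: H.
    move=> g h /asboolP /= gN; apply/asboolP; rewrite /= conjgE -?mulgA !gmulfM gN mul1g -gmulfM mulVg.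
    exact: Th1.
  move=> r rR; apply/asboolP => /=.
  have pir : pi r = 1.
    have : Defs.kernel pi r by rewrite kerE => N' _; apply.
    by [].
  have : (Th r).2 = 1 by rewrite Th2.
  have : (Th r).1 = fun=> false by apply/funext => u; rewrite (ThB r u (relB r rR)) pir mulg1.
  by rewrite wreath_one; case: (Th r) => /= ? ? -> ->.
have exx g : exists x, pi x = g by have [x _ <-] := pi_surj g I; exists x.
have [lift liftP] := choice exx.
exists (fun g => (Th (lift g)).1 1) => u v /inS[y by_ yE].
have ThP x x' : pi x = pi x' -> Th x = Th x'.
  move=> xx; have /kerTh : pi (x * x'^-1) = 1 by rewrite gmulfM piV xx mulgV.
  by rewrite gmulfM ThVE => /(congr1 (fun z => z * Th x')); rewrite mulgVK mul1g.
have -> : Th (lift v) = Th (lift u) * Th y.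
  by rewrite -gmulfM; apply: ThP; rewrite gmulfM !liftP yE !grpE.
rewrite wreath_mul1 Th2 liftP mul1g (ThB y u by_) yE !grpE.
by case: (_.1 1); case: (c u v).
Qed.

End FinitePresentation.

(** * Translations of the tree *)

Section Translations.
Local Open Scope classical_set_scope.
Local Open Scope group_scope.
Variables (G : groupType) (c : nat -> set G) (n : nat).
Let E := orb c `I_n.
Hypothesis nsE : nested_system E.
Variable P : set G.
Hypothesis PV : forall g, P g -> P g^-1.
Hypothesis PM : forall g h, P g -> P h -> P (g * h).

Let stab_bound : exists M, forall D, E D -> (ncard [set g | tr g D = D] <= M)%N.
Proof.
exists (\max_(i < n) ncard [set g | tr g (c i) = c i]) => D [i /= iln [g DE]].
have fi : finite_set [set h | tr h (c i) = c i].
  by apply: (ns_stab_finite nsE); exact: orb_mem.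
apply: leq_trans (leq_bigmax (Ordinal iln)) => /=.
apply: leq_trans (ncard_image_le (fun h => g * h * g^-1) fi); apply: ncard_sub.
  exact: finite_image.
move=> h hD; exists (g^-1 * h * g); last by rewrite !grpE.
have key B : tr g (c i) = B \/ tr g (~` c i) = B -> tr h B = B -> tr (g^-1 * h * g) (c i) = c i.
  case=> <-; rewrite !trM ?trC => hB; last by move: hB => /(congr1 setC); rewrite !setCK => ->; rewrite trK.
  by rewrite hB trK.
by apply: (key D) hD; case: DE => ->; [left|right].
Qed.

Let Strict (a : G) (D : set G) := tr a D `<=` D /\ tr a D <> D.

Let strict_of g D : P g -> E D -> tr g D `<=` D \/ D `<=` tr g D -> tr g D <> D ->
  exists2 a, P a & exists2 D, E D & Strict a D.
Proof.
move=> Pg ED cmp ne; case: cmp => sub.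
  by exists g => //; exists D.
exists g^-1; first exact: PV.
exists (tr g D); first exact: (ns_tr nsE).
by split; rewrite trK // => e; apply: ne.
Qed.

(** An infinite subgroup that fixes no vertex contains a translation. When an edge
    splits it, two elements that move the edge to either side do; otherwise the
    subgroup fixes an end, and a subgroup without translations fixes the edges close
    to the end. *)
Theorem ex_translation : infinite_set P -> (forall H, vst E H -> finite_set H) ->
  exists2 a, P a & exists2 D, E D & (tr a D `<=` D /\ tr a D <> D).
Proof.
move=> iP fin; apply: contrapT => nstrict.
have cmp_eq g D : P g -> E D -> tr g D `<=` D \/ D `<=` tr g D -> tr g D = D.
  by move=> Pg ED cmp; apply: contrapT => ne; apply: nstrict; exact: strict_of Pg ED cmp ne.
have [[C EC [i1 i2]]|nsplit] := pselect (exists2 C, E C & infinite_set (P `&` C) /\ infinite_set (P `&` ~` C)).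
  have cC := ns_cut nsE EC; have [x Cx] := ns_ne nsE EC; have [y nCy] := ns_proper nsE EC.
  have cC' := cutC cC.
  have [h [[Ph Ch] hC]] : exists h, (P `&` C) h /\ ~` tr h C `<=` C /\ tr h (~` C) <> C.
    apply: contrapT => nh; apply: i1; apply: (@sub_finite_set _ _
      ([set h | C h /\ ~ C (h * x)] `|` [set h | tr h C = C] `|` [set h | tr h (~` C) = C])).
      move=> h [Ph Ch]; have [H|H|H|H] := ns_nested nsE (ns_tr nsE h EC) EC.
      - by left; right; apply: cmp_eq => //; left.
      - by left; left; split=> //; apply: H; rewrite mem_trM.
      - have [e|ne] := pselect (tr h (~` C) = C); first by right.
        by case: nh; exists h; split.
      - by left; right; apply: cmp_eq => //; right; exact/subCC.
    rewrite !finite_setU; split; first split.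
    - exact: cC.
    - exact: (ns_stab_finite nsE).
    - exact: (ns_stab_finite nsE _ (nsC nsE EC)).
  have [k [[Pk nCk] kC]] : exists k, (P `&` ~` C) k /\ tr k C `<=` ~` C.
    apply: contrapT => nk; apply: i2; apply: (@sub_finite_set _ _
      ([set h | (~` C) h /\ ~ (~` C) (h * y)] `|` [set h | tr h C = C])).
      move=> k [Pk nCk]; have [H|H|H|H] := ns_nested nsE (ns_tr nsE k EC) EC.
      - by right; apply: cmp_eq => //; left.
      - by case: nk; exists k.
      - left; split=> // nC; apply: nC; apply: H => /=.
        by rewrite mem_trM; exact: nCy.
      - by right; apply: cmp_eq => //; right; exact/subCC.
    by rewrite finite_setU; split; [exact: cC'|exact: (ns_stab_finite nsE)].
  have [hsub hne] := hC; apply: hne.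
  have sub : tr (h * k) C `<=` tr h (~` C) by rewrite trM tr_sub.
  have e : tr (h * k) C = C.
    by apply: cmp_eq => //; [exact: PM|left; exact: subset_trans sub hsub].
  by apply/seteqP; split=> //; rewrite -{1}e.
have inP D : E D -> finite_set (P `\` D) \/ finite_set (P `&` D).
  move=> ED; apply: contrapT => /not_orP[f1 f2]; apply: nsplit; exists D => //.
pose o D := E D /\ finite_set (P `\` D).
have meet C D : o C -> o D -> exists z, C z /\ D z.
  move=> [_ fC] [_ fD]; apply: contrapT => nz; apply: iP.
  apply: (@sub_finite_set _ _ ((P `\` C) `|` (P `\` D))); last by rewrite finite_setU.
  move=> z Pz; have [Cz|nCz] := pselect (C z); [right|by left].
  by split=> // Dz; apply: nz; exists z.
have o_tr g D : P g -> o D -> o (tr g D).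
  move=> Pg [ED fD]; split; first exact: (ns_tr nsE).
  apply: sub_finite_set (finite_image (fun h => g * h) fD) => h [Ph nD].
  by exists (g^-1 * h); [split=> //; apply: PM => //; exact: PV|rewrite !grpE].
have o_nor D : E D -> ~ o D -> o (~` D).
  move=> ED noD; split; first exact: (nsC nsE).
  by have [fD|fD] := inP D ED; [case: noD|rewrite setDE setCK].
have [D0 oD0] : exists D, o D.
  have [C EC] : exists C, E C.
    apply: contrapT => nC; apply: iP; apply: sub_finite_set (fin setT _) => //; left; split=> //.
    by apply/seteqP; split=> // C EC; apply: nC; exists C.
  by have [oC|/o_nor oC] := pselect (o C); [exists C|exists (~` C); exact: oC].
have nomin D : o D -> exists2 F, o F & F `<=` D /\ F <> D.
  move=> oD; apply: contrapT => nF; have [ED fD] := oD.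
  have sub F : o F -> tau E D F.
    move=> oF; have [EF _] := oF; have [H|H|H|H] := ns_nested nsE ED EF.
    - by split=> //; left.
    - by have [z [Dz Fz]] := meet _ _ oD oF; case: (H z Dz).
    - split=> //; right; split=> // FE; have [z [Dz Fz]] := meet _ _ oD oF.
      by rewrite FE in Fz.
    - have [FD|ne] := pselect (F = D); first by rewrite FD; exact: tau_self.
      by case: nF; exists F => //; split=> //; exact/subCC.
  have oE : o = tau E D.
    apply/seteqP; split=> // F tF; apply: contrapT => noF.
    exact: (tau_nand nsE ED tF (sub _ (o_nor F (tauE tF) noF))).
  apply: iP; apply: sub_finite_set (fin (vstab (tau E D)) _); last by right; exists D.
  move=> g Pg; rewrite /vstab /= -oE; apply/seteqP; split=> F; rewrite /trv /=.
    by move=> /(o_tr g _ Pg); rewrite trVK.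
  by apply: o_tr; exact: PV.
have [M MP] := stab_bound.
have [A AP cA] := infinite_set_fset M.+1 iP.
have [D [oD D1 DA]] : exists D, [/\ o D, ~ D 1 & forall g, g \in A -> ~ D g^-1].
  apply: contrapT => nD; have [ED0 _] := oD0; have [y nD0y] := ns_proper nsE ED0.
  pose U := [set D | o D /\ D `<=` D0].
  have fU : finite_set U.
    apply: (@sub_finite_set _ _ [set D | exists2 z, ([set 1] `|` [set g^-1 | g in [set` A]]) z &
        [/\ E D, D z & ~ D y]]).
      move=> D [oD DD0]; apply: contrapT => nz; apply: nD; exists D; have [ED _] := oD.
      by split=> // [Dz|g gA Dz]; apply: nz; [exists 1|exists g^-1]; (try by split=> // /DD0);
        [left|right; exists g].
    apply: finite_bigU => [|z _]; last exact: (ns_sep nsE).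
    by rewrite finite_setU; split; [exact: finite_set1|apply: finite_image; exact: finite_fset].
  have [F [[oF FD0] _ mF]] := finite_minimal fU (conj oD0 (@subset_refl _ D0) : U D0).
  have [F' oF' [F'F ne]] := nomin F oF.
  by apply: ne; apply: mF => //; split=> //; exact: subset_trans FD0.
have [ED _] := oD; have Dfix g : g \in A -> tr g D = D.
  move=> gA; have Pg := AP g gA; apply: cmp_eq => //.
  have ogD := o_tr g D Pg oD.
  have [H|H|H|H] := ns_nested nsE (ns_tr nsE g ED) ED.
  - by left.
  - by have [z [z1 z2]] := meet _ _ ogD oD; case: (H z z1).
  - by case: D1; apply: H => /=; rewrite mem_tr mulg1; exact: DA.
  - by right; exact/subCC.
have := MP D ED; rewrite leqNgt => /negP; apply; apply: leq_trans cA _.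
have fS : finite_set [set g | tr g D = D] by exact: (ns_stab_finite nsE).
have -> : #|` A| = ncard [set` A] by rewrite /ncard set_fsetK.
exact: ncard_sub.
Qed.

Variables (a : G) (D : set G).
Hypothesis ED : E D.
Hypothesis aD : tr a D `<=` D.
Hypothesis naD : tr a D <> D.

Let tr_desc i j : (i <= j)%N -> tr (a ^+ j) D `<=` tr (a ^+ i) D.
Proof.
elim: j => [|j IH]; first by rewrite leqn0 => /eqP->.
rewrite leq_eqVlt => /orP[/eqP->//|/IH sub]; apply: subset_trans sub.
by rewrite expgSr trM tr_sub.
Qed.

Let tr_strict i j : tr (a ^+ j) D = tr (a ^+ i) D -> (j <= i)%N.
Proof.
move=> e; rewrite leqNgt; apply/negP => ij; apply: naD; apply: (@tr_inj _ (a ^+ i)).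
rewrite -trM -expgSr; apply/seteqP; split; first exact: tr_desc.
by rewrite -e; exact: tr_desc.
Qed.

Lemma translation_inj : injective (fun k => a ^+ k).
Proof.
move=> i j ij; apply/eqP; rewrite eqn_leq; apply/andP; split; apply: tr_strict;
by rewrite (ij : a ^+ i = a ^+ j).
Qed.

Let Zp := [set g | exists k m, g = a ^- k * a ^+ m].

Let aC k m : a ^+ m * a ^- k = a ^- k * a ^+ m.
Proof.
have : commute (a ^+ m) (a ^+ k)^-1 by apply: commuteV; apply: commuteX2; exact: commute_refl.
by [].
Qed.

Let ZpM g h : Zp g -> Zp h -> Zp (g * h).
Proof.
move=> [k [m ->]] [k' [m' ->]]; exists (k' + k)%N, (m + m')%N.
rewrite !expgnDr invgM !mulgA; congr (_ * _).
by rewrite -[LHS]mulgA -[RHS]mulgA aC.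
Qed.

Let ZpV g : Zp g -> Zp g^-1.
Proof. by move=> [k [m ->]]; exists m, k; rewrite invgM invgK. Qed.

Let aE i : E (tr (a ^+ i) D). Proof. exact: (ns_tr nsE). Qed.
Let aVE i : E (tr (a ^- i) D). Proof. exact: (ns_tr nsE). Qed.
Let infinite_seq_E (F : nat -> set G) x y : injective F -> (forall i, E (F i)) ->
  (forall i, F i x) -> (forall i, ~ F i y) -> False.
Proof.
move=> Fi FE Fx Fy; apply: infinite_nat.
apply: (@sub_finite_set _ _ (F @^-1` [set C | [/\ E C, C x & ~ C y]])); first by move=> i _; split.
by apply: finite_preimage (ns_sep nsE x y) => i j _ _ /Fi.
Qed.

Let trX_inj : injective (fun i => tr (a ^+ i) D).
Proof. by move=> i j e; apply/eqP; rewrite eqn_leq !tr_strict //; exact: esym. Qed.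

Let fwd : exists N, forall i, (N <= i)%N -> D (a ^+ i).
Proof.
have [d Dd] := ns_ne nsE ED.
have [N DN] : exists i, D (a ^+ i).
  apply: contrapT => no; apply: (@infinite_seq_E (fun i => tr (a ^- i) D) d 1) => //.
  - move=> i j /(congr1 (tr (a ^+ (i + j)))).
    by rewrite -!trM {1}[(i + j)%N]addnC !expgnDr !mulgK => /trX_inj.
  - move=> i; rewrite mem_tr invgK -[d]mul1g; have := @tr_desc 0 i (leq0n i).
    by rewrite tr1 => sub; rewrite mul1g; apply: sub; rewrite mem_trM.
  - by move=> i; rewrite mem_tr invgK mulg1 => Di; apply: no; exists i.
exists N => i /subnKC <-; elim: (i - N)%N => [|k IH]; rewrite ?addn0 //.
by apply: aD; rewrite addnS expgS mem_trM.
Qed.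

Let bwd : exists N, forall i, (N <= i)%N -> ~ D (a ^- i).
Proof.
have [y nDy] := ns_proper nsE ED.
have [N DN] : exists i, ~ D (a ^- i).
  apply: contrapT => no; apply: (@infinite_seq_E (fun i => tr (a ^+ i) D) 1 y) => //.
  - by move=> i; rewrite mem_tr mulg1; apply: contrapT => nD; apply: no; exists i.
  - by move=> i; have := @tr_desc 0 i (leq0n i); rewrite tr1 => sub /sub.
exists N => i /subnKC <-; elim: (i - N)%N => [|k IH]; rewrite ?addn0 // => Di; apply: IH.
have -> : a ^- (N + k) = a * a ^- (N + k).+1 by rewrite expgSr invgM mulgA mulgV mul1g.
by apply: aD; rewrite mem_trM -addnS.
Qed.

(** Every element of [P] maps the axis of [a] to itself; edges of the axis are those
    that split the powers of [a], and there are finitely many up to [a]. *)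
Theorem axis_virtually_Z :
  (forall b, P b -> exists l, (0 < l)%N /\ exists k m, b * a ^+ l * b^-1 = a ^- k * a ^+ m) ->
  exists2 X : set G, finite_set X & forall h, P h -> exists2 x, X x & exists k m, h = a ^- k * a ^+ m * x.
Proof.
move=> comm; have cD := ns_cut nsE ED.
pose W := [set F | [/\ E F, F 1 & ~ F a]] `|` [set F | [/\ E F, F a & ~ F 1]].
have fW : finite_set W by rewrite finite_setU; split; exact: (ns_sep nsE).
exists [set x | exists2 w, W w & tr x D = w].
  by apply: finite_bigU => // w _; exact: (ns_stab_finite nsE).
move=> b Pb; have [l [l0 [k0 [m0 bE]]]] := comm b Pb.
have ZX i g : Zp g -> Zp (g ^+ i).
  by move=> Zg; elim: i => [|i IH]; [exists 0%N, 0%N; rewrite !expg0 !grpE|rewrite expgS; exact: ZpM].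
have bX i : b * a ^+ (l * i) * b^-1 = (b * a ^+ l * b^-1) ^+ i.
  by elim: i => [|i IH]; rewrite ?muln0 ?expg0 ?mulg1 ?mulgV // mulnS expgnDr expgS -IH !grpE.
have Zb i : Zp (b * a ^+ (l * i) * b^-1) by rewrite bX; apply: ZX; exists k0, m0.
have Zb' i : Zp (b * a ^- (l * i) * b^-1).
  by have := ZpV (Zb i); rewrite !grpE.
have linj i j : a ^+ (l * i) = a ^+ (l * j) -> i = j.
  by move=> /translation_inj /eqP; rewrite eqn_pmul2l // => /eqP.
(* the powers of [a] on the side [B] of an edge give others on the side [tr b B] *)
have inf B (u : nat -> G) N : cut B -> injective u -> (forall i, (N <= i)%N -> B (u i)) ->
    (forall i, Zp (b * u i * b^-1)) -> infinite_set (Zp `&` tr b B).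
  move=> cB ui uB uZ fin; apply: infinite_nat.
  apply: (@sub_finite_set _ _ (`I_N `|` u @^-1` [set g | B g /\ ~ B (g * b^-1)] `|`
     (fun i => b * u i * b^-1) @^-1` (Zp `&` tr b B))).
    move=> i _; have [Ni|iN] := leqP N i; last by left; left.
    have [Bb|nBb] := pselect (B (u i * b^-1)); last by left; right; split=> //; exact: uB.
    by right; split=> //=; rewrite mem_tr -mulgA mulKg.
  rewrite !finite_setU; split; first split.
  - exact: finite_II.
  - by apply: finite_preimage (cB b^-1) => i j _ _ /ui.
  - by apply: finite_preimage fin => i j _ _ /mulIg /mulgI /ui.
have i1 : infinite_set (Zp `&` tr b D).
  have [N NP] := fwd; apply: (inf D (fun i => a ^+ (l * i)) N) => // i Ni.
  by apply: NP; apply: leq_trans Ni _; rewrite leq_pmull.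
have i2 : infinite_set (Zp `&` tr b (~` D)).
  have [N NP] := bwd; apply: (inf (~` D) (fun i => a ^- (l * i)) N) => //.
  - exact: cutC.
  - by move=> i j /(congr1 (fun g => g^-1)); rewrite !invgK => /linj.
  - by move=> i Ni; apply: NP; apply: leq_trans Ni _; rewrite leq_pmull.
have [z [[k [m zE]] sep]] : exists z, Zp z /\ tr b D z <> tr b D (z * a).
  apply: contrapT => nz.
  have step z : Zp z -> tr b D z = tr b D (z * a).
    by move=> Zz; apply: contrapT => ne; apply: nz; exists z.
  have ZV i : Zp (a ^- i) by exists i, 0%N; rewrite expg0 mulg1.
  have all g : Zp g -> tr b D g = tr b D 1.
    move=> [k [m ->]]; elim: m => [|m IH]; last first.
      by rewrite expgSr mulgA -step //; exists k, m.
    rewrite expg0 mulg1; elim: k => [|k IH]; first by rewrite expg0 invg1.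
    by rewrite (step _ (ZV k.+1)) expgS invgM mulgVK.
  have [D1|nD1] := pselect (tr b D 1).
    apply: i2; apply: (@sub_finite_set _ _ set0) => // g [/all e].
    by rewrite trC => ng; apply: ng; rewrite e.
  by apply: i1; apply: (@sub_finite_set _ _ set0) => // g [/all -> ].
exists (z^-1 * b); last by exists k, m; rewrite -zE mulgA mulgV mul1g.
exists (tr (z^-1 * b) D) => //; have EzD : E (tr (z^-1 * b) D) by exact: (ns_tr nsE).
have e1 : tr (z^-1 * b) D 1 = tr b D z by rewrite trM mem_tr invgK mulg1.
have e2 : tr (z^-1 * b) D a = tr b D (z * a) by rewrite trM mem_tr invgK.
rewrite -e1 -e2 in sep.
have [D1|nD1] := pselect (tr (z^-1 * b) D 1); [left|right]; split=> //.
  by move=> Da; apply: sep; exact/propext.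
by apply: contrapT => nDa; apply: sep; exact/propext.
Qed.

End Translations.

(** * Parabolic subgroups *)

Lemma expr_small (R : realType) (q e : R) : (0 < q)%R -> (q < 1)%R -> (0 < e)%R ->
  exists N, forall n, (N <= n)%N -> (q ^+ n < e)%R.
Proof.
move=> q0 q1 e0; have nq : (`|q| < 1)%R by rewrite gtr0_norm.
have /cvgrPdist_lt /(_ _ e0) [N _ NP] := cvg_expr nq.
by exists N => n /NP /=; rewrite sub0r normrN gtr0_norm ?exprn_gt0.
Qed.

Section Parabolic.
Local Open Scope classical_set_scope.
Local Open Scope group_scope.
Variables (R : realType) (X : metricType R) (G : groupType) (act : {multiplicative G -> isom X}) (o : X).
Hypothesis cat : CAT_minus_1 X.
Variables (s M : R).
Hypothesis s0 : (0 < s)%R.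
Hypothesis s1 : (s < 1)%R.
Hypothesis sumM : forall p : seq G, uniq p -> (\sum_(g <- p) expR (- s * disp act o g) <= M)%R.
Variable P : set G.
Hypothesis P1 : P 1.
Hypothesis PV : forall g, P g -> P g^-1.
Hypothesis PM : forall g h, P g -> P h -> P (g * h).
Variable c : R -> X.
Hypothesis c_ray : ray c.
Hypothesis Pc : forall g, P g -> exists K : R, forall t : R, (0 <= t)%R -> (mdist (c t) (act g (c t)) <= K)%R.

Let F : set_system R := pinfty_nbhs R.
Let pt := pt act o.
Let size_of := size_of act o.

Let act1 : act 1 = 1.
Proof. by apply: (mulgI (act 1)); rewrite -gmulfM !mulg1. Qed.
Let actV g : act g^-1 = isomV (act g).
Proof. by apply: (mulgI (act g)); rewrite -gmulfM mulgV act1; apply/esym; exact: (mulgV (act g)). Qed.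

Let sh_lin (t : R) : (0 <= t)%R -> (t / 2 <= sh t)%R.
Proof.
move=> t0; rewrite sh_expR; have := expR_ge1Dx t.
have : (expR (- t) <= 1)%R by rewrite -expR0 ler_expR oppr_le0.
by lra.
Qed.

Let far (x : X) (B : R) : exists T : R, forall t, (T <= t)%R -> (0 <= t)%R /\ (B <= hsin x (c t))%R.
Proof.
exists (4 * `|B| + mdist x (c 0))%R => t tT.
have d0 : (0 <= mdist x (c 0))%R by exact: mdist_ge0.
have B0 := normr_ge0 B; have t0 : (0 <= t)%R by lra.
split=> //; have c0t : mdist (c 0) (c t) = t.
  by rewrite c_ray // sub0r normrN ger0_norm.
have : (mdist (c 0) (c t) <= mdist (c 0) x + mdist x (c t))%R by exact: metric_triangle.
rewrite c0t (metric_sym (c 0)) => le.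
have h0 : (0 <= mdist x (c t) / 2)%R by rewrite divr_ge0 // mdist_ge0.
apply: le_trans (sh_lin h0); apply: le_trans (ler_norm B) _; lra.
Qed.

Let F_ge (T : R) : F [set t | (T <= t)%R].
Proof. by apply: nbhs_pinfty_ge; exact: num_real. Qed.

Let F_cauchy e : (0 < e)%R -> exists2 A, F A & forall i j, A i -> A j ->
  (0 < hsin o (c i))%R /\ (hsin (c i) (c j) <= e * (hsin o (c i) * hsin o (c j)))%R.
Proof.
move=> e0; pose C := expR (mdist o (c 0)).
have C0 : (0 < C)%R by exact: expR_gt0.
have [T TP] := far o (Num.max (1%R : R) (4 * C / e)%R).
pose T2 := Num.max T (mdist o (c 0) + 2)%R.
exists [set t | (T2 <= t)%R]; first exact: F_ge.
have big t : (T2 <= t)%R -> [/\ (0 <= t)%R, (1 <= hsin o (c t))%R, (4 * C / e <= hsin o (c t))%R &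
    (expR (t / 2) <= 4 * C * hsin o (c t))%R].
  rewrite ge_max => /andP[/TP[t0]]; rewrite ge_max => /andP[h1 h2] td; split=> //.
  have c0t : mdist (c 0) (c t) = t by rewrite c_ray // sub0r normrN ger0_norm.
  have : (mdist (c 0) (c t) <= mdist (c 0) o + mdist o (c t))%R by exact: metric_triangle.
  rewrite c0t (metric_sym (c 0)) => le.
  have : (expR (t / 2) <= C * expR (mdist o (c t) / 2))%R.
    have d0 : (0 <= mdist o (c 0))%R by exact: mdist_ge0.
    by rewrite /C -expRD ler_expR; lra.
  have : (expR (mdist o (c t) / 2) <= 4 * hsin o (c t))%R.
    rewrite /hsin -ch_add_sh; move: h1; rewrite /hsin.
    have := ch_sh (mdist o (c t) / 2); have := ch_gt0 (mdist o (c t) / 2).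
    by move: (ch _) (sh _) => x y; nra.
  by move: (expR _) (expR _) (hsin _ _) => x y z; nra.
have main i j : (i <= j)%R -> (T2 <= i)%R -> (T2 <= j)%R ->
    (hsin (c i) (c j) <= e * (hsin o (c i) * hsin o (c j)))%R.
  move=> ij /big[i0 _ ie _] /big[j0 _ _ je].
  have -> : hsin (c i) (c j) = sh ((j - i) / 2).
    by rewrite /hsin c_ray // distrC ger0_norm // subr_ge0.
  have : (sh ((j - i) / 2) <= expR (j / 2))%R.
    rewrite sh_expR; have : (expR ((j - i) / 2) <= expR (j / 2))%R by rewrite ler_expR; lra.
    by have := expR_gt0 (- ((j - i) / 2)); have := expR_gt0 (j / 2); lra.
  have h0 := hsin_ge0 o (c j).
  have : (4 * C * hsin o (c j) <= e * (hsin o (c i) * hsin o (c j)))%R.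
    have ie' : (4 * C <= e * hsin o (c i))%R by rewrite [(e * _)%R]mulrC -ler_pdivrMr.
    by have := ler_wpM2r (hsin_ge0 o (c j)) ie'; rewrite -[(e * _ * _)%R]mulrA.
  by lra.
move=> i j Ai Aj; have [_ h1 _ _] := big i Ai; split; first exact: lt_le_trans h1.
have [ij|/ltW ji] := leP i j; first exact: main.
by rewrite hsinC [(hsin o _ * _)%R]mulrC; exact: main.
Qed.

Let lam g := busemann F o c (pt g).
Let FF : ProperFilter F := @proper_pinfty_nbhs R.

Let lamM g h : P g -> lam (g * h) = (lam h * lam g)%R.
Proof.
move=> Pg; rewrite /lam /pt ptM; apply: (busemann_cocycle cat (FF := FF) F_cauchy) => e e0.
have [K KP] := Pc (PV Pg); have K0 : (0 <= K)%R by apply: le_trans (KP 0%R (lexx _)); exact: mdist_ge0.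
have [T TP] := far o (Num.max (1%R : R) (sh (K / 2) / e)%R); have [T' TP'] := far (act g o) 1%R.
exists [set t | (Num.max T T' <= t)%R]; first exact: F_ge.
move=> t /=; rewrite ge_max => /andP[/TP[t0]]; rewrite ge_max => /andP[h1 h2] /TP'[_ h3].
have gE : hsin o (isomV (act g) (c t)) = hsin (act g o) (c t).
  by rewrite -[c t in RHS](isomVK (act g)) hsin_act.
rewrite gE; split; first exact: lt_le_trans h3.
apply: (@le_trans _ _ (sh (K / 2))).
  by apply: sh_le; rewrite ler_pM2r //; have := KP t t0; rewrite actV.
have : (sh (K / 2) <= e * hsin o (c t))%R by rewrite [(e * _)%R]mulrC -ler_pdivrMr.
have k0 : (0 <= sh (K / 2))%R by rewrite sh_ge0 // divr_ge0.
by move: (sh _) (hsin o _) (hsin (act g o) _) h1 h3 k0 => k x y x1 y1 k0 ke; nra.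
Qed.

Let lam1 : lam 1 = 1%R.
Proof. by rewrite /lam /pt pt1; exact: (busemann_base cat (FF := FF) F_cauchy). Qed.

Let lamV g : P g -> (lam g^-1 * lam g = 1)%R.
Proof. by move=> Pg; rewrite -lamM // mulgV lam1. Qed.

Let lam_gt0 g : P g -> (0 < lam g)%R.
Proof.
move=> Pg; rewrite lt_def (busemann_ge0 cat (FF := FF) F_cauchy) andbT.
by apply/eqP => l0; have := lamV Pg; rewrite l0 mulr0 => /esym /eqP; rewrite oner_eq0.
Qed.

Let lam_pto g h k : (hsin (pt g) (pt k) * lam h <=
  hsin (pt g) (pt h) * lam k + hsin (pt h) (pt k) * lam g)%R.
Proof. exact: (busemann_ptolemy cat (FF := FF) F_cauchy). Qed.

Let finite_size B : finite_set [set g | (size_of g <= B)%R].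
Proof.
apply: sub_finite_set (finite_ball s0 sumM (4 * B)%R) => g /= gB.
have h0 : (0 <= disp act o g / 2)%R by rewrite divr_ge0 // mdist_ge0.
have : (disp act o g / 2 / 2 <= B)%R by apply: le_trans (sh_lin h0) _; exact: gB.
by lra.
Qed.

Let D g h := (hsin (pt g) (pt h) / (lam g * lam h))%R.

Let lamX g n : P g -> P (g ^+ n) /\ lam (g ^+ n) = (lam g ^+ n)%R.
Proof.
move=> Pg; elim: n => [|n [Pn IH]]; first by rewrite expg0 lam1.
by rewrite expgS; split; [exact: PM|rewrite lamM // IH exprSr].
Qed.

Let D_tri g h k : P g -> P h -> P k -> (D g k <= D g h + D h k)%R.
Proof.
move=> Pg Ph Pk; have := lam_pto g h k; rewrite /D.
have := lam_gt0 Pg; have := lam_gt0 Ph; have := lam_gt0 Pk.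
move: (lam g) (lam h) (lam k) (hsin (pt g) (pt k)) (hsin (pt g) (pt h)) (hsin (pt h) (pt k)) =>
  x y z u v w z0 y0 x0 le.
have -> : (u / (x * z) = (u * y) / (x * y * z))%R by field; rewrite !gt_eqF.
have -> : (v / (x * y) + w / (y * z) = (v * z + w * x) / (x * y * z))%R by field; rewrite !gt_eqF.
by rewrite ler_pM2r // invr_gt0 !mulr_gt0.
Qed.

Let D_mul k g h : P k -> (D (k * g) (k * h) = D g h / lam k ^+ 2)%R.
Proof.
move=> Pk; rewrite /D /pt !ptM hsin_act -/(pt g) -/(pt h) !lamM //.
rewrite expr2 !invfM.
have e (u x y z : R) : (u * (x * z * (y * z)) = u * (x * y) * (z * z))%R by ring.
exact: e.
Qed.

Let DC g h : D g h = D h g. Proof. by rewrite /D hsinC [(lam g * _)%R]mulrC. Qed.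

Let D_ge0 g h : P g -> P h -> (0 <= D g h)%R.
Proof.
by move=> Pg Ph; apply: mulr_ge0; [exact: hsin_ge0|rewrite invr_ge0 mulr_ge0 // ltW // lam_gt0].
Qed.

(** An element that contracts towards the point at infinity conjugates the elements
    with bounded multiplier into a ball, so that there are finitely many of these. *)
Let contraction_virtually_Z a : P a -> (lam a < 1)%R -> exists2 X0 : set G, finite_set X0 &
  forall h, P h -> exists2 x, X0 x & exists k m, h = a ^- k * a ^+ m * x.
Proof.
move=> Pa a1; pose q := lam a; have q0 : (0 < q)%R := lam_gt0 Pa.
pose E0 := (D 1 a * q ^+ 2 / (1 - q ^+ 2))%R.
have q2 : (q ^+ 2 < 1)%R by rewrite expr_lt1 // ltW.
(* [D] is scaled by [a], so the distances of its powers add up to a geometric sum *)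
have En n : (q ^+ n ^+ 2 * D 1 (a ^+ n) <= E0)%R.
  have d0 : (0 <= D 1 a)%R by exact: D_ge0.
  have q20 : (0 <= q ^+ 2)%R by rewrite exprn_ge0 // ltW.
  elim: n => [|n IH].
    rewrite expg0 /D hsinxx mul0r mulr0 divr_ge0 //; first exact: mulr_ge0.
    by rewrite subr_ge0 ltW.
  have [Pn ln] := lamX n Pa; have [Pn1 _] := lamX n.+1 Pa.
  have le : (D 1 (a ^+ n.+1) <= D 1 (a ^+ n) + D 1 a / (q ^+ n) ^+ 2)%R.
    apply: le_trans (D_tri P1 Pn Pn1) _; rewrite lerD2l.
    by rewrite -[X in D X _]mulg1 expgSr D_mul // ln.
  have qn0 : (0 < (q ^+ n) ^+ 2)%R by rewrite !exprn_gt0.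
  have EE : (E0 * (1 - q ^+ 2) = D 1 a * q ^+ 2)%R.
    by rewrite /E0 divfK // gt_eqF // subr_gt0.
  have : (q ^+ n.+1 ^+ 2 * D 1 (a ^+ n.+1) <= q ^+ 2 * ((q ^+ n) ^+ 2 * D 1 (a ^+ n) + D 1 a))%R.
    have -> : (q ^+ n.+1 ^+ 2 = q ^+ 2 * (q ^+ n) ^+ 2)%R by rewrite (exprSr q n) exprMn mulrC.
    rewrite -mulrA ler_wpM2l //.
    have := ler_wpM2l (ltW qn0) le; rewrite mulrDr => /le_trans; apply.
    by rewrite lerD2l mulrC divfK // gt_eqF.
  move/le_trans; apply; have -> : (E0 = q ^+ 2 * E0 + D 1 a * q ^+ 2)%R.
    by rewrite -EE mulrBr mulr1 [(E0 * _)%R]mulrC addrC subrK.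
  by rewrite mulrDr [(q ^+ 2 * D 1 a)%R]mulrC lerD2r ler_wpM2l.
pose Q := (q^-1)%R; have Q1 : (1 < Q)%R by rewrite invf_gt1.
pose B := ((Q + 1) * E0 + 1)%R.
pose Z := [set g | P g /\ (1 <= lam g <= Q)%R].
have E00 : (0 <= E0)%R by apply: le_trans (En 0%N); rewrite expg0 /D hsinxx mul0r mulr0.
(* high powers of [a] conjugate [g] into a fixed ball *)
have conj g : Z g -> exists N, forall n, (N <= n)%N -> (size_of ((a ^+ n)^-1 * g * a ^+ n) <= B)%R.
  move=> [Pg /andP[lg1 lgQ]]; have lg0 := lam_gt0 Pg.
  have sg0 : (0 <= size_of g)%R by exact: size_ge0.
  have [N NP] : exists N, forall n, (N <= n)%N -> ((q ^+ n) ^+ 2 * size_of g <= 1)%R.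
    have e0 : (0 < (size_of g + 1)^-1)%R by rewrite invr_gt0 ltr_wpDl.
    have [N NP] := expr_small q0 a1 e0; exists N => n /NP lt.
    have qn0 : (0 < q ^+ n)%R by rewrite exprn_gt0.
    have qn1 : (q ^+ n <= 1)%R by rewrite exprn_ile1 // ltW.
    have : (q ^+ n * (size_of g + 1) <= 1)%R by rewrite -ler_pdivlMr ?ltr_wpDl // mul1r ltW.
    by move: (q ^+ n)%R (size_of g) sg0 qn0 qn1 => x y; nra.
  exists N => n Nn; have [Pn ln] := lamX n Pa; have qn0 : (0 < q ^+ n)%R by rewrite exprn_gt0.
  rewrite -mulgA /size_of -(hsin_pt act o (a ^+ n)) -/pt.
  have Pgn : P (g * a ^+ n) by exact: PM.
  have -> : hsin (pt (a ^+ n)) (pt (g * a ^+ n)) =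
      ((q ^+ n) ^+ 2 * lam g * D (a ^+ n) (g * a ^+ n))%R.
    by rewrite /D lamM // ln -/q; field; rewrite !gt_eqF.
  have t1 : (D (a ^+ n) (g * a ^+ n) <= D 1 (a ^+ n) + D 1 g + D 1 (a ^+ n) / lam g ^+ 2)%R.
    apply: le_trans (D_tri Pn P1 Pgn) _; rewrite DC -addrA lerD2l.
    apply: le_trans (D_tri P1 Pg Pgn) _; rewrite lerD2l.
    by rewrite -[X in D X _]mulg1 D_mul.
  have sgE : (lam g * D 1 g = size_of g)%R.
    by rewrite /D lam1 mul1r mulrC divfK ?gt_eqF // /pt pt1.
  have En' := En n; have q2n : (0 < (q ^+ n) ^+ 2)%R by rewrite exprn_gt0.
  have := ler_wpM2l (ltW (mulr_gt0 q2n lg0)) t1.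
  move=> /le_trans; apply.
  have -> : ((q ^+ n) ^+ 2 * lam g * (D 1 (a ^+ n) + D 1 g + D 1 (a ^+ n) / lam g ^+ 2) =
     (lam g + (lam g)^-1) * ((q ^+ n) ^+ 2 * D 1 (a ^+ n)) + (q ^+ n) ^+ 2 * (lam g * D 1 g))%R.
    by field; rewrite gt_eqF.
  rewrite sgE /B; apply: lerD (NP n Nn).
  have x0 : (0 <= (q ^+ n) ^+ 2 * D 1 (a ^+ n))%R by apply: mulr_ge0; [exact: ltW|exact: D_ge0].
  apply: ler_pM => //; first by rewrite addr_ge0 ?invr_ge0 // ltW.
  by apply: lerD => //; rewrite invf_le1.
have fZ : finite_set Z.
  apply: contrapT => iZ; pose k := ncard [set g | (size_of g <= B)%R].
  have [A AZ cA] := infinite_set_fset k.+1 iZ.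
  have exN g : exists N, g \in A -> forall n, (N <= n)%N -> (size_of ((a ^+ n)^-1 * g * a ^+ n) <= B)%R.
    have [gA|ngA] := boolP (g \in A); last by exists 0%N.
    by have [N NP] := conj g (AZ g gA); exists N.
  have [N NP] := choice exN; pose n := (\max_(g <- A) N g)%N.
  have sub : (fun g => (a ^+ n)^-1 * g * a ^+ n) @` [set` A] `<=` [set g | (size_of g <= B)%R].
    move=> _ [g /= gA <-]; apply: (NP g gA).
    by have : (N g <= \max_(g <- A) N g)%N by exact: leq_bigmax_seq.
  have := ncard_sub (finite_size B) sub; rewrite leqNgt => /negP; apply.
  apply: leq_trans cA _; have -> : #|` A| = ncard [set` A] by rewrite /ncard set_fsetK.
  have fA : finite_set [set` A] by exact: finite_fset.
  apply: leq_trans (ncard_image_le (fun g => a ^+ n * g * (a ^+ n)^-1) (finite_image _ fA)).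
  apply: ncard_sub; first by do 2!apply: finite_image.
  by move=> g gA; exists ((a ^+ n)^-1 * g * a ^+ n); [exists g|rewrite !grpE].
exists Z => // h Ph; have lh0 := lam_gt0 Ph.
have Qpow n : (Q ^+ n * q ^+ n = 1)%R by rewrite -exprMn mulVf ?gt_eqF // expr1n.
have arch (x : R) : exists n, (x <= Q ^+ n)%R.
  have x0 := normr_ge0 x; have x1 : (0 < `|x| + 1)%R by lra.
  have e0 : (0 < (`|x| + 1)^-1)%R by rewrite invr_gt0.
  have [N NP] := expr_small q0 a1 e0; exists N; have lt := NP N (leqnn N).
  have qN0 : (0 < q ^+ N)%R by rewrite exprn_gt0.
  have : (q ^+ N * (`|x| + 1) <= 1)%R by rewrite -ler_pdivlMr // mul1r ltW.
  have QN0 : (0 < Q ^+ N)%R by rewrite exprn_gt0 // invr_gt0.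
  have QN := Qpow N; have xx := ler_norm x.
  move=> le; have := ler_wpM2l (ltW QN0) le; rewrite mulrA QN mul1r mulr1; lra.
(* multiplying by powers of [a] brings the multiplier into the interval *)
have [n nP] := arch (lam h).
have qn0 : (0 < q ^+ n)%R by rewrite exprn_gt0.
have QN0 i : (0 < Q ^+ i)%R by rewrite exprn_gt0 // invr_gt0.
have b0 : (0 < lam h * q ^+ n)%R by rewrite mulr_gt0.
have b1 : (lam h * q ^+ n <= 1)%R by rewrite -(Qpow n) ler_pM2r.
have exm : exists m, (1 <= lam h * q ^+ n * Q ^+ m)%R.
  have [m mP] := arch (lam h * q ^+ n)^-1%R; exists m.
  by rewrite mulrC -ler_pdivrMr // mul1r.
have [m [m1 m2]] : exists m, (1 <= lam h * q ^+ n * Q ^+ m)%R /\ (lam h * q ^+ n * Q ^+ m <= Q)%R.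
  case: (ex_minnP exm) => m m1 mmin; exists m; split=> //.
  case: m m1 mmin => [|m] m1 mmin; first by rewrite expr0 mulr1; apply: le_trans b1 (ltW Q1).
  have lt : (lam h * q ^+ n * Q ^+ m < 1)%R.
    by rewrite ltNge; apply/negP => /mmin; rewrite ltnn.
  rewrite exprSr mulrA -[X in (_ <= X)%R]mul1r ler_pM2r; last by rewrite invr_gt0.
  exact: ltW.
have [Pn ln] := lamX n Pa; have [Pm lm] := lamX m Pa.
have lVm : lam (a ^- m) = (Q ^+ m)%R.
  have := lamV Pm; rewrite lm -/q -(Qpow m) => e.
  by apply: (mulIf (lt0r_neq0 (exprn_gt0 m q0))).
have Pnm : P (a ^+ n * a ^- m) by apply: PM => //; exact: PV.
exists (a ^+ n * a ^- m * h).
  split; first exact: PM.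
  rewrite lamM // lamM // ln lVm [(Q ^+ m * _)%R]mulrC mulrA; exact/andP.
exists n, m; have cm : a ^- n * a ^+ m = a ^+ m * a ^- n.
  have : commute (a ^+ m) (a ^+ n)^-1 by apply: commuteV; apply: commuteX2; exact: commute_refl.
  by [].
by rewrite cm !mulgA mulgVK mulgV mul1g.
Qed.

Let size_sub : (forall g, P g -> lam g = 1%R) -> forall g h, P g -> P h ->
  (size_of (g * h) <= size_of g + size_of h)%R.
Proof.
move=> l1 g h Pg Ph; have Pgh : P (g * h) by exact: PM.
have := lam_pto 1 g (g * h); rewrite !l1 // !mulr1 => le.
have e : hsin (pt g) (pt (g * h)) = size_of h by rewrite hsin_pt mulKg.
have o1 : pt 1 = o by exact: pt1.
by move: le; rewrite e o1.
Qed.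

Let size_subX : (forall g, P g -> lam g = 1%R) -> forall a n, P a ->
  (size_of (a ^+ n) <= n%:R * size_of a)%R.
Proof.
move=> l1 a n Pa; elim: n => [|n IH]; last first.
  rewrite expgS mulrS mulrDl mul1r; apply: le_trans (size_sub l1 Pa (lamX n Pa).1) _.
  by rewrite lerD2l.
by rewrite mul0r expg0; change (hsin o (pt 1) <= 0)%R; rewrite [pt 1](pt1 act o) hsinxx.
Qed.

(** When the multipliers are trivial, the size is subadditive and grows so slowly
    that two commuting sets of powers have too many products to be different. *)
Let commensurable a b : (forall g, P g -> lam g = 1%R) -> injective (fun k => a ^+ k) -> P a -> P b ->
  exists l, (0 < l)%N /\ exists k m, b * a ^+ l * b^-1 = a ^- k * a ^+ m.
Proof.
move=> l1 ai Pa Pb; apply: contrapT => nc.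
pose C := (2 * size_of a + 2 * size_of b)%R.
apply: (@size_growth _ _ _ act o s M s0 s1 sumM setT C) => n.
pose f (x : 'I_n * 'I_n) := a ^+ x.1 * (b * a ^+ x.2 * b^-1); exists f; split.
  have lt (i j i' j' : nat) : (j < j')%N -> a ^+ i * (b * a ^+ j * b^-1) <> a ^+ i' * (b * a ^+ j' * b^-1).
    move=> jj e; apply: nc; exists (j' - j)%N; rewrite subn_gt0; split=> //; exists i', i.
    have -> : b * a ^+ (j' - j) * b^-1 = (b * a ^+ j' * b^-1) * (b * a ^+ j * b^-1)^-1.
      rewrite -{2}(subnK (ltnW jj)) expgnDr !invgM invgK !mulgA.
      by rewrite mulgVK mulgK.
    by apply: (mulgI (a ^+ i')); rewrite [LHS]mulgA -e mulgK mulgA mulgV mul1g.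
  move=> [i j] [i' j'] /= e; have [jj|jj|jj] := ltngtP j j'; first by case: (lt _ _ _ _ jj e).
    by case: (lt _ _ _ _ jj (esym e)).
  have ej : j = j' by exact: val_inj.
  by move: e; rewrite /f /= ej => /mulIg /ai /val_inj ->.
move=> [i j]; split=> //; rewrite /f /=.
have [Pi _] := lamX i Pa; have [Pj _] := lamX j Pa; have Pbj : P (b * a ^+ j) by exact: PM.
have PVb := PV Pb.
have le1 := size_sub l1 Pi (PM Pbj PVb); have le2 := size_sub l1 Pbj PVb.
have le3 := size_sub l1 Pb Pj; have le4 := size_subX l1 i Pa; have le5 := size_subX l1 j Pa.
have e : size_of b^-1 = size_of b by exact: size_ofV.
have a0 : (0 <= size_of a)%R by exact: size_ge0.
have b0 : (0 <= size_of b)%R by exact: size_ge0.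
have n1 : (1 <= n%:R :> R)%R by rewrite ler1n; exact: leq_ltn_trans (leq0n _) (ltn_ord i).
have ni : (i%:R * size_of a <= n%:R * size_of a)%R by rewrite ler_wpM2r // ler_nat ltnW.
have nj : (j%:R * size_of a <= n%:R * size_of a)%R by rewrite ler_wpM2r // ler_nat ltnW.
have nb : (size_of b <= n%:R * size_of b)%R by rewrite -{1}[size_of b]mul1r ler_wpM2r.
change (size_of (a ^+ i * (b * a ^+ j * b^-1)) <= C * n%:R)%R.
have -> : (C * n%:R = n%:R * size_of a + n%:R * size_of a + n%:R * size_of b + n%:R * size_of b)%R.
  by rewrite /C; ring.
move: le1 le2 le3; rewrite e; lra.
Qed.

(** The stabilizer of a point at infinity is virtually infinite cyclic: if it has a
    nontrivial multiplier, it is generated up to a finite set by a contraction, and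
    otherwise by a translation of the tree. *)
Theorem parabolic_virtually_Z (d : nat -> set G) n : nested_system (orb d `I_n) ->
  (forall H, vst (orb d `I_n) H -> finite_set H) -> infinite_set P ->
  exists2 a, P a & exists2 X0 : set G, finite_set X0 &
    forall h, P h -> exists2 x, X0 x & exists k m, h = a ^- k * a ^+ m * x.
Proof.
move=> nsE fin iP.
have [[g Pg g1]|nl] := pselect (exists2 g, P g & lam g <> 1%R).
  have [lt|gt|//] := ltgtP (lam g) 1%R; first by exists g => //; exact: contraction_virtually_Z.
  exists g^-1; first exact: PV.
  apply: contraction_virtually_Z; first exact: PV.
  have := lamV Pg; have := lam_gt0 (PV Pg); move: (lam g) (lam _) gt => x y; nra.
have l1 g : P g -> lam g = 1%R.
  by move=> Pg; apply: contrapT => ne; apply: nl; exists g.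
have [a Pa [D0 ED [aD naD]]] := ex_translation nsE PV PM iP fin.
exists a => //; apply: (axis_virtually_Z nsE ED aD naD) => b Pb.
by apply: commensurable => //; exact: (translation_inj aD naD).
Qed.

End Parabolic.

(** * Groups with finite vertex stabilizers *)

Section Terminal.
Local Open Scope classical_set_scope.
Local Open Scope group_scope.

Lemma chain_distinct (G : groupType) (S : seq G) c n i j g : chain S c n ->
  (i < n)%N -> (j < n)%N -> tr g (c i) = c j -> i = j.
Proof.
move=> ch; have key i' j' g' : (i' < j')%N -> (j' < n)%N -> tr g' (c i') = c j' -> False.
  move=> lt jn e; have [H [vH _ [[_ i1 i2] _] _ _]] := ch _ jn.
  have : orb c `I_j' (c j') by exists i' => //; exists g'; left.
  have chj : chain S c j' by move=> k kj; apply: ch; exact: ltn_trans jn.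
  by move=> /(vst_side (chain_system chj (@subset_refl _ _)) vH); case.
move=> ilt jlt e; have [lt|lt|//] := ltngtP i j; first by case: (key _ _ _ lt jlt e).
by case: (key j i g^-1 lt ilt); rewrite -e trK.
Qed.

Lemma finite_virtually_free (G : groupType) : finite_set [set: G] -> virtually_free G.
Proof.
move=> fG; have N1 : [set (1 : G)] 1 by [].
have NV g : [set (1 : G)] g -> [set (1 : G)] g^-1 by move=> /= ->; rewrite invg1.
have NM g h : [set (1 : G)] g -> [set (1 : G)] h -> [set (1 : G)] (g * h).
  by move=> /= -> ->; rewrite mulg1.
exists (subgroup_of N1 NV NM); first exact: finite_image.
have triv (g : subgrp (subgroup_of N1 NV NM)) : g = 1.
  by have := subgrp_valP g; rewrite subgroup_ofE => /asboolP e; apply: val_inj; exact: e.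
exists set0 => K f; split.
  have oneM : {morph (fun _ : subgrp (subgroup_of N1 NV NM) => 1 : K) : x y / x * y >-> x * y}.
    by move=> x y; rewrite mulg1.
  by exists (hom_of oneM) => g; rewrite inE.
move=> phi psi _ _ g; rewrite (triv g).
have one (u : {multiplicative subgrp (subgroup_of N1 NV NM) -> K}) : u 1 = 1.
  by apply: (mulgI (u 1)); rewrite -gmulfM !mulg1.
by rewrite !one.
Qed.

(** The tree of the cuts has finite vertex stabilizers and finitely many orbits of
    edges, except that there is no tree to speak of when there are no cuts: then
    the whole group is the only vertex stabilizer. *)
Theorem terminal_virtually_free (G : groupType) (S : seq G) c n : chain S c n ->
  (forall H, vst (orb c `I_n) H -> finite_set H) -> virtually_free G.
Proof.
case: n => [|n] ch fin.
  apply: finite_virtually_free; apply: fin; left; split=> //.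
  by apply/seteqP; split=> // C [i].
have nsE := chain_system ch (@subset_refl _ `I_n.+1).
apply: (finite_stab_virtually_free (orb_gtree nsE) (e := fun i : 'I_n.+1 => c i)).
- by move=> i; exists (nat_of_ord i); [exact: ltn_ord|exists 1; rewrite tr1].
- by move=> f [i /= iln [g ->]]; exists (Ordinal iln), g.
- by move=> i j g /esym e; apply/esym/val_inj; exact: (chain_distinct ch (ltn_ord j) (ltn_ord i) e).
- have finv D : orb c `I_n.+1 D -> finite_set (vstab (tau (orb c `I_n.+1) D)).
    by move=> ED; apply: fin; right; exists D.
  have finl v : finite_set (vstab v) -> finite_set (estab (orb_av (G := G)) (inl v)).
    by move=> fv; apply: sub_finite_set fv => g /= [].
  move=> D x oD; have ED := orb_pos_E oD; have EDC := nsC nsE ED.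
  case=> ->; last by apply: finl; exact: finv.
  rewrite /orb_src; case: asboolP => _; last by apply: finl; exact: finv.
  apply: (@sub_finite_set _ _ ([set g | tr g D = D] `|` [set g | tr g D = ~` D])).
    by move=> g [] ; rewrite -midpoint_tr => /midpoint_inj.
  by rewrite finite_setU; split; apply: (ns_stab_finite nsE).
Qed.

End Terminal.

(** * The Poincare series *)

Section Poincare.
Local Open Scope classical_set_scope.
Local Open Scope group_scope.
Variables (R : realType) (X : metricType R) (o : X) (Gamma : groupClosed (isom X)).

Lemma convergent_sums : (critical_exponent o Gamma < 1)%E ->
  exists s M : R, [/\ (0 < s)%R, (s < 1)%R & forall p : seq (subgrp Gamma), uniq p ->
    (\sum_(g <- p) expR (- s * disp (incl Gamma) o g) <= M)%R].
Proof.
move=> /ereal_inf_lt [_ [s [s0 fin] <-]]; rewrite lte_fin => s1.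
exists s, (fine (esum [set` Gamma] (fun g : isom X => (expR (- s * mdist o (g o))%R)%:E))); split=> // p up.
rewrite -lee_fin fineK; last first.
  rewrite ge0_fin_numE //; apply: esum_ge0 => g _.
  by rewrite lee_fin expR_ge0.
apply: esum_ge; exists [set` map val p].
  split; first exact: finite_seq.
  by move=> _ /= /mapP[g _ ->]; exact: subgrp_valP.
rewrite -fsbig_seq; last by rewrite map_inj_uniq //; exact: val_inj.
by rewrite big_map sumEFin lee_fin.
Qed.

Hypothesis cat : CAT_minus_1 X.
Variables (s M : R).
Hypothesis s0 : (0 < s)%R.
Hypothesis s1 : (s < 1)%R.
Hypothesis sumM : forall p : seq (subgrp Gamma), uniq p ->
  (\sum_(g <- p) expR (- s * disp (incl Gamma) o g) <= M)%R.

(** Every infinite vertex stabilizer can be split further, and each of the finiteness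
    conditions stops this process. *)
Theorem terminal_chain :
  [\/ finitely_generated (subgrp Gamma) /\ accessible_over_finite (subgrp Gamma),
      finitely_presented (subgrp Gamma)
    | finitely_generated (subgrp Gamma) /\ bounded_finite_subgroups (subgrp Gamma)] ->
  exists (S : seq (subgrp Gamma)) c n, chain S c n /\
    forall H, vst (orb c `I_n) H -> finite_set H.
Proof.
have main (S : seq (subgrp Gamma)) :
    (forall s : subgrp Gamma, s \in S -> s^-1 \in S) ->
    (forall P : subgrp Gamma -> Prop, P 1 ->
      (forall g s, s \in S -> P g -> P (g * s)) -> forall g, P g) ->
    (forall c, (forall n, chain S c n) -> False) ->
    exists (S : seq (subgrp Gamma)) c n, chain S c n /\
      forall H, vst (orb c `I_n) H -> finite_set H.
  move=> Ssym Sgen noinf; have [||[c ch]] := @chain_alternative _ S Ssym Sgen.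
  - move=> c n H ch vH iH.
    exact: (vertex_splits cat Sgen s0 s1 sumM (chain_system ch (@subset_refl _ _)) vH iH).
  - by move=> [c [n ?]]; exists S, c, n.
  - by case: (noinf c ch).
case=> [[/finitely_generated_seq[S [Ssym Sgen]] acc]|/finitely_presented_coherent[S [Ssym Sgen coh]]|
    [/finitely_generated_seq[S [Ssym Sgen]] [N NP]]]; apply: (main S Ssym Sgen) => c ch.
- exact: (accessible_no_infinite_chain ch R Sgen acc).
- exact: (coherent_no_infinite_chain Ssym Sgen coh ch).
- apply: (no_infinite_bounded_chain Sgen ch R (k := N)) => j.
  pose K : set (subgrp Gamma) := [set g | tr g (c j) = c j].
  have K1 : K 1 by exact: tr1.
  have KV g : K g -> K g^-1 by rewrite /K /= => gc; rewrite -{1}gc trK.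
  have KM g h : K g -> K h -> K (g * h) by rewrite /K /= => gc hc; rewrite trM hc gc.
  have KE : [set` subgroup_of K1 KV KM] = K.
    apply/seteqP; split=> g Kg.
      by have : g \in subgroup_of K1 KV KM := Kg; rewrite subgroup_ofE => /asboolP.
    suff : g \in subgroup_of K1 KV KM by [].
    by rewrite subgroup_ofE; apply/asboolP.
  have nsE := chain_system (ch j.+1) (@subset_refl _ _).
  have fK : finite_set K.
    by apply: (ns_stab_finite nsE); exists j => //=; exists 1; left; rewrite tr1.
  by have := NP (subgroup_of K1 KV KM); rewrite KE => /(_ fK) /geq_card_fset_set.
Qed.

End Poincare.

(** * Virtually cyclic groups *)

Section VirtuallyCyclic.
Local Open Scope classical_set_scope.
Local Open Scope group_scope.

Lemma mult_powers (G H : groupType) (f : {multiplicative G -> H}) a k m :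
  f (a ^- k * a ^+ m) = f a ^- k * f a ^+ m.
Proof.
have f1 : f 1 = 1 by apply: (mulgI (f 1)); rewrite -gmulfM !mulg1.
have fV g : f g^-1 = (f g)^-1 by apply: (mulgI (f g)); rewrite -gmulfM !mulgV.
have fX g n : f (g ^+ n) = f g ^+ n.
  by elim: n => [|n IH]; rewrite ?expg0 // !expgS gmulfM IH.
by rewrite gmulfM fV !fX.
Qed.

Lemma powers_virtually_cyclic (G : groupType) (a : G) (X0 : set G) : finite_set X0 ->
  (forall h, exists2 x, X0 x & exists k m, h = a ^- k * a ^+ m * x) -> virtually_cyclic G.
Proof.
move=> fX XP; pose Z := [set g | exists k m, g = a ^- k * a ^+ m].
have aC k m : a ^+ m * a ^- k = a ^- k * a ^+ m.
  have : commute (a ^+ m) (a ^+ k)^-1 by apply: commuteV; apply: commuteX2; exact: commute_refl.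
  by [].
have Z1 : Z 1 by exists 0%N, 0%N; rewrite !expg0 invg1 mulg1.
have ZV g : Z g -> Z g^-1 by move=> [k [m ->]]; exists m, k; rewrite invgM invgK.
have ZM g h : Z g -> Z h -> Z (g * h).
  move=> [k [m ->]] [k' [m' ->]]; exists (k' + k)%N, (m + m')%N.
  rewrite !expgnDr invgM !mulgA; congr (_ * _).
  by rewrite -[LHS]mulgA -[RHS]mulgA aC.
have ZE g : (g \in subgroup_of Z1 ZV ZM) <-> Z g by rewrite subgroup_ofE; split=> /asboolP.
exists (subgroup_of Z1 ZV ZM).
  apply: sub_finite_set (finite_image (fun x => left_coset x^-1 [set` subgroup_of Z1 ZV ZM]) fX).
  move=> _ [g _ <-]; have [x Xx [k [m gE]]] := XP g^-1; exists x => //.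
  have Zz : Z (a ^- k * a ^+ m) by exists k, m.
  have gz : x^-1 = g * (a ^- k * a ^+ m).
    by rewrite -[g]invgK gE invgM mulgVK.
  apply/seteqP; split=> _ [y /ZE Zy <-].
    exists (a ^- k * a ^+ m * y); last by rewrite gz mulgA.
    by apply/ZE; exact: (ZM _ _ Zz Zy).
  exists ((a ^- k * a ^+ m)^-1 * y); last by rewrite gz mulgA mulgK.
  by apply/ZE; exact: (ZM _ _ (ZV _ Zz) Zy).
have aZ : a \in subgroup_of Z1 ZV ZM.
  by apply/ZE; exists 0%N, 1%N; rewrite expg0 invg1 mul1g expg1.
exists (Subgrp aZ) => H aH x; have aH' : Subgrp aZ \in H by exact: aH.
case: x => x xZ; have := xZ; rewrite subgroup_ofE => /asboolP [k [m xE]].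
have -> : Subgrp xZ = Subgrp aZ ^- k * Subgrp aZ ^+ m.
  by apply: val_inj; rewrite -[RHS]/(incl _ _) mult_powers.
by apply: gpredM; [exact: gpredXNn|exact: gpredXn].
Qed.

Lemma stab_bounded (R : realType) (X : metricType R) (o : X) (Gamma : groupClosed (isom X)) xi :
  parabolic_point o Gamma xi -> exists2 c : R -> X, ray c & forall g, boundary_stab Gamma xi g ->
    exists K : R, forall t : R, (0 <= t)%R -> (mdist (c t) (g (c t)) <= K)%R.
Proof.
move=> [[[c rc xiE] _] _ _]; exists c => // g [_ gxi].
have xc : xi c.
  by rewrite xiE; split=> //; exists 0%R => t _; rewrite mdistxx.
have : xi ((g : X -> X) \o c) by rewrite -gxi; exists c.
by rewrite xiE => -[_ [K KP]]; exists K => t t0; exact: KP.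
Qed.

Lemma maximal_parabolic_virtually_cyclic (R : realType) (X : metricType R) (o : X)
    (Gamma P : groupClosed (isom X)) (s M : R) (S : seq (subgrp Gamma)) c n :
  CAT_minus_1 X -> (0 < s)%R -> (s < 1)%R ->
  (forall p : seq (subgrp Gamma), uniq p ->
    (\sum_(g <- p) expR (- s * disp (incl Gamma) o g) <= M)%R) ->
  chain S c n -> (forall H, vst (orb c `I_n) H -> finite_set H) ->
  maximal_parabolic o Gamma P -> virtually_cyclic (subgrp P).
Proof.
move=> cat s0 s1 sumM ch fin [xi pp PE].
have [r rr rP] := stab_bounded pp; have [_ iP _] := pp.
have PG g : g \in P -> g \in Gamma.
  by move=> gP; have : [set` P] g by []; rewrite PE => -[].
pose P' : set (subgrp Gamma) := [set g | incl Gamma g \in P].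
have P1 : P' 1 by exact: gpred1.
have PV g : P' g -> P' g^-1 by rewrite /P' /= => gP; rewrite gpredV.
have PM g h : P' g -> P' h -> P' (g * h) by move=> gP hP; exact: gpredM.
have iP' : infinite_set P'.
  move=> fP'; apply: iP; rewrite -PE; apply: sub_finite_set (finite_image (incl Gamma) fP') => g gP.
  by exists (Subgrp (PG g gP)).
have Pr g : P' g -> exists K : R, forall t : R, (0 <= t)%R -> (mdist (r t) (incl Gamma g (r t)) <= K)%R.
  by move=> gP; apply: rP; rewrite -PE.
have [a Pa [X0 fX XP]] := parabolic_virtually_Z cat s0 s1 sumM P1 PV PM rr Pr
  (chain_system ch (@subset_refl _ _)) fin iP'.
apply: (@powers_virtually_cyclic (subgrp P) (Subgrp Pa) [set y | (incl Gamma @` X0) (incl P y)]).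
  by apply: finite_preimage (finite_image _ fX) => y z _ _; exact: val_inj.
move=> h; have hP := subgrp_valP h; have hG := PG _ hP.
have [x Xx [k [m hE]]] := XP (Subgrp hG) hP.
pose z : subgrp P := Subgrp Pa ^- k * Subgrp Pa ^+ m.
have zE : incl P z = incl Gamma (a ^- k * a ^+ m) by rewrite !mult_powers.
have hE' : incl P h = incl P z * incl Gamma x by rewrite zE -gmulfM -hE.
exists (z^-1 * h); last by exists k, m; rewrite mulgA mulgV mul1g.
exists x => //; apply: (mulgI (incl P z)); rewrite -hE' -gmulfM.
by rewrite mulgA mulgV mul1g.
Qed.

End VirtuallyCyclic.

Local Open Scope ring_scope.

Theorem corollary1p5 (R : realType) (X : metricType R)
    (X_proper : proper_space X) (X_cat : CAT_minus_1 X) (o : X)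
    (Gamma : groupClosed (isom X)) (Gamma_discrete : discrete_isom_group Gamma) :
  [/\ finitely_generated (subgrp Gamma) ->
        accessible_over_finite (subgrp Gamma) ->
        ~ virtually_free (subgrp Gamma) ->
        (1 <= critical_exponent o Gamma)%E,
      finitely_presented (subgrp Gamma) ->
        ~ virtually_free (subgrp Gamma) ->
        (1 <= critical_exponent o Gamma)%E,
      finitely_generated (subgrp Gamma) ->
        bounded_finite_subgroups (subgrp Gamma) ->
        ~ virtually_free (subgrp Gamma) ->
        (1 <= critical_exponent o Gamma)%E
    & [\/ finitely_generated (subgrp Gamma) /\
            accessible_over_finite (subgrp Gamma),
          finitely_presented (subgrp Gamma)
        | finitely_generated (subgrp Gamma) /\
            bounded_finite_subgroups (subgrp Gamma)] ->
      (exists2 P : groupClosed (isom X),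
         maximal_parabolic o Gamma P & ~ virtually_cyclic (subgrp P)) ->
      (1 <= critical_exponent o Gamma)%E].
Proof.
have fin : (critical_exponent o Gamma < 1)%E -> ([\/ finitely_generated (subgrp Gamma) /\
      accessible_over_finite (subgrp Gamma), finitely_presented (subgrp Gamma)
    | finitely_generated (subgrp Gamma) /\ bounded_finite_subgroups (subgrp Gamma)]) ->
    virtually_free (subgrp Gamma) /\ forall P : groupClosed (isom X),
      maximal_parabolic o Gamma P -> virtually_cyclic (subgrp P).
  move=> /convergent_sums[s [M [s0 s1 sumM]]] /(terminal_chain X_cat s0 s1 sumM)[S [c [n [ch fin]]]].
  split; first exact: terminal_virtually_free ch fin.
  by move=> P; exact: maximal_parabolic_virtually_cyclic X_cat s0 s1 sumM ch fin.
split.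
- by move=> fg acc nvf; rewrite leNgt; apply/negP => /fin[]; [apply: Or31|].
- by move=> fp nvf; rewrite leNgt; apply/negP => /fin[]; [apply: Or32|].
- by move=> fg bd nvf; rewrite leNgt; apply/negP => /fin[]; [apply: Or33|].
- by move=> fc [P mP nvc]; rewrite leNgt; apply/negP => /fin /(_ fc)[_ /(_ P mP)].
Qed.
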